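(* Let $k$ be a field of characteristic $0$ and let $X$ be either a smooth scheme over $k$ or a smooth rigid analytic space over $k$, equipped with an action of a product $G\times H$ of abstract groups. Then: (1) The functor $\mathcal{O}_X\otimes_k- \colon \mathrm{Mod}^{\mathrm{fd}}_{k[H]}\to\mathrm{VectCon}^{G\times H}(X)$ is exact, monoidal and faithful. Suppose in addition that $c_X(X)^G=k$. Then: (2) the functor $\mathcal{O}_X\otimes_k-$ is full; (3) the essential image of $\mathcal{O}_X\otimes_k-$ is the full subcategory of objects $\mathcal{M}$ with $\dim_k\mathrm{Hom}_{G\text{-}\mathcal{D}_X}(\mathcal{O}_X,\mathcal{M})=\mathrm{rank}(\mathcal{M})$, and on this subcategory $\mathrm{Hom}_{G\text{-}\mathcal{D}_X}(\mathcal{O}_X,-)$ is a quasi-inverse of $\mathcal{O}_X\otimes_k-$; (4) the essential image of $\mathcal{O}_X\otimes_k-$ is closed under sub-quotients.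
   Context: $\mathcal{D}_X$ is the sheaf of differential operators (universal enveloping algebra of the tangent sheaf $\mathcal{T}_X$). For a group $\Gamma$ acting on $X$, $\mathrm{VectCon}^\Gamma(X)$ is the category of $\Gamma$-equivariant $\mathcal{D}_X$-modules that are coherent (hence locally free) as $\mathcal{O}_X$-modules, with $\mathcal{O}_X$-tensor product. $c_X=\ker(d\colon\mathcal{O}_X\to\Omega^1_{X/k})$ is the sheaf of constant functions; $G$ acts on $c_X(X)$ through its action on $X$. $\mathrm{Mod}^{\mathrm{fd}}_{k[H]}$ is the category of finite-dimensional $k$-representations of $H$. The functor $\mathcal{O}_X\otimes_k-$ sends $V$ to the sheaf $U\mapsto\mathcal{O}_X(U)\otimes_kV$, with $\mathcal{D}_X$ acting on the first factor and $(g,h)\in G\times H$ acting by (action of $(g,h)$ on $\mathcal{O}_X$)$\otimes h$. For $\mathcal{M}\in\mathrm{VectCon}^{G\times H}(X)$, $\mathrm{Hom}_{G\text{-}\mathcal{D}_X}(\mathcal{O}_X,\mathcal{M})$ denotes the $G$-equivariant $\mathcal{D}_X$-linear morphisms, a $k[H]$-module via $h\cdot\phi = h^{\mathcal{M}}\circ\phi\circ(h^{\mathcal{O}_X})^{-1}$.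
   Formalization: Faithfulness in (1) is stated for nonempty X only: for the empty space every O_X ⊗ V is zero, so the functor is not faithful; exactness and monoidality are stated for all X, and c_X(X)^G = k already forces X to be nonempty. *)

(* Defs.v *)
From HB Require Import structures.
From mathcomp Require Import all_boot all_order all_algebra.
From mathcomp Require Import boolp classical_sets reals.
From mathcomp.multinomials Require Import (canonicals, coercions) mpoly.

Set Implicit Arguments.
Unset Strict Implicit.
Unset Printing Implicit Defensive.

Import Order.TTheory GRing.Theory Num.Theory.
Local Open Scope classical_set_scope.
Local Open Scope ring_scope.

Lemma sig_ext (A : Type) (P : A -> Prop) (a b : {x : A | P x}) :
  sval a = sval b -> a = b.
Proof. by case: a b => [a pa] [b pb] /= e; apply: eq_exist. Qed.

(** A set with a Grothendieck topology in the sense of Bosch-Guentzer-Remmert: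
    [adm] are the admissible open subsets, [cov U C] says that the set [C] of
    admissible opens is an admissible covering of [U].  The points form the
    subset [whole] of the carrier, so that restricting to an admissible open
    keeps the carrier. *)
Record gspace := GSpace {
  point : Type;
  whole : set point;
  adm : set (set point);
  cov : set point -> set (set (set point));
  adm_whole : adm whole;
  adm_set0 : adm set0;
  adm_sub : forall U, adm U -> U `<=` whole;
  admI : forall U V, adm U -> adm V -> adm (U `&` V);
  cov_adm : forall U C, cov U C ->
    [/\ adm U, C `<=` adm & \bigcup_(W in C) W = U];
  cov1 : forall U, adm U -> cov U [set U];
  cov_trans : forall U C (D : set point -> set (set point)), cov U C ->
    (forall W, C W -> cov W (D W)) -> cov U (\bigcup_(W in C) D W);
  cov_restr : forall U C V, cov U C -> adm V -> V `<=` U ->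
    cov V [set V `&` W | W in C] }.

Set Primitive Projections.
Record opn (X : gspace) := Opn { oset : set (point X); opnP : adm oset }.
Unset Primitive Projections.

Definition osub (X : gspace) (V U : opn X) : Prop := oset V `<=` oset U.
Notation "V [<=] U" := (osub V U) (at level 70, no associativity).

Definition osub_refl (X : gspace) (U : opn X) : U [<=] U := fun x Ux => Ux.
Definition osub_trans (X : gspace) (U V W : opn X) (hVU : V [<=] U)
  (hWV : W [<=] V) : W [<=] U := fun x Wx => hVU x (hWV x Wx).

Arguments osub_refl {X} U.
Arguments osub_trans {X U V W} hVU hWV.

Definition owhole (X : gspace) : opn X := Opn (adm_whole X).

Lemma cov_sub (X : gspace) (U : set (point X)) C W :
  cov U C -> C W -> W `<=` U.
Proof. by move=> /cov_adm [_ _ <-] CW x Wx; exists W. Qed.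

Definition locally (X : gspace) (U : opn X)
    (P : forall V : opn X, V [<=] U -> Prop) : Prop :=
  exists2 C, cov (oset U) C &
    forall (V : opn X) (h : V [<=] U), C (oset V) -> P V h.

Lemma locally_triv (X : gspace) (U : opn X) P :
  (forall V (h : V [<=] U), P V h) -> @locally X U P.
Proof. by move=> H; exists [set oset U]; [apply: cov1; apply: opnP|]. Qed.

Definition is_sheaf (X : gspace) (F : opn X -> Type)
    (r : forall U V : opn X, V [<=] U -> F U -> F V) : Prop :=
  forall (U : opn X) C, cov (oset U) C ->
    (forall s t : F U,
       (forall W (h : W [<=] U), C (oset W) -> r U W h s = r U W h t) ->
       s = t) /\
    (forall s : (forall W : opn X, C (oset W) -> F W),
       (forall W1 W2 W c1 c2 (h1 : W [<=] W1) (h2 : W [<=] W2),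
          r W1 W h1 (s W1 c1) = r W2 W h2 (s W2 c2)) ->
       exists t : F U, forall W c (h : W [<=] U), r U W h t = s W c).

(** A G-topological space with a sheaf of commutative k-algebras; the
    structure map [cst] encodes the k-algebra structure, since the
    library's algebras exclude the zero ring. *)
Record rgspace (k : fieldType) := RGSpace {
  gsp :> gspace;
  reg : opn gsp -> comPzRingType;
  cst : forall U, {rmorphism k -> reg U};
  rs : forall U V : opn gsp, V [<=] U -> {rmorphism reg U -> reg V};
  rs_id : forall U (h : U [<=] U) a, rs h a = a;
  rs_comp : forall U V W (hVU : V [<=] U) (hWV : W [<=] V) (hWU : W [<=] U) a,
    rs hWV (rs hVU a) = rs hWU a;
  rs_cst : forall U V (h : V [<=] U) c, rs h (cst U c) = cst V c;
  reg_sheaf : is_sheaf (fun U V (h : V [<=] U) => rs h : reg U -> reg V) }.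

Record omod (k : fieldType) (X : rgspace k) := OMod {
  sec : forall U : opn X, lmodType (reg U);
  mrs : forall U V : opn X, V [<=] U -> sec U -> sec V;
  mrs_lin : forall U V (h : V [<=] U) (a : reg U) (x y : sec U),
    mrs h (a *: x + y) = rs h a *: mrs h x + mrs h y;
  mrs_id : forall U (h : U [<=] U) x, mrs h x = x;
  mrs_comp : forall U V W (hVU : V [<=] U) (hWV : W [<=] V) (hWU : W [<=] U) x,
    mrs hWV (mrs hVU x) = mrs hWU x;
  sec_sheaf : is_sheaf mrs }.

Section Restriction.
Variables (k : fieldType) (X : rgspace k) (U0 : opn X).

Definition restr_gspace : gspace.
Proof.
refine (@GSpace (point X) (oset U0) [set V | adm V /\ V `<=` oset U0]
  (fun V C => cov V C /\ V `<=` oset U0) _ _ _ _ _ _ _ _).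
- by split => //; apply: opnP.
- by split; [apply: adm_set0 | apply: sub0set].
- by move=> U [].
- by move=> U V [aU sU] [aV sV]; split; [apply: admI | move=> x [/sU]].
- move=> U C [cU sU]; have [aU aC eU] := cov_adm cU; split => //.
  by move=> W CW; split; [apply: aC | apply: subset_trans sU; apply: cov_sub CW].
- by move=> U [aU sU]; split => //; apply: cov1.
- move=> U C D [cU sU] H; split => //; apply: cov_trans => // W CW.
  by have [] := H W CW.
- by move=> U C V [cU sU] [aV sV] VU; split => //; apply: cov_restr cU _ _.
Defined.

Definition wid (V : opn restr_gspace) : opn X :=
  @Opn X (oset V) (let: conj a _ := opnP V in a).

Definition narrow (V : opn X) (h : V [<=] U0) : opn restr_gspace :=
  @Opn restr_gspace (oset V) (conj (opnP V) h).

Lemma restr_is_sheaf (F : opn X -> Type)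
    (r : forall U V : opn X, V [<=] U -> F U -> F V) :
  is_sheaf r ->
  @is_sheaf restr_gspace (fun U => F (wid U))
    (fun U V (h : V [<=] U) => r (wid U) (wid V) h).
Proof.
move=> Fsh U C [cU sU]; have [Fs Fg] := Fsh (wid U) C cU.
have CU0 (W : opn X) : C (oset W) -> W [<=] U0.
  by move=> CW; apply: subset_trans sU; apply: cov_sub CW.
split.
  move=> s t st; apply: Fs => W h CW.
  exact: (st (narrow (CU0 W CW)) h CW).
move=> s sP; pose s' (W : opn X) (c : C (oset W)) : F W := s (narrow (CU0 W c)) c.
have [W1 W2 W c1 c2 h1 h2|t tP] := Fg s'.
  have hW : W [<=] U0 by exact: osub_trans (CU0 W1 c1) h1.
  exact: (sP (narrow (CU0 W1 c1)) (narrow (CU0 W2 c2)) (narrow hW) c1 c2 h1 h2).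
exists t => W c h; rewrite (tP (wid W) c h) /s'.
case: W c h => W [aW sW] c h; rewrite /narrow /=.
by rewrite (Prop_irrelevance (CU0 (@Opn X W aW) c) sW).
Qed.

Definition restr : rgspace k.
Proof.
refine (@RGSpace k restr_gspace (fun V => reg (wid V)) (fun V => cst (wid V))
  (fun U V h => @rs k X (wid U) (wid V) h) _ _ _ _).
- by move=> U h a; apply: rs_id.
- by move=> U V W h1 h2 h3 a; apply: rs_comp.
- by move=> U V h c; apply: rs_cst.
- exact: (restr_is_sheaf (@reg_sheaf k X)).
Defined.

Definition restr_mod (M : omod X) : omod restr.
Proof.
refine (@OMod k restr (fun V => sec M (wid V))
  (fun U V h => @mrs k X M (wid U) (wid V) h) _ _ _ _).
- by move=> U V h a x y; apply: mrs_lin.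
- by move=> U h x; apply: mrs_id.
- by move=> U V W h1 h2 h3 x; apply: mrs_comp.
- exact: (restr_is_sheaf (@sec_sheaf k X M)).
Defined.

End Restriction.

Record kalg (k : fieldType) := KAlg {
  car :> comPzRingType;
  str : {rmorphism k -> car} }.

Definition reg_alg (k : fieldType) (X : rgspace k) (U : opn X) : kalg k :=
  KAlg (cst U).

Definition kalg_mor (k : fieldType) (A B : kalg k) (phi : {rmorphism A -> B}) :=
  forall c, phi (str A c) = str B c.

Definition is_ideal (A : comPzRingType) (I : set A) : Prop :=
  [/\ I 0, forall a b, I a -> I b -> I (a + b) & forall a b, I b -> I (a * b)].

Definition is_prime (A : comPzRingType) (p : set A) : Prop :=
  [/\ is_ideal p, ~ p 1 & forall a b, p (a * b) -> p a \/ p b].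

Definition is_localization (A B : comPzRingType) (f : A)
    (phi : {rmorphism A -> B}) : Prop :=
  [/\ exists b, phi f * b = 1,
      forall b, exists n a, phi (f ^+ n) * b = phi a
    & forall a, phi a = 0 -> exists n, f ^+ n * a = 0].

(** [U] with the restricted sheaf is isomorphic to Spec A for A = O(U):
    [theta] is a homeomorphism onto the prime spectrum with its Zariski
    topology, and O(D(f)) is A_f for every basic open D(f). *)
Definition affine_open (k : fieldType) (X : rgspace k) (U : opn X) : Prop :=
  exists theta : point X -> set (reg U),
  [/\ forall x, oset U x -> is_prime (theta x),
      forall p, is_prime p -> exists! x, oset U x /\ theta x = p,
      forall V, V `<=` oset U ->
        (adm V <-> exists I : set (reg U),
           V = [set x | oset U x /\ exists2 f, I f & ~ theta x f])
    & forall (f : reg U) (V : opn X) (h : V [<=] U),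
        oset V = [set x | oset U x /\ ~ theta x f] ->
        is_localization f (rs h)].

(** Standard smooth algebras: k[T_1, .., T_n] / (f_1, .., f_c) with an
    invertible c x c minor of the Jacobian matrix. *)
Definition standard_smooth (k : fieldType) (A : kalg k) : Prop :=
  exists (n c : nat) (pi : {rmorphism mpoly.mpoly n k -> A})
         (f : 'I_c -> mpoly.mpoly n k) (s : 'I_c -> 'I_n),
  [/\ forall a, pi (mpoly.mpolyC n a) = str A a,
      forall b, exists p, pi p = b,
      forall p, pi p = 0 <-> exists q : 'I_c -> mpoly.mpoly n k,
        p = \sum_i q i * f i
    & exists b, \det (\matrix_(i, j) pi (mpoly.mderiv (s j) (f i))) * b = 1].

Definition topological (X : gspace) : Prop :=
  (forall F : set (set (point X)), F `<=` @adm X ->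
     adm (\bigcup_(W in F) W)) /\
  (forall (U : set (point X)) C,
     cov U C <-> C `<=` @adm X /\ \bigcup_(W in C) W = U).

Definition smooth_scheme (k : fieldType) (X : rgspace k) : Prop :=
  topological X /\
  locally (U := owhole X) (fun U _ => affine_open U /\ standard_smooth (reg_alg U)).

Record nonarch_field (R : realType) (k : fieldType) (nu : k -> R) : Prop := {
  nu_ge0 : forall x, 0 <= nu x;
  nu_eq0 : forall x, nu x = 0 <-> x = 0;
  nuM : forall x y, nu (x * y) = nu x * nu y;
  nuD : forall x y, nu (x + y) <= Num.max (nu x) (nu y);
  nu_nontrivial : exists x, x != 0 /\ nu x != 1;
  nu_complete : forall u : nat -> k,
    (forall e, 0 < e -> exists N, forall i j, (N <= i)%N -> (N <= j)%N ->
       nu (u i - u j) < e) ->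
    exists l, forall e, 0 < e -> exists N, forall i, (N <= i)%N ->
       nu (u i - l) < e }.

Section Rigid.
Variables (R : realType) (k : fieldType) (nu : k -> R).

(** Power series in n variables, given by their coefficients; the Tate
    algebra T_n consists of those satisfying [tate], and the operations below
    are its ring operations. *)
Definition pseries (n : nat) := mpoly.multinom n -> k.

Definition tate n (c : pseries n) : Prop :=
  forall e, 0 < e -> exists N, forall m, (N <= mpoly.mdeg m)%N -> nu (c m) < e.

Definition ps_const n (a : k) : pseries n :=
  fun m => if m == mpoly.mnm0 then a else 0.

Definition ps_add n (c d : pseries n) : pseries n := fun m => c m + d m.

Definition ps_mul n (c d : pseries n) : pseries n := fun m =>
  \sum_(l : mpoly.bmultinom n (mpoly.mdeg m).+1 | mpoly.lem l m)
     c l * d (mpoly.mnm_sub m l).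

Definition ps_deriv n (j : 'I_n) (c : pseries n) : pseries n :=
  fun m => c (mpoly.mnm_add m (mpoly.mnm1 j)) *+ (m j).+1.

(** A surjective homomorphism of k-algebras from T_n onto A; the values of
    [pi] outside T_n are irrelevant. *)
Definition tate_surjection n (A : kalg k) (pi : pseries n -> A) : Prop :=
  [/\ forall a, pi (@ps_const n a) = str A a,
      forall c d, tate c -> tate d -> pi (ps_add c d) = pi c + pi d,
      forall c d, tate c -> tate d -> pi (ps_mul c d) = pi c * pi d
    & forall b, exists2 c, tate c & pi c = b].

Definition affinoid (A : kalg k) : Prop :=
  exists n (pi : pseries n -> A), tate_surjection pi.

Definition standard_smooth_affinoid (A : kalg k) : Prop :=
  exists (n c : nat) (pi : pseries n -> A) (f : 'I_c -> pseries n)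
         (s : 'I_c -> 'I_n),
  [/\ tate_surjection pi,
      forall i, tate (f i),
      forall p, tate p -> (pi p = 0 <->
        exists2 q : 'I_c -> pseries n, forall i, tate (q i) &
          p = fun m => \sum_i ps_mul (q i) (f i) m)
    & exists b, \det (\matrix_(i, j) pi (ps_deriv (s j) (f i))) * b = 1].

Definition max_ideal (A : comPzRingType) (m : set A) : Prop :=
  [/\ is_ideal m, ~ m 1 & forall I, is_ideal I -> m `<=` I -> ~ I 1 -> I = m].

Definition pull (A B : comPzRingType) (phi : {rmorphism A -> B})
  (m : set B) : set A := [set a | m (phi a)].

(** Sp phi : Sp B -> Sp A has image in V. *)
Definition lands_in (A B : comPzRingType) (phi : {rmorphism A -> B})
    (V : set (set A)) : Prop :=
  forall m, max_ideal m -> V (pull phi m).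

Definition represents (A A' : kalg k) (V : set (set A))
    (phi : {rmorphism A -> A'}) : Prop :=
  [/\ affinoid A', kalg_mor phi, lands_in phi V
    & forall (B : kalg k) (psi : {rmorphism A -> B}), affinoid B ->
        kalg_mor psi -> lands_in psi V ->
        exists chi : {rmorphism A' -> B},
          [/\ kalg_mor chi, forall a, chi (phi a) = psi a
            & forall chi' : {rmorphism A' -> B}, kalg_mor chi' ->
                (forall a, chi' (phi a) = psi a) -> forall a, chi' a = chi a]].

Definition aff_subdomain (A : kalg k) (V : set (set A)) : Prop :=
  V `<=` @max_ideal A /\
  exists (A' : kalg k) (phi : {rmorphism A -> A'}), represents V phi.

(** The sets of C, pulled back along Sp psi : Sp B -> Sp A, are refined by a
    finite covering of Sp B by affinoid subdomains. *)
Definition finitely_refined (A B : kalg k) (psi : {rmorphism A -> B})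
    (C : set (set (set A))) : Prop :=
  exists n (W : 'I_n -> set (set B)),
  [/\ forall i, aff_subdomain (W i),
      forall m, max_ideal m -> exists i, W i m
    & forall i, exists2 V, C V & forall m, W i m -> V (pull psi m)].

Definition universally_refined (A : kalg k) (U : set (set A))
    (C : set (set (set A))) : Prop :=
  forall (B : kalg k) (psi : {rmorphism A -> B}), affinoid B ->
    kalg_mor psi -> lands_in psi U -> finitely_refined psi C.

(** The strong G-topology on Sp A. *)
Definition adm_sp (A : kalg k) (U : set (set A)) : Prop :=
  exists C : set (set (set A)),
  [/\ C `<=` @aff_subdomain A, \bigcup_(W in C) W = U
    & universally_refined U C].

Definition cov_sp (A : kalg k) (U : set (set A)) (C : set (set (set A))) : Prop :=
  [/\ adm_sp U, C `<=` @adm_sp A, \bigcup_(W in C) W = U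
    & universally_refined U C].

(** [U] with the restricted G-topology and sheaf is isomorphic to Sp A for
    A = O(U). *)
Definition affinoid_open (X : rgspace k) (U : opn X) : Prop :=
  affinoid (reg_alg U) /\
  exists theta : point X -> set (reg U),
  [/\ forall x, oset U x -> max_ideal (theta x),
      forall m, max_ideal m -> exists! x, oset U x /\ theta x = m,
      forall V, V `<=` oset U ->
        (adm V <-> @adm_sp (reg_alg U) (theta @` V)),
      forall V C, V `<=` oset U -> (forall W, C W -> W `<=` V) ->
        (cov V C <->
         @cov_sp (reg_alg U) (theta @` V) [set theta @` W | W in C])
    & forall (V : opn X) (h : V [<=] U),
        @aff_subdomain (reg_alg U) (theta @` oset V) ->
        @represents (reg_alg U) (reg_alg V) (theta @` oset V) (rs h)].

(** The completeness conditions (G1) and (G2); (G0) is part of [gspace]. *)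
Definition complete_gtop (X : gspace) : Prop :=
  (forall (U : set (point X)) C V, cov U C -> V `<=` U ->
     (forall W, C W -> adm (V `&` W)) -> adm V) /\
  (forall (U : set (point X)) C, adm U -> C `<=` @adm X ->
     \bigcup_(W in C) W = U ->
     (exists2 D, cov U D & forall W, D W -> exists2 W', C W' & W `<=` W') ->
     cov U C).

Definition smooth_rigid_space (X : rgspace k) : Prop :=
  complete_gtop X /\
  locally (U := owhole X)
    (fun U _ => affinoid_open U /\ standard_smooth_affinoid (reg_alg U)).

End Rigid.

Section Modules.
Variables (k : fieldType) (X : rgspace k).

(** M restricted to W is the cokernel of a morphism O^m -> O^n, given by
    generators [e] and a matrix of relations [A]. *)
Definition fin_presented (M : omod X) (W : opn X) : Prop :=
  exists (n m : nat) (e : 'I_n -> sec M W) (A : 'I_m -> 'I_n -> reg W),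
  [/\ forall j, \sum_i A j i *: e i = 0,
      forall V (h : V [<=] W) (x : sec M V),
        locally (U := V) (fun V' h' => exists c : 'I_n -> reg V',
          mrs h' x = \sum_i c i *: mrs (osub_trans h h') (e i))
    & forall V (h : V [<=] W) (c : 'I_n -> reg V),
        \sum_i c i *: mrs h (e i) = 0 ->
        locally (U := V) (fun V' h' => exists b : 'I_m -> reg V',
          forall i, rs h' (c i) = \sum_j b j * rs (osub_trans h h') (A j i))].

(** The structure sheaf of a smooth scheme or rigid space is locally
    noetherian, so coherent modules are the locally finitely presented ones. *)
Definition coherent (M : omod X) : Prop :=
  locally (U := owhole X) (fun W _ => fin_presented M W).

Definition free_on (M : omod X) (r : nat) (W : opn X) : Prop :=
  exists e : 'I_r -> sec M W, forall V (h : V [<=] W) (x : sec M V),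
    exists! c : {ffun 'I_r -> reg V}, x = \sum_i c i *: mrs h (e i).

Definition has_rank (M : omod X) (r : nat) : Prop :=
  locally (U := owhole X) (fun W _ => free_on M r W).

Lemma free_coherent (M : omod X) r : free_on M r (owhole X) -> coherent M.
Proof.
move=> [e eP]; apply: locally_triv => W hW.
have eP' V (h : V [<=] W) (x : sec M V) : exists! c : {ffun 'I_r -> reg V},
    x = \sum_i c i *: mrs h (mrs hW (e i)).
  have [c [xE cU]] := eP V (osub_trans hW h) x; exists c; split.
    by rewrite xE; apply: eq_bigr => i _; rewrite (mrs_comp _ _ (osub_trans hW h)).
  move=> c' xE'; apply: cU; rewrite xE'; apply: eq_bigr => i _.
  by rewrite (mrs_comp _ _ (osub_trans hW h)).
exists r, 0%N, (fun i => mrs hW (e i)), (fun=> fun=> 0); split.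
- by case.
- move=> V h x; apply: locally_triv => V' h'.
  by have [c [xE _]] := eP' V' (osub_trans h h') (mrs h' x); exists c.
- move=> V h c c0; apply: locally_triv => V' h'; exists (fun=> 0) => i.
  rewrite big_ord0; have [c' [_ cU]] := eP' V h 0.
  have e1 : c' = [ffun i => c i].
    by apply: cU; rewrite -[LHS]c0; apply: eq_bigr => j _; rewrite ffunE.
  have e2 : c' = [ffun i => 0].
    by apply: cU; rewrite big1// => j _; rewrite ffunE scale0r.
  by move: e1; rewrite e2 => /ffunP/(_ i); rewrite !ffunE => <-; rewrite rmorph0.
Qed.

Record is_derivation (F : omod X) (D : forall U, reg U -> sec F U) : Prop := {
  derivation_add : forall U a b, D U (a + b) = D U a + D U b;
  derivation_mul : forall U a b, D U (a * b) = a *: D U b + b *: D U a;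
  derivation_cst : forall U c, D U (cst U c) = 0;
  derivation_res : forall U V (h : V [<=] U) a,
    mrs h (D U a) = D V (rs h a) }.

(** A section over [U] of the tangent sheaf: a k-linear derivation of the
    structure sheaf of [U]. *)
Record tangent (U : opn X) := Tangent {
  tfun : forall V, V [<=] U -> reg V -> reg V;
  tfun_add : forall V (h : V [<=] U) a b, tfun h (a + b) = tfun h a + tfun h b;
  tfun_mul : forall V (h : V [<=] U) a b,
    tfun h (a * b) = a * tfun h b + b * tfun h a;
  tfun_cst : forall V (h : V [<=] U) c, tfun h (cst V c) = 0;
  tfun_res : forall V W (hV : V [<=] U) (hW : W [<=] U) (h : W [<=] V) a,
    rs h (tfun hV a) = tfun hW (rs h a) }.

Definition tapp (U : opn X) (D : tangent U) (a : reg U) : reg U :=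
  tfun D (osub_refl U) a.

Record omod_mor (M N : omod X) (phi : forall U, sec M U -> sec N U) : Prop := {
  omod_mor_lin : forall U (a : reg U) x y,
    phi U (a *: x + y) = a *: phi U x + phi U y;
  omod_mor_res : forall U V (h : V [<=] U) x,
    mrs h (phi U x) = phi V (mrs h x) }.

End Modules.

(** (Om, d) is the sheaf of differentials of X over k: the universal
    derivation, over every admissible open, into coherent modules (in the rigid
    case only coherent modules are allowed as targets). *)
Definition is_differentials (k : fieldType) (X : rgspace k) (Om : omod X)
    (d : forall U, reg U -> sec Om U) : Prop :=
  [/\ coherent Om, is_derivation d
    & forall (U : opn X) (F : omod (restr U)) (D : forall V, reg V -> sec F V),
        coherent F -> is_derivation D ->
        exists phi : forall V, sec (restr_mod U Om) V -> sec F V,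
          [/\ omod_mor phi,
              forall V a, phi V (d (wid V) a) = D V a
            & forall phi' : forall V, sec (restr_mod U Om) V -> sec F V,
                omod_mor phi' ->
                (forall V a, phi' V (d (wid V) a) = D V a) ->
                forall V x, phi' V x = phi V x]].

Record category := Category {
  ob :> Type;
  hom : ob -> ob -> Type;
  idm : forall a, hom a a;
  cmp : forall a b c, hom b c -> hom a b -> hom a c;
  cmp1m : forall a b (f : hom a b), cmp (idm b) f = f;
  cmpm1 : forall a b (f : hom a b), cmp f (idm a) = f;
  cmpA : forall a b c d (f : hom c d) (g : hom b c) (h : hom a b),
    cmp f (cmp g h) = cmp (cmp f g) h }.

Definition is_iso (C : category) (a b : C) (f : hom a b) : Prop :=
  exists g : hom b a, cmp g f = idm a /\ cmp f g = idm b.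

Definition full_subcat (C : category) (P : C -> Prop) : category :=
  @Category {x : C | P x} (fun x y => hom (sval x) (sval y))
    (fun x => idm (sval x)) (fun _ _ _ f g => cmp f g)
    (fun _ _ f => cmp1m f) (fun _ _ f => cmpm1 f) (fun _ _ _ _ f g h => cmpA f g h).

Record functor (C D : category) := Functor {
  fob :> C -> D;
  fmap : forall a b, hom a b -> hom (fob a) (fob b);
  fmap1 : forall a, fmap (idm a) = idm (fob a);
  fmapM : forall a b c (f : hom b c) (g : hom a b),
    fmap (cmp f g) = cmp (fmap f) (fmap g) }.

Definition functor_id (C : category) : functor C C :=
  @Functor C C id (fun _ _ f => f) (fun _ => erefl) (fun _ _ _ _ _ => erefl).

Lemma functor_comp_subproof1 (C D E : category) (G : functor D E)
  (F : functor C D) a : fmap G (fmap F (idm a)) = idm (G (F a)).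
Proof. by rewrite !fmap1. Qed.

Lemma functor_comp_subproof2 (C D E : category) (G : functor D E)
  (F : functor C D) a b c (f : hom b c) (g : hom a b) :
  fmap G (fmap F (cmp f g)) = cmp (fmap G (fmap F f)) (fmap G (fmap F g)).
Proof. by rewrite !fmapM. Qed.

Definition functor_comp (C D E : category) (G : functor D E) (F : functor C D) :
  functor C E :=
  @Functor C E (fun a => G (F a)) (fun _ _ f => fmap G (fmap F f))
    (functor_comp_subproof1 G F) (functor_comp_subproof2 G F).

(** The corestriction of F to a full subcategory containing its image, and the
    restriction of F to full subcategories of the source and the target. *)
Definition corestrict (C D : category) (F : functor C D) (P : D -> Prop)
    (h : forall a, P (F a)) : functor C (full_subcat P) :=
  @Functor C (full_subcat P) (fun a => exist P (F a) (h a))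
    (fun _ _ f => fmap F f) (fmap1 F) (fun _ _ _ f g => fmapM F f g).

Definition restrict (C D : category) (F : functor C D) (P : C -> Prop)
    (Q : D -> Prop) (h : forall a, P a -> Q (F a)) :
    functor (full_subcat P) (full_subcat Q) :=
  @Functor (full_subcat P) (full_subcat Q)
    (fun a => exist Q (F (sval a)) (h _ (svalP a)))
    (fun _ _ f => fmap F f) (fun a => fmap1 F (sval a))
    (fun _ _ _ f g => fmapM F f g).

Definition faithful (C D : category) (F : functor C D) : Prop :=
  forall a b (f g : hom a b), fmap F f = fmap F g -> f = g.

Definition full (C D : category) (F : functor C D) : Prop :=
  forall a b (g : hom (F a) (F b)), exists f, fmap F f = g.

Definition ess_image (C D : category) (F : functor C D) (d : D) : Prop :=
  exists a (f : hom (F a) d), is_iso f.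

Definition nat_iso (C D : category) (F G : functor C D) : Prop :=
  exists eta : forall a, hom (F a) (G a),
    (forall a, is_iso (eta a)) /\
    (forall a b (f : hom a b), cmp (eta b) (fmap F f) = cmp (fmap G f) (eta a)).

Definition quasi_inverse (C D : category) (F : functor C D) (G : functor D C) :
    Prop :=
  nat_iso (functor_comp G F) (functor_id C) /\
  nat_iso (functor_comp F G) (functor_id D).

Definition dprod (G H : groupType) : Type := (G * H)%type.

Section DirectProduct.
Variables G H : groupType.
HB.instance Definition _ := Choice.on (dprod G H).
Definition dprod_one : dprod G H := (1%g, 1%g).
Definition dprod_inv (x : dprod G H) : dprod G H := (x.1^-1, x.2^-1)%g.
Definition dprod_mul (x y : dprod G H) : dprod G H := (x.1 * y.1, x.2 * y.2)%g.
Lemma dprod_mulA : associative dprod_mul.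
Proof. by move=> x y z; rewrite /dprod_mul /= !mulgA. Qed.
Lemma dprod_mul1 : left_id dprod_one dprod_mul.
Proof. by case=> x y; rewrite /dprod_mul /= !mul1g. Qed.
Lemma dprod_1mul : right_id dprod_one dprod_mul.
Proof. by case=> x y; rewrite /dprod_mul /= !mulg1. Qed.
Lemma dprod_mulV : left_inverse dprod_one dprod_inv dprod_mul.
Proof. by case=> x y; rewrite /dprod_mul /= !mulVg. Qed.
Lemma dprod_Vmul : right_inverse dprod_one dprod_inv dprod_mul.
Proof. by case=> x y; rewrite /dprod_mul /= !mulgV. Qed.
HB.instance Definition _ := isGroup.Build (dprod G H)
  dprod_mulA dprod_mul1 dprod_1mul dprod_mulV dprod_Vmul.
End DirectProduct.

Record rep (k : fieldType) (H : groupType) := Rep {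
  rmod :> lmodType k;
  ract : H -> rmod -> rmod;
  ract_lin : forall h, linear (ract h);
  ract1 : forall v, ract 1%g v = v;
  ractM : forall h1 h2 v, ract (h1 * h2)%g v = ract h1 (ract h2 v) }.

Definition has_dim (k : fieldType) (V : lmodType k) (n : nat) : Prop :=
  exists e : 'I_n -> V, forall v,
    exists! c : {ffun 'I_n -> k}, v = \sum_i c i *: e i.

Section RepCategory.
Variables (k : fieldType) (H : groupType).

Definition rep_hom (V W : rep k H) : Type :=
  {f : V -> W | linear f /\ forall h v, f (ract h v) = ract h (f v)}.

Definition rep_id (V : rep k H) : rep_hom V V.
Proof. by exists id. Defined.

Definition rep_cmp (U V W : rep k H) (f : rep_hom V W) (g : rep_hom U V) :
  rep_hom U W.
Proof.
exists (sval f \o sval g); case: f g => [f [fl fe]] [g [gl ge]] /=; split.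
  by move=> a u v /=; rewrite gl fl.
by move=> h v /=; rewrite ge fe.
Defined.

Definition rep_cat : category.
Proof.
by refine (@Category (rep k H) rep_hom rep_id rep_cmp _ _ _) => *; apply: sig_ext.
Defined.

Definition repfd : category :=
  full_subcat (C := rep_cat) (fun V : rep k H => exists n, has_dim V n).

Definition rep_of (V : repfd) : rep k H := sval V.

Definition rep_unit : rep k H.
Proof. by refine (@Rep k H k^o (fun _ v => v) _ _ _). Defined.

Lemma rep_unit_fd : exists n, has_dim rep_unit n.
Proof.
exists 1%N, (fun=> 1 : k) => v; exists [ffun=> v : k]; split.
  by rewrite big_ord1 ffunE /GRing.scale /= mulr1.
move=> c; rewrite big_ord1 /GRing.scale /= mulr1 => vE.
by apply/ffunP => i; rewrite ffunE ord1.
Qed.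

Definition unitfd : repfd := exist _ rep_unit rep_unit_fd.

Definition rep_short_exact (V' V V'' : repfd) (f : hom V' V) (g : hom V V'') :
    Prop :=
  [/\ injective (sval f),
      forall v : rep_of V, sval g v = 0 <-> exists u, sval f u = v
    & forall w : rep_of V'', exists v, sval g v = w].

End RepCategory.

Section Tensor.
Variables (k : fieldType).

Definition dual (V : lmodType k) : Type := {l : V -> k | linear (l : V -> k^o)}.

Definition dcomp (V W : lmodType k) (f : V -> W) (hf : linear f) (l : dual W) :
  dual V.
Proof.
by exists (sval l \o f); case: l => l hl a u v /=; rewrite hf hl.
Defined.

Variables (A : comPzRingType) (iota : {rmorphism k -> A}).

Definition pure_fun (V : lmodType k) (a : A) (v : V) : dual V -> A :=
  fun l => iota (sval l v) * a.

(** As V is a vector space over a field, [A (x)_k V] embeds in the maps from the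
    dual of V to A, [a (x) v] being the map sending l to [l v * a]; [tens]
    is the image, i.e. the set of finite sums of such maps. *)
Definition tens (V : lmodType k) : Type :=
  {T : dual V -> A | exists s : seq (A * V),
     forall l, T l = \sum_(p <- s) pure_fun p.1 p.2 l}.

Definition pure (V : lmodType k) (a : A) (v : V) : tens V.
Proof.
exists (pure_fun a v), [:: (a, v)].
by move=> l; rewrite big_seq1.
Defined.

Section TensModule.
Variable V : lmodType k.
HB.instance Definition _ := gen_eqMixin (tens V).
HB.instance Definition _ := gen_choiceMixin (tens V).

Definition tens0 : tens V.
Proof. by exists (fun=> 0), [::] => l; rewrite big_nil. Defined.

Definition tens_opp (T : tens V) : tens V.
Proof.
exists (fun l => - sval T l); have [s sE] := svalP T; exists [seq (- p.1, p.2) | p <- s] => l.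
by rewrite sE big_map -sumrN; apply: eq_bigr => p _; rewrite /pure_fun /= mulrN.
Defined.

Definition tens_add (S T : tens V) : tens V.
Proof.
exists (fun l => sval S l + sval T l); have [[s sE] [t tE]] := (svalP S, svalP T).
by exists (s ++ t) => l; rewrite big_cat sE tE.
Defined.

Definition tens_scale (a : A) (T : tens V) : tens V.
Proof.
exists (fun l => a * sval T l); have [s sE] := svalP T; exists [seq (a * p.1, p.2) | p <- s] => l.
by rewrite sE big_map mulr_sumr; apply: eq_bigr => p _; rewrite /pure_fun /= mulrCA.
Defined.

Lemma tens_addA : associative tens_add.
Proof. by move=> S T U; apply/sig_ext/funext => l /=; rewrite addrA. Qed.
Lemma tens_addC : commutative tens_add.
Proof. by move=> S T; apply/sig_ext/funext => l /=; rewrite addrC. Qed.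
Lemma tens_add0 : left_id tens0 tens_add.
Proof. by move=> T; apply/sig_ext/funext => l /=; rewrite add0r. Qed.
Lemma tens_addN : left_inverse tens0 tens_opp tens_add.
Proof. by move=> T; apply/sig_ext/funext => l /=; rewrite addNr. Qed.
HB.instance Definition _ :=
  GRing.isZmodule.Build (tens V) tens_addA tens_addC tens_add0 tens_addN.

Lemma tens_scaleA a b T : tens_scale a (tens_scale b T) = tens_scale (a * b) T.
Proof. by apply/sig_ext/funext => l /=; rewrite mulrA. Qed.
Lemma tens_scale1 : left_id 1 tens_scale.
Proof. by move=> T; apply/sig_ext/funext => l /=; rewrite mul1r. Qed.
Lemma tens_scaleDr : right_distributive tens_scale +%R.
Proof. by move=> a S T; apply/sig_ext/funext => l /=; rewrite mulrDr. Qed.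
Lemma tens_scaleDl T : {morph tens_scale^~ T : a b / a + b}.
Proof. by move=> a b; apply/sig_ext/funext => l /=; rewrite mulrDl. Qed.
HB.instance Definition _ := GRing.Zmodule_isLmodule.Build A (tens V)
  tens_scaleA tens_scale1 tens_scaleDr tens_scaleDl.

Lemma tensD (S T : tens V) l : sval (S + T) l = sval S l + sval T l.
Proof. by []. Qed.
Lemma tensZ a (T : tens V) l : sval (a *: T) l = a * sval T l.
Proof. by []. Qed.
Lemma tens_sum I (r : seq I) (F : I -> tens V) l :
  sval (\sum_(i <- r) F i) l = \sum_(i <- r) sval (F i) l.
Proof. by elim/big_rec2: _ => // i y T _ <-. Qed.

End TensModule.
End Tensor.

Section TensMap.
Variables (k : fieldType) (A B : comPzRingType).
Variables (iA : {rmorphism k -> A}) (iB : {rmorphism k -> B}).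
Variables (V W : lmodType k).

Definition klinear (phi : A -> B) : Prop :=
  (forall a b, phi (a + b) = phi a + phi b) /\
  (forall c a, phi (iA c * a) = iB c * phi a).

Definition tmap (phi : A -> B) (f : V -> W) (hphi : klinear phi)
  (hf : linear f) : tens iA V -> tens iB W.
Proof.
move=> T; exists (fun l => phi (sval T (dcomp hf l))).
have [[s sE] [hD hM]] := (svalP T, hphi).
exists [seq (phi p.1, f p.2) | p <- s] => l; rewrite sE big_map {sE}.
have phi0 : phi 0 = 0 by apply: (addrI (phi 0)); rewrite -hD !addr0.
elim: s => [|p s IH]; first by rewrite !big_nil.
by rewrite !big_cons hD IH /pure_fun /= hM.
Defined.

End TensMap.

Lemma linear_id (k : fieldType) (V : lmodType k) : linear (@id V).
Proof. by []. Qed.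

Lemma dcomp_id (k : fieldType) (V : lmodType k) (f : V -> V) (hf : linear f) l :
  (forall v, f v = v) -> dcomp hf l = l.
Proof. by move=> fE; apply/sig_ext/funext => v /=; rewrite fE. Qed.

Section Basis.
Variables (k : fieldType) (V : lmodType k) (n : nat) (e : 'I_n -> V).
Hypothesis eP : forall v, exists! c : {ffun 'I_n -> k}, v = \sum_i c i *: e i.

Lemma basis_free (c c' : {ffun 'I_n -> k}) :
  \sum_i c i *: e i = \sum_i c' i *: e i -> c = c'.
Proof.
by move=> cc'; have [d [_ dU]] := eP (\sum_i c i *: e i); rewrite -(dU c)// (dU c').
Qed.

Lemma coord_exists : exists x : 'I_n -> dual V,
  (forall v, v = \sum_i sval (x i) v *: e i) /\
  (forall i j, sval (x i) (e j) = (i == j)%:R).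
Proof.
have /boolp.choice[c cP] : forall v, exists c : {ffun 'I_n -> k},
    v = \sum_i c i *: e i.
  by move=> v; have [c [? _]] := eP v; exists c.
have clin i : linear ((fun v => c v i) : V -> k^o).
  move=> a u v; suff -> : c (a *: u + v) = [ffun j => a * c u j + c v j].
    by rewrite ffunE.
  apply: basis_free; rewrite -cP {1}(cP u) {1}(cP v) scaler_sumr -big_split /=.
  by apply: eq_bigr => j _; rewrite ffunE scalerDl scalerA.
exists (fun i => exist _ _ (clin i)); split=> [v|i j] /=; first exact: cP.
suff -> : c (e j) = [ffun i => (i == j)%:R] by rewrite ffunE.
apply: basis_free; rewrite -cP (bigD1 j)//= ffunE eqxx scale1r big1 ?addr0//.
by move=> l /negbTE lj; rewrite ffunE lj scale0r.
Qed.

Lemma tens_expand (x : 'I_n -> dual V) (A : comPzRingType)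
    (iota : {rmorphism k -> A}) (T : tens iota V) :
  (forall v, v = \sum_i sval (x i) v *: e i) ->
  forall l, sval T l = \sum_i iota (sval l (e i)) * sval T (x i).
Proof.
move=> xe l; have [s sE] := svalP T; rewrite sE.
under [RHS]eq_bigr => i _ do rewrite sE mulr_sumr.
rewrite exchange_big /=; apply: eq_bigr => p _; rewrite /pure_fun.
have {1}-> : sval l p.2 = \sum_i sval (x i) p.2 * sval l (e i).
  rewrite {1}(xe p.2); case: l => l hl /=.
  have l0 : l 0 = 0.
    by have := hl (-1) 0 0; rewrite scaleN1r addNr [in RHS]/GRing.scale /= mulN1r addNr.
  elim: (index_enum _) => [|i r IH]; first by rewrite !big_nil.
  by rewrite !big_cons hl IH.
rewrite rmorph_sum mulr_suml; apply: eq_bigr => i _.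
by rewrite rmorphM mulrA; congr (_ * _); rewrite mulrC.
Qed.
End Basis.

Lemma tens_universal (k : fieldType) (V : lmodType k) n (A : comPzRingType)
    (iota : {rmorphism k -> A}) (E : zmodType) (B : A -> V -> E) :
  has_dim V n ->
  (forall a a' v, B (a + a') v = B a v + B a' v) ->
  (forall a v v', B a (v + v') = B a v + B a v') ->
  (forall c a v, B (iota c * a) v = B a (c *: v)) ->
  exists L : tens iota V -> E,
    [/\ forall S T, L (S + T) = L S + L T,
        forall a v, L (pure iota a v) = B a v
      & forall L' : tens iota V -> E,
          (forall S T, L' (S + T) = L' S + L' T) ->
          (forall a v, L' (pure iota a v) = B a v) -> forall T, L' T = L T].
Proof.
move=> [e eP] Bl Br Bk; have [x [xe _]] := coord_exists eP.
pose L (T : tens iota V) := \sum_i B (sval T (x i)) (e i).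
have LD S T : L (S + T) = L S + L T.
  by rewrite /L -big_split; apply: eq_bigr => i _; rewrite tensD Bl.
have LB a v : L (pure iota a v) = B a v.
  have B0 : B a 0 = 0 by apply: (addrI (B a 0)); rewrite -Br !addr0.
  rewrite {2}(xe v) /L (big_morph _ (Br a) B0).
  by apply: eq_bigr => i _; rewrite -Bk.
exists L; split=> // L' L'D L'B T.
have [s sE] := svalP T.
have -> : T = \sum_(p <- s) pure iota p.1 p.2.
  by apply/sig_ext/funext => l; rewrite tens_sum sE.
have L0 : L 0 = 0 by apply: (addrI (L 0)); rewrite -LD !addr0.
have L'0 : L' 0 = 0 by apply: (addrI (L' 0)); rewrite -L'D !addr0.
rewrite (big_morph _ L'D L'0) (big_morph _ LD L0).
by apply: eq_bigr => p _; rewrite L'B LB.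
Qed.

(** An action of a group by k-automorphisms of X.  For an admissible open V
    contained in g U, [oact g] maps O(U) to O(V): it is the isomorphism
    O(U) -> O(g U) followed by restriction. *)
Record gact (Gam : groupType) (k : fieldType) (X : rgspace k) := GAct {
  pact : Gam -> point X -> point X;
  pact_whole : forall g x, whole x -> whole (pact g x);
  pact1 : forall x, whole x -> pact 1%g x = x;
  pactM : forall g1 g2 x, whole x -> pact (g1 * g2)%g x = pact g1 (pact g2 x);
  translate := fun g (U : set (point X)) =>
    [set x | whole x /\ U (pact g^-1%g x)];
  pact_adm : forall g U, adm U -> adm (translate g U);
  pact_cov : forall g U C, cov U C ->
    cov (translate g U) [set translate g W | W in C];
  within := fun g (V U : opn X) => forall x, oset V x -> oset U (pact g^-1%g x);
  oact : forall g (U V : opn X), within g V U -> {rmorphism reg U -> reg V};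
  oact1 : forall U V (h : within 1%g V U) (h' : V [<=] U) a,
    oact h a = rs h' a;
  oactM : forall g1 g2 U V W (h1 : within g1 W V) (h2 : within g2 V U)
    (h : within (g1 * g2)%g W U) a, oact h a = oact h1 (oact h2 a);
  oact_cst : forall g U V (h : within g V U) c, oact h (cst U c) = cst V c }.

Section Equivariant.
Variables (Gam : groupType) (k : fieldType) (X : rgspace k) (act : gact Gam X).

(** Objects of VectCon^Gam(X).  As D_X is the enveloping algebra of the tangent
    sheaf, a D_X-module is an O_X-module with an action [nab] of the tangent
    sheaf satisfying the defining relations of that algebra.  [eact g] is
    the equivariant structure, with the same convention as [oact]. *)
Record vectcon := VectCon {
  vmod :> omod X;
  vcoh : coherent vmod;
  nab : forall U : opn X, tangent U -> sec vmod U -> sec vmod U;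
  nabD : forall U (D : tangent U) x y, nab D (x + y) = nab D x + nab D y;
  nabM : forall U (D : tangent U) a x,
    nab D (a *: x) = a *: nab D x + tapp D a *: x;
  nab_lin : forall U (D D1 D2 : tangent U) (a : reg U),
    (forall V (h : V [<=] U) b,
       tfun D h b = rs h a * tfun D1 h b + tfun D2 h b) ->
    forall x, nab D x = a *: nab D1 x + nab D2 x;
  nab_lie : forall U (D D1 D2 : tangent U),
    (forall V (h : V [<=] U) b,
       tfun D h b = tfun D1 h (tfun D2 h b) - tfun D2 h (tfun D1 h b)) ->
    forall x, nab D x = nab D1 (nab D2 x) - nab D2 (nab D1 x);
  nab_res : forall U V (h : V [<=] U) (D : tangent U) (D' : tangent V),
    (forall W (hW : W [<=] V) b, tfun D' hW b = tfun D (osub_trans h hW) b) ->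
    forall x, mrs h (nab D x) = nab D' (mrs h x);
  eact : forall g (U V : opn X), within act g V U -> sec vmod U -> sec vmod V;
  eact_lin : forall g U V (h : within act g V U) (a : reg U) x y,
    eact h (a *: x + y) = oact h a *: eact h x + eact h y;
  eact1 : forall U V (h : within act 1%g V U) (h' : V [<=] U) x,
    eact h x = mrs h' x;
  eactM : forall g1 g2 U V W (h1 : within act g1 W V) (h2 : within act g2 V U)
    (h : within act (g1 * g2)%g W U) x, eact h x = eact h1 (eact h2 x);
  eact_nab : forall g U V (h : within act g V U) (D : tangent U) (D' : tangent V),
    (forall W W' (hW : W [<=] U) (hW' : W' [<=] V) (hg : within act g W' W) b,
       tfun D' hW' (oact hg b) = oact hg (tfun D hW b)) ->
    forall x, eact h (nab D x) = nab D' (eact h x) }.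

Record dmod_mor (M N : vectcon) (phi : forall U, sec M U -> sec N U) : Prop := {
  dmod_mor_omod : omod_mor phi;
  dmod_mor_nab : forall U (D : tangent U) x, phi U (nab D x) = nab D (phi U x) }.

Definition commutes_with (M N : vectcon) (phi : forall U, sec M U -> sec N U)
    (g : Gam) : Prop :=
  forall U V (h : within act g V U) x, phi V (eact h x) = eact h (phi U x).

Definition vc_hom (M N : vectcon) : Type :=
  {phi : forall U, sec M U -> sec N U |
     dmod_mor phi /\ forall g, commutes_with phi g}.

Definition vc_id (M : vectcon) : vc_hom M M.
Proof. by exists (fun U x => x). Defined.

Definition vc_cmp (M N P : vectcon) (f : vc_hom N P) (g : vc_hom M N) :
  vc_hom M P.
Proof.
exists (fun U x => sval f U (sval g U x)).
case: f g => [f [[[fl fr] fn] fe]] [g [[[gl gr] gn] ge]] /=; split.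
  split; first split.
  - by move=> U a x y; rewrite gl fl.
  - by move=> U V h x; rewrite fr gr.
  - by move=> U D x; rewrite gn fn.
by move=> y U V h x; rewrite ge fe.
Defined.

Definition vc_cat : category.
Proof.
by refine (@Category vectcon vc_hom vc_id vc_cmp _ _ _) => *; apply: sig_ext.
Defined.

Definition sheaf_mono (M N : vectcon) (f : vc_hom M N) : Prop :=
  forall U, injective (sval f U).

Definition sheaf_epi (M N : vectcon) (f : vc_hom M N) : Prop :=
  forall U (y : sec N U),
    locally (U := U) (fun V h => exists x, sval f V x = mrs h y).

Definition vc_short_exact (M' M M'' : vectcon) (f : vc_hom M' M)
    (g : vc_hom M M'') : Prop :=
  [/\ sheaf_mono f,
      forall U (x : sec M U), sval g U x = 0 <-> locally (U := U)
        (fun V h => exists y, sval f V y = mrs h x)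
    & sheaf_epi g].

Definition subquotient (M N : vectcon) : Prop :=
  exists (P : vectcon) (i : vc_hom P M) (q : vc_hom P N),
    sheaf_mono i /\ sheaf_epi q.

Lemma tfun_irr (U V : opn X) (D : tangent U) (h h' : V [<=] U) a : tfun D h a = tfun D h' a.
Proof. by rewrite (Prop_irrelevance h h'). Qed.

Definition reg_mod : omod X.
Proof.
refine (@OMod k X (fun U => (reg U)^o) (fun U V h => rs h) _ _ _ _).
- by move=> U V h a x y; rewrite /GRing.scale /= rmorphD rmorphM.
- by move=> U h x; apply: rs_id.
- by move=> U V W h1 h2 h3 x; apply: rs_comp.
- exact: reg_sheaf.
Defined.

Lemma reg_coherent : coherent reg_mod.
Proof.
apply: (@free_coherent _ _ _ 1); exists (fun=> 1) => V h x.
exists [ffun=> x]; split.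
  by rewrite big_ord1 ffunE /= rmorph1 /GRing.scale /= mulr1.
move=> c; rewrite big_ord1 /= rmorph1 /GRing.scale /= mulr1 => xE.
by apply/ffunP => i; rewrite ffunE ord1.
Qed.

Definition reg_vc : vectcon.
Proof.
refine (@VectCon reg_mod reg_coherent (fun U D => tapp D) _ _ _ _ _
  (fun g U V h => oact h) _ _ _ _).
- by move=> U D x y; apply: tfun_add.
- by move=> U D a x; rewrite /tapp tfun_mul /GRing.scale /= [X in _ + X]mulrC.
- by move=> U D D1 D2 a DE x; rewrite /tapp DE rs_id.
- by move=> U D D1 D2 DE x; rewrite /tapp DE.
- move=> U V h D D' DE x /=; rewrite /tapp (tfun_res D _ h) DE; exact: tfun_irr.
- by move=> g U V h a x y; rewrite /GRing.scale /= rmorphD rmorphM.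
- by move=> U V h h1 x; exact: (oact1 h h1).
- by move=> g1 g2 U V W h1 h2 h x; exact: (oactM h1 h2 h).
- by move=> g U V h D D' DE x; apply: esym; apply: DE.
Defined.

Record bilin (M N P : omod X)
    (b : forall U, sec M U -> sec N U -> sec P U) : Prop := {
  bilin_l : forall U (a : reg U) x x' y,
    b U (a *: x + x') y = a *: b U x y + b U x' y;
  bilin_r : forall U (a : reg U) x y y',
    b U x (a *: y + y') = a *: b U x y + b U x y';
  bilin_res : forall U V (h : V [<=] U) x y,
    mrs h (b U x y) = b V (mrs h x) (mrs h y) }.

(** Tensor products over O_X, characterised by their universal property among
    all O_X-modules, with D_X acting by the Leibniz rule and Gam diagonally. *)
Record is_tensor (M N P : vectcon)
    (b : forall U, sec M U -> sec N U -> sec P U) : Prop := {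
  tensor_bilin : bilin b;
  tensor_nab : forall U (D : tangent U) x y,
    nab D (b U x y) = b U (nab D x) y + b U x (nab D y);
  tensor_eact : forall g U V (h : within act g V U) x y,
    eact h (b U x y) = b V (eact h x) (eact h y);
  tensor_univ : forall (E : omod X) (c : forall U, sec M U -> sec N U -> sec E U),
    bilin c ->
    exists phi : forall U, sec P U -> sec E U,
      [/\ omod_mor phi, forall U x y, phi U (b U x y) = c U x y
        & forall phi' : forall U, sec P U -> sec E U, omod_mor phi' ->
            (forall U x y, phi' U (b U x y) = c U x y) ->
            forall U z, phi' U z = phi U z] }.

Record vc_tensor := VCTensor {
  vct : vectcon -> vectcon -> vectcon;
  vcp : forall (M N : vectcon) U, sec M U -> sec N U -> sec (vct M N) U;
  vctP : forall M N, is_tensor (@vcp M N) }.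

End Equivariant.

Arguments reg_vc {Gam k X} act.

Record rep_tensor (k : fieldType) (H : groupType) := RepTensor {
  rpt : repfd k H -> repfd k H -> repfd k H;
  rpp : forall V W, rep_of V -> rep_of W -> rep_of (rpt V W);
  rpp_l : forall V W a (v v' : rep_of V) (w : rep_of W),
    rpp (a *: v + v') w = a *: rpp v w + rpp v' w;
  rpp_r : forall V W a (v : rep_of V) (w w' : rep_of W),
    rpp v (a *: w + w') = a *: rpp v w + rpp v w';
  rpp_act : forall V W h (v : rep_of V) (w : rep_of W),
    ract h (rpp v w) = rpp (ract h v) (ract h w);
  rpp_univ : forall V W (E : lmodType k) (c : rep_of V -> rep_of W -> E),
    (forall a v v' w, c (a *: v + v') w = a *: c v w + c v' w) ->
    (forall a v w w', c v (a *: w + w') = a *: c v w + c v w') ->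
    exists L : rep_of (rpt V W) -> E,
      [/\ linear L, forall v w, L (rpp v w) = c v w
        & forall L' : rep_of (rpt V W) -> E, linear L' ->
            (forall v w, L' (rpp v w) = c v w) -> forall z, L' z = L z] }.

Section Trivial.
Variables (G H : groupType) (k : fieldType) (X : rgspace k).
Variable act : gact (dprod G H) X.

Lemma rs_klinear (U V : opn X) (h : V [<=] U) : klinear (cst U) (cst V) (rs h).
Proof. by split=> [a b|c a]; rewrite ?rmorphD ?rmorphM ?rs_cst. Qed.

Lemma oact_klinear g (U V : opn X) (h : within act g V U) :
  klinear (cst U) (cst V) (oact h).
Proof. by split=> [a b|c a]; rewrite ?rmorphD ?rmorphM ?oact_cst. Qed.

Lemma id_klinear (U : opn X) : klinear (cst U) (cst U) id.
Proof. by []. Qed.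

Lemma tapp_klinear (U : opn X) (D : tangent U) :
  klinear (cst U) (cst U) (tapp D).
Proof.
by split=> [a b|c a]; rewrite /tapp ?tfun_add ?tfun_mul ?tfun_cst ?mulr0 ?addr0.
Qed.

Section Object.
Variables (V : rep k H) (fdV : exists n, has_dim V n).

Definition triv_sec (U : opn X) : lmodType (reg U) := tens (cst U) V.

Definition triv_res (U W : opn X) (h : W [<=] U) : triv_sec U -> triv_sec W :=
  tmap (rs_klinear h) (@linear_id k V).

Lemma triv_resE U W (h : W [<=] U) (T : triv_sec U) l :
  sval (triv_res h T) l = rs h (sval T l).
Proof. by rewrite /= dcomp_id. Qed.

Lemma triv_sheaf : is_sheaf triv_res.
Proof.
have [n [e eP]] := fdV; have [x [xe _]] := coord_exists eP.
move=> U C UC; split=> [S T ST|s sP].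
  apply/sig_ext/funext => l.
  apply: (reg_sheaf UC).1 => W h CW.
  by rewrite -!triv_resE ST.
have /boolp.choice[t tP] : forall l : dual V, exists t : reg U,
    forall W c (h : W [<=] U), rs h t = sval (s W c) l.
  move=> l; apply: ((reg_sheaf UC).2 (fun W c => sval (s W c) l)).
  by move=> W1 W2 W c1 c2 h1 h2; rewrite -!triv_resE (sP W1 W2 W c1 c2 h1 h2).
have tE l : t l = \sum_i cst U (sval l (e i)) * t (x i).
  apply: (reg_sheaf UC).1 => W h CW; rewrite (tP l W CW) rmorph_sum.
  rewrite (tens_expand _ xe); apply: eq_bigr => i _.
  by rewrite rmorphM rs_cst (tP _ W CW).
have tS : exists s : seq (reg U * V),
    forall l, t l = \sum_(p <- s) pure_fun (cst U) p.1 p.2 l.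
  exists [seq (t (x i), e i) | i <- index_enum 'I_n] => l.
  by rewrite big_map tE.
exists (exist _ t tS) => W c h; apply/sig_ext/funext => l.
by rewrite triv_resE /= (tP l W c).
Qed.

Definition triv_mod : omod X.
Proof.
refine (@OMod k X triv_sec triv_res _ _ _ triv_sheaf).
- by move=> U W h a x y; apply/sig_ext/funext => l;
    rewrite tensD tensZ !triv_resE tensD tensZ rmorphD rmorphM.
- by move=> U h x; apply/sig_ext/funext => l; rewrite triv_resE rs_id.
- by move=> U W W' h1 h2 h3 x; apply/sig_ext/funext => l;
    rewrite !triv_resE (rs_comp h1 h2 h3).
Defined.

Lemma triv_coherent : coherent triv_mod.
Proof.
have [n [e eP]] := fdV; have [x [xe xd]] := coord_exists eP.
apply: (@free_coherent _ _ _ n); exists (fun i => pure (cst _) 1 (e i)) => U h T.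
have E (c : {ffun 'I_n -> reg U}) l :
    sval (\sum_i c i *: triv_res h (pure (cst (owhole X)) 1 (e i))) l =
    \sum_i cst U (sval l (e i)) * c i.
  rewrite tens_sum; apply: eq_bigr => i _.
  by rewrite tensZ triv_resE /= /pure_fun rmorphM rs_cst rmorph1 mulr1 mulrC.
exists [ffun i => sval T (x i)]; split.
  apply/sig_ext/funext => l; rewrite E (tens_expand _ xe).
  by apply: eq_bigr => i _; rewrite ffunE.
move=> c ->; apply/ffunP => i; rewrite ffunE E (bigD1 i)//= xd eqxx rmorph1 mul1r.
by rewrite big1 ?addr0// => j /negbTE ji; rewrite xd eq_sym ji rmorph0 mul0r.
Qed.

Definition triv_nab (U : opn X) (D : tangent U) : triv_sec U -> triv_sec U :=
  tmap (tapp_klinear D) (@linear_id k V).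

Lemma triv_nabE (U : opn X) (D : tangent U) T l :
  sval (triv_nab D T) l = tapp D (sval T l).
Proof. by rewrite /= dcomp_id. Qed.

Definition triv_act (g : dprod G H) (U W : opn X) (h : within act g W U) :
    triv_sec U -> triv_sec W :=
  tmap (oact_klinear h) (ract_lin g.2).

Definition triv_vc : vectcon act.
Proof.
refine (@VectCon _ k X act triv_mod triv_coherent triv_nab _ _ _ _ _ triv_act
  _ _ _ _).
- by move=> U D x y; apply/sig_ext/funext => l;
    rewrite tensD !triv_nabE tensD /tapp tfun_add.
- by move=> U D a x; apply/sig_ext/funext => l;
    rewrite tensD !tensZ !triv_nabE tensZ /tapp tfun_mul [X in _ + X]mulrC.
- by move=> U D D1 D2 a DE x; apply/sig_ext/funext => l;
    rewrite tensD tensZ !triv_nabE /tapp DE rs_id.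
- by move=> U D D1 D2 DE x; apply/sig_ext/funext => l;
    rewrite /= !dcomp_id// /tapp DE.
- move=> U W h D D' DE x; apply/sig_ext/funext => l.
  rewrite /mrs triv_resE !triv_nabE triv_resE /tapp (tfun_res D _ h) DE.
  exact: tfun_irr.
- by move=> g U W h a x y; apply/sig_ext/funext => l;
    rewrite tensD tensZ /= rmorphD rmorphM.
- move=> U W h h' x; apply/sig_ext/funext => l.
  rewrite /mrs triv_resE /= (oact1 h h') dcomp_id// => v; exact: ract1.
- move=> g1 g2 U W W' h1 h2 h x; apply/sig_ext/funext => l.
  rewrite /= (oactM h1 h2); congr (oact h1 (oact h2 (sval x _))).
  by apply/sig_ext/funext => v /=; rewrite ractM.
- move=> g U W h D D' DE x; apply/sig_ext/funext => l.
  by rewrite triv_nabE /= dcomp_id// /tapp (DE _ _ (osub_refl U)).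
Defined.

End Object.

Definition triv_hom (V W : repfd k H) (f : hom V W) :
  vc_hom (triv_vc (svalP V)) (triv_vc (svalP W)).
Proof.
exists (fun U => tmap (@id_klinear U) (proj1 (svalP f))).
split; first split; first split.
- by move=> U a x y; apply/sig_ext/funext.
- move=> U U' h x; apply/sig_ext/funext => l.
  by rewrite /mrs triv_resE /= dcomp_id.
- move=> U D x; apply/sig_ext/funext => l.
  by rewrite /nab /= !dcomp_id.
move=> g U U' h x; apply/sig_ext/funext => l /=; congr (oact h (sval x _)).
by apply/sig_ext/funext => v /=; rewrite (proj2 (svalP f)).
Defined.

Definition triv : functor (repfd k H) (vc_cat act).
Proof.
refine (@Functor (repfd k H) (vc_cat act) (fun V => triv_vc (svalP V)) triv_hom _ _).
- move=> V; apply/sig_ext/functional_extensionality_dep => U.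
  by apply/funext => x; apply/sig_ext/funext => l /=; rewrite dcomp_id.
- move=> V W Z f g; apply/sig_ext/functional_extensionality_dep => U.
  apply/funext => x; apply/sig_ext/funext => l /=; congr (sval x _).
  exact: sig_ext.
Defined.

End Trivial.

Section Translates.
Variables (Gam : groupType) (k : fieldType) (X : rgspace k) (act : gact Gam X).

Definition otrans (g : Gam) (U : opn X) : opn X := Opn (pact_adm act g (opnP U)).

Lemma pactK g x : whole x -> pact act g^-1%g (pact act g x) = x.
Proof. by move=> wx; rewrite -pactM// mulVg pact1. Qed.

Lemma pactKV g x : whole x -> pact act g (pact act g^-1%g x) = x.
Proof. by move=> wx; rewrite -pactM// mulgV pact1. Qed.

Lemma whole_opn (U : opn X) x : oset U x -> whole x.
Proof. by apply: adm_sub; apply: opnP. Qed.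

Lemma within_trans g U : within act g (otrans g U) U.
Proof. by move=> x []. Qed.

Lemma within_transV g U : within act g U (otrans g^-1%g U).
Proof.
move=> x Ux; have wx := whole_opn Ux; split; first exact: pact_whole.
by rewrite invgK pactKV.
Qed.

Lemma within_whole g : within act g (owhole X) (owhole X).
Proof. by move=> x; apply: pact_whole. Qed.

Lemma within_mul g1 g2 U V W : within act g1 W V -> within act g2 V U ->
  within act (g1 * g2)%g W U.
Proof.
by move=> h1 h2 x Wx; rewrite invgM pactM; [apply/h2/h1|apply: whole_opn Wx].
Qed.

Lemma oact_eq g g' U V (h : within act g V U) (h' : within act g' V U) a :
  g = g' -> oact h a = oact h' a.
Proof. by move=> e; case: _ / e h' => h'; rewrite (Prop_irrelevance h h'). Qed.

Lemma eact_eq (M : vectcon act) g g' U V (h : within act g V U)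
    (h' : within act g' V U) (x : sec M U) :
  g = g' -> eact h x = eact h' x.
Proof. by move=> e; case: _ / e h' => h'; rewrite (Prop_irrelevance h h'). Qed.

Lemma oact_comm g1 g2 g1' g2' U V V' W (h1 : within act g1 W V)
    (h2 : within act g2 V U) (h1' : within act g1' W V')
    (h2' : within act g2' V' U) a :
  (g1 * g2 = g1' * g2')%g -> oact h1 (oact h2 a) = oact h1' (oact h2' a).
Proof.
move=> e; rewrite -(oactM h1 h2 (within_mul h1 h2)).
by rewrite -(oactM h1' h2' (within_mul h1' h2')); apply: oact_eq.
Qed.

Lemma eact_comm (M : vectcon act) g1 g2 g1' g2' U V V' W
    (h1 : within act g1 W V) (h2 : within act g2 V U)
    (h1' : within act g1' W V') (h2' : within act g2' V' U) (x : sec M U) :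
  (g1 * g2 = g1' * g2')%g -> eact h1 (eact h2 x) = eact h1' (eact h2' x).
Proof.
move=> e; rewrite -(eactM h1 h2 (within_mul h1 h2)).
by rewrite -(eactM h1' h2' (within_mul h1' h2')); apply: eact_eq.
Qed.

Lemma osub_within (U V : opn X) : V [<=] U -> within act 1%g V U.
Proof.
by move=> h x Vx; rewrite invg1 pact1; [apply: h|apply: whole_opn Vx].
Qed.

Lemma mrs_eact (M : vectcon act) g U V U' V' (h : within act g V U)
    (h' : within act g V' U') (hV : V' [<=] V) (hU : U' [<=] U) (x : sec M U) :
  mrs hV (eact h x) = eact h' (mrs hU x).
Proof.
rewrite -(eact1 (osub_within hV)) -(eact1 (osub_within hU)).
by apply: eact_comm; rewrite mul1g mulg1.
Qed.

Lemma oact_inv g U V (h : within act g U V) (h' : within act g^-1%g V U) a :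
  oact h (oact h' a) = a.
Proof.
have hU := osub_within (osub_refl U).
rewrite (oact_comm h h' hU hU) ?mulgV ?mulg1//.
by rewrite !(oact1 hU (osub_refl U)) !rs_id.
Qed.

Lemma trans_sub g U (W : opn X) (h : W [<=] otrans g U) :
  otrans g^-1%g W [<=] U.
Proof.
by move=> x [wx /h [_ +]]; rewrite invgK pactK.
Qed.

Section Conjugate.
Variables (g : Gam) (U : opn X) (D : tangent U).

Let c W (h : W [<=] otrans g U) (a : reg W) : reg W :=
  oact (@within_transV g W) (tfun D (trans_sub h) (oact (@within_trans g^-1%g W) a)).

Lemma conj_oact W V (hW : W [<=] otrans g U) (hV : V [<=] U)
    (h : within act g W V) b :
  c hW (oact h b) = oact h (tfun D hV b).
Proof.
have hs : otrans g^-1%g W [<=] V.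
  by move=> x [wx Wx]; have := h _ Wx; rewrite invgK pactK.
have E : oact (@within_trans g^-1%g W) (oact h b) = rs hs b.
  rewrite -(oact1 (osub_within hs)).
  rewrite (oact_comm _ _ (osub_within hs) (osub_within (osub_refl V))).
    by rewrite (oact1 (osub_within (osub_refl V)) (osub_refl V)) rs_id.
  by rewrite mulVg mulg1.
rewrite /c E -(tfun_res D hV (trans_sub hW) hs) -(oact1 (osub_within hs)).
rewrite (oact_comm _ _ h (osub_within (osub_refl V))) ?mulg1//.
by rewrite (oact1 (osub_within (osub_refl V)) (osub_refl V)) rs_id.
Qed.

Lemma conj_oactV g' W V (hW : W [<=] otrans g U) (hV : V [<=] U)
    (h : within act g' V W) b :
  (g' * g = 1)%g -> tfun D hV (oact h b) = oact h (c hW b).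
Proof.
move=> gg; have e : (g' = g^-1)%g by apply: (mulIg g); rewrite gg mulVg.
have hs : V [<=] otrans g^-1%g W.
  by move=> x Vx; split; [apply: whole_opn Vx|rewrite -e; apply: h].
have E : oact h b = rs hs (oact (@within_trans g^-1%g W) b).
  rewrite -(oact1 (osub_within hs)).
  rewrite -(oactM _ _ (within_mul (osub_within hs) (@within_trans g^-1%g W))).
  by apply: oact_eq; rewrite mul1g.
rewrite E -(tfun_res D (trans_sub hW) hV hs) /c -(oact1 (osub_within hs)).
rewrite -[LHS](rs_id (osub_refl V)) -(oact1 (osub_within (osub_refl V))).
by apply: oact_comm; rewrite mul1g gg.
Qed.

Definition conj_tangent : tangent (otrans g U).
Proof.
refine (@Tangent _ _ _ c _ _ _ _).
- by move=> V h a b; rewrite /c rmorphD tfun_add rmorphD.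
- by move=> V h a b; rewrite /c rmorphM tfun_mul rmorphD !rmorphM !oact_inv.
- by move=> V h a; rewrite /c oact_cst tfun_cst rmorph0.
- move=> V W hV hW h a.
  have hs : otrans g^-1%g W [<=] otrans g^-1%g V by move=> x [wx /h].
  have E : rs h a = oact (@within_transV g W)
      (rs hs (oact (@within_trans g^-1%g V) a)).
    rewrite -(oact1 (osub_within hs)) (oact_comm _ (osub_within hs)
      (osub_within h) (@within_transV g V)) ?mulg1 ?mul1g//.
    by rewrite oact_inv (oact1 (osub_within h) h).
  rewrite E (conj_oact hW (trans_sub hW)) -(tfun_res D (trans_sub hV) _ hs).
  rewrite -(oact1 (osub_within h) h) -(oact1 (osub_within hs)) /c.
  by apply: oact_comm; rewrite mul1g mulg1.
Defined.

End Conjugate.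
End Translates.

Arguments osub_within {Gam k X act U V} _.

Section HomFunctor.
Variables (G H : groupType) (k : fieldType) (X : rgspace k).
Variable act : gact (dprod G H) X.

Definition inG (g : G) : dprod G H := (g, 1%g).
Definition inH (h : H) : dprod G H := (1%g, h).

Lemma inGH g h : (inG g * inH h = inH h * inG g)%g.
Proof. by congr pair => /=; rewrite mul1g mulg1. Qed.

Lemma inHM h1 h2 : inH (h1 * h2)%g = (inH h1 * inH h2)%g.
Proof. by congr pair => /=; rewrite mulg1. Qed.

Section Object.
Variable M : vectcon act.

Definition homGD : Type :=
  {phi : forall U, sec (reg_vc act) U -> sec M U |
     dmod_mor phi /\ forall g : G, commutes_with phi (inG g)}.

Lemma homGD_ext (f g : homGD) :
  (forall U x, sval f U x = sval g U x) -> f = g.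
Proof.
move=> fg; apply/sig_ext/functional_extensionality_dep => U.
by apply/funext => x.
Qed.

HB.instance Definition _ := gen_eqMixin homGD.
HB.instance Definition _ := gen_choiceMixin homGD.

Lemma mrs_additive (N : omod X) (U V : opn X) (h : V [<=] U) (x y : sec N U) :
  mrs h (x + y) = mrs h x + mrs h y.
Proof. by rewrite -[x in LHS]scale1r mrs_lin rmorph1 scale1r. Qed.

Lemma mrs_scale (N : omod X) (U V : opn X) (h : V [<=] U) a (x : sec N U) :
  mrs h (a *: x) = rs h a *: mrs h x.
Proof.
have m0 : mrs h (0 : sec N U) = 0.
  by apply: (addrI (mrs h 0)); rewrite -mrs_additive !addr0.
by rewrite -[a *: x]addr0 mrs_lin m0 addr0.
Qed.

Lemma eact_additive g (U V : opn X) (h : within act g V U) (x y : sec M U) :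
  eact h (x + y) = eact h x + eact h y.
Proof. by rewrite -[x in LHS]scale1r eact_lin rmorph1 scale1r. Qed.

Lemma eact_scale g (U V : opn X) (h : within act g V U) a (x : sec M U) :
  eact h (a *: x) = oact h a *: eact h x.
Proof.
have m0 : eact h (0 : sec M U) = 0.
  by apply: (addrI (eact h 0)); rewrite -eact_additive !addr0.
by rewrite -[a *: x]addr0 eact_lin m0 addr0.
Qed.

Lemma nab_cst (U : opn X) (D : tangent U) c (x : sec M U) :
  nab D (cst U c *: x) = cst U c *: nab D x.
Proof. by rewrite nabM /tapp tfun_cst scale0r addr0. Qed.

Lemma nab0 (U : opn X) (D : tangent U) : nab D (0 : sec M U) = 0.
Proof. by apply: (addrI (nab D 0)); rewrite -nabD !addr0. Qed.

Definition homGD_comb (c : k) (f g : homGD) : homGD.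
Proof.
exists (fun U x => cst U c *: sval f U x + sval g U x).
case: f g => [f [[[fl fr] fn] fe]] [g [[[gl gr] gn] ge]] /=; split.
  split; first split.
  - move=> U a x y; rewrite fl gl !scalerDr !scalerA [cst U c * a]mulrC.
    by rewrite !addrA; congr (_ + _); rewrite -!addrA; congr (_ + _); rewrite addrC.
  - by move=> U V h x; rewrite mrs_lin rs_cst fr gr.
  - by move=> U D x; rewrite nabD nab_cst fn gn.
by move=> y U V h x; rewrite eact_lin oact_cst fe ge.
Defined.

Definition homGD0 : homGD.
Proof.
exists (fun U x => 0); split; first split; first split.
- by move=> U a x y; rewrite scaler0 addr0.
- by move=> U V h x; apply: (addrI (mrs h 0)); rewrite -mrs_additive !addr0.
- by move=> U D x; rewrite nab0.
by move=> y U V h x; apply: esym; apply: (addrI (eact h 0));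
  rewrite -eact_additive !addr0.
Defined.

Definition homGD_add (f g : homGD) := homGD_comb 1 f g.
Definition homGD_scale (c : k) (f : homGD) := homGD_comb c f homGD0.
Definition homGD_opp (f : homGD) := homGD_scale (-1) f.

Lemma homGD_addE f g U x : sval (homGD_add f g) U x = sval f U x + sval g U x.
Proof. by rewrite /= rmorph1 scale1r. Qed.

Lemma homGD_scaleE c f U x : sval (homGD_scale c f) U x = cst U c *: sval f U x.
Proof. by rewrite /= addr0. Qed.

Lemma homGD_addA : associative homGD_add.
Proof. by move=> f g h; apply: homGD_ext => U x; rewrite !homGD_addE addrA. Qed.
Lemma homGD_addC : commutative homGD_add.
Proof. by move=> f g; apply: homGD_ext => U x; rewrite !homGD_addE addrC. Qed.
Lemma homGD_add0 : left_id homGD0 homGD_add.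
Proof. by move=> f; apply: homGD_ext => U x; rewrite homGD_addE add0r. Qed.
Lemma homGD_addN : left_inverse homGD0 homGD_opp homGD_add.
Proof.
move=> f; apply: homGD_ext => U x.
by rewrite homGD_addE homGD_scaleE rmorphN1 scaleN1r addNr.
Qed.
HB.instance Definition _ :=
  GRing.isZmodule.Build homGD homGD_addA homGD_addC homGD_add0 homGD_addN.

Lemma homGD_scaleA a b f :
  homGD_scale a (homGD_scale b f) = homGD_scale (a * b) f.
Proof.
by apply: homGD_ext => U x; rewrite !homGD_scaleE scalerA rmorphM.
Qed.
Lemma homGD_scale1 : left_id 1 homGD_scale.
Proof.
by move=> f; apply: homGD_ext => U x; rewrite homGD_scaleE rmorph1 scale1r.
Qed.
Lemma homGD_scaleDr : right_distributive homGD_scale +%R.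
Proof.
move=> a f g; apply: homGD_ext => U x.
by rewrite homGD_scaleE !homGD_addE !homGD_scaleE scalerDr.
Qed.
Lemma homGD_scaleDl f : {morph homGD_scale^~ f : a b / a + b}.
Proof.
move=> a b; apply: homGD_ext => U x.
by rewrite homGD_addE !homGD_scaleE rmorphD scalerDl.
Qed.
HB.instance Definition _ := GRing.Zmodule_isLmodule.Build k homGD
  homGD_scaleA homGD_scale1 homGD_scaleDr homGD_scaleDl.

Lemma homGD_combE a (f g : homGD) U x :
  sval (a *: f + g) U x = cst U a *: sval f U x + sval g U x.
Proof. by rewrite homGD_addE homGD_scaleE. Qed.

(** h . phi = h^M o phi o (h^O)^-1 *)
Definition homGD_fun (h : H) (phi : homGD) (U : opn X) (x : sec (reg_vc act) U) :
    sec M U :=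
  eact (@within_transV _ _ _ act (inH h) U)
    (sval phi _ (eact (@within_trans _ _ _ act (inH h)^-1%g U) x)).

Lemma homGD_fun_comb h (phi : homGD) (U : opn X) a (x y : sec (reg_vc act) U) :
  homGD_fun h phi (a *: x + y) = a *: homGD_fun h phi x + homGD_fun h phi y.
Proof.
rewrite /homGD_fun eact_lin; case: phi => phi [[[fl _] _] _] /=.
by rewrite fl eact_lin oact_inv.
Qed.

Definition homGD_act (h : H) (phi : homGD) : homGD.
Proof.
exists (homGD_fun h phi); split; first split; first split.
- by move=> U a x y; apply: homGD_fun_comb.
- move=> U V hV x; rewrite /homGD_fun.
  have hs : otrans act (inH h)^-1%g V [<=] otrans act (inH h)^-1%g U.
    by move=> y [wy /hV].
  rewrite (mrs_eact _ (@within_transV _ _ _ act (inH h) V) _ hs); congr (eact _ _).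
  case: phi => phi [[[_ fr] _] _] /=; rewrite fr; congr (phi _ _).
  exact: (@mrs_eact _ _ _ act (reg_vc act)).
- move=> U D x; rewrite /homGD_fun.
  set D' := conj_tangent act (inH h)^-1%g D.
  have E : eact (@within_trans _ _ _ act (inH h)^-1%g U)
      (nab D x : sec (reg_vc act) U) =
      nab D' (eact (@within_trans _ _ _ act (inH h)^-1%g U) x).
    by apply: eact_nab => W W' hW hW' hg b; apply: conj_oact.
  rewrite E (dmod_mor_nab (proj1 (svalP phi))).
  by apply: eact_nab => W W' hW hW' hg b; apply: conj_oactV; rewrite mulgV.
move=> g U V hg x; rewrite /homGD_fun.
have hg' : within act (inG g) (otrans act (inH h)^-1%g V)
    (otrans act (inH h)^-1%g U).
  move=> y [wy]; rewrite invgK => Vy; split; first exact: pact_whole.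
  have e : (inH h * (inG g)^-1 = (inG g)^-1 * inH h)%g.
    by congr pair; rewrite /= ?invg1 ?mul1g ?mulg1.
  rewrite invgK -pactM// e pactM//.
  exact: hg.
have -> : eact (@within_trans _ _ _ act (inH h)^-1%g V)
    (eact hg x : sec (reg_vc act) V) =
    eact hg' (eact (@within_trans _ _ _ act (inH h)^-1%g U) x).
  by apply: eact_comm; congr pair; rewrite /= ?invg1 ?mul1g ?mulg1.
rewrite (proj2 (svalP phi)).
by apply: eact_comm; rewrite inGH.
Defined.

Lemma homGD_actE h (phi : homGD) U U' (h1 : within act (inH h) U U')
    (h2 : within act (inH h)^-1%g U' U) (x : sec (reg_vc act) U) :
  sval (homGD_act h phi) U x = eact h1 (sval phi U' (eact h2 x)).
Proof.
rewrite /= /homGD_fun.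
have hs : U' [<=] otrans act (inH h)^-1%g U.
  by move=> y U'y; split; [apply: whole_opn U'y|apply: h2].
rewrite -[LHS](mrs_id (osub_refl U)) (mrs_eact _ h1 _ hs); congr (eact h1 _).
rewrite (omod_mor_res (dmod_mor_omod (proj1 (svalP phi)))); congr (sval phi U' _).
rewrite (@mrs_eact _ _ _ act (reg_vc act) _ _ _ _ _ _ h2 hs (osub_refl U)).
by rewrite mrs_id.
Qed.

Lemma homGD_act_lin h : linear (homGD_act h).
Proof.
move=> a f g; apply: homGD_ext => U x.
rewrite [RHS]homGD_addE homGD_scaleE /= /homGD_fun homGD_addE homGD_scaleE.
by rewrite eact_lin oact_cst.
Qed.

Lemma homGD_act1 f : homGD_act 1%g f = f.
Proof.
apply: homGD_ext => U x.
have h1 : within act (inH 1) U U by apply/osub_within/osub_refl.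
have h2 : within act (inH 1)^-1%g U U.
  by have -> : ((inH 1)^-1 = 1)%g; [rewrite invg1|apply/osub_within/osub_refl].
rewrite (homGD_actE _ h1 h2).
have -> : eact h2 x = x.
  rewrite (@eact_eq _ _ _ act (reg_vc act) _ 1%g _ _ h2 (osub_within (osub_refl U))).
    by rewrite (eact1 _ (osub_refl U)) mrs_id.
  by rewrite invg1.
by rewrite (eact1 _ (osub_refl U)) mrs_id.
Qed.

Lemma homGD_actM h1 h2 f : homGD_act (h1 * h2)%g f = homGD_act h1 (homGD_act h2 f).
Proof.
apply: homGD_ext => U x.
pose U1 := otrans act (inH h1)^-1%g U; pose U2 := otrans act (inH h2)^-1%g U1.
have a1 : within act (inH h1) U U1 := @within_transV _ _ _ act _ U.
have a2 : within act (inH h2) U1 U2 := @within_transV _ _ _ act _ U1.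
have b1 : within act (inH h1)^-1%g U1 U := @within_trans _ _ _ act _ U.
have b2 : within act (inH h2)^-1%g U2 U1 := @within_trans _ _ _ act _ U1.
have a12 : within act (inH (h1 * h2)%g) U U2.
  by rewrite inHM; apply: within_mul a1 a2.
have b12 : within act (inH (h1 * h2)%g)^-1%g U2 U.
  by rewrite inHM invgM; apply: within_mul b2 b1.
rewrite (homGD_actE _ a12 b12) (homGD_actE _ a1 b1) (homGD_actE _ a2 b2).
have -> : eact b12 x = eact b2 (eact b1 x).
  rewrite -(eactM b2 b1 (within_mul b2 b1)).
  by apply: eact_eq; rewrite inHM invgM.
rewrite -(eactM a1 a2 (within_mul a1 a2)).
by apply: eact_eq; rewrite inHM.
Qed.

Definition homGD_rep : rep k H :=
  @Rep k H homGD homGD_act homGD_act_lin homGD_act1 homGD_actM.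

End Object.

Lemma homGD_map_subproof (M N : vectcon act) (f : vc_hom M N) (phi : homGD M) :
  dmod_mor (fun U (x : sec (reg_vc act) U) => sval f U (sval phi U x)) /\
  forall g : G, commutes_with
    (fun U (x : sec (reg_vc act) U) => sval f U (sval phi U x)) (inG g).
Proof.
have [[[fl fr] fn] fe] := svalP f.
case: phi => phi [[[pl pr] pn] pe] /=; split; first split; first split.
- by move=> U a x y; rewrite pl fl.
- by move=> U V h x; rewrite fr pr.
- by move=> U D x; rewrite pn fn.
- by move=> g U V h x; rewrite pe fe.
Qed.

Definition homGD_map (M N : vectcon act) (f : vc_hom M N) :
  rep_hom (homGD_rep M) (homGD_rep N).
Proof.
exists (fun phi : homGD M => exist _ _ (homGD_map_subproof f phi) : homGD N).
have [[[fl fr] fn] fe] := svalP f.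
have f0 U : sval f U 0 = 0.
  have := fl U 1 0 0; rewrite !scale1r addr0 => e.
  by apply: (addrI (sval f U 0)); rewrite addr0 -e.
have fZ U (a : reg U) x : sval f U (a *: x) = a *: sval f U x.
  by rewrite -[a *: x]addr0 fl f0 addr0.
have fD U x y : sval f U (x + y) = sval f U x + sval f U y.
  by rewrite -[x in LHS]scale1r fl scale1r.
split.
  move=> a u v; apply: homGD_ext => U x; rewrite [RHS]homGD_combE.
  transitivity (sval f U (sval (a *: u + v) U x)); first by [].
  by rewrite homGD_combE fD fZ.
move=> h phi; apply: homGD_ext => U x.
by rewrite /= /homGD_fun /= fe.
Defined.

Definition homGD_functor : functor (vc_cat act) (rep_cat k H).
Proof.
refine (@Functor (vc_cat act) (rep_cat k H) homGD_rep homGD_map _ _).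
- move=> M; apply/sig_ext/funext => phi; exact: homGD_ext.
- move=> M N P f g; apply/sig_ext/funext => phi; exact: homGD_ext.
Defined.

(** The invariants c_X(X)^G, for c_X the kernel of d, coincide with k. *)
Definition invariant_constants_are_k (Om : omod X)
    (d : forall U, reg U -> sec Om U) : Prop :=
  forall f : reg (owhole X),
    (d (owhole X) f = 0 /\
     forall g : G, oact (within_whole act (inG g)) f = f) <->
    exists! c : k, f = cst (owhole X) c.

Definition dim_hom_eq_rank (M : vc_cat act) : Prop :=
  exists r, has_rank (M : vectcon act) r /\ has_dim (homGD_functor M : rep k H) r.

Lemma dim_hom_fd (M : vc_cat act) : dim_hom_eq_rank M ->
  exists n, has_dim (homGD_functor M : rep k H) n.
Proof. by move=> [r [_ ?]]; exists r. Qed.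

(** Hom_{G-D_X}(O_X, -) on the full subcategory of the M with
    dim_k Hom_{G-D_X}(O_X, M) = rank M. *)
Definition homGD_sub :
    functor (full_subcat (C := vc_cat act) dim_hom_eq_rank) (repfd k H) :=
  restrict (Q := fun V : rep_cat k H => exists n, has_dim (V : rep k H) n)
    (F := homGD_functor) dim_hom_fd.

Definition exact_functor (F : functor (repfd k H) (vc_cat act)) : Prop :=
  forall (V' V V'' : repfd k H) (f : hom V' V) (g : hom V V''),
    rep_short_exact f g ->
    vc_short_exact (fmap F f) (fmap F g).

(** F is a (strong) monoidal functor for the tensor products TX over
    O_X and TH over k.  The coherence isomorphisms are those determined on pure
    tensors; as morphisms out of a tensor product are determined by their
    values on pure tensors, the coherence diagrams are checked there. *)
Definition monoidal_functor (F : functor (repfd k H) (vc_cat act)) : Prop :=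
  forall (TX : vc_tensor act) (TH : rep_tensor k H),
  exists (mu : forall V W : repfd k H,
            vc_hom (vct TX (F V) (F W)) (F (rpt TH V W)))
         (eps : vc_hom (reg_vc act) (F (unitfd k H))),
  let m V W U (x : sec (F V : vectcon act) U)
        (y : sec (F W : vectcon act) U) := sval (mu V W) U (vcp TX x y) in
  [/\ forall V W, is_iso (C := vc_cat act) (mu V W),
      is_iso (C := vc_cat act) eps,
      forall (V V' W W' : repfd k H) (f : hom V V') (g : hom W W')
             (fg : hom (rpt TH V W) (rpt TH V' W')),
        (forall v w, sval fg (rpp TH v w) = rpp TH (sval f v) (sval g w)) ->
        forall U (x : sec (F V : vectcon act) U)
                 (y : sec (F W : vectcon act) U),
          sval (fmap F fg) U (m V W U x y) =
          m V' W' U (sval (fmap F f) U x) (sval (fmap F g) U y),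
      forall (V W Z : repfd k H)
             (al : hom (rpt TH (rpt TH V W) Z) (rpt TH V (rpt TH W Z))),
        (forall v w z, sval al (rpp TH (rpp TH v w) z) =
                       rpp TH v (rpp TH w z)) ->
        forall U (x : sec (F V : vectcon act) U)
                 (y : sec (F W : vectcon act) U)
                 (z : sec (F Z : vectcon act) U),
          sval (fmap F al) U (m (rpt TH V W) Z U (m V W U x y) z) =
          m V (rpt TH W Z) U x (m W Z U y z)
    & forall (V : repfd k H) (lu : hom (rpt TH (unitfd k H) V) V)
             (ru : hom (rpt TH V (unitfd k H)) V),
        (forall (c : k) (v : rep_of V),
           sval lu (rpp TH (c : rep_of (unitfd k H)) v) = c *: v) ->
        (forall (c : k) (v : rep_of V),
           sval ru (rpp TH v (c : rep_of (unitfd k H))) = c *: v) ->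
        forall U (a : reg U) (x : sec (F V : vectcon act) U),
          sval (fmap F lu) U
            (m (unitfd k H) V U (sval eps U a) x) = a *: x /\
          sval (fmap F ru) U
            (m V (unitfd k H) U x (sval eps U a)) = a *: x].

End HomFunctor.

(* Main.v *)
(** Schemes and rigid spaces are treated together: a polynomial ring is a Tate algebra over
    the trivially valued field [k].  Weierstrass division shows that Tate algebras are
    noetherian with residue fields algebraic over [k].  In characteristic 0 it follows that
    at every point [m] of a smooth affinoid some combination of vector fields, with
    coefficients in [m], is the identity on [m / m ^ 2], hence multiplication by [N] on
    [m ^ N / m ^ (N + 1)]: an ideal contained in [m] and stable under vector fields lies in
    all powers of [m] and vanishes near [m], by Krull's theorem.  So a stable ideal is
    generated by an idempotent, and a finitely generated subsheaf of [O ^ n] stable under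
    vector fields and [G] is, by induction on [n], the kernel of an idempotent matrix with
    entries in [c_X(X) ^ G = k].

    Let [s_1, .., s_r] be flat [G]-invariant sections of [M], linearly independent over [k],
    with [r] the rank of [M].  The image of the dual of [M] in [O ^ r] under evaluation at the
    [s_i] is such a subsheaf, and a constant equation for it is a linear relation between the
    [s_i]; so it is [O ^ r], and the [s_i] form a basis of [M].  This identifies the essential
    image.  For a subquotient [N] of a trivial module, apply the result on stable subsheaves
    first to the submodule of which [N] is a quotient, then to the relations between the
    resulting flat generators of [N]. *)
From HB Require Import structures.
From mathcomp Require Import all_boot all_order all_algebra separable.
From mathcomp Require Import boolp classical_sets reals Rstruct.
From mathcomp Require Import zify ring lra.
From mathcomp.multinomials Require Import mpoly.
Require Import Defs.

Set Implicit Arguments.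
Unset Strict Implicit.
Unset Printing Implicit Defensive.

Import Order.TTheory GRing.Theory Num.Theory.
Local Open Scope ring_scope.

(** * Formal power series *)

(** The residue field at [m] may be larger than [k], so the coordinates [T_i] cannot be made to
    vanish at [m] by subtracting constants. Instead a generator of the residue field is corrected by
    one Newton step to some [th] with [p(th)] in [m ^ 2], [p] being its minimal polynomial. Then
    [k[th]] lifts the residue field modulo [m ^ 2], and with [nu_i = T_i - w_i(th)] in [m] the field
    [sum nu_i d/dT_i] is the Euler field; a square Jacobian block carries it to a smooth quotient. A
    vector field is a section of the tangent sheaf, so a derivation of the ring of an affine or
    affinoid open has to be spread over all smaller opens. Localizations and affinoid subdomains
    allow this by their universal properties, used in the second case through dual numbers. Nothing
    makes [X] connected, so a stable ideal need not be trivial. But its idempotent generator is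
    unique; hence it glues, is horizontal and is [G]-invariant, and the hypothesis on constants
    leaves only 0 and 1. The same pattern (local uniqueness, then gluing, then constancy) yields the
    other matrix entries. *)

Section FormalSeries.
Variables (k : fieldType) (n : nat).

(** A copy of [pseries] that carries the ring structure given by [ps_add] and [ps_mul]. *)
Definition fps : Type := 'X_{1..n} -> k.
Identity Coercion fps_fun : fps >-> Funclass.

HB.instance Definition _ := gen_eqMixin fps.
HB.instance Definition _ := gen_choiceMixin fps.

Implicit Types (c d e : fps) (m : 'X_{1..n}) (p q : {mpoly k[n]}).

Fact fps_addA : associative (@ps_add k n).
Proof. by move=> a b c; apply/funext => m; rewrite /ps_add addrA. Qed.
Fact fps_addC : commutative (@ps_add k n).
Proof. by move=> a b; apply/funext => m; rewrite /ps_add addrC. Qed.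
Fact fps_add0 : left_id (fun=> 0) (@ps_add k n).
Proof. by move=> a; apply/funext => m; rewrite /ps_add add0r. Qed.
Fact fps_addN : left_inverse (fun=> 0) (fun c m => - c m) (@ps_add k n).
Proof. by move=> a; apply/funext => m; rewrite /ps_add addNr. Qed.
HB.instance Definition _ := GRing.isZmodule.Build fps
  fps_addA fps_addC fps_add0 fps_addN.

Definition ptrunc (N : nat) c : {mpoly k[n]} :=
  \sum_(m : 'X_{1..n < N}) c m *: 'X_[m].

Lemma mcoeff_trunc N c m : (ptrunc N c)@_m = if (mdeg m < N)%N then c m else 0.
Proof.
case: ifP => [mN|mN]; first by rewrite /ptrunc mcoeff_mpoly.
rewrite /ptrunc raddf_sum big1 //= => i _; rewrite mcoeffZ mcoeffX.
by case: eqP => [e|]; rewrite ?mulr0//; move: (bmdeg i); rewrite e mN.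
Qed.

Definition peq (N : nat) p q := forall m, (mdeg m < N)%N -> p@_m = q@_m.

Lemma peqM N p p' q q' : peq N p p' -> peq N q q' -> peq N (p * q) (p' * q').
Proof.
move=> pp qq m mN; rewrite !mcoeffM; apply: eq_bigr => -[[a ha] [b hb]] _ /=.
by rewrite pp ?qq//; [apply: leq_trans hb _|apply: leq_trans ha _].
Qed.

(** A coefficient of a product only involves coefficients of smaller or equal degree, so the ring
    axioms for series reduce to those for polynomials up to degree [N]. *)
Lemma ps_mulE N (c d : fps) m : (mdeg m < N)%N ->
  ps_mul c d m = (ptrunc N c * ptrunc N d)@_m.
Proof.
move=> mN; rewrite (@peqM (mdeg m).+1 _ (ptrunc (mdeg m).+1 c) _ (ptrunc (mdeg m).+1 d))//.
- rewrite [RHS](mcoeff_poly_mul_lin _ _ (ltnSn (mdeg m))); apply: eq_bigr => i im.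
  by rewrite !mcoeff_trunc bmdeg ltnS mdegB.
- by move=> m' m'N; rewrite !mcoeff_trunc m'N (leq_trans m'N mN).
- by move=> m' m'N; rewrite !mcoeff_trunc m'N (leq_trans m'N mN).
Qed.

Lemma ptruncM N (c d : fps) : peq N (ptrunc N (ps_mul c d)) (ptrunc N c * ptrunc N d).
Proof. by move=> m mN; rewrite mcoeff_trunc mN; apply: ps_mulE. Qed.

Fact fps_mulA : associative (@ps_mul k n).
Proof.
move=> a b c; apply/funext => m; rewrite !(@ps_mulE (mdeg m).+1)//.
have := @ptruncM (mdeg m).+1 b c; have := @ptruncM (mdeg m).+1 a b => h1 h2.
transitivity ((ptrunc (mdeg m).+1 a * (ptrunc (mdeg m).+1 b * ptrunc (mdeg m).+1 c))@_m).
  by apply: (@peqM (mdeg m).+1).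
by rewrite mulrA; apply/esym/(@peqM (mdeg m).+1).
Qed.

Fact fps_mulC : commutative (@ps_mul k n).
Proof.
by move=> a b; apply/funext => m; rewrite !(@ps_mulE (mdeg m).+1)// mulrC.
Qed.

Fact fps_mul1 : left_id (@ps_const k n 1) (@ps_mul k n).
Proof.
move=> a; apply/funext => m; rewrite !(@ps_mulE (mdeg m).+1)//.
rewrite (@peqM (mdeg m).+1 _ 1 _ (ptrunc (mdeg m).+1 a))// ?mul1r ?mcoeff_trunc ?leqnn//.
by move=> m' m'N; rewrite mcoeff_trunc m'N mcoeff1 /ps_const eq_sym; case: eqP => // <-; rewrite eqxx.
Qed.

Fact fps_mulDl : left_distributive (@ps_mul k n : fps -> fps -> fps) +%R.
Proof.
move=> a b c; apply/funext => m; rewrite [RHS]/GRing.add/= /ps_add.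
rewrite /ps_mul -big_split; apply: eq_bigr => i _.
by rewrite [X in X * _]/GRing.add /= /ps_add mulrDl.
Qed.

HB.instance Definition _ := GRing.Zmodule_isComPzRing.Build fps
  fps_mulA fps_mulC fps_mul1 fps_mulDl.

Lemma fpsD c d m : (c + d) m = c m + d m. Proof. by []. Qed.
Lemma fpsN c m : (- c) m = - c m. Proof. by []. Qed.
Lemma fpsB c d m : (c - d) m = c m - d m. Proof. by []. Qed.
Lemma fpsM c d m : (c * d) m = ps_mul c d m. Proof. by []. Qed.
Lemma fps1 m : (1 : fps) m = (m == 0%MM)%:R.
Proof. by rewrite /GRing.one /= /ps_const; case: eqP. Qed.
Lemma fps_sum I (r : seq I) P (F : I -> fps) m :
  (\sum_(i <- r | P i) F i) m = \sum_(i <- r | P i) F i m.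
Proof. by elim/big_rec2: _ => // i y T _ <-. Qed.

Definition fps_of p : fps := fun m => p@_m.

Lemma ptrunc_of N p : peq N (ptrunc N (fps_of p)) p.
Proof. by move=> m mN; rewrite mcoeff_trunc mN. Qed.

Fact fps_of_additive : additive fps_of.
Proof. by move=> p q; apply/funext => m; rewrite fpsB /fps_of mcoeffB. Qed.
HB.instance Definition _ := GRing.isAdditive.Build _ _ fps_of fps_of_additive.
Fact fps_of_multiplicative : multiplicative fps_of.
Proof.
split=> [p q|]; apply/funext => m; last by rewrite fps1 /fps_of mcoeff1.
rewrite fpsM (@ps_mulE (mdeg m).+1)//.
by apply/esym/(@peqM (mdeg m).+1) => //; apply: ptrunc_of.
Qed.
HB.instance Definition _ := GRing.isMultiplicative.Build _ _ fps_of fps_of_multiplicative.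

Lemma fps_of_inj : injective fps_of.
Proof. by move=> p q pq; apply/mpolyP => m; have := congr1 (fun f : fps => f m) pq. Qed.

Lemma fps_const a : @ps_const k n a = fps_of a%:MP.
Proof.
apply/funext => m; rewrite /fps_of mcoeffC /ps_const.
by case: eqP => _; rewrite ?mulr1 ?mulr0.
Qed.

Lemma fpsCM a c m : (fps_of a%:MP * c) m = a * c m.
Proof.
rewrite fpsM (@ps_mulE (mdeg m).+1)//.
rewrite (@peqM (mdeg m).+1 _ a%:MP _ (ptrunc (mdeg m).+1 c))//.
  by rewrite mcoeffCM mcoeff_trunc leqnn.
exact: ptrunc_of.
Qed.

Lemma fpsMX c (m s : 'X_{1..n}) :
  (c * fps_of 'X_[s]) m = if (s <= m)%MM then c (m - s)%MM else 0.
Proof.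
rewrite fpsM (@ps_mulE (mdeg m).+1)//.
rewrite (@peqM (mdeg m).+1 _ (ptrunc (mdeg m).+1 c) _ 'X_[s])//; last exact: ptrunc_of.
case: ifP => [sm|/negbT sm].
  rewrite -{1}(submK sm) addmC mcoeffMX mcoeff_trunc ifT//.
  by rewrite ltnS mdegB.
rewrite mcoeffM big1 // => -[[a ha] [b hb]] /= /eqP e; rewrite mcoeffX; case: eqP => h; rewrite ?mulr0//.
by move: sm; rewrite h e lem_addl.
Qed.

Definition fderiv (j : 'I_n) c : fps := ps_deriv j c.

Fact fps_deriv_additive j : additive (fderiv j).
Proof. by move=> p q; apply/funext => m; rewrite fpsB /fderiv /ps_deriv mulrnBl. Qed.
HB.instance Definition _ j := GRing.isAdditive.Build fps fps (fderiv j)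
  (fps_deriv_additive j).

Lemma fps_derivM j c d :
  fderiv j (c * d) = fderiv j c * d + c * fderiv j d.
Proof.
(* The derivative at [m] reads the coefficient at [m + U_(j)], one degree higher: the series are cut
   at [N] and their derivatives at [N.-1]. *)
apply/funext => m; pose N := (mdeg m).+2.
have dN (a : fps) : peq N.-1 (ptrunc N.-1 (fderiv j a)) (ptrunc N a)^`M(j).
  move=> l lN; rewrite mcoeff_deriv !mcoeff_trunc lN mdegD mdeg1.
  by rewrite ifT// /N; move: lN; rewrite /N; lia.
have -> : fderiv j (c * d) m = ps_mul c d (m + U_(j))%MM *+ (m j).+1 by [].
rewrite (@ps_mulE N); last by rewrite mdegD mdeg1 /N; lia.
rewrite fpsD !fpsM !(@ps_mulE N.-1)//.
rewrite -mcoeff_deriv mderivM mcoeffD; congr (_ + _).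
  by apply: (@peqM N.-1) => // l lN; [rewrite dN|rewrite !mcoeff_trunc lN (ltn_trans lN)].
by apply: (@peqM N.-1) => // l lN; [rewrite !mcoeff_trunc lN (ltn_trans lN)|rewrite dN].
Qed.

Lemma fps_deriv_of j p : fderiv j (fps_of p) = fps_of p^`M(j).
Proof. by apply/funext => m; rewrite /fps_of mcoeff_deriv. Qed.

End FormalSeries.

(** * Substitution of polynomials without constant term *)

Section Substitution.
Variables (k : fieldType) (n n' : nat) (lq : n.-tuple {mpoly k[n']}).

Hypothesis lq_noconst : forall i, (tnth lq i)@_0 = 0.

Definition order_ge (a : nat) (p : {mpoly k[n']}) :=
  forall m, (mdeg m < a)%N -> p@_m = 0.

Lemma order_geM a b p q : order_ge a p -> order_ge b q -> order_ge (a + b) (p * q).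
Proof.
move=> pa qb m mab; rewrite mcoeffM big1// => -[[i hi] [j hj]] /= /eqP mi.
have [ia|ia] := ltnP (mdeg i) a; first by rewrite pa ?mul0r.
by rewrite [X in _ * X]qb ?mulr0//; move: mab; rewrite mi mdegD; lia.
Qed.

Lemma order_geX a p i : order_ge a p -> order_ge (i * a) (p ^+ i).
Proof.
move=> pa; elim: i => [|i IH]; first by move=> m; rewrite mul0n ltn0.
by rewrite exprS mulSn; apply: order_geM.
Qed.

(** Without constant terms, substitution does not lower the order; each coefficient of the result is
    therefore a finite sum, although the series is infinite. *)
Lemma order_subst m : order_ge (mdeg m) ('X_[m] \mPo lq).
Proof.
rewrite comp_mpolyX mdegE.
elim/big_ind2: _ => [m'|a b c d|i _]; rewrite ?ltn0//; first exact: order_geM.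
rewrite -{1}(muln1 (m i)); apply: order_geX => m' m'0.
have -> : m' = 0%MM by apply/eqP; rewrite -mdeg_eq0; move: m'0; lia.
exact: lq_noconst.
Qed.

Lemma peq_subst N p q : peq N p q -> peq N (p \mPo lq) (q \mPo lq).
Proof.
move=> pq m mN; apply/eqP; rewrite -subr_eq0 -mcoeffB -comp_mpolyB; apply/eqP.
rewrite comp_mpolyEX raddf_sum /= big_seq big1// => l lpq.
rewrite mcoeffZ order_subst ?mulr0//; move: lpq; rewrite mcoeff_msupp.
apply: contraNltn => lm; rewrite mcoeffB pq ?subrr//.
exact: leq_ltn_trans lm mN.
Qed.

Definition fps_subst (c : fps k n) : fps k n' :=
  fun m => (ptrunc (mdeg m).+1 c \mPo lq)@_m.

Lemma fps_substE N c m : (mdeg m < N)%N -> fps_subst c m = (ptrunc N c \mPo lq)@_m.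
Proof.
move=> mN; apply: (@peq_subst (mdeg m).+1) => // l lm.
by rewrite !mcoeff_trunc lm (leq_trans lm mN).
Qed.

Lemma ptrunc_subst N c : peq N (ptrunc N (fps_subst c)) (ptrunc N c \mPo lq).
Proof. by move=> m mN; rewrite mcoeff_trunc mN; apply: fps_substE. Qed.

Lemma ptruncB N (c d : fps k n) : ptrunc N (c - d) = ptrunc N c - ptrunc N d.
Proof.
by apply/mpolyP => m; rewrite mcoeffB !mcoeff_trunc; case: ifP => //; rewrite subr0.
Qed.

Fact fps_subst_additive : additive fps_subst.
Proof.
by move=> c d; apply/funext => m; rewrite fpsB /fps_subst ptruncB comp_mpolyB mcoeffB.
Qed.
HB.instance Definition _ := GRing.isAdditive.Build _ _ fps_subst fps_subst_additive.

Lemma fps_subst_of p : fps_subst (fps_of p) = fps_of (p \mPo lq).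
Proof. by apply/funext => m; apply: (@peq_subst (mdeg m).+1) => //; apply: ptrunc_of. Qed.

Fact fps_subst_multiplicative : multiplicative fps_subst.
Proof.
split=> [c d|]; last first.
  by rewrite -(rmorph1 (@fps_of k n)) fps_subst_of comp_mpoly1 rmorph1.
apply/funext => m; rewrite fpsM (@ps_mulE _ _ (mdeg m).+1)//.
transitivity (((ptrunc (mdeg m).+1 c * ptrunc (mdeg m).+1 d) \mPo lq)@_m).
  by apply: (@peq_subst (mdeg m).+1) => //; apply: ptruncM.
rewrite rmorphM; apply: (@peqM _ _ (mdeg m).+1) => // l lm.
  by rewrite ptrunc_subst.
by rewrite ptrunc_subst.
Qed.
HB.instance Definition _ := GRing.isMultiplicative.Build _ _ fps_subst fps_subst_multiplicative.

End Substitution.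

Lemma fps_substK (k : fieldType) n (lq lq' : n.-tuple {mpoly k[n]}) :
  (forall i, (tnth lq i)@_0 = 0) -> (forall i, (tnth lq' i)@_0 = 0) ->
  (forall i, (tnth lq i) \mPo lq' = 'X_i) -> cancel (fps_subst lq) (fps_subst lq').
Proof.
move=> l0 l0' ll' c; apply/funext => m.
transitivity (((ptrunc (mdeg m).+1 c \mPo lq) \mPo lq')@_m).
  apply: (@peq_subst _ _ _ _ l0' (mdeg m).+1) => // l lm.
  by rewrite ptrunc_subst.
have E p : (p \mPo lq) \mPo lq' = p.
  rewrite (comp_mpolyEX p lq) raddf_sum [RHS]mpolyE; apply: eq_bigr => l _.
  rewrite /= comp_mpolyZ; congr (_ *: _); rewrite comp_mpolyX rmorph_prod.
  rewrite mpolyXE_id; apply: eq_bigr => i _; rewrite rmorphXn /=.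
  by rewrite ll'.
by rewrite E mcoeff_trunc leqnn.
Qed.

(** * Tate algebras *)

(** Unlike [nonarch_field], the trivial absolute value is allowed: its Tate
    algebras are the polynomial rings, so that schemes are treated together with
    rigid spaces. *)
Record nabs (R : realType) (k : fieldType) := NAbs {
  nav :> k -> R;
  nav_ge0 : forall x, 0 <= nav x;
  nav_eq0 : forall x, nav x = 0 <-> x = 0;
  navM : forall x y, nav (x * y) = nav x * nav y;
  navD : forall x y, nav (x + y) <= Num.max (nav x) (nav y);
  nav_complete : forall u : nat -> k,
    (forall e, 0 < e -> exists N, forall i j, (N <= i)%N -> (N <= j)%N ->
       nav (u i - u j) < e) ->
    exists l, forall e, 0 < e -> exists N, forall i, (N <= i)%N ->
       nav (u i - l) < e }.

Section AbsoluteValue.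
Variables (R : realType) (k : fieldType) (v : nabs R k).

Lemma nav0 : v 0 = 0. Proof. exact/nav_eq0. Qed.

Lemma nav1 : v 1 = 1.
Proof.
have : v 1 * v 1 = v 1 * 1 by rewrite -navM !mulr1.
by apply: mulfI; apply/eqP => /nav_eq0/eqP; rewrite oner_eq0.
Qed.

Lemma navN x : v (- x) = v x.
Proof.
have vN1 : v (-1) = 1.
  apply/eqP; rewrite -(@eqrXn2 _ 2)// ?nav_ge0//.
  by rewrite expr2 -navM mulrNN mulr1 nav1 expr1n.
by rewrite -mulN1r navM vN1 mul1r.
Qed.

Lemma navB x y : v (x - y) <= Num.max (v x) (v y).
Proof. by rewrite -(navN y) navD. Qed.

Lemma navV x : x != 0 -> v x^-1 = (v x)^-1.
Proof.
move=> x0; have vx0 : v x != 0 by apply: contra_neq x0 => /nav_eq0.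
by apply: (mulfI vx0); rewrite -navM !divff// nav1.
Qed.

Lemma nav_sum I (r : seq I) (P : pred I) (F : I -> k) a :
  0 <= a -> (forall i, P i -> v (F i) <= a) -> v (\sum_(i <- r | P i) F i) <= a.
Proof.
move=> a0 Fa; elim/big_rec: _ => [|i x Pi xa]; first by rewrite nav0.
by apply: le_trans (navD _ _ _) _; rewrite ge_max Fa.
Qed.

Lemma nav_sum_lt I (r : seq I) (P : pred I) (F : I -> k) a :
  0 < a -> (forall i, P i -> v (F i) < a) -> v (\sum_(i <- r | P i) F i) < a.
Proof.
move=> a0 Fa; elim/big_rec: _ => [|i x Pi xa]; first by rewrite nav0.
by apply: le_lt_trans (navD _ _ _) _; rewrite gt_max Fa.
Qed.

Lemma nav_nat i : v i%:R <= 1.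
Proof.
elim: i => [|i IH]; first by rewrite nav0 ler01.
by rewrite -addn1 natrD; apply: le_trans (navD _ _ _) _; rewrite ge_max IH nav1 lexx.
Qed.

(** Bernoulli's inequality for [e^-1 = 1 + h], together with the archimedean property of [R]. *)
Lemma geometric_small (e a d : R) : 0 <= e < 1 -> 0 < d ->
  exists N : nat, e ^+ N * a < d.
Proof.
move=> /andP[e0 e1] d0.
have [a0|a0] := lerP a 0; first by exists 0%N; rewrite expr0 mul1r; apply: le_lt_trans d0.
have [->|en0] := eqVneq e 0; first by exists 1%N; rewrite expr1 mul0r.
have ep : 0 < e by rewrite lt_def en0.
pose h := e^-1 - 1; have h0 : 0 < h by rewrite subr_gt0 invf_gt1.
have eE : e^-1 = 1 + h by rewrite /h addrC subrK.
have bern N : 1 + N%:R * h <= e^-1 ^+ N.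
  rewrite eE; elim: N => [|N IH]; first by rewrite mul0r addr0 expr0.
  rewrite exprS; have : (1 + h) * (1 + N%:R * h) <= (1 + h) * (1 + h) ^+ N.
    by rewrite ler_pM2l// addr_gt0 ?ltr01.
  apply: le_trans; have h2 : 0 <= h * (N%:R * h) by rewrite !mulr_ge0// ltW.
  have -> : (1 + h) * (1 + N%:R * h) = 1 + N.+1%:R * h + h * (N%:R * h).
    by rewrite -natr1; ring.
  by rewrite lerDl.
exists (Num.bound (a / (d * h))); set N := Num.bound _.
have aN : a / (d * h) < N%:R by apply: archi_boundP; rewrite divr_ge0 ?mulr_ge0 ?ltW.
have eN : 0 < e ^+ N by rewrite exprn_gt0.
rewrite mulrC -ltr_pdivlMr// -exprVn.
apply: (@lt_le_trans _ _ (d * (1 + N%:R * h))); last exact: ler_wpM2l (ltW d0) _ _ (bern N).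
move: aN; rewrite ltr_pdivrMr ?mulr_gt0// => aN.
apply: lt_trans aN _; have -> : d * (1 + N%:R * h) = d + N%:R * (d * h) by ring.
by rewrite ltrDr.
Qed.

Section TateAlgebra.
Variable n : nat.

Definition tate_pred : {pred fps k n} := fun c => `[< tate v c >].

Lemma tateP c : reflect (tate v c) (c \in tate_pred).
Proof. exact: asboolP. Qed.

Lemma fps_bounded (c : fps k n) : tate v c -> exists2 a, 0 < a & forall m, v (c m) <= a.
Proof.
move=> /(_ 1 ltr01)[N cN].
have S0 : 0 <= \sum_(m : 'X_{1..n < N}) v (c m) by apply: sumr_ge0 => i _; apply: nav_ge0.
exists (\sum_(m : 'X_{1..n < N}) v (c m) + 1) => [|m]; first by rewrite ltr_wpDl.
have [mN|Nm] := ltnP (mdeg m) N; last first.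
  by apply: le_trans (ltW (cN _ Nm)) _; rewrite lerDr.
rewrite (bigD1 (BMultinom mN))//= -addrA lerDl addr_ge0//.
by apply: sumr_ge0 => i _; apply: nav_ge0.
Qed.

Fact tate_subring : subring_closed tate_pred.
Proof.
split.
- apply/tateP => e e0; exists 1%N => m m1; rewrite fps1.
  by case: eqP => [e'|_]; rewrite ?nav0//; move: m1; rewrite e' mdeg0.
- move=> c d /tateP cT /tateP dT; apply/tateP => e e0.
  have [[N cN] [M dM]] := (cT e e0, dT e e0).
  exists (maxn N M) => m; rewrite geq_max => /andP[Nm Mm].
  by rewrite fpsB; apply: le_lt_trans (navB _ _) _; rewrite gt_max cN ?dM.
- move=> c d /tateP cT /tateP dT; apply/tateP => e e0.
  have [[a a0 ca] [b b0 db]] := (fps_bounded cT, fps_bounded dT).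
  have [[N cN] [M dM]] := (cT (e / b) (divr_gt0 e0 b0), dT (e / a) (divr_gt0 e0 a0)).
  exists (N + M)%N => m mNM; rewrite fpsM; apply: nav_sum_lt => // l lm.
  (* In degree at least [N + M], one of the two factors is beyond its own threshold, while the other
     one is bounded. *)
  rewrite navM; have [lN|lN] := leqP N (mdeg l).
    have := cN _ lN; rewrite ltr_pdivlMr//; apply: le_lt_trans.
    by apply: ler_wpM2l; rewrite ?nav_ge0.
  have lM : (M <= mdeg (m - l))%N.
    by move: mNM; rewrite -{1}(submK lm) mdegD; lia.
  have := dM _ lM; rewrite ltr_pdivlMr// mulrC; apply: le_lt_trans.
  by apply: ler_wpM2r; rewrite ?nav_ge0.
Qed.
HB.instance Definition _ := GRing.isSubringClosed.Build (fps k n) tate_pred tate_subring.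

Lemma tateM (c d : fps k n) : tate v c -> tate v d -> tate v (c * d : fps k n).
Proof. by move=> /tateP cT /tateP dT; apply/tateP; apply: rpredM. Qed.

Lemma tateB (c d : fps k n) : tate v c -> tate v d -> tate v (c - d : fps k n).
Proof. by move=> /tateP cT /tateP dT; apply/tateP; apply: rpredB. Qed.

Lemma tateN (c : fps k n) : tate v c -> tate v (- c : fps k n).
Proof.
move=> cT e e0; have [N cN] := cT e e0; exists N => m mN.
by rewrite fpsN navN; apply: cN.
Qed.

Lemma tate_sum I (r : seq I) (F : I -> fps k n) :
  (forall i, tate v (F i)) -> tate v (\sum_(i <- r) F i : fps k n).
Proof. by move=> FT; apply/tateP; apply: rpred_sum => i _; apply/tateP. Qed.

Record tateT := TateT { tser :> fps k n; _ : tser \in tate_pred }.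
HB.instance Definition _ := [isSub for tser].
HB.instance Definition _ := [Choice of tateT by <:].
HB.instance Definition _ := GRing.SubChoice_isSubComPzRing.Build (fps k n) tate_pred tateT tate_subring.

Lemma tate_tser (c : tateT) : tate v (tser c). Proof. by case: c => c h; apply/tateP. Qed.

Definition mkT (c : fps k n) (h : tate v c) : tateT := TateT (introT (tateP c) h).

Lemma tser_inj : injective tser. Proof. exact: val_inj. Qed.
HB.instance Definition _ := GRing.RMorphism.copy tser (val : tateT -> fps k n).

Lemma tateP_ext (c d : tateT) : (forall m, c m = d m) -> c = d.
Proof. by move=> cd; apply/tser_inj/funext. Qed.

Lemma tate_poly (p : {mpoly k[n]}) : tate v (fps_of p).
Proof.
move=> e e0; exists (msize p) => m pm.
by rewrite /fps_of memN_msupp_eq0 ?nav0 ?msize_mdeg_ge.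
Qed.

Definition polyT (p : {mpoly k[n]}) : tateT := mkT (tate_poly p).

Fact polyT_additive : additive polyT.
Proof. by move=> p q; apply: tser_inj; rewrite /= !rmorphB. Qed.
HB.instance Definition _ := GRing.isAdditive.Build _ _ polyT polyT_additive.
Fact polyT_multiplicative : multiplicative polyT.
Proof. by split=> [p q|]; apply: tser_inj; rewrite /= ?rmorphM ?rmorph1. Qed.
HB.instance Definition _ := GRing.isMultiplicative.Build _ _ polyT polyT_multiplicative.

Definition cstT : k -> tateT := polyT \o (@mpolyC n k).
HB.instance Definition _ := GRing.RMorphism.copy cstT (polyT \o (@mpolyC n k)).

Definition varT (i : 'I_n) : tateT := polyT 'X_i.

Fact tate_deriv (j : 'I_n) (c : tateT) : tate v (fderiv j c).
Proof.
move=> e e0; have [N cN] := tate_tser c e0; exists N => m mN.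
rewrite /fderiv /ps_deriv -mulr_natr navM.
apply: le_lt_trans (cN (m + U_(j))%MM _); last by rewrite mdegD; lia.
by rewrite ler_piMr ?nav_ge0 ?nav_nat.
Qed.
Definition derivT j (c : tateT) : tateT := mkT (@tate_deriv j c).
Fact derivT_additive j : additive (derivT j).
Proof. by move=> c d; apply: tateP_ext => m; apply: mulrnBl. Qed.
HB.instance Definition _ j := GRing.isAdditive.Build _ _ (derivT j) (derivT_additive j).

Lemma derivTM j (c d : tateT) : derivT j (c * d) = derivT j c * d + c * derivT j d.
Proof. by apply: tser_inj; rewrite /= fps_derivM. Qed.

Lemma derivT_poly j p : derivT j (polyT p) = polyT p^`M(j).
Proof. by apply: tser_inj; rewrite /= fps_deriv_of. Qed.

Lemma derivT_cst j a : derivT j (cstT a) = 0.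
Proof. by rewrite /cstT /= derivT_poly mderivC rmorph0. Qed.

Lemma cstTM a (c : tateT) m : (cstT a * c) m = a * c m.
Proof. exact: fpsCM. Qed.

(** The Gauss norm of [c] is at most [a]. *)
Definition bnd (c : fps k n) (a : R) := forall m, v (c m) <= a.

Lemma bnd_ge0 c a : bnd c a -> 0 <= a.
Proof. by move=> /(_ 0%MM); apply: le_trans; apply: nav_ge0. Qed.

Lemma bndB c d a : bnd c a -> bnd d a -> bnd (c - d) a.
Proof. by move=> ca da m; apply: le_trans (navB _ _) _; rewrite ge_max ca da. Qed.


Lemma bndM c d a b : bnd c a -> bnd d b -> bnd (c * d) (a * b).
Proof.
move=> ca db m; rewrite fpsM; apply: nav_sum; first by rewrite mulr_ge0 ?(bnd_ge0 ca) ?(bnd_ge0 db).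
by move=> l _; rewrite navM ler_pM ?nav_ge0.
Qed.

Lemma bnd_sum I (r : seq I) (P : pred I) (F : I -> fps k n) a : 0 <= a ->
  (forall i, P i -> bnd (F i) a) -> bnd (\sum_(i <- r | P i) F i) a.
Proof. by move=> a0 Fa m; rewrite fps_sum; apply: nav_sum => // i /Fa. Qed.

End TateAlgebra.

(** * Division by a series that is nearly monic in one variable *)

Section Division.
Variables (n : nat) (j : 'I_n) (s : nat).
Notation sh := (U_(j) *+ s)%MM.

(** Quotient by the monomial [X_j ^ s]; [flo s] is the remainder. Division by [f] is a perturbation
    of this one. *)
Definition fhi (c : fps k n) : fps k n := fun m => c (m + sh)%MM.
Definition flo (d : nat) (c : fps k n) : fps k n := fun m => if (m j < d)%N then c m else 0.

Fact fhi_additive : additive fhi.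
Proof. by move=> c d; apply/funext => m. Qed.
HB.instance Definition _ := GRing.isAdditive.Build _ _ fhi fhi_additive.

Lemma flo_fhi c : c = flo s c + fhi c * fps_of 'X_[sh].
Proof.
apply/funext => m; rewrite fpsD fpsMX /flo /fhi.
have E : (sh <= m)%MM = (s <= m j)%N.
  apply/mnm_lepP/idP => [/(_ j)|sm i]; first by rewrite mulmnE mnm1E eqxx mul1n.
  by rewrite mulmnE mnm1E; case: eqP => [<-|]; rewrite ?mul1n ?mul0n.
by rewrite E; case: ltnP => /= h; rewrite ?addr0// add0r submK// E.
Qed.

Lemma fhiX d : fhi (d * fps_of 'X_[sh]) = d.
Proof. by apply/funext => m; rewrite /fhi fpsMX lem_addl addmK. Qed.

Lemma tate_hi c : tate v c -> tate v (fhi c).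
Proof.
move=> cT e e0; have [N cN] := cT e e0; exists N => m mN; apply: cN.
by rewrite mdegD; lia.
Qed.

Lemma tate_lo d c : tate v c -> tate v (flo d c).
Proof.
move=> cT e e0; have [N cN] := cT e e0; exists N => m mN.
by rewrite /flo; case: ifP => _; rewrite ?nav0// cN.
Qed.

Variables (f : tateT n) (ep : R).
Hypotheses (ep01 : 0 < ep < 1) (f1 : bnd f 1) (fep : bnd (fhi f - 1) ep).

Variable Z : pred 'X_{1..n}.
Hypotheses (Zf : forall a b, f b != 0 -> Z a -> Z (a + b)%MM)
  (Zj : forall a, Z (a + U_(j))%MM = Z a).

(** A support condition that division preserves. It keeps the degree bounds already reached when one
    divides by polynomials in several variables in turn ([tate_poly_mod]). *)
Definition supp (c : fps k n) := forall m, ~~ Z m -> c m = 0.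

Let l := flo s f.

Let ep01w : 0 <= ep < 1.
Proof. by case/andP: ep01 => e0 ->; rewrite ltW. Qed.

Let Zsh a : Z (a + sh)%MM = Z a.
Proof.
by elim: (s) => [|i IH]; rewrite ?mulm0n ?addm0// mulmSr addmA Zj.
Qed.

Let supp_hi c : supp c -> supp (fhi c).
Proof. by move=> cZ m Zm; apply: cZ; rewrite Zsh. Qed.

Let supp_mul (c d : fps k n) : supp c -> (forall b, d b != 0 -> f b != 0) -> supp (c * d).
Proof.
move=> cZ df m Zm; rewrite fpsM /ps_mul big1// => i im.
have [->|/df d0] := eqVneq (d (m - i)%MM) 0; first by rewrite mulr0.
rewrite cZ ?mul0r//; apply: contra Zm => Zi.
by rewrite -(submK im) addmC Zf.
Qed.

Let suppD c d : supp c -> supp d -> supp (c + d).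
Proof. by move=> cZ dZ m Zm; rewrite fpsD cZ// dZ// addr0. Qed.

Let suppN c : supp c -> supp (- c).
Proof. by move=> cZ m Zm; rewrite fpsN cZ// oppr0. Qed.

(** Dividing [g] means solving [L q = fhi g], for then [g - q * f] has no term of [X_j]-degree [s]
    or more. By [LE], [L] is the identity, plus [Nop], which does not increase the norm and lowers
    the [X_j]-degree, plus an error of norm at most [ep]. *)
Let L (q : fps k n) := fhi (q * f).
Let Nop (q : fps k n) := fhi (q * l).

Let L_additive : additive L.
Proof. by move=> c d; rewrite /L mulrBl raddfB. Qed.

Let l_f b : l b != 0 -> f b != 0.
Proof. by rewrite /l /flo; case: ifP; rewrite ?eqxx. Qed.

Let l1 : bnd l 1.
Proof. by move=> m; rewrite /l /flo; case: ifP => _; rewrite ?nav0 ?ler01. Qed.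

Let LE q : L q = q + Nop q + q * (fhi f - 1).
Proof.
rewrite /L {1}(flo_fhi f) mulrDr raddfD /= mulrA fhiX /Nop -/l.
by rewrite mulrBr mulr1; ring.
Qed.

Let deglt (d : nat) (q : fps k n) := forall m : 'X_{1..n}, (d <= m j)%N -> q m = 0.

Let deglt_N d q : deglt d q -> deglt d.-1 (Nop q).
Proof.
move=> qd m dm; rewrite /Nop /fhi fpsM /ps_mul big1// => i im.
rewrite /l /flo; case: ifP => h; rewrite ?mulr0// qd ?mul0r//.
by move: h; have := mnm_lepP im j; rewrite mnmBE mnmDE mulmnE mnm1E eqxx mul1n; lia.
Qed.

Let bndN q a : bnd q a -> bnd (Nop q) a.
Proof. by move=> qa m; rewrite -[a]mulr1; apply: bndM. Qed.

(** The part [y1] of [y] of [X_j]-degree below [d] differs from [y] by at most [ep * a]. On such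
    series [Nop] is nilpotent, so [1 + Nop] is inverted by the finite geometric series of
    [- Nop]. *)
Let approx (y : fps k n) a : tate v y -> supp y -> bnd y a -> 0 < a ->
  exists q : fps k n, [/\ tate v q, supp q, bnd q a & bnd (y - L q) (ep * a)].
Proof.
move=> yT yZ ya a0; have ea : 0 < ep * a by rewrite mulr_gt0//; case/andP: ep01.
have [d yd] := yT _ ea; pose y1 := flo d y.
pose qs i := iter i (fun q => - Nop q) y1.
have q1 i : [/\ tate v (qs i), supp (qs i), bnd (qs i) a & deglt (d - i) (qs i)].
  elim: i => [|i [qT qZ qa qd]].
    split; rewrite /qs /= /y1; first exact: tate_lo.
    - by move=> m Zm; rewrite /flo yZ// if_same.
    - by move=> m; rewrite /flo; case: ifP => _; [exact: ya|rewrite nav0 ltW].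
    - by move=> m; rewrite subn0 /flo ltnNge => ->.
  have qsS : qs i.+1 = - Nop (qs i) by [].
  split; rewrite qsS.
  - by apply/tateN/tate_hi/tateM => //; apply/tate_lo/tate_tser.
  - by apply/suppN/supp_hi; apply: supp_mul => //; apply: l_f.
  - by move=> m; rewrite fpsN navN; apply: bndN.
  - by move=> m dm; rewrite fpsN subnS in dm *; rewrite (deglt_N qd)// oppr0.
pose q := \sum_(i < d) qs i.
have qa : bnd q a by apply: bnd_sum; [exact: ltW|move=> i _; case: (q1 i)].
exists q; split => //.
- by apply: tate_sum => i; case: (q1 i).
- by move=> m Zm; rewrite /q fps_sum big1// => i _; case: (q1 i) => _ H _ _; apply: H.
have NE : Nop q = - \sum_(i < d) qs i.+1.
  rewrite /Nop /q mulr_suml raddf_sum -sumrN; apply: eq_bigr => i _.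
  by rewrite /qs iterS opprK.
have tel : q + Nop q = y1.
  have -> : y1 = qs 0%N - qs d.
    have -> : qs d = 0.
      by apply/funext => m; case: (q1 d) => _ _ _ ->; rewrite ?subnn.
    by rewrite subr0.
  rewrite NE /q; elim: (d) => [|e IH]; first by rewrite !big_ord0 !subrr.
  by rewrite !big_ord_recr /= opprD addrACA IH addrA subrK.
rewrite LE tel opprD addrA; apply: bndB; last by rewrite mulrC; apply: bndM.
move=> m; rewrite fpsB /y1 /flo; case: ifP => mj; first by rewrite subrr nav0 ltW.
rewrite subr0 ltW// yd//; apply: leq_trans (_ : m j <= _)%N; first by rewrite leqNgt mj.
by rewrite mdegE (bigD1 j)//= leq_addr.
Qed.

(** The limit is taken coefficientwise. The estimate is uniform in the exponent, so the tail of the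
    limit is controlled by that of a partial sum. *)
Lemma fps_limit (u : nat -> fps k n) a : 0 < a -> (forall i, tate v (u i)) ->
  (forall i, bnd (u i) (ep ^+ i * a)) ->
  exists q : fps k n, tate v q /\ forall N, bnd (q - \sum_(i < N) u i) (ep ^+ N * a).
Proof.
move=> a0 uT ua; have /andP[e0 e1] := ep01.
have eN N : 0 < ep ^+ N * a by rewrite mulr_gt0 ?exprn_gt0.
have eNM N M : (N <= M)%N -> ep ^+ M * a <= ep ^+ N * a.
  by move=> NM; rewrite ler_pM2r// ler_wiXn2l// ltW.
pose S N : fps k n := \sum_(i < N) u i.
have SB N M : (N <= M)%N -> bnd (S M - S N) (ep ^+ N * a).
  move=> NM; rewrite /S -(subnKC NM) big_split_ord /= [X in X - _]addrC addrK.
  apply: bnd_sum => [|i _ m]; first exact: ltW.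
  by apply: le_trans (ua _ m) _; apply: eNM; rewrite leq_addr.
have /choice[q0 qP] m : exists l, forall e, 0 < e -> exists N, forall i, (N <= i)%N ->
    v (S i m - l) < e.
  apply: nav_complete => e e0'.
  have [N Ne] := geometric_small a ep01w e0'; exists N.
    move=> i i' Ni Ni'; apply: le_lt_trans Ne.
    have -> : S i m - S i' m = (S i - S N - (S i' - S N)) m by rewrite !fpsB; ring.
    by apply: bndB; apply: SB.
pose q : fps k n := q0.
have qS N : bnd (q - S N) (ep ^+ N * a).
  move=> m; have [M Mm] := qP m _ (eN N).
  have -> : (q - S N) m = (S (maxn M N) - S N) m - (S (maxn M N) m - q m) by rewrite !fpsB; ring.
  apply: le_trans (navB _ _) _; rewrite ge_max SB ?leq_maxr// ltW// Mm// leq_maxl//.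
exists q; split => // e e0'; have [N Ne] := geometric_small a ep01w e0'.
have ST : tate v (S N) by apply: tate_sum.
have [M SM] := ST e e0'; exists M => m Mm.
have -> : q m = (q - S N) m + S N m by rewrite fpsB; ring.
apply: le_lt_trans (navD _ _ _) _; rewrite gt_max SM// andbT.
by apply: le_lt_trans (qS N m) Ne.
Qed.

Lemma weierstrass_division_supp (g : tateT n) : supp g ->
  exists q r : tateT n, [/\ g = q * f + r, supp r & forall m : 'X_{1..n}, (s <= m j)%N -> r m = 0].
Proof.
move=> gZ; have [a a0 ga] := fps_bounded (tate_tser g).
have /andP[e0 e1] := ep01.
(* State of the iteration: the error still to be divided and the number of the step, which fixes the
   bound on that error. *)
pose T := {yb : fps k n * nat | [/\ tate v yb.1, supp yb.1 & bnd yb.1 (ep ^+ yb.2 * a)]}.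
have stepP (y : T) : exists q : fps k n, [/\ tate v q, supp q, bnd q (ep ^+ (sval y).2 * a)
    & bnd ((sval y).1 - L q) (ep ^+ (sval y).2.+1 * a)].
  case: y => -[y i] /= [yT yZ ya].
  have [|q [qT qZ qa qL]] := approx yT yZ ya; first by rewrite mulr_gt0 ?exprn_gt0.
  by exists q; split => //; rewrite exprS -mulrA.
have /choice[st stP] := stepP.
have nxtP (y : T) : [/\ tate v ((sval y).1 - L (st y)), supp ((sval y).1 - L (st y)) &
    bnd ((sval y).1 - L (st y)) (ep ^+ (sval y).2.+1 * a)].
  have [qT qZ qa qL] := stP y; have [yT yZ ya] := svalP y; split => //.
    by apply/tateB/tate_hi/tateM => //; apply: tate_tser.
  by apply: suppD => //; apply/suppN/supp_hi/supp_mul.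
pose nxt (y : T) : T := exist _ ((sval y).1 - L (st y), (sval y).2.+1) (nxtP y).
have y0P : [/\ tate v (fhi g), supp (fhi g) & bnd (fhi g) (ep ^+ 0 * a)].
  split; [exact/tate_hi/tate_tser|exact: supp_hi|].
  by move=> m; rewrite expr0 mul1r; apply: ga.
pose ys i := iter i nxt (exist _ (fhi g, 0%N) y0P : T).
have ys2 i : (sval (ys i)).2 = i by elim: i => //= i ->.
pose u i := st (ys i).
have [||q [qT qS]] := @fps_limit u a a0.
- by move=> i; case: (stP (ys i)).
- by move=> i; case: (stP (ys i)) => _ _; rewrite ys2.
have yE N : (sval (ys N)).1 = fhi g - L (\sum_(i < N) u i).
  elim: N => [|N IH]; first by rewrite big_ord0 -[X in L X](subrr 0) L_additive subrr subr0.
  have LD c d : L (c + d) = L c + L d by rewrite /L mulrDl raddfD.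
  by rewrite big_ord_recr /= LD opprD addrA -IH.
have Lq : L q = fhi g.
  (* A nonzero coefficient would have a value exceeding [ep ^+ N * a] for some [N], against the
     estimates on the partial sums. *)
  apply/eqP; rewrite -subr_eq0; apply/eqP/funext => m; apply/(nav_eq0 v)/eqP.
  rewrite eq_le nav_ge0 andbT leNgt; apply/negP => p0.
  have [N] := geometric_small a ep01w p0.
  apply/negP; rewrite -leNgt.
  have -> : L q - fhi g = L (q - \sum_(i < N) u i) - (sval (ys N)).1.
    by rewrite yE L_additive; ring.
  apply: bndB; last by case: (svalP (ys N)) => _ _; rewrite ys2.
  by move=> m'; rewrite -[_ * a]mulr1; apply: bndM.
have qZ : supp q.
  move=> m Zm; apply/(nav_eq0 v)/eqP; rewrite eq_le nav_ge0 andbT leNgt; apply/negP => p0.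
  have [N] := geometric_small a ep01w p0.
  apply/negP; rewrite -leNgt; have := qS N m; rewrite fpsB fps_sum big1 ?subr0// => i _.
  by case: (stP (ys i)) => _ H _ _; apply: H.
exists (mkT qT), (g - mkT qT * f); split; first by rewrite addrC subrK.
  by apply: suppD => //; apply/suppN/supp_mul.
move=> m sm; have -> : (g - mkT qT * f) m = (tser g - q * tser f) m by [].
rewrite (flo_fhi (tser g - q * f)) raddfB /= -/(L q) Lq subrr mul0r addr0.
by rewrite /flo ltnNge sm.
Qed.

End Division.
End AbsoluteValue.

Local Open Scope classical_set_scope.
Local Open Scope ring_scope.

(** * Ideals and noetherian rings *)

Section Ideals.
Variable A : comPzRingType.
Implicit Types (I J : set A) (a b x y : A).

Lemma ideal0 I : is_ideal I -> I 0. Proof. by case. Qed.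
Lemma idealD I a b : is_ideal I -> I a -> I b -> I (a + b).
Proof. by case=> _ h _; apply: h. Qed.
Lemma idealMleft I a b : is_ideal I -> I b -> I (a * b).
Proof. by case=> _ _; apply. Qed.
Lemma idealMright I a b : is_ideal I -> I a -> I (a * b).
Proof. by rewrite mulrC; apply: idealMleft. Qed.
Lemma idealN I a : is_ideal I -> I a -> I (- a).
Proof. by rewrite -mulN1r; apply: idealMleft. Qed.
Lemma idealB I a b : is_ideal I -> I a -> I b -> I (a - b).
Proof. by move=> hI Ia Ib; apply: idealD => //; apply: idealN. Qed.
Lemma ideal_sum I T (r : seq T) (P : pred T) (F : T -> A) : is_ideal I ->
  (forall i, P i -> I (F i)) -> I (\sum_(i <- r | P i) F i).
Proof.
by move=> hI IF; elim/big_rec: _ => [|i x Pi]; [apply: ideal0|apply: idealD => //; apply: IF].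
Qed.
Lemma idealBr I a b : is_ideal I -> I (a - b) -> I b -> I a.
Proof. by move=> hI h1 h2; rewrite -(subrK b a); apply: idealD. Qed.
Lemma idealBl I a b : is_ideal I -> I (a - b) -> I a -> I b.
Proof.
by move=> hI h1 h2; apply: (idealBr (b := a)) => //; rewrite -opprB; apply: idealN.
Qed.
Lemma idealBC I a b : is_ideal I -> I (a - b) -> I (b - a).
Proof. by move=> hI h; rewrite -opprB; apply: idealN. Qed.
Lemma idealBM I a b c d : is_ideal I -> I (a - b) -> I (c - d) -> I (a * c - b * d).
Proof.
move=> hI h1 h2; have -> : a * c - b * d = (a - b) * c + b * (c - d) by ring.
by apply: idealD => //; [apply: idealMright|apply: idealMleft].
Qed.
Lemma idealBD I a b c d : is_ideal I -> I (a - b) -> I (c - d) -> I (a + c - (b + d)).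
Proof. by move=> hI h1 h2; rewrite opprD addrACA; apply: idealD. Qed.
Lemma idealB_trans I a b c : is_ideal I -> I (a - b) -> I (b - c) -> I (a - c).
Proof. by move=> hI h1 h2; rewrite -(subrK b a) -addrA; apply: idealD. Qed.
Lemma idealBX I a b n : is_ideal I -> I (a - b) -> I (a ^+ n - b ^+ n).
Proof.
move=> hI h; elim: n => [|n IH]; first by rewrite subrr; apply: ideal0.
by rewrite !exprS; apply: idealBM.
Qed.

Lemma det_mod I n (X Y : 'M[A]_n) : is_ideal I ->
  (forall i j, I (X i j - Y i j)) -> I (\det X - \det Y).
Proof.
move=> hI XY; rewrite /determinant -sumrB; apply: ideal_sum => // s _.
apply: idealBM => //; first by rewrite subrr; apply: ideal0.
elim/big_ind2: _ => [|a b c d h1 h2|i _]; first by rewrite subrr; apply: ideal0.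
  exact: idealBM.
exact: XY.
Qed.

Definition idealM I J : set A := fun x =>
  exists s : seq (A * A), (forall p, p \in s -> I p.1 /\ J p.2) /\ x = \sum_(p <- s) p.1 * p.2.

Lemma idealM_ideal I J : is_ideal I -> is_ideal J -> is_ideal (idealM I J).
Proof.
move=> hI hJ; split.
- by exists [::]; rewrite big_nil.
- move=> x y [s [sP ->]] [t [tP ->]]; exists (s ++ t); rewrite big_cat; split => //.
  by move=> p; rewrite mem_cat => /orP[/sP|/tP].
- move=> a x [s [sP ->]]; exists [seq (a * p.1, p.2) | p <- s]; split.
    by move=> _ /mapP[p /sP[p1 p2] ->]; split => //=; apply: idealMleft.
  by rewrite big_map mulr_sumr; apply: eq_bigr => p _; rewrite /= mulrA.
Qed.

Lemma idealM_mem I J x y : I x -> J y -> idealM I J (x * y).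
Proof.
move=> Ix Jy; exists [:: (x, y)]; rewrite big_seq1; split => // p.
by rewrite inE => /eqP ->.
Qed.

Lemma idealM_min I J K : is_ideal K -> (forall x y, I x -> J y -> K (x * y)) ->
  forall z, idealM I J z -> K z.
Proof.
move=> hK h z [s [sP ->]]; rewrite big_seq; apply: ideal_sum => // p /sP[p1 p2].
exact: h.
Qed.

Fixpoint idealX I n : set A := if n is n'.+1 then idealM I (idealX I n') else setT.

Lemma idealX_ideal I n : is_ideal I -> is_ideal (idealX I n).
Proof. by move=> hI; elim: n => //= n IH; apply: idealM_ideal. Qed.

Lemma idealXS I n x : is_ideal I -> idealX I n.+1 x -> idealX I n x.
Proof.
move=> hI; apply: idealM_min; first exact: idealX_ideal.
by move=> a b _ h; apply: idealMleft => //; apply: idealX_ideal.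
Qed.

Lemma idealX1 I x : is_ideal I -> idealX I 1 x <-> I x.
Proof.
move=> hI; split; first by apply: idealM_min => // a b Ia _; apply: idealMright.
by move=> Ix; rewrite -[x]mulr1; apply: idealM_mem.
Qed.

Lemma idealX2 I x y : I x -> I y -> idealX I 2 (x * y).
Proof. by move=> Ix Iy; apply: idealM_mem => //; rewrite -[y]mulr1; apply: idealM_mem. Qed.

Lemma idealX_sub I n x : is_ideal I -> idealX I n.+1 x -> I x.
Proof.
move=> hI; elim: n x => [|n IH] x; first by rewrite idealX1.
by move=> /(idealXS hI); apply: IH.
Qed.

Lemma idealX_mono I J n : is_ideal J -> I `<=` J -> idealX I n `<=` idealX J n.
Proof.
move=> hJ IJ; elim: n => //= n IH; apply: idealM_min.
  by apply: idealM_ideal => //; apply: idealX_ideal.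
by move=> x y Ix Iy; apply: idealM_mem; [apply: IJ|apply: IH].
Qed.

Lemma idealXD I (a b : nat) : is_ideal I -> idealX I (a + b) `<=` idealM (idealX I a) (idealX I b).
Proof.
move=> hI; have hb := idealX_ideal b hI; elim: a => [|a IH] x /=.
  by move=> Ix; rewrite -[x]mul1r; apply: idealM_mem.
have ha : is_ideal (idealM (idealM I (idealX I a)) (idealX I b)).
  by apply: idealM_ideal => //; apply: (idealX_ideal a.+1).
apply: idealM_min => // y z Iy /IH; move: z; apply: idealM_min.
  split; first by rewrite mulr0; apply: ideal0.
    by move=> u w h1 h2; rewrite mulrDr; apply: idealD.
  by move=> u w h; rewrite mulrCA; apply: idealMleft.
by move=> u w Iu Iw; rewrite mulrA; do 2!apply: idealM_mem => //.
Qed.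

Lemma idealXM I (a b : nat) : is_ideal I -> idealX I (b * a) `<=` idealX (idealX I a) b.
Proof.
move=> hI; elim: b => // b IH x; rewrite mulSn => /(idealXD hI).
have ha := idealX_ideal a hI; apply: idealM_min; first exact: (idealX_ideal b.+1).
by move=> y z Iy /IH; apply: idealM_mem.
Qed.

Lemma max_is_ideal (m : set A) : max_ideal m -> is_ideal m. Proof. by case. Qed.

Lemma max_unit (m : set A) a : max_ideal m -> ~ m a -> exists b, m (a * b - 1).
Proof.
move=> [hm m1 mM] ma; pose J : set A := fun x => exists2 b, True & m (x - a * b).
have hJ : is_ideal J.
  split; first by exists 0 => //; rewrite mulr0 subr0; apply: ideal0.
    by move=> x y [b _ mb] [c _ mc]; exists (b + c) => //; rewrite mulrDr; apply: idealBD.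
  by move=> x y [b _ mb]; exists (x * b) => //; rewrite mulrCA -mulrBr; apply: idealMleft.
apply: contrapT => nb; apply: ma; rewrite -(mM J)//.
- by exists 1 => //; rewrite mulr1 subrr; apply: ideal0.
- by move=> x mx; exists 0 => //; rewrite mulr0 subr0.
- by move=> [b _ mb]; apply: nb; exists b; apply: idealBC.
Qed.

Lemma max_prime (m : set A) a b : max_ideal m -> m (a * b) -> m a \/ m b.
Proof.
move=> mm; have hm := max_is_ideal mm => mab.
have [ma|ma] := pselect (m a); [by left|right].
have [c mc] := max_unit mm ma.
have -> : b = c * (a * b) - (a * c - 1) * b by ring.
by apply: idealB => //; [apply: idealMleft|apply: idealMright].
Qed.


Lemma maxI_unit (m : set A) : is_ideal m -> ~ m 1 ->
  (forall a, ~ m a -> exists b, m (a * b - 1)) -> max_ideal m.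
Proof.
move=> hm m1 mu; split => // I hI mI I1; apply/seteqP; split => // x Ix.
apply: contrapT => /mu[b mb]; apply: I1.
by apply: (idealBl (a := x * b)) => //; [apply: mI|apply: idealMright].
Qed.

End Ideals.

(** * Noetherian modules and Krull's intersection theorem *)

Section Submodules.
Variable A : comPzRingType.

Definition is_submod (V : lmodType A) (N : set V) : Prop :=
  [/\ N 0, forall x y, N x -> N y -> N (x + y) & forall a x, N x -> N (a *: x)].

(** Generation is expressed by minimality, without families of coefficients; [noetherian] follows
    the same pattern. *)
Definition fin_gen (V : lmodType A) (N : set V) : Prop :=
  exists2 G : seq V, forall g, g \in G -> N g
    & forall J, is_submod J -> (forall g, g \in G -> J g) -> N `<=` J.

Definition noetherian : Prop :=
  forall I : set A, is_ideal I -> exists2 G : seq A, forall g, g \in G -> I g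
    & forall J, is_ideal J -> (forall g, g \in G -> J g) -> I `<=` J.

Lemma submodB (V : lmodType A) (N : set V) x y : is_submod N -> N x -> N y -> N (x - y).
Proof. by move=> [_ ND NZ] Nx Ny; apply: ND => //; rewrite -scaleN1r; apply: NZ. Qed.

(** The first coordinates of the elements of [N] form a finitely generated ideal, and the elements
    with first coordinate 0 are handled by induction. *)
Lemma noetherian_rV n : noetherian -> forall N : set 'rV[A]_n, is_submod N -> fin_gen N.
Proof.
move=> nA; elim: n => [|n IH] N hN.
  exists [::] => // J [J0 _ _] _ x _; suff -> : x = 0 by [].
  by apply/rowP => -[].
have [N0 ND NZ] := hN.
pose I : set A := fun a => exists2 x, N x & x 0 0 = a.
have hI : is_ideal I.
  split; first by exists 0 => //; rewrite mxE.
    by move=> _ _ [x Nx <-] [y Ny <-]; exists (x + y); [apply: ND|rewrite mxE].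
  by move=> a _ [x Nx <-]; exists (a *: x); [apply: NZ|rewrite mxE].
have [G GI Gm] := nA I hI.
have /choice[lft lftP] : forall a, exists x, I a -> N x /\ x 0 0 = a.
  move=> a; have [[x Nx xa]|nI] := pselect (I a); first by exists x.
  by exists 0 => /nI.
pose rm (y : 'rV[A]_n) : 'rV[A]_n.+1 :=
  \row_i (if unlift ord0 i is Some j then y 0 j else 0).
have rmD u w : rm (u + w) = rm u + rm w.
  by apply/rowP => i; rewrite !mxE; case: unlift => [j|]; rewrite ?mxE ?addr0.
have rmZ c u : rm (c *: u) = c *: rm u.
  by apply/rowP => i; rewrite !mxE; case: unlift => [j|]; rewrite ?mxE ?mulr0.
have rm0 : rm 0 = 0.
  by apply/rowP => i; rewrite !mxE; case: unlift => [j|]; rewrite ?mxE.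
pose N' : set 'rV[A]_n := fun y => N (rm y).
have hN' : is_submod N'.
  split; rewrite /N'; first by rewrite rm0.
    by move=> x y Nx Ny; rewrite rmD; apply: ND.
  by move=> a x Nx; rewrite rmZ; apply: NZ.
have [G' G'N G'm] := IH N' hN'.
exists ([seq lft a | a <- G] ++ [seq rm y | y <- G']).
  move=> x; rewrite mem_cat => /orP[/mapP[a /GI Ia ->]|/mapP[y /G'N yN ->]] //.
  by have [] := lftP _ Ia.
move=> J hJ GJ x Nx; have [J0 JD JZ] := hJ.
have [z [Jz Nz zx]] : exists z, [/\ J z, N z & z 0 0 = x 0 0].
  apply: (Gm (fun a => exists z, [/\ J z, N z & z 0 0 = a])); last by exists x.
    split; first by exists 0; rewrite mxE.
      by move=> _ _ [u [Ju Nu <-]] [w [Jw Nw <-]]; exists (u + w); rewrite mxE; split; [apply: JD|apply: ND|].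
    by move=> a _ [u [Ju Nu <-]]; exists (a *: u); rewrite mxE; split; [apply: JZ|apply: NZ|].
  move=> a aG; have [Na a0] := lftP a (GI a aG); exists (lft a); split => //.
  by apply: GJ; rewrite mem_cat map_f.
have xz : x - z = rm (\row_j (x - z) 0 (lift ord0 j)).
  apply/rowP => i; rewrite [RHS]mxE; case: unliftP => [j ->|->]; rewrite !mxE//.
  by rewrite zx subrr.
rewrite -(subrK z x); apply: (JD) => //; rewrite xz.
apply: (G'm (fun y => J (rm y))).
- split; first by rewrite rm0.
    by move=> u w Ju Jw; rewrite rmD; apply: JD.
  by move=> a u Ju; rewrite rmZ; apply: JZ.
- by move=> y yG; apply: GJ; rewrite mem_cat map_f ?orbT.
- by rewrite /N' -xz; apply: submodB.
Qed.

Lemma noetherian_chain (C : nat -> set A) : noetherian -> (forall i, is_ideal (C i)) ->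
  (forall i, C i `<=` C i.+1) -> exists i, forall j, C j `<=` C i.
Proof.
move=> nA hC CC; have Cm i j : (i <= j)%N -> C i `<=` C j.
  by move=> /subnK <-; elim: (j - i)%N => // l IH x /IH /CC.
pose U : set A := fun x => exists i, C i x.
have hU : is_ideal U.
  split; first by exists 0%N; apply: ideal0.
    move=> x y [i Cx] [j Cy]; exists (maxn i j); apply: idealD => //.
      by apply: Cm Cx; rewrite leq_maxl.
    by apply: Cm Cy; rewrite leq_maxr.
  by move=> a x [i Cx]; exists i; apply: idealMleft.
have [G GU Gm] := nA U hU.
have [i iP] : exists i, forall g, g \in G -> C i g.
  elim: G GU {Gm} => [|g G IH] GU; first by exists 0%N.
  have [|i iG] := IH; first by move=> h hG; apply: GU; rewrite inE hG orbT.
  have [j jg] := GU g (mem_head _ _); exists (maxn i j) => h.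
  rewrite inE => /orP[/eqP ->|/iG]; first by apply: Cm jg; rewrite leq_maxr.
  by apply: Cm; rewrite leq_maxl.
by exists i => j x Cx; apply: (Gm (C i)) => //; exists j.
Qed.

Lemma noetherian_maximal (P : set (set A)) I0 : noetherian -> P I0 ->
  (forall I, P I -> is_ideal I) ->
  exists2 I, P I & forall J, P J -> I `<=` J -> J `<=` I.
Proof.
move=> nA PI0 hP; apply: contrapT => nmax.
have /choice[nx nxP] : forall I : {I | P I}, exists J : {J | P J},
    sval I `<=` sval J /\ ~ (sval J `<=` sval I).
  move=> [I PI]; apply: contrapT => nJ; apply: nmax; exists I => // J PJ IJ.
  apply: contrapT => nJI; apply: nJ; by exists (exist _ J PJ).
pose C i := sval (iter i nx (exist _ I0 PI0)).
have [||i iC] := @noetherian_chain C nA.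
- by move=> i; apply: hP; apply: (svalP (iter _ _ _)).
- by move=> i; rewrite /C /=; have [] := nxP (iter i nx (exist _ I0 PI0)).
have [_] := nxP (iter i nx (exist _ I0 PI0)); apply.
exact: (iC i.+1).
Qed.

Lemma ex_max_ideal (I : set A) : noetherian -> is_ideal I -> ~ I 1 ->
  exists2 m, max_ideal m & I `<=` m.
Proof.
move=> nA hI I1.
have [||m [hm m1 Im] mm] := @noetherian_maximal (fun J => [/\ is_ideal J, ~ J 1 & I `<=` J]) I nA.
- by split.
- by move=> J [].
exists m => //; split => // J hJ mJ J1; apply/seteqP; split => //.
by apply: mm => //; split => //; apply: subset_trans mJ.
Qed.

(** A proof without the Artin-Rees lemma. Let [q] be maximal among the ideals that contain [m x] and
    meet [A x] in [m x]. Every element of [m] has a power in [q], hence so does [m] itself; then [x]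
    lies in [q], so in [m x]. *)
Lemma krull_intersection (m : set A) (x : A) : noetherian -> is_ideal m ->
  (forall n, idealX m n x) -> exists2 a, m a & x = a * x.
Proof.
move=> nA hm xm; pose mx : set A := fun y => exists2 a, m a & y = a * x.
have hmx : is_ideal mx.
  split; first by exists 0; rewrite ?mul0r//; apply: ideal0.
    by move=> _ _ [a ma ->] [b mb ->]; exists (a + b); [apply: idealD|rewrite mulrDl].
  by move=> a _ [b mb ->]; exists (a * b); [apply: idealMleft|rewrite mulrA].
pose P (q : set A) := [/\ is_ideal q, mx `<=` q & forall c, q (c * x) -> mx (c * x)].
have Pmx : P mx by split.
have [|q [hq mxq qx] qmax] := @noetherian_maximal P mx nA Pmx; first by move=> I [].
(* The quotient ideals [(q : a ^ i)] are constant from some [t] on. Then [q + (a ^ t)] still meets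
   [A x] in [m x]: if [c x = y + a ^ t z] with [y] in [q], then [a ^ (t + 1) z] is in [q], so
   [a ^ t z] is too. Maximality of [q] puts [a ^ t] in [q]. *)
have pw a : m a -> exists t, q (a ^+ t).
  move=> ma; pose C i : set A := fun y => q (a ^+ i * y).
  have hC i : is_ideal (C i).
    split; rewrite /C; first by rewrite mulr0; apply: ideal0.
      by move=> y z h1 h2; rewrite mulrDr; apply: idealD.
    by move=> y z h; rewrite mulrCA; apply: idealMleft.
  have [|t tC] := noetherian_chain nA hC.
    by move=> i y; rewrite /C exprS -mulrA; apply: idealMleft.
  exists t; pose q' : set A := fun y => exists z, q (y - a ^+ t * z).
  apply: (qmax q'); last by exists 1; rewrite mulr1 subrr; apply: ideal0.
    split.
    - split; first by exists 0; rewrite mulr0 subr0; apply: ideal0.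
        by move=> y z [u qu] [w qw]; exists (u + w); rewrite mulrDr; apply: idealBD.
      by move=> b y [u qu]; exists (b * u); rewrite mulrCA -mulrBr; apply: idealMleft.
    - by move=> y /mxq qy; exists 0; rewrite mulr0 subr0.
    move=> c [z qz]; apply: qx.
    have h1 : q (a * (c * x)).
      by apply: mxq; exists (a * c); [apply: idealMright|rewrite mulrA].
    have h2 : C t.+1 z.
      rewrite /C exprS -mulrA; apply: (idealBl (a := a * (c * x))) => //.
      by rewrite -mulrBr; apply: idealMleft.
    by apply: (idealBr (b := a ^+ t * z)) => //; apply: (tC t.+1).
  by move=> y qy; exists 0; rewrite mulr0 subr0.
suff [s sq] : exists s, idealX m s `<=` q.
  by have := qx 1; rewrite mul1r; apply; apply: sq; apply: xm.
(* From powers of elements to a power of the ideal: adding to such a [J] an element with a power in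
   [q] gives another such ideal, so a maximal [J] contains [m]. *)
pose P' (J : set A) := [/\ is_ideal J, q `<=` J & exists s, idealX J s `<=` q].
have [||J [hJ qJ [s Jq]] Jmax] := @noetherian_maximal P' q nA.
- by split; [|exact: subset_refl|exists 1%N => y; apply: idealX_sub].
- by move=> I [].
suff mJ : m `<=` J by exists s; apply: subset_trans Jq; apply: idealX_mono.
move=> a ma; have [t at_] := pw a ma.
pose J' : set A := fun y => exists z, J (y - a * z).
have hJ' : is_ideal J'.
  split; first by exists 0; rewrite mulr0 subr0; apply: ideal0.
    by move=> y z [u Ju] [w Jw]; exists (u + w); rewrite mulrDr; apply: idealBD.
  by move=> b y [u Ju]; exists (b * u); rewrite mulrCA -mulrBr; apply: idealMleft.
have J't i y : idealX J' i y -> exists z, J (y - a ^+ i * z).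
  elim: i y => [|i IH] y /=; first by exists y; rewrite expr0 mul1r subrr; apply: ideal0.
  move: y; apply: idealM_min.
    split; first by exists 0; rewrite mulr0 subr0; apply: ideal0.
      by move=> y z [u Ju] [w Jw]; exists (u + w); rewrite mulrDr; apply: idealBD.
    by move=> b y [u Ju]; exists (b * u); rewrite mulrCA -mulrBr; apply: idealMleft.
  move=> y z [u Ju] /IH[w Jw]; exists (u * w).
  by rewrite exprS mulrACA; apply: idealBM.
apply: (Jmax J'); last by exists 1; rewrite mulr1 subrr; apply: ideal0.
  split => //; first by move=> y /qJ Jy; exists 0; rewrite mulr0 subr0.
  exists (s * t)%N => y /(idealXM hJ') h; apply: Jq; move: y h.
  apply: idealX_mono => // y /J't[z Jz]; apply: (idealBr hJ Jz).
  by apply: qJ; apply: idealMright.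
by move=> y Jy; exists 0; rewrite mulr0 subr0.
Qed.

End Submodules.

(** * Quotients and algebraic elements *)

Section Quotient.
Variables (A : comPzRingType) (I : set A) (hI : is_ideal I).

(** A canonical representative of the class of [x]. The quotient is the type of these
    representatives, so that equality in it is equality in [A]. *)
Definition qrep (x : A) : A := choose (fun y => `[< I (x - y) >]) x.

Lemma qrepP x : I (x - qrep x).
Proof.
apply/asboolP; apply: (@chooseP _ (fun y => `[< I (x - y) >])).
by apply/asboolP; rewrite subrr; apply: ideal0.
Qed.

Lemma qrep_eq x y : I (x - y) -> qrep x = qrep y.
Proof.
move=> xy; rewrite /qrep.
rewrite (@eq_choose _ _ (fun z => `[< I (y - z) >])) => [|z].
  apply: choose_id; apply/asboolP; last by rewrite subrr; apply: ideal0.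
  exact: idealBC.
apply/asbool_equiv_eq; split; apply: idealB_trans => //.
exact: idealBC.
Qed.

Record quot := Quot { qval : A; _ : qrep qval == qval }.
HB.instance Definition _ := [isSub for qval].
HB.instance Definition _ := [Choice of quot by <:].

(** The type records the proof [hI], from which the ring structure is inferred. *)
Definition quotient of is_ideal I := quot.
Notation Q := (quotient hI).
HB.instance Definition _ := Choice.on Q.

Fact qpi_proof x : qrep (qrep x) == qrep x.
Proof. by apply/eqP/esym/qrep_eq/qrepP. Qed.
Definition qpi x : Q := Quot (qpi_proof x).

Lemma qpi_eq x y : qpi x = qpi y <-> I (x - y).
Proof.
split=> [e|xy]; last by apply: val_inj; apply: qrep_eq.
have e' : qrep x = qrep y by have := congr1 qval e.
by apply: (idealB_trans hI (qrepP x)); rewrite e'; apply: (idealBC hI (qrepP y)).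
Qed.

Lemma qpi_val (u : Q) : qpi (qval u) = u.
Proof. by apply: val_inj; case: u => x /= /eqP. Qed.

Let qadd (u v : Q) := qpi (qval u + qval v).
Let qmul (u v : Q) := qpi (qval u * qval v).
Let qopp (u : Q) := qpi (- qval u).

Let val_pi x : I (qval (qpi x) - x).
Proof. exact: idealBC (qrepP x). Qed.

Let qaddE x y : qadd (qpi x) (qpi y) = qpi (x + y).
Proof. by apply/qpi_eq; apply: idealBD => //; apply: val_pi. Qed.
Let qmulE x y : qmul (qpi x) (qpi y) = qpi (x * y).
Proof. by apply/qpi_eq; apply: idealBM => //; apply: val_pi. Qed.
Let qoppE x : qopp (qpi x) = qpi (- x).
Proof. by apply/qpi_eq; rewrite -opprD; apply: idealN => //; apply: val_pi. Qed.

Let qP (P : Q -> Prop) : (forall x, P (qpi x)) -> forall u, P u.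
Proof. by move=> H u; rewrite -(qpi_val u). Qed.

Fact qaddA : associative qadd.
Proof. by do 3![elim/qP => ?]; rewrite !qaddE addrA. Qed.
Fact qaddC : commutative qadd.
Proof. by do 2![elim/qP => ?]; rewrite !qaddE addrC. Qed.
Fact qadd0 : left_id (qpi 0) qadd.
Proof. by elim/qP => ?; rewrite !qaddE add0r. Qed.
Fact qaddN : left_inverse (qpi 0) qopp qadd.
Proof. by elim/qP => ?; rewrite qoppE !qaddE addNr. Qed.
HB.instance Definition _ := GRing.isZmodule.Build Q qaddA qaddC qadd0 qaddN.
Fact qmulA : associative qmul.
Proof. by do 3![elim/qP => ?]; rewrite !qmulE mulrA. Qed.
Fact qmulC : commutative qmul.
Proof. by do 2![elim/qP => ?]; rewrite !qmulE mulrC. Qed.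
Fact qmul1 : left_id (qpi 1) qmul.
Proof. by elim/qP => ?; rewrite !qmulE mul1r. Qed.
Fact qmulDl : left_distributive qmul +%R.
Proof.
have D (x y : A) : qpi x + qpi y = qpi (x + y) := qaddE x y.
by do 3![elim/qP => ?]; rewrite D !qmulE D mulrDl.
Qed.
HB.instance Definition _ := GRing.Zmodule_isComPzRing.Build Q qmulA qmulC qmul1 qmulDl.

Fact qpi_additive : additive qpi.
Proof.
move=> x y; have -> : qpi x - qpi y = qadd (qpi x) (qopp (qpi y)) by [].
by rewrite qoppE qaddE.
Qed.
HB.instance Definition _ := GRing.isAdditive.Build A Q qpi qpi_additive.
Fact qpi_multiplicative : multiplicative qpi.
Proof. by split=> // x y; rewrite -qmulE. Qed.
HB.instance Definition _ := GRing.isMultiplicative.Build A Q qpi qpi_multiplicative.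

Lemma qpi0 x : qpi x = 0 <-> I x.
Proof. by rewrite -(rmorph0 qpi) qpi_eq subr0. Qed.

Lemma qpi_surj (u : Q) : exists x, qpi x = u.
Proof. by exists (qval u); apply: qpi_val. Qed.

End Quotient.

Lemma residue_field (A : comPzRingType) (m : set A) : max_ideal m ->
  exists (L : fieldType) (pi : {rmorphism A -> L}),
    (forall a, pi a = 0 <-> m a) /\ (forall u, exists a, pi a = u).
Proof.
move=> mm; have hm := max_is_ideal mm; pose Q := quotient hm.
have Q1 : (1 : Q) != 0.
  by apply/eqP => /(qpi0 hm); case: mm.
pose Qnz : comNzRingType := HB.pack Q (GRing.PzSemiRing_isNonZero.Build Q Q1).
have /choice[inv invP] : forall u : Q, exists w : Q, (u != 0 -> w * u = 1) /\ (u = 0 -> w = 0).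
  move=> u; have [-> |/eqP u0] := pselect (u = 0); first by exists 0; rewrite eqxx.
  have [x xu] := qpi_surj u; have [|b mb] := @max_unit _ m x mm.
    by move=> /(qpi0 hm); rewrite xu => /eqP; rewrite (negbTE u0).
  exists (qpi hm b); split=> [_|/eqP]; last by rewrite (negbTE u0).
  by rewrite -xu -rmorphM mulrC -(rmorph1 (qpi hm)); apply/qpi_eq.
pose L : fieldType := HB.pack Qnz
  (GRing.ComNzRing_isField.Build Qnz (fun u u0 => (invP u).1 u0) ((invP 0).2 erefl)).
pose pi : A -> L := qpi hm.
pose piM := GRing.isMultiplicative.Build A L pi (qpi_multiplicative hm).
pose piA := GRing.isAdditive.Build A L pi (qpi_additive hm).
pose piR : {rmorphism A -> L} := HB.pack pi piA piM.
exists L, piR; split=> [a|u]; first exact: qpi0.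
exact: qpi_surj.
Qed.

(** * Evaluation of polynomials and primitive elements *)

Section PolyEval.
Variables (k : fieldType) (A : comPzRingType) (iota : {rmorphism k -> A}).
Implicit Types (p q : {poly k}) (a b : A).

(** An explicit sum rather than the evaluation of a mapped polynomial, since [A] may be the zero
    ring. *)
Definition peval p a : A := \sum_(i < size p) iota p`_i * a ^+ i.

Lemma pevalE n p a : (size p <= n)%N -> peval p a = \sum_(i < n) iota p`_i * a ^+ i.
Proof.
move=> /subnKC <-; rewrite big_split_ord /= [X in _ = _ + X]big1 ?addr0// => i _.
by rewrite nth_default ?rmorph0 ?mul0r//= leq_addr.
Qed.

Lemma pevalD p q a : peval (p + q) a = peval p a + peval q a.
Proof.
pose n := maxn (size p) (size q).
rewrite !(@pevalE n) ?leq_maxl ?leq_maxr ?size_polyD// -big_split.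
by apply: eq_bigr => i _; rewrite coefD rmorphD mulrDl.
Qed.

Lemma pevalN p a : peval (- p) a = - peval p a.
Proof.
by rewrite /peval size_polyN -sumrN; apply: eq_bigr => i _; rewrite coefN rmorphN mulNr.
Qed.

Lemma pevalB p q a : peval (p - q) a = peval p a - peval q a.
Proof. by rewrite pevalD pevalN. Qed.

Lemma pevalC c a : peval c%:P a = iota c.
Proof. by rewrite (@pevalE 1) ?size_polyC ?leq_b1// big_ord1 coefC /= mulr1. Qed.

Lemma peval0 a : peval 0 a = 0. Proof. by rewrite -[0]/(0%:P) pevalC rmorph0. Qed.
Lemma peval1 a : peval 1 a = 1. Proof. by rewrite pevalC rmorph1. Qed.

Lemma pevalMXC p c a : peval (p * 'X + c%:P) a = peval p a * a + iota c.
Proof.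
rewrite pevalD pevalC; congr (_ + _); rewrite (@pevalE (size p).+1); last first.
  by have [->|p0] := eqVneq p 0; rewrite ?mul0r ?size_poly0// size_mulX.
rewrite big_ord_recl coefMX /= rmorph0 mul0r add0r /peval mulr_suml.
by apply: eq_bigr => i _; rewrite coefMX /= /bump /= exprSr mulrA.
Qed.

Lemma pevalX a : peval 'X a = a.
Proof. by rewrite -[X in peval X]mul1r -[_ * _]addr0 pevalMXC peval1 mul1r rmorph0 addr0. Qed.

Lemma pevalCM c p a : peval (c%:P * p) a = iota c * peval p a.
Proof.
elim/poly_ind: p => [|p d IH]; first by rewrite mulr0 peval0 mulr0.
by rewrite mulrDr mulrA -polyCM !pevalMXC IH rmorphM mulrDr mulrA.
Qed.

Lemma pevalM p q a : peval (p * q) a = peval p a * peval q a.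
Proof.
elim/poly_ind: p => [|p d IH]; first by rewrite mul0r peval0 mul0r.
rewrite mulrDl pevalD pevalCM pevalMXC mulrDl; congr (_ + _).
by rewrite -mulrA ['X * q]mulrC mulrA -[_ * 'X]addr0 pevalMXC IH rmorph0 addr0 mulrAC.
Qed.

Lemma peval_mod I p a b : is_ideal I -> I (a - b) -> I (peval p a - peval p b).
Proof.
move=> hI ab; rewrite /peval -sumrB; apply: ideal_sum => // i _.
by rewrite -mulrBr; apply: idealMleft => //; apply: idealBX.
Qed.

Lemma peval_derivation (V : lmodType A) (D : A -> V) :
  (forall a b, D (a + b) = D a + D b) ->
  (forall a b, D (a * b) = a *: D b + b *: D a) -> (forall c, D (iota c) = 0) ->
  forall p a, D (peval p a) = peval p^`() a *: D a.
Proof.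
move=> DD DM Dc p a; elim/poly_ind: p => [|p c IH].
  by rewrite deriv0 !peval0 scale0r -(rmorph0 iota) Dc.
rewrite pevalMXC DD DM Dc addr0 IH derivMXaddC pevalD -[_ * 'X]addr0 pevalMXC rmorph0 addr0.
by rewrite scalerDl scalerA mulrC.
Qed.

Definition algebraic_mod (m : set A) a := exists2 p, p != 0 & m (peval p a).

(** For [p] of least degree, the derivative is nonzero in characteristic 0 and of smaller degree, so
    its value cannot lie in [m]. This is separability. *)
Lemma minimal_poly_mod (m : set A) a : [pchar k] =i pred0 -> max_ideal m -> algebraic_mod m a ->
  exists p, [/\ m (peval p a), ~ m (peval p^`() a) & forall q, m (peval q a) -> p %| q].
Proof.
move=> ch mm [p0 p0n p0m]; have hm := max_is_ideal mm.
pose P n := `[< exists p, [/\ p != 0, size p = n & m (peval p a)] >].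
have [|n /asboolP[p [pn pN pm]] nmin] := @ex_minnP P.
  by exists (size p0); apply/asboolP; exists p0.
have small q : (size q < size p)%N -> m (peval q a) -> q = 0.
  move=> qp qm; apply/eqP/negPn/negP => qn; move: qp; rewrite pN ltnNge => /negP; apply.
  by apply: nmin; apply/asboolP; exists q.
exists p; split => // [pm'|q qm].
  have p1 : (1 < size p)%N.
    rewrite ltnNge; apply/negP => /size1_polyC pc; case: mm => _ m1 _; apply: m1.
    have c0 : p`_0 != 0 by apply: contra_neq pn => c0; rewrite pc c0.
    have -> : 1 = iota (p`_0)^-1 * peval p a by rewrite pc pevalC coefC -rmorphM mulVf ?rmorph1.
    exact: idealMleft.
  have : p^`() = 0.
    by apply: small => //; apply: lt_size_deriv.
  move/(congr1 (fun q : {poly k} => q`_(size p).-2)); rewrite coef_deriv coef0 => /eqP.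
  have -> : (size p).-2.+1 = (size p).-1 by case: (size p) p1 => [|[]].
  rewrite -mulr_natr mulf_eq0 -/(lead_coef p) lead_coef_eq0 (negbTE pn) /=.
  by move/pcharf0P: ch => ->; case: (size p) p1 => [|[]].
apply/modp_eq0P; apply: small; first by rewrite ltn_modp.
have -> : q %% p = q - q %/ p * p by rewrite [X in X - _](divp_eq q p) addrC addKr.
by rewrite pevalB pevalM; apply: idealB => //; apply: idealMleft.
Qed.

End PolyEval.

Lemma peval_rmorph (k : fieldType) (A B : comPzRingType) (iA : {rmorphism k -> A})
  (iB : {rmorphism k -> B}) (phi : {rmorphism A -> B}) p a :
  (forall c, phi (iA c) = iB c) -> phi (peval iA p a) = peval iB p (phi a).
Proof.
move=> h; rewrite /peval rmorph_sum; apply: eq_bigr => i _.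
by rewrite rmorphM rmorphXn h.
Qed.

Section Primitive.
Variables (k : fieldType) (A : comPzRingType) (iota : {rmorphism k -> A}).
Hypothesis ch : [pchar k] =i pred0.
Variable (m : set A).
Hypothesis mm : max_ideal m.

Lemma primitive_pair x y : algebraic_mod iota m x -> algebraic_mod iota m y ->
  exists z, [/\ algebraic_mod iota m z, exists w, m (x - peval iota w z)
              & exists w, m (y - peval iota w z)].
Proof.
move=> [p pn px] [q qn qy]; have hm := max_is_ideal mm.
have [L [pi [pi0 piS]]] := residue_field mm.
pose iL : {rmorphism k -> L} := pi \o iota.
have piE r a : pi (peval iota r a) = (map_poly iL r).[pi a].
  rewrite (@peval_rmorph _ _ _ _ iL)// horner_coef size_map_poly.
  by apply: eq_bigr => i _; rewrite coef_map.
have pr : root (map_poly iL p) (pi x) by apply/rootP; rewrite -piE; apply/pi0.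
have qr : root (map_poly iL q) (pi y) by apply/rootP; rewrite -piE; apply/pi0.
have [n [[u xu] [w yw]]] := pchar0_PET pn pr qn qr ch.
pose z := y *+ n - x.
have piz : pi z = pi y *+ n - pi x by rewrite rmorphB rmorphMn.
rewrite -piz -!piE in xu yw.
have mx : m (x - peval iota u z) by apply/pi0; rewrite rmorphB xu subrr.
have my : m (y - peval iota w z) by apply/pi0; rewrite rmorphB yw subrr.
exists z; split; [|by exists u|by exists w].
have az : algebraicOver iL (pi z).
  rewrite piz; apply: algebraic_sub; last by exists p.
  by rewrite -mulr_natl; apply: algebraic_mul; [rewrite -(rmorph_nat iL); apply: algebraic_id|exists q].
by have [r rn rz] := az; exists r => //; apply/pi0; rewrite piE; apply/rootP.
Qed.

Lemma primitive_element n (T : 'I_n -> A) : (forall i, algebraic_mod iota m (T i)) ->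
  exists2 z, algebraic_mod iota m z & forall i, exists w, m (T i - peval iota w z).
Proof.
have hm := max_is_ideal mm; elim: n T => [|n IH] T aT.
  exists 0; last by case.
  by exists 'X; rewrite ?polyX_eq0// pevalX; apply: ideal0.
have [z az zT] := IH (fun i => T (lift ord0 i)) (fun i => aT _).
have [t [at_ [u tz] [w t0]]] := primitive_pair az (aT ord0).
exists t => // i; case: (unliftP ord0 i) => [j|] ->; last by exists w.
have [v zv] := zT j; exists (v \Po u); apply: idealB_trans zv _ => //.
have -> : peval iota (v \Po u) t = peval iota v (peval iota u t).
  elim/poly_ind: v => [|v c IHv]; first by rewrite comp_poly0 !peval0.
  by rewrite comp_polyD comp_polyM comp_polyX comp_polyC pevalD pevalM IHv pevalC pevalMXC.
exact: peval_mod.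
Qed.

End Primitive.

(** * Substitutions in Tate algebras *)

Section TateSubstitution.
Variables (R : realType) (k : fieldType) (v : nabs R k).

(** No constant terms make the substitution a formal one, integral coefficients keep it from
    increasing absolute values, and the degree bound keeps monomials of low degree in low degree.
    Together they preserve convergence. *)
Record tate_subst (n n' : nat) := TateSubst {
  ts_tuple :> n.-tuple {mpoly k[n']};
  ts_deg : nat;
  ts_noconst : forall i, (tnth ts_tuple i)@_0 = 0;
  ts_int : forall i m, v (tnth ts_tuple i)@_m <= 1;
  ts_degP : forall i m, (ts_deg < mdeg m)%N -> (tnth ts_tuple i)@_m = 0 }.

Variables (n n' : nat) (g : tate_subst n n').

Definition integral_coefs (p : {mpoly k[n']}) := forall m, v p@_m <= 1.

Lemma integral_coefsM p q :
  integral_coefs p -> integral_coefs q -> integral_coefs (p * q).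
Proof.
move=> pi qi m; rewrite mcoeffM; apply: nav_sum => // i _.
by rewrite navM -[1]mulr1; apply: ler_pM; rewrite ?nav_ge0.
Qed.

Lemma integral_coefs1 : integral_coefs 1.
Proof. by move=> m; rewrite mcoeff1; apply: nav_nat. Qed.

Lemma integral_coefs_subst l : integral_coefs ('X_[l] \mPo g).
Proof.
rewrite comp_mpolyX; elim/big_ind: _ => [|p q|i _]; first exact: integral_coefs1.
  exact: integral_coefsM.
elim: (l i) => [|j IH]; first by rewrite expr0; apply: integral_coefs1.
by rewrite exprS; apply: integral_coefsM => // m; apply: ts_int.
Qed.

Lemma degree_subst l m : (ts_deg g * mdeg l < mdeg m)%N -> ('X_[l] \mPo g)@_m = 0.
Proof.
pose dle b (p : {mpoly k[n']}) := forall m, (b < mdeg m)%N -> p@_m = 0.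
have dM a b p q : dle a p -> dle b q -> dle (a + b)%N (p * q).
  move=> pa qb m' h; rewrite mcoeffM big1// => -[[x hx] [y hy]] /= /eqP xy.
  have [xa|xa] := ltnP a (mdeg x); first by rewrite pa ?mul0r.
  by rewrite [X in _ * X]qb ?mulr0//; move: h; rewrite xy mdegD; lia.
have d1 : dle 0%N 1 by move=> m' h; rewrite mcoeff1 -mdeg_eq0 gtn_eqF.
move: m; rewrite -/(dle _ _) comp_mpolyX mdegE big_distrr /=.
elim/big_ind2: _ => [|a p b q|i _]; [exact: d1|exact: dM|].
elim: (l i) => [|j IH]; first by rewrite expr0 muln0; apply: d1.
by rewrite exprS mulnS; apply: dM => // m'; apply: ts_degP.
Qed.

Lemma fps_substS N (c : fps k n) m : (mdeg m < N)%N ->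
  fps_subst g c m = \sum_(l : 'X_{1..n < N}) c l * ('X_[l] \mPo g)@_m.
Proof.
move=> mN; rewrite (fps_substE (ts_noconst g) _ mN) /ptrunc (raddf_sum (comp_mpoly g)) raddf_sum.
by apply: eq_bigr => l _; rewrite /= comp_mpolyZ mcoeffZ.
Qed.

Lemma fps_subst_tate (c : fps k n) : tate v c -> tate v (fps_subst g c).
Proof.
move=> cT e e0; have [N cN] := cT e e0; exists (ts_deg g * N)%N.+1 => m mN.
rewrite (@fps_substS (mdeg m).+1)//; apply: nav_sum_lt => // l _.
have [lN|lN] := leqP N (mdeg l).
  rewrite navM; apply: le_lt_trans (cN _ lN).
  by rewrite ler_piMr ?nav_ge0//; apply: integral_coefs_subst.
rewrite degree_subst ?mulr0 ?nav0//; apply: leq_trans mN; rewrite ltnS.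
by rewrite leq_mul2l (ltnW lN) orbT.
Qed.

Definition substT (c : tateT v n) : tateT v n' := mkT (fps_subst_tate (tate_tser c)).

Fact substT_additive : additive substT.
Proof. by move=> c d; apply: tser_inj; apply: fps_subst_additive. Qed.
HB.instance Definition _ := GRing.isAdditive.Build _ _ substT substT_additive.

Let sM := fps_subst_multiplicative (ts_noconst g).
Fact substT_multiplicative : multiplicative substT.
Proof.
by split=> [c d|]; apply: tser_inj; [apply: (fst sM)|apply: (snd sM)].
Qed.
HB.instance Definition _ := GRing.isMultiplicative.Build _ _ substT substT_multiplicative.

Lemma substT_poly p : substT (polyT v p) = polyT v (p \mPo g).
Proof. by apply: tser_inj; rewrite /= (fps_subst_of (ts_noconst g)). Qed.

Lemma substT_cst a : substT (cstT v n a) = cstT v n' a.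
Proof. by rewrite /cstT /= substT_poly comp_mpolyC. Qed.

Lemma substT_var i : substT (varT v i) = polyT v (tnth g i).
Proof. by rewrite substT_poly comp_mpolyXU -tnth_nth. Qed.

End TateSubstitution.

Lemma substTK (R : realType) (k : fieldType) (v : nabs R k) n (g h : tate_subst v n n) :
  (forall i, tnth g i \mPo h = 'X_i) -> cancel (substT g) (substT h).
Proof.
move=> gh c; apply: tser_inj; apply: fps_substK => //; exact: ts_noconst.
Qed.

(** * Shears and changes of the number of variables *)

Section Shear.
Variables (R : realType) (k : fieldType) (v : nabs R k) (n : nat).

(** The exponent is a successor, so no constant term appears. The last variable is fixed, so that
    [e] and [- e] give inverse substitutions. *)
Definition shear_tuple (e : k) (w : 'I_n -> nat) : n.+1.-tuple {mpoly k[n.+1]} :=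
  [tuple (if unlift ord_max i is Some j then 'X_i + e *: 'X_[U_(ord_max) *+ (w j).+1]
          else 'X_i) | i < n.+1].

Variables (e : k) (w : 'I_n -> nat).
Hypothesis e1 : v e <= 1.

Let shearE i : tnth (shear_tuple e w) i =
  if unlift ord_max i is Some j then 'X_i + e *: 'X_[U_(ord_max) *+ (w j).+1] else 'X_i.
Proof. by rewrite tnth_mktuple. Qed.

Fact shear_noconst i : (tnth (shear_tuple e w) i)@_0 = 0.
Proof.
have X0 : ('X_i : {mpoly k[n.+1]})@_0 = 0 by rewrite mcoeffX mnm1_eq0.
rewrite shearE; case: unlift => [j|//]; rewrite mcoeffD mcoeffZ X0 mcoeffX.
by rewrite -mdeg_eq0 mdegMn mdeg1 mul1n mulr0 addr0.
Qed.

Fact shear_int i m : v (tnth (shear_tuple e w) i)@_m <= 1.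
Proof.
have X1 m' : v ('X_[m'] : {mpoly k[n.+1]})@_m <= 1 by rewrite mcoeffX nav_nat.
rewrite shearE; case: unlift => [j|//]; rewrite mcoeffD mcoeffZ.
apply: le_trans (navD _ _ _) _; rewrite ge_max X1 navM /= -[leRHS]mulr1.
by apply: ler_pM; rewrite ?nav_ge0.
Qed.

Fact shear_degP i m : (\sum_j (w j).+1 < mdeg m)%N -> (0 < mdeg m)%N ->
  (1 < mdeg m)%N -> (tnth (shear_tuple e w) i)@_m = 0.
Proof.
move=> wm m0 m1; have Xd d : mdeg d != mdeg m -> ('X_[d] : {mpoly k[n.+1]})@_m = 0.
  by move=> dm; rewrite mcoeffX; case: (d =P m) dm => // ->; rewrite eqxx.
rewrite shearE; case: unlift => [j|]; last by rewrite Xd// mdeg1 ltn_eqF.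
rewrite mcoeffD mcoeffZ !Xd ?mulr0 ?addr0 ?mdeg1 ?ltn_eqF//.
rewrite mdegMn mdeg1 mul1n; apply: leq_ltn_trans wm.
by rewrite (bigD1 j)//= leq_addr.
Qed.

Definition shear : tate_subst v n.+1 n.+1.
Proof.
exists (shear_tuple e w) (\sum_j (w j).+1 + 1)%N; [exact: shear_noconst|exact: shear_int|].
by move=> i m h; apply: shear_degP; lia.
Defined.

Lemma shear_last : substT shear (varT v ord_max) = varT v ord_max.
Proof. by rewrite substT_var shearE unlift_none. Qed.

Definition incl_tuple : n.-tuple {mpoly k[n.+1]} := [tuple 'X_(lift ord_max i) | i < n].

Definition incl : tate_subst v n n.+1.
Proof.
exists incl_tuple 1%N; move=> i; rewrite tnth_mktuple.
- by rewrite mcoeffX mnm1_eq0.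
- by move=> m; rewrite mcoeffX nav_nat.
- by move=> m m1; rewrite mcoeffX; case: eqP m1 => // <-; rewrite mdeg1.
Defined.

Definition forget_tuple : n.+1.-tuple {mpoly k[n]} :=
  [tuple (if unlift ord_max i is Some j then 'X_j else 0) | i < n.+1].

Definition forget : tate_subst v n.+1 n.
Proof.
exists forget_tuple 1%N; move=> i; rewrite tnth_mktuple; case: unlift => [j|].
- by rewrite mcoeffX mnm1_eq0.
- by rewrite mcoeff0.
- by move=> m; rewrite mcoeffX nav_nat.
- by move=> m; rewrite mcoeff0 nav0 ler01.
- by move=> m m1; rewrite mcoeffX; case: eqP m1 => // <-; rewrite mdeg1.
- by move=> m _; rewrite mcoeff0.
Defined.

Lemma forget_last : substT forget (varT v ord_max) = 0.
Proof. by rewrite substT_var tnth_mktuple unlift_none rmorph0. Qed.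

Lemma inclK : cancel (substT incl) (substT forget).
Proof.
move=> c; apply: tateP_ext => m /=.
transitivity (((ptrunc (mdeg m).+1 (tser c) \mPo incl) \mPo forget)@_m).
  apply: (peq_subst (ts_noconst forget) (N := (mdeg m).+1)) => // l lm.
  by rewrite (ptrunc_subst (ts_noconst incl)).
have E p : (p \mPo incl) \mPo forget = p.
  rewrite (comp_mpolyEX p incl) raddf_sum [RHS]mpolyE; apply: eq_bigr => l _.
  rewrite /= comp_mpolyZ; congr (_ *: _); rewrite comp_mpolyX rmorph_prod.
  rewrite mpolyXE_id; apply: eq_bigr => i _; rewrite rmorphXn /= !tnth_mktuple.
  by rewrite comp_mpolyXU -tnth_nth tnth_mktuple liftK.
by rewrite E mcoeff_trunc leqnn.
Qed.

Lemma inclE (c : tateT v n) (m : 'X_{1..n.+1}) :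
  substT incl c m = if m ord_max == 0%N then c [multinom m (lift ord_max i) | i < n] else 0.
Proof.
pose wd (l : 'X_{1..n}) : 'X_{1..n.+1} :=
  [multinom (if unlift ord_max i is Some j then l j else 0%N) | i < n.+1].
have wdE (l : 'X_{1..n}) : 'X_[l] \mPo incl = 'X_[wd l].
  rewrite comp_mpolyX [RHS]mpolyXE_id big_ord_recr /= mnmE unlift_none expr0 mulr1.
  apply: eq_bigr => i _; rewrite tnth_mktuple mnmE.
  have -> : widen_ord (leqnSn n) i = lift ord_max i by apply: val_inj; rewrite /= /bump leqNgt ltn_ord.
  by rewrite liftK.
rewrite /= (@fps_substS _ _ _ _ _ incl (mdeg m).+1)//.
under eq_bigr => l _ do rewrite wdE mcoeffX.
case: eqP => [m0|/eqP m0]; last first.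
  rewrite big1// => l _; case: eqP => [e0|]; last by rewrite mulr0.
  by case/eqP: m0; have /mnmP/(_ ord_max) := e0; rewrite mnmE unlift_none.
pose r : 'X_{1..n} := [multinom m (lift ord_max i) | i < n].
have wr : wd r = m.
  apply/mnmP => i; rewrite !mnmE; case: unliftP => [j ->|->]; last by rewrite m0.
  by rewrite mnmE.
have rm : (mdeg r < (mdeg m).+1)%N.
  rewrite ltnS !mdegE big_ord_recr /= m0 addn0 leq_eqVlt; apply/orP; left; apply/eqP.
  apply: eq_bigr => i _; rewrite mnmE; congr (m _).
  by apply: val_inj; rewrite /= /bump leqNgt ltn_ord.
rewrite (bigD1 (BMultinom rm))//= wr eqxx mulr1 big1 ?addr0// => l lr.
case: eqP => [e0|]; last by rewrite mulr0.
case/eqP: lr; apply: val_inj => /=; apply/mnmP => i.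
by have /mnmP/(_ (lift ord_max i)) := e0; rewrite !mnmE liftK => ->.
Qed.

Lemma tate_low_degree s (r : tateT v n.+1) :
  (forall m : 'X_{1..n.+1}, (s <= m ord_max)%N -> r m = 0) ->
  exists r' : 'I_s -> tateT v n,
    r = \sum_(i < s) substT incl (r' i) * varT v ord_max ^+ i.
Proof.
move=> rs; pose up (i : nat) (m : 'X_{1..n}) : 'X_{1..n.+1} :=
  [multinom (if unlift ord_max j is Some l then m l else i) | j < n.+1].
have rT (i : 'I_s) : tate v (fun m => r (up i m)).
  move=> e' e0; have [N rN] := tate_tser r e0; exists N => m mN; apply: rN.
  apply: leq_trans mN _; rewrite !mdegE big_ord_recr /=; apply: leq_trans (leq_addr _ _).
  apply: leq_sum => j _; rewrite mnmE.
  have -> : widen_ord (leqnSn n) j = lift ord_max j by apply: val_inj; rewrite /= /bump leqNgt ltn_ord.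
  by rewrite liftK.
exists (fun i => mkT (rT i)); apply: tateP_ext => m.
rewrite raddf_sum fps_sum.
have T (i : 'I_s) : tser (substT incl (mkT (rT i)) * varT v ord_max ^+ i) m =
    if m ord_max == i then r m else 0.
  rewrite /varT -rmorphXn /= mpolyXn fpsMX.
  have E : (U_(ord_max) *+ i <= m)%MM = (i <= m ord_max)%N.
    apply/mnm_lepP/idP => [/(_ ord_max)|im j]; first by rewrite mulmnE mnm1E eqxx mul1n.
    by rewrite mulmnE mnm1E; case: eqP => [<-|]; rewrite ?mul1n ?mul0n.
  rewrite E; case: leqP => im; last by rewrite ltn_eqF.
  have := inclE (mkT (rT i)) (m - U_(ord_max) *+ i)%MM; rewrite /= => ->.
  rewrite mnmBE mulmnE mnm1E eqxx mul1n subn_eq0 eqn_leq im andbT.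
  case: ifP => // mi; congr (r _); apply/mnmP => j; rewrite mnmE.
  case: unliftP => [l ->|->]; last by apply/eqP; rewrite eqn_leq im mi.
  rewrite mnmE mnmBE mulmnE mnm1E.
  by rewrite (_ : ord_max == lift ord_max l = false) ?mul0n ?subn0//; apply/negbTE/neq_lift.
apply/esym/(etrans (eq_bigr _ (fun i _ => T i))).
have [ms|ms] := ltnP (m ord_max) s; last first.
  by rewrite rs// big1// => i _; rewrite gtn_eqF// (leq_trans _ ms).
rewrite (bigD1 (Ordinal ms))//= eqxx big1 ?addr0// => i im.
by case: eqP => // e0; case/eqP: im; apply: val_inj.
Qed.

End Shear.

Lemma shearK (R : realType) (k : fieldType) (v : nabs R k) n (w : 'I_n -> nat) (e : k)
  (h : v e <= 1) (h' : v (- e) <= 1) : cancel (substT (shear w h)) (substT (shear w h')).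
Proof.
apply: substTK => i; rewrite tnth_mktuple.
have last_ : ('X_ord_max : {mpoly k[n.+1]}) \mPo shear w h' = 'X_ord_max.
  by rewrite comp_mpolyXU -tnth_nth tnth_mktuple unlift_none.
case: (unliftP ord_max i) => [j|] -> //.
rewrite rmorphD /= comp_mpolyZ -mpolyXn rmorphXn /= last_ comp_mpolyXU -tnth_nth tnth_mktuple.
by rewrite liftK mpolyXn scaleNr subrK.
Qed.

(** * Weierstrass division *)

(** Uniqueness of expansions in base [N]; it separates the degrees of the dominant monomials after a
    shear. *)
Lemma digit_inj N n (a b : 'I_n -> nat) : (forall i, a i < N)%N -> (forall i, b i < N)%N ->
  (\sum_(i < n) N ^ i * a i = \sum_(i < n) N ^ i * b i)%N -> a =1 b.
Proof.
elim: n a b => [|n IH] a b aN bN; first by move=> _ [].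
rewrite !big_ord_recl !expn0 !mul1n /=.
have E (c : 'I_n.+1 -> nat) : (\sum_(i < n) N ^ bump 0 i * c (lift ord0 i) =
    N * \sum_(i < n) N ^ i * c (lift ord0 i))%N.
  by rewrite big_distrr; apply: eq_bigr => i _; rewrite /= mulnA -expnS.
rewrite !E => e.
have N0 : (0 < N)%N by apply: leq_ltn_trans (aN ord0).
have e0 : a ord0 = b ord0.
    have := congr1 (modn^~ N) e.
  have M (x y : nat) : (x + N * y = x %[mod N])%N by rewrite addnC mulnC modnMDl.
  by rewrite /= !M !modn_small.
have e1 := IH _ _ (fun i => aN (lift ord0 i)) (fun i => bN (lift ord0 i)).
move=> i; case: (unliftP ord0 i) => [j|] -> //; apply: e1.
by apply/eqP; rewrite -(eqn_pmul2l N0) -(eqn_add2l (a ord0)) {2}e0 e.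
Qed.

Section Weierstrass.
Variables (R : realType) (k : fieldType) (v : nabs R k) (n : nat).
Notation T := (tateT v n.+1).

(** A coefficient of greatest value exists, because only finitely many reach the value of a given
    nonzero one; [u] is its inverse. *)
Lemma gauss_normalize (f : T) : f != 0 -> exists2 u, u != 0 &
  (forall m, v ((cstT v _ u * f) m) <= 1) /\ exists m, v ((cstT v _ u * f) m) = 1.
Proof.
move=> f0; have [m1 fm1] : exists m1, f m1 != 0.
  apply: contrapT => nf; case/eqP: f0; apply: tateP_ext => m.
  by apply: contrapT => /eqP fm; apply: nf; exists m.
have e0 : 0 < v (f m1) by rewrite lt_def nav_ge0 andbT; apply: contra_neq fm1 => /nav_eq0.
have [N fN] := tate_tser f e0.
have m1N : (mdeg m1 < N)%N by rewrite ltnNge; apply/negP => /fN; rewrite ltxx.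
have [i _ imax] := @Order.TotalTheory.arg_maxP _ _ _ (BMultinom m1N) predT
  (fun i : 'X_{1..n.+1 < N} => v (f i)) isT.
have fi : 0 < v (f i) by apply: lt_le_trans e0 (imax (BMultinom m1N) isT).
have fi0 : f i != 0 by apply/eqP => e; move: fi; rewrite e nav0 ltxx.
exists (f i)^-1; first by rewrite invr_eq0.
split=> [m|]; last by exists (bmnm i); rewrite cstTM mulVf ?nav1.
rewrite cstTM navM navV// mulrC ler_pdivrMr// mul1r.
have [mN|Nm] := ltnP (mdeg m) N; first exact: (imax (BMultinom mN) isT).
by apply: le_trans (ltW (fN m Nm)) _; apply: (imax (BMultinom m1N) isT).
Qed.

(** All but finitely many coefficients are below 1/2, so those of value less than 1 stay below a
    common [ep < 1]. *)
Lemma unit_gap (h : T) : (forall m, v (h m) <= 1) ->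
  exists N ep, [/\ 0 < ep < 1, forall m, v (h m) = 1 -> (mdeg m < N)%N
    & forall m, v (h m) != 1 -> v (h m) <= ep].
Proof.
move=> h1; have half : 0 < (2^-1 : R) by rewrite invr_gt0 ltr0n.
have half1 : (2^-1 : R) < 1 by rewrite invf_lt1 ?ltr0n// ltr1n.
have [N hN] := tate_tser h half.
have [ep ep1 epP] : exists2 ep : R, 2^-1 <= ep < 1 &
    forall i, i \in enum {: 'X_{1..n.+1 < N}} -> v (h i) != 1 -> v (h i) <= ep.
  elim: (enum _) => [|i s [ep /andP[ep2 ep1] epP]]; first by exists 2^-1; rewrite ?lexx.
  have [hi|hi] := eqVneq (v (h i)) 1.
    exists ep; rewrite ?ep2// => j; rewrite inE => /orP[/eqP -> |/epP//].
    by rewrite hi eqxx.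
  exists (Num.max ep (v (h i))).
    by rewrite le_max ep2 /= gt_max ep1 /= lt_neqAle hi h1.
  move=> j; rewrite inE le_max => /orP[/eqP ->|/epP H /H ->//]; by rewrite lexx orbT.
case/andP: ep1 => ep2 ep1.
exists N, ep; split; first by rewrite ep1 (lt_le_trans half).
  by move=> m hm; rewrite ltnNge; apply/negP => /hN; rewrite hm ltNge ltW.
move=> m hm; have [mN|Nm] := ltnP (mdeg m) N.
  by apply: (epP (BMultinom mN)); rewrite ?mem_enum.
by apply: le_trans (ltW (hN m Nm)) ep2.
Qed.

Notation U := (U_(ord_max : 'I_n.+1))%MM.

Let low d (p : {mpoly k[n.+1]}) :=
  forall m : 'X_{1..n.+1}, (d <= m ord_max)%N -> p@_m = 0.
(** [p] is monic of degree [d] in the last variable. *)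
Let top d (p : {mpoly k[n.+1]}) := low d (p - 'X_[U *+ d]).

Let lowM a b p q : low a p -> low b.+1 q -> low (a + b) (p * q).
Proof.
move=> pa qb m h; rewrite mcoeffM big1// => -[[x hx] [y hy]] /= /eqP xy.
have [xa|xa] := leqP a (x ord_max); first by rewrite pa ?mul0r.
rewrite [X in _ * X]qb ?mulr0//; move: h; rewrite xy mnmDE; lia.
Qed.

Let lowX d : low d.+1 'X_[U *+ d].
Proof.
move=> m dm; rewrite mcoeffX; case: eqP => // e0.
by move: dm; rewrite -e0 mulmnE mnm1E eqxx mul1n ltnn.
Qed.

Let low_top d p : top d p -> low d.+1 p.
Proof.
move=> pt m dm; have := pt m (ltnW dm); rewrite mcoeffB lowX// subr0; exact.
Qed.

Let topM a b p q : top a p -> top b q -> top (a + b) (p * q).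
Proof.
move=> pa qb; rewrite /top; have -> : p * q - 'X_[U *+ (a + b)] =
    (p - 'X_[U *+ a]) * q + (q - 'X_[U *+ b]) * 'X_[U *+ a].
  have -> : 'X_[U *+ (a + b)] = 'X_[U *+ a] * 'X_[U *+ b] :> {mpoly k[n.+1]}.
    by rewrite -mpolyXD; congr 'X_[_]; apply/mnmP => i; rewrite mnmDE !mulmnE mulnDr.
  by ring.
move=> m dm; rewrite mcoeffD (lowM pa (low_top qb))// add0r.
by rewrite addnC in dm; apply: (lowM qb (lowX (d := a))).
Qed.

Let top1 : top 0 1.
Proof. by move=> m _; rewrite mulm0n mpolyX0 subrr mcoeff0. Qed.

Variables (w : 'I_n -> nat) (v1 : v 1 <= 1).
Let sg := shear w v1.
(** The degree in the last variable of the sheared monomial [X ^ m]. *)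
Let W (m : 'X_{1..n.+1}) := (\sum_(j < n) (w j).+1 * m (lift ord_max j) + m ord_max)%N.

Let top_mono m : top (W m) ('X_[m] \mPo sg).
Proof.
rewrite comp_mpolyX big_ord_recr /=.
have topX a p i : top a p -> top (a * i) (p ^+ i).
  move=> pa; elim: i => [|i IH]; first by rewrite muln0 expr0; apply: top1.
  by rewrite mulnS exprS; apply: topM.
apply: topM; last first.
  rewrite tnth_mktuple unlift_none -[X in top X _]mul1n; apply: topX.
  by move=> m' _; rewrite mulm1n subrr mcoeff0.
elim/big_ind2: _ => [|a p b q|i _]; [exact: top1|exact: topM|].
have e : widen_ord (leqnSn n) i = lift ord_max i.
  by apply: val_inj; rewrite /= /bump leqNgt ltn_ord.
rewrite e tnth_mktuple liftK scale1r; apply: topX => m' dm; rewrite addrK mcoeffX.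
case: eqP => // e0; move: dm; rewrite -e0 mnm1E.
by rewrite (_ : lift ord_max i == ord_max = false)// eq_sym; apply/negbTE/neq_lift.
Qed.

Let mono_coef m b s : (W m <= s)%N -> ('X_[m] \mPo sg)@_(b + U *+ s) =
  ((W m == s) && (b == 0%MM))%:R.
Proof.
move=> Ws; have bs : (W m <= (b + U *+ s)%MM ord_max)%N.
  by rewrite mnmDE mulmnE mnm1E eqxx mul1n; lia.
have := top_mono bs; rewrite mcoeffB => /eqP; rewrite subr_eq0 => /eqP ->.
rewrite mcoeffX; congr (_ _)%:R; apply/eqP/andP => [e0|[/eqP -> /eqP ->]]; last by rewrite add0m.
have /mnmP/(_ ord_max) := e0; rewrite mnmDE !mulmnE mnm1E eqxx !mul1n => e1.
have es : W m = s by lia.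
split; first exact/eqP; apply/eqP; move: e0; rewrite es => /mnmP e0.
by apply/mnmP => i; have := e0 i; rewrite mnmDE mnm0E; lia.
Qed.

(** Up to coefficients of value at most [ep], [h] consists of its monomials with coefficients of
    value 1. The shear makes them monic in the last variable, and that of [ms] alone reaches degree
    [W ms]; so, after division by [h ms], the part of degree at least [W ms] is close to
    [X_n ^ (W ms)]. *)
Lemma shear_distinguished (h : T) ep (ms : 'X_{1..n.+1}) : 0 < ep ->
  (forall m, v (h m) <= 1) -> (forall m, v (h m) != 1 -> v (h m) <= ep) ->
  v (h ms) = 1 -> (forall m, v (h m) = 1 -> m != ms -> (W m < W ms)%N) ->
  let f := cstT v _ (h ms)^-1 * substT sg h in
  bnd v f 1 /\ bnd v (fhi ord_max (W ms) f - 1) ep.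
Proof.
move=> ep0 h1 hep hms hW f.
have hms0 : h ms != 0 by apply/eqP => e0; move/eqP: hms; rewrite e0 nav0 eq_sym oner_eq0.
have fE m M : (mdeg m < M)%N -> f m = (h ms)^-1 *
    \sum_(l : 'X_{1..n.+1 < M}) h l * ('X_[l] \mPo sg)@_m.
  by move=> mM; rewrite /f cstTM; congr (_ * _); apply: fps_substS.
have vV x : v ((h ms)^-1 * x) = v x by rewrite navM navV// hms invr1 mul1r.
split=> m.
  rewrite (@fE _ (mdeg m).+1)// vV; apply: nav_sum => // l _.
  by rewrite navM -[1]mulr1; apply: ler_pM; rewrite ?nav_ge0//; apply: integral_coefs_subst.
set m' := (m + U *+ W ms)%MM; rewrite fpsB fps1 /fhi -/m'.
pose M := (maxn (mdeg m') (mdeg ms)).+1.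
have m'M : (mdeg m' < M)%N by rewrite ltnS leq_maxl.
have msM : (mdeg ms < M)%N by rewrite ltnS leq_maxr.
rewrite (fE _ _ m'M) -[X in _ - X](mulKf hms0) -mulrBr vV.
have -> : h ms * (m == 0%MM)%:R =
    \sum_(l : 'X_{1..n.+1 < M}) (l == BMultinom msM)%:R * (h l * (m == 0%MM)%:R).
  rewrite (bigD1 (BMultinom msM))//= eqxx mul1r big1 ?addr0// => l /negbTE ->.
  by rewrite mul0r.
rewrite -sumrB; apply: nav_sum => [|l _]; first exact: ltW.
have [->|lms] /= := eqVneq l (BMultinom msM).
  by rewrite mul1r /= mono_coef// eqxx /= subrr nav0 ltW.
rewrite mul0r subr0; have [hl|hl] := eqVneq (v (h l)) 1.
  have Wl := hW _ hl (lms : bmnm l != ms); rewrite mono_coef; last exact: ltnW.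
  by rewrite (ltn_eqF Wl) mulr0 nav0 ltW.
rewrite navM; apply: le_trans (hep _ hl); rewrite ler_piMr ?nav_ge0//.
exact: (@integral_coefs_subst _ _ _ _ _ sg (bmnm l) m').
Qed.

End Weierstrass.

(** Weierstrass division by an arbitrary nonzero series [f]: after the shear
    [X_i + X_n ^ (N ^ (i + 1))] with [N] large, the dominant monomials of [f] get
    distinct degrees in [X_n], so [f] becomes distinguished. *)
Lemma weierstrass (R : realType) (k : fieldType) (v : nabs R k) n (f : tateT v n.+1) :
  f != 0 -> exists (s : nat) (io : {rmorphism tateT v n -> tateT v n.+1}),
    (forall a, io (cstT v n a) = cstT v n.+1 a) /\
    forall g, exists q (r : 'I_s -> tateT v n),
      g = q * f + \sum_(i < s) io (r i) * varT v ord_max ^+ i.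
Proof.
move=> f0; have [u u0 [h1 [m1 hm1]]] := gauss_normalize f0.
set h := cstT v _ u * f in h1 hm1.
have [N [ep [ep01 SN hep]]] := unit_gap h1.
have m1N := SN _ hm1; have N0 : (0 < N)%N by apply: leq_ltn_trans m1N.
(* The predecessor cancels the successor built into the shear: variable [j] gets weight
   [N ^ (j + 1)] and the last one weight 1. The exponents of dominant monomials are below [N], so
   they are digits of [W] in base [N]. *)
pose w (j : 'I_n) := (N ^ j.+1).-1.
pose W (m : 'X_{1..n.+1}) := (\sum_(j < n) (w j).+1 * m (lift ord_max j) + m ord_max)%N.
have Winj m m' : (mdeg m < N)%N -> (mdeg m' < N)%N -> W m = W m' -> m = m'.
  pose d (m : 'X_{1..n.+1}) (i : 'I_n.+1) :=
    if unlift ord0 i is Some j then m (lift ord_max j) else m ord_max.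
  have WE m0 : W m0 = (\sum_(i < n.+1) N ^ i * d m0 i)%N.
    rewrite big_ord_recl /d unlift_none expn0 mul1n /W addnC; congr (_ + _)%N.
    apply: eq_bigr => j _; rewrite liftK /w prednK ?expn_gt0 ?N0//.
  have dN m0 i : (mdeg m0 < N)%N -> (d m0 i < N)%N.
    move=> mN; apply: leq_ltn_trans mN; rewrite mdegE /d.
    by case: unlift => [j|]; [rewrite (bigD1 (lift ord_max j))//= leq_addr|rewrite (bigD1 ord_max)//= leq_addr].
  move=> mN m'N; rewrite !WE => /(digit_inj (fun i => dN m i mN) (fun i => dN m' i m'N)) dd.
  apply/mnmP => i; case: (unliftP ord_max i) => [j|] ->.
    by have := dd (lift ord0 j); rewrite /d liftK.
  by have := dd ord0; rewrite /d unlift_none.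
have vh (m : 'X_{1..n.+1 < N}) := v (h m) == 1.
have [ms /eqP hms msmax] := @arg_maxnP _ (BMultinom m1N) (fun m => v (h (bmnm m)) == 1)
  (fun m => W (bmnm m)) (introT eqP hm1).
have hW m : v (h m) = 1 -> m != ms -> (W m < W ms)%N.
  move=> hm mms; rewrite ltn_neqAle; apply/andP; split.
    by apply: contra_neq mms; apply: Winj; [exact: SN|exact: bmdeg].
  by apply: (msmax (BMultinom (SN _ hm))); apply/eqP.
have v1 : v 1 <= 1 by rewrite nav1.
have vN1 : v (-1) <= 1 by rewrite navN nav1.
have ep0 : 0 < ep by case/andP: ep01.
have [f1 fe] := shear_distinguished (w := w) v1 ep0 h1 hep hms hW.
set sg := shear w v1 in f1 fe; set f' := cstT v _ _ * _ in f1 fe.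
pose sg' := shear w vN1.
have sK : cancel (substT sg) (substT sg') by apply: shearK.
exists (W ms), (substT sg' \o substT (incl v n)); split=> [a|g].
  by rewrite /= !substT_cst.
have [q [r [gE _ rs]]] := @weierstrass_division_supp _ _ v _ ord_max (W ms) f' ep ep01 f1 fe
  xpredT (fun _ _ _ _ => isT) (fun=> erefl) (substT sg g) (fun m (h : ~~ true) => match notF h with end).
have [r' rE] := tate_low_degree rs.
exists (substT sg' q * cstT v _ ((h ms)^-1 * u)), r'.
have sf' : substT sg' f' = cstT v _ (h ms)^-1 * h.
  transitivity (substT sg' (cstT v _ (h ms)^-1) * substT sg' (substT sg h)).
    exact: (rmorphM (substT sg')).
  rewrite (sK h); congr (_ * _); exact: substT_cst.
have gE' : substT sg' (substT sg g) = substT sg' q * substT sg' f' + substT sg' r.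
  by rewrite gE (rmorphD (substT sg')) (rmorphM (substT sg')).
rewrite sK in gE'; rewrite gE' sf'; congr (_ + _).
  have -> : cstT v n.+1 ((h ms)^-1 * u) = cstT v n.+1 (h ms)^-1 * cstT v n.+1 u.
    exact: rmorphM.
  by rewrite -!mulrA.
have sx : substT sg' (varT v ord_max) = varT v ord_max by apply: shear_last.
rewrite rE (rmorph_sum (substT sg')); apply: eq_bigr => i _.
by rewrite (rmorphM (substT sg')) (rmorphXn (substT sg')) /= sx.
Qed.

(** * Noetherianity and the Nullstellensatz *)

Lemma noetherian_surj (A B : comPzRingType) (phi : {rmorphism A -> B}) :
  (forall b, exists a, phi a = b) -> noetherian A -> noetherian B.
Proof.
move=> surj nA I hI.
have hpull J : is_ideal J -> is_ideal (pull phi J).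
  move=> hJ; split; rewrite /pull /=; first by rewrite rmorph0; apply: ideal0.
    by move=> a b Ja Jb; rewrite rmorphD; apply: idealD.
  by move=> a b Jb; rewrite rmorphM; apply: idealMleft.
have [G GI Gm] := nA _ (hpull I hI).
exists (map phi G) => [_ /mapP[g /GI Ig ->] //|J hJ GJ b Ib].
have [a ab] := surj b; rewrite -ab; apply: (Gm (pull phi J) (hpull J hJ)).
  by move=> g gG; apply/GJ/map_f.
by rewrite /pull /= ab.
Qed.

(** The hypothesis says that [A / m] is spanned over [k] by [B]; so the powers of [a] with exponents
    up to [size B] are linearly dependent modulo [m]. *)
Lemma span_algebraic (k : fieldType) (A : comPzRingType) (iota : {rmorphism k -> A})
    (m : set A) (B : seq A) : is_ideal m ->
  (forall S : set A, (forall x y, S x -> S y -> S (x + y)) ->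
     (forall c x, S x -> S (iota c * x)) -> m `<=` S -> (forall b, b \in B -> S b) ->
     forall g, S g) ->
  forall a, algebraic_mod iota m a.
Proof.
move=> hm Bspan a; set t := size B.
have Bc g : exists c : 'I_t -> k, m (g - \sum_i iota (c i) * B`_i).
  apply: (Bspan (fun g => exists c : 'I_t -> k, m (g - \sum_i iota (c i) * B`_i))).
  - move=> x y [c mc] [d md]; exists (fun i => c i + d i).
    have -> : \sum_i iota (c i + d i) * B`_i =
      \sum_i iota (c i) * B`_i + \sum_i iota (d i) * B`_i.
      by rewrite -big_split; apply: eq_bigr => i _; rewrite rmorphD mulrDl.
    exact: idealBD.
  - move=> c x [d md]; exists (fun i => c * d i).
    have -> : \sum_i iota (c * d i) * B`_i = iota c * \sum_i iota (d i) * B`_i.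
      by rewrite mulr_sumr; apply: eq_bigr => i _; rewrite rmorphM mulrA.
    by rewrite -mulrBr; apply: idealMleft.
  - move=> x mx; exists (fun=> 0); rewrite big1 ?subr0// => i _.
    by rewrite rmorph0 mul0r.
  move=> b bB; have bt : (index b B < t)%N by rewrite index_mem.
  exists (fun i => (i == Ordinal bt)%:R); rewrite (bigD1 (Ordinal bt))//= eqxx rmorph1 mul1r.
  rewrite big1 ?addr0 ?nth_index ?subrr//; first exact: ideal0.
  by move=> i /negbTE ->; rewrite rmorph0 mul0r.
have /choice[c cP] := fun j : nat => Bc (a ^+ j).
pose C : 'M[k]_(t.+1, t) := \matrix_(j, i) c j i.
have [u u0 uC] : exists2 u : 'rV[k]_t.+1, u != 0 & u *m C = 0.
  have : kermx C != 0.
    rewrite kermx_eq0 /row_free; apply: contraTneq (rank_leq_col C) => ->.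
    by rewrite ltnn.
  case/rowV0Pn => u /sub_kermxP uC u0; by exists u.
pose p := \poly_(j < t.+1) u 0 (inord j); exists p.
  apply: contra_neq u0 => p0; apply/rowP => j; rewrite mxE.
  by have := coef_poly t.+1 (fun j => u 0 (inord j)) j; rewrite -/p p0 coef0 ltn_ord inord_val.
have pE (j : 'I_t.+1) : p`_j = u 0 j by rewrite coef_poly ltn_ord inord_val.
rewrite (@pevalE _ _ _ t.+1) ?size_poly//.
have E : \sum_(j < t.+1) iota p`_j * (\sum_i iota (c j i) * B`_i) = 0.
  under eq_bigr => j _ do rewrite mulr_sumr.
  rewrite exchange_big big1// => i _ /=; have := congr1 (fun M : 'rV_t => M 0 i) uC.
  rewrite mxE [RHS]mxE => e; transitivity (iota (\sum_j u 0 j * C j i) * B`_i).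
    rewrite rmorph_sum mulr_suml; apply: eq_bigr => j _.
    by rewrite mulrA -rmorphM pE mxE.
  by rewrite e rmorph0 mul0r.
rewrite -[X in m X]subr0 -[X in _ - X]E -sumrB; apply: ideal_sum => // j _.
by rewrite -mulrBr; apply: idealMleft.
Qed.

Section TateRings.
Variables (R : realType) (k : fieldType) (v : nabs R k).

Lemma tate0E (f : tateT v 0) : f = cstT v 0 (f 0%MM).
Proof.
apply: tateP_ext => m; have -> : m = 0%MM by apply/mnmP => -[].
by rewrite /= /fps_of mcoeffC eqxx mulr1.
Qed.

Lemma cst_unit n a : a != 0 -> cstT v n a * cstT v n a^-1 = 1.
Proof. by move=> a0; rewrite -rmorphM divff ?rmorph1. Qed.

(** If [I] contains a nonzero [f], Weierstrass division reduces [I] modulo [f] to remainders, which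
    form a submodule of a free module of finite rank over the Tate algebra in one variable less. *)
Lemma noetherian_tate n : noetherian (tateT v n).
Proof.
elim: n => [|n IH] I hI.
  have [[f If f0]|nI] := pselect (exists2 f, I f & f != 0); last first.
    exists [::] => // J hJ _ f If; have -> : f = 0; last exact: ideal0.
    by apply: contrapT => /eqP f0; apply: nI; exists f.
  exists [:: f] => [g|J hJ fJ g _]; first by rewrite inE => /eqP ->.
  have c0 : f 0%MM != 0 by apply: contra_neq f0 => c0; rewrite (tate0E f) c0 rmorph0.
  have fu : cstT v 0 (f 0%MM)^-1 * f = 1.
    by rewrite [X in _ * X](tate0E f) mulrC cst_unit.
  have -> : g = g * cstT v 0 (f 0%MM)^-1 * f by rewrite -mulrA fu mulr1.
  by apply: idealMleft => //; apply: fJ; rewrite mem_head.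
have [[f If f0]|nI] := pselect (exists2 f, I f & f != 0); last first.
  exists [::] => // J hJ _ f If; have -> : f = 0; last exact: ideal0.
  by apply: contrapT => /eqP f0; apply: nI; exists f.
have [s [io [_ W]]] := weierstrass f0.
pose ev (r : 'rV[tateT v n]_s) := \sum_(i < s) io (r 0 i) * varT v ord_max ^+ i.
have evD x y : ev (x + y) = ev x + ev y.
  by rewrite /ev -big_split; apply: eq_bigr => i _; rewrite mxE rmorphD mulrDl.
have evZ a x : ev (a *: x) = io a * ev x.
  by rewrite /ev mulr_sumr; apply: eq_bigr => i _; rewrite mxE rmorphM mulrA.
have ev0 : ev 0 = 0 by rewrite /ev big1// => i _; rewrite mxE rmorph0 mul0r.
have hev J : is_ideal J -> is_submod (fun r => J (ev r)).
  move=> hJ; split; first by rewrite ev0; apply: ideal0.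
    by move=> x y Jx Jy; rewrite evD; apply: idealD.
  by move=> a x Jx; rewrite evZ; apply: idealMleft.
have [G GI Gm] := noetherian_rV IH (hev I hI).
exists (f :: map ev G) => [g|J hJ GJ g Ig].
  by rewrite inE => /orP[/eqP ->|/mapP[r /GI Ir ->]].
have [q [r gE]] := W g; pose rr : 'rV_s := \row_i r i.
have rE : ev rr = \sum_(i < s) io (r i) * varT v ord_max ^+ i.
  by apply: eq_bigr => i _; rewrite mxE.
have Jf : J f by apply: GJ; rewrite mem_head.
rewrite gE -rE; apply: idealD; [by []|exact: idealMleft|].
apply: (Gm _ (hev J hJ)); first by move=> x xG; apply: GJ; rewrite inE map_f ?orbT.
have -> : ev rr = g - q * f by rewrite rE {1}gE addrC addKr.
by apply: idealB => //; apply: idealMleft.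
Qed.

Lemma var_nonunit n (q : tateT v n.+1) : varT v ord_max * q <> 1.
Proof.
move=> /(congr1 (fun g : tateT v n.+1 => g 0%MM)); rewrite mulrC.
have -> : (q * varT v ord_max) 0%MM = (tser q * fps_of 'X_[U_(ord_max)]) 0%MM by [].
rewrite fpsMX; have -> : ((U_(ord_max) : 'X_{1..n.+1}) <= 0)%MM = false.
  by rewrite lep1mP mnm0E eqxx.
by move=> /esym/eqP; rewrite [X in X == _]fps1 eqxx oner_eq0.
Qed.

(** The last variable is not a unit, which forces a nonzero [f] into [M]. By division the quotient
    by [f] is spanned by finitely many powers of [x] over the smaller Tate algebra; [M] contracts to
    a maximal ideal there, and the spanning sets multiply. *)
Lemma nullstellensatz_span n (M : set (tateT v n)) : max_ideal M ->
  exists B : seq (tateT v n),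
  forall S : set (tateT v n), (forall x y, S x -> S y -> S (x + y)) ->
     (forall c x, S x -> S (cstT v n c * x)) -> M `<=` S -> (forall b, b \in B -> S b) ->
     forall g, S g.
Proof.
elim: n M => [|n IH] M mM; have hM := max_is_ideal mM.
  exists [:: 1] => S _ SZ _ S1 g; rewrite (tate0E g) -[cstT _ _ _]mulr1; apply: SZ.
  by apply: S1; rewrite mem_head.
have [f Mf f0] : exists2 f, M f & f != 0.
  apply: contrapT => nM; have [|b Mb] := @max_unit _ M (varT v ord_max) mM.
    move=> Mx; apply: nM; exists (varT v ord_max) => //; apply/eqP => x0.
    have := congr1 (fun g : tateT v n.+1 => g U_(ord_max)%MM) x0.
    by rewrite /= /fps_of mcoeffX eqxx => /eqP; rewrite oner_eq0.
  apply: nM; exists (varT v ord_max * b - 1) => //; rewrite subr_eq0.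
  exact/eqP/var_nonunit.
have [s [io [ioc W]]] := weierstrass f0.
pose x := varT v (ord_max : 'I_n.+1); rewrite -/x in W.
pose M' := pull io M.
have hM' : is_ideal M'.
  split; rewrite /M' /pull /=; first by rewrite rmorph0; apply: ideal0.
    by move=> a b Ma Mb; rewrite rmorphD; apply: idealD.
  by move=> a b Mb; rewrite rmorphM; apply: idealMleft.
have M'1 : ~ M' 1 by rewrite /M' /pull /= rmorph1; case: mM.
have mM' : max_ideal M'.
  (* Integrality of an inverse. Multiplication by the inverse [h] of [io b] acts on the powers of
     [x] through a matrix [Hm] over the smaller algebra, so [det(h - Hm)] lies in [M]. Multiplied by
     a power of [b] it becomes [det(1 - b Hm) = 1 - b c], which inverts [b] modulo [M']. *)
  apply: maxI_unit => // b Mb; have [h Mh] := max_unit mM Mb.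
  have /choice[H HP] : forall i : 'I_s, exists r : 'I_s -> tateT v n,
      M (h * x ^+ i - \sum_(j < s) io (r j) * x ^+ j).
    move=> i; have [q [r E]] := W (h * x ^+ i); exists r.
    by rewrite E addrK; apply: idealMleft.
  pose Hm : 'M[tateT v n]_s := \matrix_(i, j) H i j.
  pose N : 'M[tateT v n.+1]_s := h%:M - map_mx io Hm.
  have NX : forall i, M (\sum_j N i j * x ^+ j).
    move=> i; have -> : \sum_j N i j * x ^+ j = h * x ^+ i - \sum_(j < s) io (H i j) * x ^+ j.
      under eq_bigr => j _ do rewrite !mxE mulrBl.
      rewrite sumrB; congr (_ - _); rewrite (bigD1 i)//= eqxx mulr1n big1 ?addr0// => j /negbTE ji.
      by rewrite eq_sym ji mulr0n mul0r.
    exact: HP.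
  have s0 : (0 < s)%N.
    rewrite lt0n; apply/eqP => s0; case: mM => _ M1 _; apply: M1.
    have [q [r ->]] := W 1; rewrite big1 ?addr0; first exact: idealMleft.
    by move=> [i si]; exfalso; move: si; rewrite s0.
  have Mdet : M (\det N).
    (* Cramer's rule in row 0, where the power of [x] is [x ^ 0 = 1]; hence the need for [s > 0]. *)
    have E : \sum_i (\adj N) (Ordinal s0) i * (\sum_j N i j * x ^+ j) = \det N.
      under eq_bigr => i _ do rewrite mulr_sumr.
      rewrite exchange_big /= (bigD1 (Ordinal s0))//= [X in _ + X]big1 ?addr0.
        have := mul_adj_mx N.
        move=> /(congr1 (fun Y : 'M_s => Y (Ordinal s0) (Ordinal s0))).
        rewrite mxE [X in _ = X]mxE eqxx mulr1n => <-; apply: eq_bigr => i _.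
        by rewrite [X in _ * (_ * X)](expr0 x) mulr1.
      move=> j /negbTE j0; have := mul_adj_mx N.
      move=> /(congr1 (fun Y : 'M_s => Y (Ordinal s0) j)).
      rewrite mxE [X in _ = X]mxE eq_sym j0 mulr0n => e.
      by under eq_bigr => i _ do rewrite mulrA; rewrite -mulr_suml e mul0r.
    by rewrite -E; apply: ideal_sum => // i _; apply: idealMleft.
  pose N1 : 'M[tateT v n]_s := 1%:M - b *: Hm.
  have Mdet1 : M (io (\det N1)).
    have d1 : M (\det (io b *: N) - \det (map_mx io N1)).
      apply: det_mod => // i j; rewrite !mxE rmorphB rmorphM.
      case: eqP => _; rewrite ?mulr1n ?mulr0n ?rmorph1 ?rmorph0.
        by rewrite mulrBr opprB addrA addrNK.
      by rewrite !sub0r mulrN subrr; apply: ideal0.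
    rewrite -det_map_mx; apply: (idealBl hM d1).
    by rewrite detZ; apply: idealMleft.
  have d2 : exists c, \det N1 = 1 - b * c.
    pose J : set (tateT v n) := fun y => exists c, y = b * c.
    have hJ : is_ideal J.
      split; first by exists 0; rewrite mulr0.
        by move=> _ _ [c ->] [d ->]; exists (c + d); rewrite mulrDr.
      by move=> a _ [c ->]; exists (a * c); rewrite mulrCA.
    have : J (\det N1 - \det (1%:M : 'M[tateT v n]_s)).
      apply: det_mod => // i j; rewrite !mxE addrAC subrr add0r.
      by exists (- H i j); rewrite mulrN.
    by rewrite det1 => -[c cE]; exists (- c); rewrite mulrN opprK -cE addrC subrK.
  have [c cE] := d2; exists c; apply: idealBC => //.
  by rewrite /M' /pull /= -cE.
have [B' BP] := IH M' mM'.
exists [seq io b * x ^+ i | b <- B', i <- iota 0 s] => S SD SZ MS SB g.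
have [q [r ->]] := W g; have S0 : S 0 by apply: (MS); apply: ideal0.
apply: (SD); first by apply: (MS); apply: idealMleft.
apply: big_ind => // i _.
apply: (BP (fun a => S (io a * x ^+ i))).
- by move=> a b Sa Sb; rewrite rmorphD mulrDl; apply: SD.
- by move=> c a Sa; rewrite rmorphM ioc -mulrA; apply: SZ.
- by move=> a Ma; apply: (MS); apply: (@idealMright _ M).
- move=> b bB; apply: SB; apply/allpairsP; exists (b, val i); split => //=.
  by rewrite mem_iota /= add0n ltn_ord.
Qed.

Lemma tate_residue_algebraic n (M : set (tateT v n)) a : max_ideal M ->
  algebraic_mod (cstT v n) M a.
Proof.
move=> mM; have [B BP] := nullstellensatz_span mM.
exact: span_algebraic (max_is_ideal mM) BP a.
Qed.

Lemma gap_seq (s : seq R) : (forall a, a \in s -> a < 1) ->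
  exists2 ep : R, 0 < ep < 1 & forall a, a \in s -> a <= ep.
Proof.
elim: s => [|a s IH] s1.
  by exists 2^-1; rewrite ?invr_gt0 ?ltr0n// invf_lt1 ?ltr0n// ltr1n.
have [b bs|ep /andP[e0 e1] eP] := IH; first by apply: s1; rewrite inE bs orbT.
exists (Num.max ep a); first by rewrite lt_max e0 /= gt_max e1 s1// mem_head.
move=> b; rewrite inE le_max => /orP[/eqP ->|/eP -> //]; by rewrite lexx orbT.
Qed.

(** [s] is the largest index of a coefficient of greatest absolute value, possibly smaller than the
    degree of [q]. *)
Lemma poly_dominant (q : {poly k}) : q != 0 -> exists s ep, [/\ 0 < ep < 1, q`_s != 0,
    (s < size q)%N, forall i, v q`_i <= v q`_s
    & forall i, (s < i)%N -> v (q`_i / q`_s) <= ep].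
Proof.
move=> q0; have sq : (0 < size q)%N by rewrite size_poly_gt0.
have [i _ imax] := @Order.TotalTheory.arg_maxP _ _ _ (Ordinal sq) predT
  (fun i : 'I_(size q) => v q`_i) isT.
have imax' j : v q`_j <= v q`_i.
  have [jq|qj] := ltnP j (size q); first exact: (imax (Ordinal jq) isT).
  by rewrite nth_default// nav0 nav_ge0.
have [s /eqP si smax] := @arg_maxnP _ i (fun j : 'I_(size q) => v q`_j == v q`_i)
  (fun j => val j) (eqxx _).
have qs0 : q`_s != 0.
  apply/eqP => e; case/negP: q0; rewrite -lead_coef_eq0; apply/eqP/(nav_eq0 v)/eqP.
  by rewrite eq_le nav_ge0 andbT -(nav0 v) -[X in _ <= v X]e si; apply: imax'.
have vs : 0 < v q`_s by rewrite lt_def nav_ge0 andbT; apply: contra_neq qs0 => /nav_eq0.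
have [|ep ep01 epP] := @gap_seq [seq v (q`_j / q`_s) | j <- iota s.+1 (size q)].
  move=> a /mapP[j]; rewrite mem_iota => /andP[sj _] ->.
  rewrite navM navV// ltr_pdivrMr// mul1r si lt_neqAle imax' andbT.
  apply: contraTneq sj => e; rewrite -leqNgt.
  have [jq|qj] := ltnP j (size q); first by apply: (smax (Ordinal jq)); apply/eqP.
  by move: e; rewrite nth_default// nav0 -si => e; move: vs; rewrite -e ltxx.
exists s, ep; split => // [j|j sj]; first by rewrite si.
have [jq|qj] := ltnP j (size q).
  by apply: epP; apply/mapP; exists j => //; rewrite mem_iota sj /= (leq_trans jq) ?leq_addl.
by rewrite nth_default// mul0r nav0 ltW//; case/andP: ep01.
Qed.

(** After division by its dominant coefficient, a polynomial in [X_j] alone is distinguished in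
    [X_j]. It does not mix exponents of the other variables, so a condition [Z] on those
    survives. *)
Lemma divide_by_poly n (j : 'I_n) (q : {poly k}) (Z : pred 'X_{1..n}) (g : tateT v n) :
  q != 0 -> (forall a b : 'X_{1..n}, (forall i, i != j -> a i = b i) -> Z a = Z b) ->
  (forall m, ~~ Z m -> g m = 0) ->
  exists h r : tateT v n, [/\ g = h * peval (cstT v n) q (varT v j) + r,
    forall m, ~~ Z m -> r m = 0 & forall m : 'X_{1..n}, (size q <= m j)%N -> r m = 0].
Proof.
move=> q0 Zj gZ; have [s [ep [ep01 qs0 sq qmax qep]]] := poly_dominant q0.
set P := peval _ _ _; pose f := cstT v n (q`_s)^-1 * P.
have PE m : P m = \sum_(i < size q) q`_i * (U_(j) *+ i == m)%MM%:R.
  rewrite /P /peval raddf_sum fps_sum; apply: eq_bigr => i _.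
  have := cstTM q`_i (varT v j ^+ i) m; rewrite /= => ->.
  by rewrite /varT -rmorphXn /= /fps_of mcoeffXn.
have Pj m : P m != 0 -> m = (U_(j) *+ m j)%MM.
  move=> Pm; apply: contrapT => mj; case/eqP: Pm; rewrite PE big1// => i _.
  case: eqP => [e|]; last by rewrite mulr0.
  by case: mj; rewrite -e mulmnE mnm1E eqxx mul1n.
have PU i : P (U_(j) *+ i)%MM = q`_i.
  have E (l l' : nat) : (U_(j) *+ l == U_(j) *+ l' :> 'X_{1..n})%MM = (l == l').
    apply/eqP/eqP => [/mnmP/(_ j)|->//]; by rewrite !mulmnE mnm1E eqxx !mul1n.
  rewrite PE; have [iq|qi] := ltnP i (size q).
    rewrite (bigD1 (Ordinal iq))//= eqxx mulr1 big1 ?addr0// => l li.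
    by rewrite E (_ : val l == i = false) ?mulr0//; apply/negbTE.
  rewrite nth_default// big1// => l _; rewrite E ltn_eqF ?mulr0//.
  exact: leq_trans (ltn_ord l) qi.
have fE m : f m = (q`_s)^-1 * P m by rewrite /f cstTM.
have vs : 0 < v q`_s by rewrite lt_def nav_ge0 andbT; apply: contra_neq qs0 => /nav_eq0.
have f1 : bnd v f 1.
  move=> m; rewrite fE navM navV// mulrC ler_pdivrMr// mul1r.
  have [->|Pm] := eqVneq (P m) 0; first by rewrite nav0 nav_ge0.
  by rewrite (Pj _ Pm) PU.
have fep : bnd v (fhi j s f - 1) ep.
  move=> m; rewrite fpsB fps1 /fhi; have [->|m0] := eqVneq m 0%MM.
    by rewrite add0m fE PU mulVf// subrr nav0 ltW//; case/andP: ep01.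
  rewrite subr0 fE; have [->|Pm] := eqVneq (P (m + U_(j) *+ s)%MM) 0.
    by rewrite mulr0 nav0 ltW//; case/andP: ep01.
  rewrite (Pj _ Pm) PU mulrC; apply: qep; rewrite mnmDE mulmnE mnm1E eqxx mul1n.
  rewrite -[X in (X < _)%N]add0n ltn_add2r lt0n; apply: contra_neq m0 => mj.
  have := Pj _ Pm; rewrite mnmDE mulmnE mnm1E eqxx mul1n mj add0n => /mnmP e.
  by apply/mnmP => i; have := e i; rewrite mnmDE mnm0E; lia.
have [|||h [r [gE rZ rs]]] := @weierstrass_division_supp _ _ v _ j s f ep ep01 f1 fep Z _ _ g.
- move=> a b; rewrite fE mulf_eq0 negb_or => /andP[_ /Pj ->].
  suff -> : Z (a + U_(j) *+ b j)%MM = Z a by [].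
  by apply: Zj => i ij; rewrite mnmDE mulmnE mnm1E eq_sym (negbTE ij) addn0.
- by move=> a; apply: Zj => i ij; rewrite mnmDE mnm1E eq_sym (negbTE ij) addn0.
- exact: gZ.
exists (h * cstT v n (q`_s)^-1), r; split => //; first by rewrite -mulrA.
by move=> m qm; apply: rs; apply: leq_trans qm; apply: ltnW.
Qed.

(** Division by the [q j], one variable after the other, bounds all exponents. The predicate [Z] in
    the proof holds the bounds on the variables already treated. *)
Lemma tate_poly_mod n (J : set (tateT v n)) (q : 'I_n -> {poly k}) : is_ideal J ->
  (forall j, q j != 0) -> (forall j, J (peval (cstT v n) (q j) (varT v j))) ->
  forall g, exists p, J (g - polyT v p).
Proof.
move=> hJ q0 Jq g; pose d := (\sum_j size (q j))%N.
have qd j : (size (q j) <= d)%N by rewrite /d (bigD1 j)//= leq_addr.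
have H t : exists r : tateT v n, J (g - r) /\
    forall m : 'X_{1..n}, (exists2 i : 'I_n, (i < t)%N & (d <= m i)%N) -> r m = 0.
  elim: t => [|t [r [Jr rt]]].
    by exists g; rewrite subrr; split; [apply: ideal0|move=> m []].
  have [tn|nt] := ltnP t n; last first.
    exists r; split => // m [i it dm]; apply: rt; exists i => //.
    exact: leq_trans (ltn_ord i) nt.
  pose j := Ordinal tn.
  pose Z (m : 'X_{1..n}) := [forall i : 'I_n, (i < t)%N ==> (m i < d)%N].
  have Zneg m : ~~ Z m <-> exists2 i : 'I_n, (i < t)%N & (d <= m i)%N.
    split=> [|[i it dm]].
      by rewrite negb_forall => /existsP[i]; rewrite negb_imply -leqNgt => /andP[]; exists i.
    by rewrite negb_forall; apply/existsP; exists i; rewrite it -leqNgt.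
  have [||h [r' [rE r'Z r's]]] := @divide_by_poly n j (q j) Z r (q0 j).
  - move=> a b ab; apply: eq_forallb => i; case: ltnP => // it.
    by rewrite ab//; apply/eqP => e; move: it; rewrite e ltnn.
  - by move=> m /Zneg; apply: rt.
  exists r'; split.
    rewrite -(subrK r g) -addrA; apply: idealD => //.
    by rewrite rE addrK; apply: idealMleft.
  move=> m [i]; rewrite ltnS leq_eqVlt => /orP[/eqP it dm|it dm].
    apply: r's; apply: leq_trans (qd _) _; have -> : j = i by apply: val_inj.
    exact: dm.
  by apply: r'Z; apply/Zneg; exists i.
have [r [Jr rn]] := H n; exists (ptrunc (n * d).+1 (tser r)).
have -> : polyT v (ptrunc (n * d).+1 (tser r)) = r; last by [].
apply: tateP_ext => m; rewrite /= /fps_of mcoeff_trunc ltnS; case: leqP => // mnd.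
apply/esym/rn; apply: contrapT => nm; move: mnd; rewrite ltnNge => /negP; apply.
rewrite mdegE -[X in (_ <= X * _)%N]card_ord -sum_nat_const; apply: leq_sum => i _.
by rewrite leqNgt; apply/negP => dm; apply: nm; exists i => //; apply: ltnW.
Qed.

End TateRings.

(** * Derivations and Euler fields *)

Lemma idealX_mul (A : comPzRingType) (I : set A) a b x y : is_ideal I ->
  idealX I a x -> idealX I b y -> idealX I (a + b) (x * y).
Proof.
move=> hI; elim: a x => [|a IH] x.
  by move=> _ Iy; apply: idealMleft => //; apply: idealX_ideal.
move=> Ix Iy; rewrite addSn; have hab := idealX_ideal (a + b).+1 hI.
move: x Ix; apply: (idealM_min (K := fun x => idealX I (a + b).+1 (x * y))).
  split; first by rewrite mul0r; apply: ideal0.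
    by move=> u w h1 h2; rewrite mulrDl; apply: idealD.
  by move=> u w h; rewrite -mulrA; apply: idealMleft.
by move=> u w Iu Iw; rewrite -mulrA; apply: idealM_mem => //; apply: IH.
Qed.

Lemma peval_taylor (k : fieldType) (A : comPzRingType) (iota : {rmorphism k -> A}) p (a b : A) :
  exists c, peval iota p (a + b) = peval iota p a + peval iota p^`() a * b + c * (b * b).
Proof.
elim/poly_ind: p => [|p d [c IH]].
  by exists 0; rewrite deriv0 !peval0 !mul0r !addr0.
exists (peval iota p^`() a + c * (a + b)).
rewrite derivMXaddC pevalD -[p^`() * 'X]addr0 !pevalMXC rmorph0 IH; ring.
Qed.

Section Derivations.
Variables (k : fieldType) (A : comPzRingType) (iota : {rmorphism k -> A}).

Definition kderivation (D : A -> A) : Prop :=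
  [/\ forall a b, D (a + b) = D a + D b, forall a b, D (a * b) = a * D b + b * D a
    & forall c, D (iota c) = 0].

Lemma kder0 D : kderivation D -> D 0 = 0.
Proof. by move=> [_ _ Dc]; rewrite -[X in D X](rmorph0 iota) Dc. Qed.

Lemma kder_comb n (D : 'I_n -> A -> A) (a : 'I_n -> A) : (forall i, kderivation (D i)) ->
  kderivation (fun x => \sum_i a i * D i x).
Proof.
move=> hD; split=> [x y|x y|c].
- by rewrite -big_split; apply: eq_bigr => i _; case: (hD i) => -> _ _; rewrite mulrDr.
- rewrite !mulr_sumr -big_split; apply: eq_bigr => i _; case: (hD i) => _ -> _.
  by rewrite mulrDr mulrCA [a i * (y * _)]mulrCA.
- by rewrite big1// => i _; case: (hD i) => _ _ ->; rewrite mulr0.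
Qed.

(** [m] is, to first order, the maximal ideal of a point at which the vector
    fields [D i] form a frame: some combination of them with coefficients in
    [m] is an Euler field. *)
Definition euler_at n (D : 'I_n -> A -> A) (m : set A) : Prop :=
  exists2 a : 'I_n -> A, forall i, m (a i)
    & forall z, m z -> idealX m 2 (z - \sum_i a i * D i z).

Hypothesis ch : [pchar k] =i pred0.
Variables (n : nat) (D : 'I_n -> A -> A) (m : set A).
Hypotheses (hD : forall i, kderivation (D i)) (nA : noetherian A) (mm : max_ideal m)
  (Em : euler_at D m).

Let hm := max_is_ideal mm.

Lemma euler_power (a : 'I_n -> A) : (forall i, m (a i)) ->
  (forall z, m z -> idealX m 2 (z - \sum_i a i * D i z)) ->
  forall N h, idealX m N h -> idealX m N.+1 (\sum_i a i * D i h - h *+ N).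
Proof.
move=> ma E; pose th x := \sum_i a i * D i x.
have hth : kderivation th := kder_comb a hD.
have [thD thM thc] := hth.
have mth x : m (th x) by apply: ideal_sum => // i _; apply: idealMright.
elim=> [|N IH] h; first by move=> _; rewrite mulr0n subr0; apply/idealX1; do ?exact: mth.
(* Only the conjunction is an ideal: in [th (c * x)] the term [x * th c] has to be absorbed by the
   membership of [x] in [m ^ (N + 1)]. *)
pose K : set A := fun h => idealX m N.+1 h /\ idealX m N.+2 (th h - h *+ N.+1).
suff H : idealX m N.+1 `<=` K by move=> /H[].
have h1 := idealX_ideal N.+1 hm; have h2 := idealX_ideal N.+2 hm.
apply: idealM_min.
  split.
  - split; first exact: ideal0.
    by rewrite (kder0 hth) mul0rn subrr; apply: ideal0.
  - move=> x y [x1 x2] [y1 y2]; split; first exact: idealD.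
    by rewrite thD mulrnDl opprD addrACA; apply: idealD.
  move=> c x [x1 x2]; split; first exact: idealMleft.
  have -> : th (c * x) - (c * x) *+ N.+1 = c * (th x - x *+ N.+1) + x * th c.
    by rewrite thM mulrBr -mulrnAr addrAC.
  apply: idealD => //; first exact: idealMleft.
  by rewrite mulrC; apply: (idealM_mem (mth c) x1).
move=> x y mx my; split; first exact: idealM_mem.
have -> : th (x * y) - (x * y) *+ N.+1 = x * (th y - y *+ N) - y * (x - th x).
  rewrite thM mulrSr -(mulr_natr (x * y)) -(mulr_natr y); move: (th x) (th y) N%:R => tx ty r; ring.
apply: idealB => //; first by apply: idealM_mem => //; apply: IH.
by have := idealX_mul hm my (E x mx); rewrite addnC.
Qed.

(** For [g] in [m ^ N], the Euler field sends [g] to [N g] modulo [m ^ (N + 1)]. By stability and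
    since its coefficients are in [m], it also sends [g] into [m ^ (N + 1)]; then one divides by
    [N]. *)
Lemma stable_in_powers (J : set A) : (forall g, J g -> m g) ->
  (forall g i, J g -> J (D i g)) -> forall N, J `<=` idealX m N.
Proof.
move=> Jm JD; have [a ma E] := Em; elim=> [|N IH] g Jg //.
have [->|N0] := posnP N; first by apply/idealX1 => //; apply: Jm.
have h1 := idealX_ideal N.+1 hm.
have g1 : idealX m N.+1 (g *+ N).
  have := euler_power ma E (IH _ Jg); move=> /(idealBl h1); apply.
  by apply: ideal_sum => // i _; apply: idealM_mem => //; apply/IH/JD.
have -> : g = iota (N%:R^-1) * (g *+ N).
  rewrite -(mulr_natl g) mulrA -(rmorph_nat iota N) -rmorphM mulVf ?rmorph1 ?mul1r//.
  by move/pcharf0P: ch => ->; rewrite -lt0n.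
exact: idealMleft.
Qed.

(** The family lies in all powers of [m], so that Krull's theorem applies. *)
Lemma stable_vanish (J : set A) (s : seq A) : (forall g, J g -> m g) ->
  (forall g i, J g -> J (D i g)) -> (forall g, g \in s -> J g) ->
  exists2 u, ~ m u & forall g, g \in s -> u * g = 0.
Proof.
move=> Jm JD; have m1 : ~ m 1 by case: mm.
elim: s => [|g s IH] sJ; first by exists 1.
have [|u mu us] := IH; first by move=> h hs; apply: sJ; rewrite inE hs orbT.
have [|a ma ga] := krull_intersection nA hm (x := g).
  by move=> N; apply: (stable_in_powers Jm JD); apply: sJ; rewrite mem_head.
have mw : ~ m (1 - a).
  by move=> h; apply: m1; rewrite -(subrK a 1); apply: idealD.
exists (u * (1 - a)); first by case/(max_prime mm).
move=> h; rewrite inE => /orP[/eqP ->|/us e].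
  by rewrite -mulrA mulrBl mul1r -ga subrr mulr0.
by rewrite mulrAC e mul0r.
Qed.

End Derivations.

(** * Euler fields on Tate algebras and on their smooth quotients *)

Section Smooth.
Variables (R : realType) (k : fieldType) (v : nabs R k).
Hypothesis ch : [pchar k] =i pred0.

Section Tate.
Variable n : nat.
Notation T := (tateT v n).

Lemma euler_tate (M : set T) : max_ideal M -> exists2 nu : 'I_n -> T, forall i, M (nu i)
  & forall z, M z -> idealX M 2 (z - \sum_i nu i * derivT i z).
Proof.
move=> mM; have hM := max_is_ideal mM; pose iota := cstT v n.
have h2 := idealX_ideal 2 hM.
have alg a : algebraic_mod iota M a := tate_residue_algebraic a mM.
have [z0 az0 Tz0] := primitive_element ch mM (fun i => alg (varT v i)).
have [p [pz pz' pdiv]] := minimal_poly_mod ch mM az0.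
have [u Mu] := max_unit mM pz'.
(* One Newton step: [u] inverts [p'(z0)] modulo [M], so [p(th)] lies in [M ^ 2] while [th] and [z0]
   agree modulo [M]. *)
pose th := z0 + (- (u * peval iota p z0)).
have thz : M (th - z0) by rewrite /th addrC addKr; apply: idealN => //; apply: idealMleft.
have pth : idealX M 2 (peval iota p th).
  have [c ->] := peval_taylor iota p z0 (- (u * peval iota p z0)).
  apply: idealD => //; last first.
    by apply: idealMleft => //; rewrite mulrNN; apply: idealX2; apply: idealMleft.
  have -> : peval iota p z0 + peval iota p^`() z0 * - (u * peval iota p z0) =
    - ((peval iota p^`() z0 * u - 1) * peval iota p z0) by ring.
  by apply: idealN => //; apply: idealX2.
have /choice[w wP] : forall i, exists w, M (varT v i - peval iota w th).
  move=> i; have [w wz] := Tz0 i; exists w; apply: idealB_trans wz _ => //.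
  by apply: idealBC => //; apply: peval_mod.
pose nu i := varT v i - peval iota (w i) th; exists nu => //.
pose de z := \sum_i nu i * derivT i z.
have [deD deM dec] : kderivation iota de.
  apply: (@kder_comb _ _ iota n (fun i => derivT i) nu) => i; split.
  - exact: raddfD.
  - by move=> a b; rewrite derivTM addrC mulrC [X in _ + X]mulrC addrC [X in X + _]mulrC [X in _ + X]mulrC addrC.
  - exact: derivT_cst.
have Mde z : M (de z) by apply: ideal_sum => // i _; apply: idealMright => //; apply: wP.
(* By the Leibniz rule this is a subring: the correction terms are products of two values of [de],
   hence in [M ^ 2]. It contains the constants, and the variables because [de] sends [T_i] to
   [nu i]. *)
pose S : set T := fun z => exists w, idealX M 2 (z - peval iota w th - de z).
have SD x y : S x -> S y -> S (x + y).
  move=> [a Sa] [b Sb]; exists (a + b); rewrite pevalD deD.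
  have E (x1 x2 x3 x4 x5 x6 : T) : x1 + x2 - (x3 + x4) - (x5 + x6) =
    (x1 - x3 - x5) + (x2 - x4 - x6) by ring.
  by rewrite E; apply: idealD.
have SM x y : S x -> S y -> S (x * y).
  move=> [a Sa] [b Sb]; exists (a * b); rewrite pevalM deM.
  have E (x1 x2 x3 x4 x5 x6 : T) : x1 * x2 - x3 * x4 - (x1 * x6 + x2 * x5) =
    (x1 - x3 - x5) * (x2 - x6) + x3 * (x2 - x4 - x6) - (x5 * x6) by ring.
  rewrite E.
  apply: idealB => //; last by apply: idealX2; apply: Mde.
  by apply: idealD => //; [apply: idealMright|apply: idealMleft].
have Sc c : S (iota c).
  by exists c%:P; rewrite pevalC dec subr0 subrr; apply: ideal0.
have SX i : S (varT v i).
  exists (w i); rewrite -/(nu i); suff -> : de (varT v i) = nu i by rewrite subrr; apply: ideal0.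
  rewrite /de (bigD1 i)//= /varT derivT_poly mderivX big1 => [|j ji].
    by rewrite addr0 mnm1E eqxx scale1r (_ : U_(i) - U_(i) = 0)%MM ?mpolyX0 ?rmorph1 ?mulr1// -[X in (X - _)%MM]addm0 addmC addmK.
  by rewrite derivT_poly mderivX mnm1E eq_sym (negbTE ji) scale0r rmorph0 mulr0.
have S1 : S 1 by rewrite -(rmorph1 iota).
have Spoly q : S (polyT v q).
  have S0 : S 0 by rewrite -(rmorph0 iota).
  rewrite [q]mpolyE rmorph_sum; apply: (big_ind S) => [|x y Sx Sy|m _]; [exact: S0|exact: SD|].
  rewrite -mul_mpolyC rmorphM; apply: (SM); first exact: Sc.
  rewrite mpolyXE_id rmorph_prod; apply: (big_ind S) => [|x y|i _]; [exact: S1|exact: (SM)|].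
  by rewrite rmorphXn; elim: (m i) => [|j IH]; rewrite ?expr0// exprS; apply: (SM); first exact: SX.
(* [de] maps [M ^ 2] into itself, so [w = 0] serves. *)
have S2 z : idealX M 2 z -> S z.
  pose K : set T := fun z => M z /\ idealX M 2 (de z).
  have de0 : de 0 = 0 by rewrite -[X in de X](rmorph0 iota) dec.
  have hK : is_ideal K.
    split; first by split; [apply: ideal0|rewrite de0; apply: ideal0].
      by move=> x y [x1 x2] [y1 y2]; split; [apply: idealD|rewrite deD; apply: idealD].
    move=> a x [x1 x2]; split; first exact: idealMleft.
    by rewrite deM; apply: idealD => //; [apply: idealMleft|apply: idealX2].
  move=> z2; have [_ de2] : K z.
    move: z z2; apply: idealM_min => // x y Mx /(idealX1 _ hM) My; split.
      exact: idealMleft.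
    by rewrite deM; apply: idealD => //; apply: idealX2.
  by exists 0; rewrite peval0 subr0; apply: idealB.
have Sall z : S z.
  have /choice[q qP] : forall j : 'I_n, exists q, q != 0 /\ M (peval iota q (varT v j)).
    by move=> j; have [q q0 qj] := alg (varT v j); exists q.
  (* The squares of polynomials with values in [M] have values in [M ^ 2], so modulo [M ^ 2] every
     series is a polynomial. *)
  have [||r zr] := @tate_poly_mod _ _ v n (idealX M 2) (fun j => q j * q j) h2 _ _ z.
  - by move=> j; rewrite mulf_neq0//; case: (qP j).
  - by move=> j; rewrite pevalM; apply: idealX2; case: (qP j).
  by rewrite -(subrK (polyT v r) z); apply: SD => //; apply: S2.
move=> z Mz; have [c zc] := Sall z.
have cth : M (peval iota c th).
  have := idealX_sub hM zc; rewrite -addrA -opprD => /(idealBl hM)/(_ Mz).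
  by move=> h; rewrite -(addrK (de z) (peval _ _ _)); apply: idealB.
(* For [z] in [M] the part [c(th)] lies in [M], so [p] divides [c] and [c(th)] already lies in
   [M ^ 2]: only [de z] remains. *)
have /dvdpP[e ce] : p %| c.
  by apply: pdiv; apply: idealBr (peval_mod iota c hM (idealBC hM thz)) cth.
have c2 : idealX M 2 (peval iota c th) by rewrite ce pevalM; apply: idealMleft.
by have := idealD h2 zc c2; rewrite addrAC subrK.
Qed.

End Tate.

(** The common form of [standard_smooth] and [standard_smooth_affinoid], with [Pi] a ring
    morphism. *)
Definition tate_smooth (A : kalg k) : Prop :=
  exists (n c : nat) (Pi : {rmorphism tateT v n -> A}) (f : 'I_c -> tateT v n)
    (s : 'I_c -> 'I_n),
  [/\ forall a, Pi (cstT v n a) = str A a, forall b, exists p, Pi p = b,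
      forall p, Pi p = 0 <-> exists q : 'I_c -> tateT v n, p = \sum_i q i * f i
    & exists b, \det (\matrix_(i, j) Pi (derivT (s j) (f i))) * b = 1].

Definition tate_quotient (A : kalg k) : Prop :=
  exists n (Pi : {rmorphism tateT v n -> A}),
    (forall a, Pi (cstT v n a) = str A a) /\ forall b, exists p, Pi p = b.

Lemma tate_quotient_noetherian (A : kalg k) : tate_quotient A -> noetherian A.
Proof. by move=> [n [Pi [_ PiS]]]; apply: (noetherian_surj PiS); apply: noetherian_tate. Qed.

Lemma pull_max (A B : comPzRingType) (phi : {rmorphism A -> B}) (m : set B) :
  (forall b, exists a, phi a = b) -> max_ideal m -> max_ideal (pull phi m).
Proof.
move=> surj mm; have hm := max_is_ideal mm; apply: maxI_unit.
- split; rewrite /pull /=; first by rewrite rmorph0; apply: ideal0.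
    by move=> a b Ja Jb; rewrite rmorphD; apply: idealD.
  by move=> a b Jb; rewrite rmorphM; apply: idealMleft.
- by rewrite /pull /= rmorph1; case: mm.
- move=> a ma; have [b mb] := max_unit mm ma; have [c cb] := surj b.
  by exists c; rewrite /pull /= rmorphB rmorphM rmorph1 cb.
Qed.

Lemma idealX2_pull (A B : comPzRingType) (phi : {rmorphism A -> B}) (m : set B) a :
  is_ideal m -> idealX (pull phi m) 2 a -> idealX m 2 (phi a).
Proof.
move=> hm; have h2 := idealX_ideal 2 hm.
have hp : is_ideal (pull phi m).
  split; rewrite /pull /=; first by rewrite rmorph0; apply: ideal0.
    by move=> x y Jx Jy; rewrite rmorphD; apply: idealD.
  by move=> x y Jy; rewrite rmorphM; apply: idealMleft.
apply: (idealM_min (K := fun x => idealX m 2 (phi x))).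
  split; first by rewrite rmorph0; apply: ideal0.
    by move=> u w hu hw; rewrite rmorphD; apply: idealD.
  by move=> u w hw; rewrite rmorphM; apply: idealMleft.
by move=> u w Mu /(idealX1 _ hp) Mw; rewrite rmorphM; exact: idealX2.
Qed.

Lemma tate_quotient_algebraic (A : kalg k) : tate_quotient A ->
  forall (m : set A) a, max_ideal m -> algebraic_mod (str A) m a.
Proof.
move=> [n [Pi [Pic PiS]]] m a mm; have [b ba] := PiS a.
have [p p0 pb] := tate_residue_algebraic b (pull_max PiS mm).
by exists p => //; rewrite -ba -(peval_rmorph p b Pic).
Qed.

(** The partial derivatives are corrected by combinations of the [d/dT_(s j)] so as to kill all
    equations, and then descend to [A]. The Euler field of the Tate algebra induces one on [A],
    provided elements are lifted so that the corrections vanish. *)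
Lemma tate_smooth_euler (A : kalg k) : tate_smooth A ->
  exists n (D : 'I_n -> A -> A), (forall i, kderivation (str A) (D i)) /\
    forall m, max_ideal m -> euler_at D m.
Proof.
move=> [n [c [Pi [f [s [Pic PiS Piker [b Jb]]]]]]].
pose J : 'M[A]_c := \matrix_(i, j) Pi (derivT (s j) (f i)).
pose J' : 'M[A]_c := b *: \adj J.
have JJ' : J *m J' = 1%:M by rewrite /J' -scalemxAr mul_mx_adj scale_scalar_mx mulrC Jb.
have J'J : J' *m J = 1%:M by rewrite /J' -scalemxAl mul_adj_mx scale_scalar_mx mulrC Jb.
(* The coefficients of the correction, solving [J G = d_i f] with the inverse [J'] of the Jacobian
   block. *)
pose G i : 'cV[A]_c := J' *m (\col_l Pi (derivT i (f l))).
have JG i l : \sum_j Pi (derivT (s j) (f l)) * G i j 0 = Pi (derivT i (f l)).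
  have e : J *m G i = \col_l Pi (derivT i (f l)) by rewrite /G mulmxA JJ' mul1mx.
  transitivity ((J *m G i) l 0); last by rewrite e mxE.
  by rewrite [RHS]mxE; apply: eq_bigr => j _; rewrite [J _ _]mxE.
pose Dt i (h : tateT v n) := Pi (derivT i h) - \sum_j Pi (derivT (s j) h) * G i j 0.
have DtB i g h : Dt i (g - h) = Dt i g - Dt i h.
  have -> : Dt i (g - h) = Pi (derivT i g) - Pi (derivT i h) -
    (\sum_j Pi (derivT (s j) g) * G i j 0 - \sum_j Pi (derivT (s j) h) * G i j 0).
    rewrite /Dt raddfB rmorphB -sumrB; congr (_ - _); apply: eq_bigr => j _.
    by rewrite raddfB rmorphB mulrBl.
  rewrite /Dt; ring.
have DtM i g h : Dt i (g * h) = Pi g * Dt i h + Pi h * Dt i g.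
  rewrite /Dt derivTM rmorphD !rmorphM !mulrBr !mulr_sumr.
  have -> : \sum_j Pi (derivT (s j) (g * h)) * G i j 0 =
    \sum_j Pi g * (Pi (derivT (s j) h) * G i j 0) + \sum_j Pi h * (Pi (derivT (s j) g) * G i j 0).
    rewrite -big_split; apply: eq_bigr => j _; rewrite derivTM rmorphD !rmorphM /=; ring.
  by ring.
have Dtf i l : Dt i (f l) = 0 by rewrite /Dt JG subrr.
have Pif l : Pi (f l) = 0.
  apply/Piker; exists (fun j => (j == l)%:R); rewrite (bigD1 l)//= eqxx mul1r big1 ?addr0// => j /negbTE ->.
  by rewrite mul0r.
have Dt0 i : Dt i 0 = 0 by rewrite -(subrr 0) DtB subrr.
have DtD i g h : Dt i (g + h) = Dt i g + Dt i h.
  by rewrite -{1}(opprK h) DtB -(sub0r h) DtB Dt0 sub0r opprK.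
have Dtker i g h : Pi g = Pi h -> Dt i g = Dt i h.
  move=> gh; apply/eqP; rewrite -subr_eq0 -DtB; apply/eqP.
  have /Piker[q ->] : Pi (g - h) = 0 by rewrite rmorphB gh subrr.
  apply: (big_ind (fun x => Dt i x = 0)) => [|x y x0 y0|l _]; [exact: Dt0|by rewrite DtD x0 y0 addr0|].
  by rewrite DtM Dtf Pif mulr0 mul0r addr0.
have /choice[lft lftP] := PiS.
pose D i a := Dt i (lft a).
have DPi i g : D i (Pi g) = Dt i g by apply: Dtker; rewrite lftP.
exists n, D; split=> [i|m mm].
  split.
  - by move=> x y; rewrite -(lftP x) -(lftP y) -rmorphD !DPi DtD.
  - by move=> x y; rewrite -(lftP x) -(lftP y) -rmorphM !DPi DtM !lftP.
  - move=> a; rewrite -Pic DPi /Dt derivT_cst rmorph0 sub0r big1 ?oppr0// => j _.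
    by rewrite derivT_cst rmorph0 mul0r.
have hm := max_is_ideal mm.
pose M := pull Pi m; have mM : max_ideal M by apply: pull_max.
have [nu Mnu nuE] := euler_tate mM.
exists (fun i => Pi (nu i)) => [|z mz]; first exact: Mnu.
pose h := lft z; pose eta : 'rV[A]_c := \row_j Pi (derivT (s j) h).
pose ga := eta *m J'.
have /choice[cl clP] : forall l, exists g, Pi g = ga 0 l by move=> l; apply: PiS.
(* Another lift of [z]: the multiples of the equations are chosen so that the derivatives of [h']
   along the [s j] vanish in [A]. On [h'] the corrected derivations are the plain partial
   derivatives. *)
pose h' := h - \sum_l cl l * f l.
have Ph' : Pi h' = z.
  rewrite rmorphB lftP rmorph_sum big1 ?subr0// => l _; by rewrite rmorphM Pif mulr0.
have dh' j : Pi (derivT (s j) h') = 0.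
  rewrite /h' raddfB rmorphB /= raddf_sum rmorph_sum.
  have : ga *m J = eta by rewrite -mulmxA J'J mulmx1.
  move=> /(congr1 (fun Y : 'rV_c => Y 0 j)); rewrite mxE [X in _ = X]mxE => <-.
  rewrite -sumrB big1// => l _; rewrite [J _ _]mxE /= derivTM rmorphD !rmorphM clP Pif mulr0 add0r.
  by rewrite subrr.
have Mh' : M h' by rewrite /M /pull /= Ph'.
have := idealX2_pull hm (nuE h' Mh'); rewrite rmorphB Ph' rmorph_sum.
set S1 := \sum_i _; set S2 := \sum_i _; suff -> : S1 = S2 by [].
apply: eq_bigr => i _; rewrite -[in RHS]Ph' DPi /Dt.
rewrite (eq_bigr (fun=> 0)) ?big1_eq ?subr0 ?rmorphM//.
by move=> j _; rewrite dh' mul0r.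
Qed.

End Smooth.

(** * Charts *)

Section Along.
Variables (k : fieldType) (A B : comPzRingType) (iA : {rmorphism k -> A}).

Definition derivation_along (phi : A -> B) (E : A -> B) : Prop :=
  [/\ forall a b, E (a + b) = E a + E b,
      forall a b, E (a * b) = phi a * E b + phi b * E a & forall c, E (iA c) = 0].

End Along.

Section Charts.
Variables (k : fieldType) (X : rgspace k).

(** The Euler fields are built from sections of the tangent sheaf over [W], not merely from
    derivations of its ring: stability of a sheaf concerns the former. *)
Definition chart (W : opn X) : Prop :=
  [/\ noetherian (reg W), forall m a, max_ideal m -> algebraic_mod (cst W) m a
    & exists n (D : 'I_n -> tangent W),
        forall m, max_ideal m -> euler_at (fun i => tapp (D i)) m].

(** Charts are demanded inside any given covering, because finite generation and freeness only hold
    on the members of some covering. *)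
Definition charted : Prop := forall C, cov (whole (g := X)) C ->
  exists2 C', cov (whole (g := X)) C' & forall W : opn X, C' (oset W) ->
    chart W /\ exists2 V, C V & oset W `<=` V.

Lemma tapp_kder (W : opn X) (D : tangent W) : kderivation (cst W) (tapp D).
Proof.
by split=> [a b|a b|c]; rewrite /tapp ?tfun_add ?tfun_mul ?tfun_cst.
Qed.

(** A class of opens inside [U] with the properties of the basic opens of an affine scheme, or
    of the affinoid subdomains of an affinoid space. *)
Record base_of (R : realType) (v : nabs R k) (U : opn X) (Bs : opn X -> Prop) : Prop := {
  base_sub : forall W, Bs W -> W [<=] U;
  base_cov : forall V : opn X, V [<=] U ->
    exists2 C, cov (oset V) C & forall W : opn X, C (oset W) -> Bs W;
  base_ext : forall D W (h : W [<=] U), Bs W -> kderivation (cst U) D ->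
    exists2 D', kderivation (cst W) D' & forall a, D' (rs h a) = rs h (D a);
  base_uniq : forall W V (hW : W [<=] U) (h : V [<=] W) E1 E2, Bs W -> Bs V ->
    derivation_along (cst W) (rs h) E1 -> derivation_along (cst W) (rs h) E2 ->
    (forall a, E1 (rs hW a) = E2 (rs hW a)) -> forall a, E1 a = E2 a;
  base_quot : forall W, Bs W -> tate_quotient v (reg_alg W);
  base_onto : forall W (h : W [<=] U) m, Bs W -> max_ideal m ->
    forall b, exists a, idealX m 2 (b - rs h a) }.

Section Base.
Variables (R : realType) (v : nabs R k) (U : opn X) (Bs : opn X -> Prop).
Hypothesis bU : base_of v U Bs.

Lemma base_sep (V : opn X) (hV : V [<=] U) (s t : reg V) :
  (forall W (h : W [<=] V), Bs W -> rs h s = rs h t) -> s = t.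
Proof.
move=> H; have [C VC CB] := base_cov bU hV.
by apply: (reg_sheaf VC).1 => W h /CB; apply: H.
Qed.

Section Tangent.
Variable D : reg U -> reg U.
Hypothesis hD : kderivation (cst U) D.

Let ext W : exists D' : reg W -> reg W, forall h : W [<=] U, Bs W ->
  kderivation (cst W) D' /\ forall a, D' (rs h a) = rs h (D a).
Proof.
(* The identity is a dummy value outside the base; it makes the choice total. *)
have [bW|nW] := pselect (Bs W); last by exists id.
have [D' h1 h2] := base_ext bU (base_sub bU bW) bW hD.
by exists D' => h _; split=> // a; rewrite (Prop_irrelevance h (base_sub bU bW)).
Qed.

Let DB W : reg W -> reg W := sval (cid (ext W)).

Let DBder W : Bs W -> kderivation (cst W) (DB (W := W)).
Proof. by move=> bW; case: (svalP (cid (ext W)) (base_sub bU bW) bW). Qed.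

Let DBU W (h : W [<=] U) a : Bs W -> DB (rs h a) = rs h (D a).
Proof. by move=> bW; have [_] := svalP (cid (ext W)) h bW; apply. Qed.

Let DBres W V (h : V [<=] W) a : Bs W -> Bs V -> rs h (DB a) = DB (rs h a).
Proof.
move=> bW bV; have [a1 m1 c1] := DBder bW; have [a2 m2 c2] := DBder bV.
apply: (base_uniq bU (hW := base_sub bU bW) (h := h) (E1 := fun a => rs h (DB a))
  (E2 := fun a => DB (rs h a))) a => //.
- split=> [a b|a b|c]; first by rewrite a1 rmorphD.
    by rewrite m1 rmorphD !rmorphM.
  by rewrite c1 rmorph0.
- split=> [a b|a b|c]; first by rewrite rmorphD a2.
    by rewrite rmorphM m2.
  by rewrite rs_cst c2.
- move=> a; have hV : V [<=] U := osub_trans (base_sub bU bW) h.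
  by rewrite DBU// !(rs_comp _ _ hV) DBU.
Qed.

Let glue V (hV : V [<=] U) (a : reg V) : exists t : reg V,
  forall W (h : W [<=] V), Bs W -> rs h t = DB (rs h a).
Proof.
have [C VC CB] := base_cov bU hV.
have CV (W : opn X) : C (oset W) -> W [<=] V by move=> c; apply: cov_sub VC c.
pose s W (c : C (oset W)) : reg W := DB (rs (CV W c) a).
have [|t tP] := (reg_sheaf VC).2 s.
  move=> W1 W2 W c1 c2 h1 h2.
  have hW : W [<=] V := osub_trans (CV W1 c1) h1.
  apply: (base_sep (osub_trans hV hW)) => W' h b; rewrite /s.
  rewrite (rs_comp _ _ (osub_trans h1 h)) (rs_comp _ _ (osub_trans h2 h)).
  rewrite !DBres//; [|exact: CB..].
  by rewrite !(rs_comp _ _ (osub_trans hW h)).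
exists t => W h bW.
apply: (reg_sheaf (cov_restr VC (opnP W) h)).1 => N hN [W0 C0 eN].
have W0a : adm W0 by case: (cov_adm VC) => _ /(_ _ C0).
have hN0 : N [<=] Opn W0a by move=> x; rewrite -eN => -[].
apply: (base_sep (osub_trans hV (osub_trans h hN))) => W' h' b'.
have e : rs h' (rs hN (rs h t)) = rs (osub_trans hN0 h') (rs (CV (Opn W0a) C0) t).
  rewrite (rs_comp _ _ (osub_trans h hN)) (rs_comp _ _ (osub_trans h (osub_trans hN h'))).
  by rewrite (rs_comp _ _ (osub_trans h (osub_trans hN h'))).
rewrite e tP /s (rs_comp _ _ (osub_trans hN h')) !DBres//; last exact: CB.
by rewrite !(rs_comp _ _ (osub_trans h (osub_trans hN h'))).
Qed.

Let tf V (hV : V [<=] U) (a : reg V) : reg V := sval (cid (glue hV a)).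

Let tfE V (hV : V [<=] U) a W (h : W [<=] V) : Bs W -> rs h (tf hV a) = DB (rs h a).
Proof. exact: (svalP (cid (glue hV a))). Qed.

(** On the opens of the base [D] has an extension, and uniqueness makes the extensions compatible
    with restriction. On any other open they glue over a covering from the base. *)
Lemma base_tangent : exists T : tangent U, forall a, tapp T a = D a.
Proof.
unshelve eexists; first refine (@Tangent k X U (fun V h => tf h) _ _ _ _).
- move=> V h a b; apply: (base_sep h) => W hW bW; have [a1 _ _] := DBder bW.
  by rewrite !(rmorphD, tfE)//= a1.
- move=> V h a b; apply: (base_sep h) => W hW bW; have [_ m1 _] := DBder bW.
  by rewrite rmorphD !rmorphM !tfE// rmorphM m1.
- move=> V h c; apply: (base_sep h) => W hW bW; have [_ _ c1] := DBder bW.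
  by rewrite tfE// rs_cst c1 rmorph0.
- move=> V W hV hW h a; apply: (base_sep hW) => N hN bN.
  by rewrite (rs_comp _ _ (osub_trans h hN)) !tfE// (rs_comp _ _ (osub_trans h hN)).
move=> a; apply: (base_sep (osub_refl U)) => W h bW.
by rewrite /tapp tfE// DBU.
Qed.

End Tangent.

Definition restr_tangent (V W : opn X) (h : W [<=] V) (T : tangent V) : tangent W.
Proof.
refine (@Tangent k X W (fun N hN => tfun T (osub_trans h hN)) _ _ _ _).
- by move=> N hN a b; apply: tfun_add.
- by move=> N hN a b; apply: tfun_mul.
- by move=> N hN c; apply: tfun_cst.
- by move=> N1 N2 h1 h2 h12 a; apply: tfun_res.
Defined.

Lemma tapp_restr (V W : opn X) (h : W [<=] V) (T : tangent V) a :
  tapp (restr_tangent h T) (rs h a) = rs h (tapp T a).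
Proof.
by rewrite /tapp /= -(tfun_res T (osub_refl V)).
Qed.

(** [O(U)] maps onto [O(W) / m ^ 2], so the contraction of [m] is maximal and the Euler field there
    restricts to one at [m]. *)
Lemma base_chart n (D : 'I_n -> reg U -> reg U) :
  (forall i, kderivation (cst U) (D i)) -> (forall m, max_ideal m -> euler_at D m) ->
  forall W, Bs W -> chart W.
Proof.
move=> hD ED W bW; have qW := base_quot bU bW; have h := base_sub bU bW; split.
- exact: tate_quotient_noetherian qW.
- by move=> m a; apply: (tate_quotient_algebraic qW).
have /choice[T TD] : forall i, exists T : tangent U, forall a, tapp T a = D i a.
  by move=> i; apply: base_tangent.
exists n, (fun i => restr_tangent h (T i)) => m mm; have hm := max_is_ideal mm.
have onto b : exists a, m (b - rs h a).
  by have [a ba] := base_onto bU h bW mm b; exists a; apply: idealX_sub ba.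
have mU : max_ideal (pull (rs h) m).
  apply: maxI_unit.
  - split; rewrite /pull /=; first by rewrite rmorph0; apply: ideal0.
      by move=> a b Ja Jb; rewrite rmorphD; apply: idealD.
    by move=> a b Jb; rewrite rmorphM; apply: idealMleft.
  - by rewrite /pull /= rmorph1; case: mm.
  - move=> a ma; have [b mb] := max_unit mm ma; have [c cb] := onto b.
    exists c; rewrite /pull /= rmorphB rmorphM rmorph1.
    have -> : rs h a * rs h c - 1 = (rs h a * b - 1) - rs h a * (b - rs h c) by ring.
    by apply: idealB => //; apply: idealMleft.
have [a ma E] := ED _ mU; exists (fun i => rs h (a i)) => [|z mz]; first exact: ma.
have h2 := idealX_ideal 2 hm.
have [y zy] := base_onto bU h bW mm z.
have my : m (rs h y) by apply: (idealBr hm (idealBC hm (idealX_sub hm zy)) mz).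
have DM i x : idealX m 2 x -> m (tapp (restr_tangent h (T i)) x).
  have [Da Dm Dc] := tapp_kder (restr_tangent h (T i)).
  pose K : set (reg W) := fun x => m x /\ m (tapp (restr_tangent h (T i)) x).
  suff H : idealX m 2 `<=` K by move=> /H[].
  apply: idealM_min.
    split; first by split; [apply: ideal0|rewrite (kder0 (tapp_kder _)); apply: ideal0].
      by move=> u w [u1 u2] [w1 w2]; split; [apply: idealD|rewrite Da; apply: idealD].
    move=> u w [w1 w2]; split; first exact: idealMleft.
    by rewrite Dm; apply: idealD => //; [apply: idealMleft|apply: idealMright].
  move=> u w mu mw1; have mw : m w by apply/idealX1.
  split; first exact: idealMleft.
  by rewrite Dm; apply: idealD => //; apply: idealMright.
(* The part coming from [y] is treated on [U]. The difference [z - y] is in [m ^ 2], so its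
   derivatives are in [m] and become elements of [m ^ 2] after multiplication by the [a i]. *)
have -> : z - \sum_i rs h (a i) * tapp (restr_tangent h (T i)) z =
  (z - rs h y) + rs h (y - \sum_i a i * D i y) -
  \sum_i rs h (a i) * tapp (restr_tangent h (T i)) (z - rs h y).
  rewrite rmorphB addrA subrK -addrA -opprD; congr (_ - _).
  rewrite rmorph_sum -big_split; apply: eq_bigr => i _.
  have [Da _ _] := tapp_kder (restr_tangent h (T i)).
  by rewrite /= rmorphM -TD -tapp_restr -mulrDr -Da addrC subrK.
apply: idealB => //; first by apply: idealD => //; apply: idealX2_pull => //; apply: E.
by apply: ideal_sum => // i _; apply: idealX2; [apply: ma|apply: DM].
Qed.

End Base.
End Charts.

(** * Smooth schemes *)

Lemma rmorph_factor (A B C : comPzRingType) (pi : {rmorphism A -> B}) (f : {rmorphism A -> C}) :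
  (forall b, exists a, pi a = b) -> (forall a, pi a = 0 -> f a = 0) ->
  exists g : {rmorphism B -> C}, forall a, g (pi a) = f a.
Proof.
move=> pis ker; pose g b := f (sval (cid (pis b))).
have gE a : g (pi a) = f a.
  rewrite /g; case: cid => a' /= e; apply/eqP; rewrite -subr_eq0 -rmorphB.
  by apply/eqP/ker; rewrite rmorphB e subrr.
have gB : additive g.
  by move=> x y; have [a <-] := pis x; have [b <-] := pis y; rewrite -rmorphB !gE rmorphB.
have gM : multiplicative g.
  split; last by rewrite -(rmorph1 pi) gE rmorph1.
  by move=> x y; have [a <-] := pis x; have [b <-] := pis y; rewrite -rmorphM !gE rmorphM.
pose ga := GRing.isAdditive.Build _ _ g gB.
pose gm := GRing.isMultiplicative.Build _ _ g gM.
by exists (HB.pack g ga gm : {rmorphism B -> C}).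
Qed.

(** Factors [X] are removed from an annihilating polynomial until its constant term is nonzero. As
    the inverse is a polynomial in [b], it comes from any subalgebra containing [b], which makes
    preimages of maximal ideals maximal. *)
Lemma algebraic_inverse (k : fieldType) (B : comPzRingType) (iota : {rmorphism k -> B})
    (m : set B) b : max_ideal m -> algebraic_mod iota m b -> ~ m b ->
  exists q, m (b * peval iota q b - 1).
Proof.
move=> mm [p p0 pb] nb; have hm := max_is_ideal mm.
elim/poly_ind: p p0 pb => [|p c IH]; first by rewrite eqxx.
rewrite pevalMXC; have [->|c0 _ pc] := eqVneq c 0.
  rewrite polyC0 addr0 rmorph0 addr0 mulf_eq0 polyX_eq0 orbF => p0 /(max_prime mm)[|//].
  exact: IH.
exists ((- c^-1)%:P * p); rewrite pevalCM rmorphN mulrCA mulNr.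
have -> : - (iota c^-1 * (b * peval iota p b)) - 1 = - (iota c^-1 * (peval iota p b * b + iota c)).
  rewrite mulrDr -(rmorphM iota) mulVf// rmorph1; ring.
by apply: idealN => //; apply: idealMleft.
Qed.

Section TrivialAbs.
Variable k : fieldType.
Let R : realType := Rdefinitions.R.

Definition trivial_abs : nabs R k.
Proof.
refine (@NAbs R k (fun x => (x != 0)%:R) _ _ _ _ _).
- by move=> x; case: (x != 0); rewrite ?ler01.
- move=> x; split=> [|->]; last by rewrite eqxx.
  by have [//|_ /eqP] := eqVneq x 0; rewrite oner_eq0.
- by move=> x y; rewrite mulf_eq0 negb_or; case: (x != 0); case: (y != 0); rewrite ?mulr1 ?mulr0 ?mul0r.
- move=> x y; rewrite le_max; have [->|x0] := eqVneq x 0; first by rewrite add0r lexx orbT.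
  by apply/orP; left; case: (x + y != 0); rewrite ?ler01.
- move=> u H; have [N HN] := H 1 ltr01; exists (u N) => e e0; exists N => i iN.
  have := HN i N iN (leqnn _); case: (u i - u N != 0) => //; by rewrite ltxx.
Defined.

Lemma trivial_polyT n (c : tateT trivial_abs n) : exists p, polyT trivial_abs p = c.
Proof.
have [N HN] := tate_tser c ltr01.
exists (ptrunc N (tser c)); apply: tateP_ext => m; rewrite /= /fps_of mcoeff_trunc.
case: ltnP => // /HN; rewrite /=; case: eqP => [->//|_]; by rewrite ltxx.
Qed.

Lemma polyT_inj (R' : realType) (v : nabs R' k) n : injective (@polyT R' k v n).
Proof. by move=> p q /(congr1 (@tser R' k v n)) /fps_of_inj. Qed.

Lemma trivial_tate_hom (A : comPzRingType) n (pi : {rmorphism {mpoly k[n]} -> A}) :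
  exists Pi : {rmorphism tateT trivial_abs n -> A}, forall p, Pi (polyT trivial_abs p) = pi p.
Proof.
apply: rmorph_factor => [c|p]; first exact: trivial_polyT.
by rewrite -(rmorph0 (polyT trivial_abs (n := n))) => /polyT_inj ->; rewrite rmorph0.
Qed.

Lemma mpoly_quotient (A : kalg k) n (pi : {rmorphism {mpoly k[n]} -> A}) :
  (forall a, pi a%:MP = str A a) -> (forall b, exists p, pi p = b) -> tate_quotient trivial_abs A.
Proof.
move=> pic pis; have [Pi PiE] := trivial_tate_hom pi; exists n, Pi; split=> [a|b].
  by rewrite PiE.
by have [p <-] := pis b; exists (polyT trivial_abs p); rewrite PiE.
Qed.

Lemma standard_smooth_tate (A : kalg k) : standard_smooth A -> tate_smooth trivial_abs A.
Proof.
move=> [n [c [pi [f [s [pic pis piker [b Jb]]]]]]].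
have [Pi PiE] := trivial_tate_hom pi.
exists n, c, Pi, (fun i => polyT trivial_abs (f i)), s; split.
- by move=> a; rewrite PiE.
- by move=> x; have [p <-] := pis x; exists (polyT trivial_abs p); rewrite PiE.
- move=> x; have [p <-] := trivial_polyT x; rewrite PiE piker; split=> -[q qE].
    exists (fun i => polyT trivial_abs (q i)); rewrite qE rmorph_sum.
    by apply: eq_bigr => i _; rewrite rmorphM.
  have /choice[q' q'E] : forall i, exists p, polyT trivial_abs p = q i by move=> i; apply: trivial_polyT.
  exists q'; apply: (@polyT_inj _ trivial_abs); rewrite qE rmorph_sum.
  by apply: eq_bigr => i _; rewrite rmorphM /= q'E.
- exists b; rewrite -Jb; congr (\det _ * _); apply/matrixP => i j; rewrite !mxE derivT_poly PiE.
  by [].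
Qed.

Lemma tate_smooth_quotient (R' : realType) (v : nabs R' k) (A : kalg k) :
  tate_smooth v A -> tate_quotient v A.
Proof. by move=> [n [c [Pi [f [s [h1 h2 _ _]]]]]]; exists n, Pi. Qed.

End TrivialAbs.

Lemma mpoly_hom_ext (k : fieldType) n (B : comPzRingType) (f g : {rmorphism {mpoly k[n]} -> B}) :
  (forall c, f c%:MP = g c%:MP) -> (forall i, f 'X_i = g 'X_i) -> forall p, f p = g p.
Proof.
move=> fgc fgX p; rewrite [p]mpolyE !rmorph_sum; apply: eq_bigr => m _.
rewrite -mul_mpolyC !rmorphM fgc mpolyXE_id !rmorph_prod; congr (_ * _).
by apply: eq_bigr => i _; rewrite !rmorphXn fgX.
Qed.

(** * Localizations of quotients of polynomial rings *)

Section Localization.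
Variables (k : fieldType) (A B : kalg k) (f : A) (phi : {rmorphism A -> B}).
Hypotheses (kphi : kalg_mor phi) (loc : is_localization f phi).

Lemma loc_unitX n : exists u, phi (f ^+ n) * u = 1.
Proof.
have [[u fu] _ _] := loc; exists (u ^+ n).
by rewrite rmorphXn -exprMn fu expr1n.
Qed.

Lemma loc_cancel n x y : phi (f ^+ n) * x = phi (f ^+ n) * y -> x = y.
Proof.
have [u fu] := loc_unitX n => /(congr1 (fun z => u * z)).
by rewrite !mulrA [u * _]mulrC fu !mul1r.
Qed.

Lemma loc_quotient : tate_quotient (trivial_abs k) A -> tate_quotient (trivial_abs k) B.
Proof.
move=> [n [Pi [Pic Pis]]]; have [e|/eqP B1] := pselect (1 = 0 :> B).
  exists n, (phi \o Pi); split=> [a|b]; first by rewrite /= Pic kphi.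
  by exists 0; rewrite rmorph0 -[b]mulr1 e mulr0.
pose m := GRing.PzSemiRing_isNonZero.Build (car B) B1.
pose B' : comNzRingType := HB.pack (car B) m.
have [[u fu] locS _] := loc.
(* The additional variable goes to the inverse [u] of [f]. *)
pose h (i : 'I_n.+1) : B' :=
  if unlift ord_max i is Some j then phi (Pi (polyT (trivial_abs k) 'X_j)) else u.
pose strB : {rmorphism k -> B'} := str B.
pose pi : {rmorphism {mpoly k[n.+1]} -> B'} := mmap strB h.
have piC c : pi c%:MP = str B c by rewrite /pi /= mmapC.
have piX i : pi 'X_i = h i by rewrite /pi /= mmapX mmap1U.
apply: (@mpoly_quotient k B n.+1 pi) => // b.
have [N [a ab]] := locS b; have [c ca] := Pis a; have [p pc] := trivial_polyT c.
exists ((p \mPo (incl_tuple k n)) * 'X_(ord_max) ^+ N).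
pose E1 : {rmorphism {mpoly k[n]} -> B} := pi \o comp_mpoly (incl_tuple k n).
pose E2 : {rmorphism {mpoly k[n]} -> B} := phi \o Pi \o @polyT _ _ (trivial_abs k) n.
have E : E1 p = E2 p.
  apply: mpoly_hom_ext => [d|i] /=; first by rewrite comp_mpolyC piC -kphi -Pic.
  by rewrite comp_mpolyXU /incl_tuple -tnth_nth tnth_mktuple piX /h liftK.
rewrite rmorphM rmorphXn piX /h unlift_none; have := E; rewrite /E1 /E2 /= => ->.
by rewrite pc ca -ab rmorphXn mulrAC -exprMn fu expr1n mul1r.
Qed.

Lemma loc_uniq (C : comPzRingType) (psi : {rmorphism B -> C}) E1 E2 :
  derivation_along (str B) psi E1 -> derivation_along (str B) psi E2 ->
  (forall a, E1 (phi a) = E2 (phi a)) -> forall b, E1 b = E2 b.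
Proof.
move=> [_ m1 _] [_ m2 _] e b; have [_ locS _] := loc; have [n [a ab]] := locS b.
have [u fu] := loc_unitX n; have pu : psi u * psi (phi (f ^+ n)) = 1.
  by rewrite -rmorphM mulrC fu rmorph1.
have : E1 (phi (f ^+ n) * b) = E2 (phi (f ^+ n) * b) by rewrite ab e.
rewrite m1 m2 e => /addIr /(congr1 (fun z => psi u * z)).
by rewrite !mulrA pu !mul1r.
Qed.

(** The quotient rule. It is stated through the graph [P], where [d] belongs to [b = a / f ^ n], so
    that the work lies in the independence of the fraction. *)
Lemma loc_ext D : kderivation (str A) D ->
  exists2 D', kderivation (str B) D' & forall a, D' (phi a) = phi (D a).
Proof.
move=> [DD DM Dc]; have [_ locS locK] := loc.
pose P b d := exists n a, phi (f ^+ n) * b = phi a /\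
  phi (f ^+ n) * d + b * phi (D (f ^+ n)) = phi (D a).
have D0 : D 0 = 0 by apply: (addrI (D 0)); rewrite -DD !addr0.
have DN x : D (- x) = - D x.
  by apply: (addrI (D x)); rewrite -DD !subrr.
have Pu b d d' : P b d -> P b d' -> d = d'.
  move=> [n [a [ab da]]] [n' [a' [ab' da']]].
  have [l] : exists l, f ^+ l * (f ^+ n' * a - f ^+ n * a') = 0.
    apply: locK; rewrite rmorphB !rmorphM -ab -ab'; ring.
  set g := f ^+ l; set s := f ^+ n; set s' := f ^+ n' => e.
  (* [A] may have zero divisors. Differentiating [g x = 0] gives [g D x + x D g = 0], and
     multiplying by [g] once more kills the second term. *)
  have e2 : g * (g * D (s' * a - s * a')) = 0.
    move: (DM g (s' * a - s * a')) e; move: (s' * a - s * a') => x gx e; move: gx; rewrite e D0.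
    by move=> /esym/(congr1 (fun z => g * z)); rewrite mulr0 mulrDr [g * (x * _)]mulrA e mul0r addr0.
  have e3 : phi (D (s' * a - s * a')) = 0.
    apply: (loc_cancel (n := l)); apply: (loc_cancel (n := l)).
    by rewrite !mulr0 -!rmorphM e2 rmorph0.
  move: e3; rewrite DD DN !DM rmorphB !rmorphD !rmorphM -da -da' -ab -ab'.
  rewrite -/s -/s' => e3; apply: (loc_cancel (n := n)); apply: (loc_cancel (n := n')).
  rewrite -/s -/s'; apply/eqP; rewrite -subr_eq0 -e3; apply/eqP; ring.
have PD b d b' d' : P b d -> P b' d' -> P (b + b') (d + d').
  move=> [n [a [ab da]]] [n' [a' [ab' da']]].
  exists (n + n')%N, (f ^+ n' * a + f ^+ n * a'); rewrite exprD DD !DM !rmorphD !rmorphM.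
  rewrite -da -da' -ab -ab'; split; ring.
have PM b d b' d' : P b d -> P b' d' -> P (b * b') (b * d' + b' * d).
  move=> [n [a [ab da]]] [n' [a' [ab' da']]].
  exists (n + n')%N, (a * a'); rewrite exprD !DM !rmorphM.
  rewrite !rmorphD !rmorphM -da -da' -ab -ab'; split; ring.
have D1 : D 1 = 0 by rewrite -(rmorph1 (str A)) Dc.
have PA a : P (phi a) (phi (D a)).
  by exists 0%N, a; rewrite expr0 D1 rmorph0 mulr0 rmorph1 !mul1r addr0.
have /choice[D' D'P] : forall b, exists d, P b d.
  move=> b; have [n [a ab]] := locS b; have [u fu] := loc_unitX n.
  exists (u * (phi (D a) - b * phi (D (f ^+ n)))), n, a; split=> //.
  by rewrite mulrA fu mul1r subrK.
exists D' => [|a]; last exact: Pu (D'P _) (PA a).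
split=> [a b|a b|c]; first exact: Pu (D'P _) (PD _ _ _ _ (D'P a) (D'P b)).
  exact: Pu (D'P _) (PM _ _ _ _ (D'P a) (D'P b)).
by apply: Pu (D'P _) _; rewrite -kphi -(rmorph0 phi) -(Dc c).
Qed.

Lemma loc_onto m : tate_quotient (trivial_abs k) B -> max_ideal m ->
  forall b, exists a, idealX m 2 (b - phi a).
Proof.
move=> qB mm b; have hm := max_is_ideal mm; have h2 := idealX_ideal 2 hm.
have [[u fu] locS _] := loc; have [n [a ab]] := locS b.
have fm : ~ m (phi f).
  by move=> h; case: mm => _ m1 _; apply: m1; rewrite -fu; apply: idealMright.
have [g fg] : exists g, m (phi (f * g) - 1).
  have [q qf] := algebraic_inverse mm (tate_quotient_algebraic qB (phi f) mm) fm.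
  by exists (peval (str A) q f); rewrite rmorphM (peval_rmorph _ _ kphi).
(* [g] inverts [f] modulo [m]; the Newton iterate [g (2 - f g)] inverts it modulo [m ^ 2]. *)
have cE : idealX m 2 (u - phi (g * (2 - f * g))).
  have -> : u - phi (g * (2 - f * g)) =
    u * ((phi (f * g) - 1) * (phi (f * g) - 1)) -
      (1 - phi f * u) * phi (g * (2 - f * g)).
    rewrite !rmorphM rmorphB !rmorphM -[2]/(1 + 1) rmorphD rmorph1; ring.
  by rewrite fu subrr mul0r subr0; apply: idealMleft => //; apply: idealX2.
exists ((g * (2 - f * g)) ^+ n * a); rewrite rmorphM rmorphXn -ab.
have -> : b - phi (g * (2 - f * g)) ^+ n * (phi (f ^+ n) * b) =
  (u ^+ n - phi (g * (2 - f * g)) ^+ n) * (phi (f ^+ n) * b).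
  by rewrite mulrBl; congr (_ - _); rewrite mulrA rmorphXn -exprMn mulrC [u * _]mulrC fu expr1n mulr1.
by apply: idealMright => //; apply: idealBX.
Qed.

End Localization.

Section Scheme.
Variables (k : fieldType) (X : rgspace k).
Hypothesis ch : [pchar k] =i pred0.

Lemma scheme_base (U : opn X) : topological X -> affine_open U -> standard_smooth (reg_alg U) ->
  exists2 Bs, base_of (trivial_abs k) U Bs & Bs U.
Proof.
move=> [Xu Xc] [theta [thp _ thV thloc]] smU.
have qU : tate_quotient (trivial_abs k) (reg_alg U).
  exact/tate_smooth_quotient/standard_smooth_tate.
pose Df (f : reg U) := [set x | oset U x /\ ~ theta x f].
exists (fun W => exists f, oset W = Df f); last first.
  exists 1; apply/seteqP; split=> [x Ux|x [Ux _]] //; split=> //.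
  by have [] := thp x Ux.
have sub (W : opn X) : (exists f, oset W = Df f) -> W [<=] U.
  by move=> [f fW] x; rewrite /= fW => -[].
have kmor (W : opn X) (h : W [<=] U) : @kalg_mor k (reg_alg U) (reg_alg W) (rs h).
  by move=> c; apply: rs_cst.
split=> //.
- move=> V hV; have [I VI] := (thV _ hV).1 (opnP V).
  exists [set Df f | f in I].
    apply/Xc; split.
      move=> _ [f If <-]; apply/(thV _ _); first by move=> x [].
      exists [set f]; apply/seteqP; split=> x.
        by move=> [Ux fx]; split=> //; exists f.
      by move=> [Ux [_ -> fx]].
    rewrite VI; apply/seteqP; split=> [x [_ [f If <-] [Ux fx]]|x [Ux [f If fx]]].
      by split=> //; exists f.
    by exists (Df f) => //; exists f.
  by move=> W [f If fW]; exists f.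
- move=> D W h [f fW] hD.
  exact: (@loc_ext k (reg_alg U) (reg_alg W) f (rs h) (kmor W h) (thloc f W h fW) D hD).
- move=> W V hW h E1 E2 [f fW] _ d1 d2 e a.
  exact: (@loc_uniq k (reg_alg U) (reg_alg W) f (rs hW) (thloc f W hW fW) (reg V) (rs h) E1 E2 d1 d2 e a).
- move=> W bW; have [f fW] := bW; have h := sub W bW.
  exact: (loc_quotient (kmor W h) (thloc f W h fW) qU).
- move=> W h m bW mm; have [f fW] := bW.
  have qW := loc_quotient (kmor W h) (thloc f W h fW) qU.
  exact: (loc_onto (kmor W h) (thloc f W h fW) qW mm).
Qed.

Lemma base_charted (C1 : set (set (point X))) : cov (whole (g := X)) C1 ->
  (forall U : opn X, C1 (oset U) -> exists (R : realType) (v : nabs R k) Bs,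
     [/\ base_of v U Bs, Bs U & tate_smooth v (reg_alg U)]) ->
  charted X.
Proof.
move=> cC1 C1P C cC.
have base U : exists Bs : opn X -> Prop, C1 (oset U) ->
    [/\ forall W, Bs W -> chart W & forall V : opn X, V [<=] U ->
    exists2 C, cov (oset V) C & forall W : opn X, C (oset W) -> Bs W].
  have [CU|nC] := pselect (C1 (oset U)); last by exists (fun=> False).
  have [R [v [Bs [bU BU smU]]]] := C1P U CU.
  have [n [D [hD ED]]] := tate_smooth_euler ch smU.
  exists Bs => _; split=> [W|V hV]; last by have := base_cov bU hV.
  exact: (base_chart bU hD ED).
have /choice[Bs BsP] := base.
have ref (V : set (point X)) : exists D : set (set (point X)),
    (exists U W, [/\ C1 U, C W & V = U `&` W]) ->
    cov V D /\ forall N : opn X, D (oset N) -> chart N /\ exists2 W, C W & oset N `<=` W.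
  have [[U [W [CU CW eV]]]|n] := pselect (exists U W, [/\ C1 U, C W & V = U `&` W]); last first.
    by exists set0.
  have Ua : adm U by case: (cov_adm cC1) => _ /(_ _ CU).
  have Wa : adm W by case: (cov_adm cC) => _ /(_ _ CW).
  have [ch1 cov1] := BsP (Opn Ua) CU.
  have hV : Opn (admI Ua Wa) [<=] Opn Ua by move=> x [].
  have [D cD DB] := cov1 _ hV; exists D => _; rewrite eV; split=> // N DN; split.
    exact/ch1/DB.
  by exists W => //; move=> x Nx; have [] := cov_sub cD DN Nx.
have /choice[D DP] := ref.
pose C2 := \bigcup_(U in C1) [set U `&` W | W in C].
have cC2 : cov (whole (g := X)) C2.
  apply: (cov_trans (D := fun U => [set U `&` W | W in C]) cC1) => U CU.
  have Ua : adm U by case: (cov_adm cC1) => _ /(_ _ CU).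
  by apply: (cov_restr cC) => //; apply: adm_sub.
have C2P V : C2 V -> exists U W, [/\ C1 U, C W & V = U `&` W].
  by move=> [U CU [W CW <-]]; exists U, W.
exists (\bigcup_(V in C2) D V).
  by apply: cov_trans cC2 _ => V /C2P /DP [].
by move=> N [V /C2P /DP [_ +] DN]; apply.
Qed.

Lemma scheme_charted : smooth_scheme X -> charted X.
Proof.
move=> [Xt [C cC CP]]; apply: (base_charted cC) => U CU.
have [aU sU] := CP U (fun x h => adm_sub (opnP U) h) CU.
have [Bs bU BU] := scheme_base Xt aU sU.
by exists _, (trivial_abs k), Bs; split=> //; apply: standard_smooth_tate.
Qed.

End Scheme.

(** * Smooth rigid spaces *)

(** The dual numbers [A[e] / e ^ 2]. A derivation along [psi] is a lift of [psi] to them, which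
    brings derivations under the universal property of affinoid subdomains. *)
Definition dualn (A : comPzRingType) : Type := (A * A)%type.

Section DualNumbers.
Variable A : comPzRingType.
HB.instance Definition _ := GRing.Zmodule.copy (dualn A) (A * A)%type.
Definition dual_one : dualn A := (1, 0).
Definition dual_mul (x y : dualn A) : dualn A := (x.1 * y.1, x.1 * y.2 + y.1 * x.2).
Fact dual_mulA : associative dual_mul.
Proof. by move=> x y z; congr pair => /=; ring. Qed.
Fact dual_mulC : commutative dual_mul.
Proof. by move=> x y; congr pair => /=; ring. Qed.
Fact dual_mul1 : left_id dual_one dual_mul.
Proof. by case=> a b; congr pair => /=; ring. Qed.
Fact dual_mulDl : left_distributive dual_mul +%R.
Proof. by move=> x y z; congr pair => /=; ring. Qed.
HB.instance Definition _ := GRing.Zmodule_isComPzRing.Build (dualn A)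
  dual_mulA dual_mulC dual_mul1 dual_mulDl.

Lemma derivation_hom (k : fieldType) (B : comPzRingType) (iB : {rmorphism k -> B})
    (psi : {rmorphism B -> A}) E : derivation_along iB psi E ->
  exists g : {rmorphism B -> dualn A}, forall b, g b = (psi b, E b).
Proof.
move=> [ED EM Ec]; pose g b : dualn A := (psi b, E b).
have EB : additive g.
  move=> x y; congr pair; first exact: rmorphB.
  by apply: (addIr (E y)); rewrite -ED subrK /= subrK.
have E1 : E 1 = 0 by rewrite -(rmorph1 iB) Ec.
have gM : multiplicative g.
  split=> [x y|]; last by congr pair; rewrite ?rmorph1.
  by congr pair; [apply: rmorphM|apply: EM].
pose ga := GRing.isAdditive.Build _ _ g EB.
pose gm := GRing.isMultiplicative.Build _ _ g gM.
by exists (HB.pack g ga gm : {rmorphism B -> dualn A}).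
Qed.

End DualNumbers.

Section KDual.
Variables (k : fieldType).

Lemma dual_str_exists (B : kalg k) : exists g : {rmorphism k -> dualn B}, forall c, g c = (str B c, 0).
Proof.
apply: (@derivation_hom B k k idfun (str B) (fun=> 0)); split=> // a b.
  by rewrite addr0.
by rewrite !mulr0 addr0.
Qed.

Definition kdual (B : kalg k) : kalg k := KAlg (sval (cid (dual_str_exists B))).

Lemma kdual_str (B : kalg k) c : str (kdual B) c = (str B c, 0).
Proof. exact: (svalP (cid (dual_str_exists B))). Qed.

Definition kquot (B : kalg k) (I : set B) (hI : is_ideal I) : kalg k :=
  KAlg (qpi hI \o str B).

End KDual.

Section Quotients.
Variables (R : realType) (k : fieldType) (v : nabs R k).

Lemma tate_quotient_surj (A B : kalg k) (phi : {rmorphism A -> B}) : kalg_mor phi ->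
  (forall b, exists a, phi a = b) -> tate_quotient v A -> tate_quotient v B.
Proof.
move=> kphi phis [n [Pi [Pic Pis]]]; exists n, (phi \o Pi); split=> [c|b] /=.
  by rewrite Pic kphi.
by have [a <-] := phis b; have [c <-] := Pis a; exists c.
Qed.

Lemma tate_quotient_kquot (A : kalg k) (I : set A) (hI : is_ideal I) :
  tate_quotient v A -> tate_quotient v (kquot hI).
Proof. by apply: (@tate_quotient_surj A (kquot hI) (qpi hI)) => // b; apply: qpi_surj. Qed.

Lemma derivT_incl n (c : tateT v n) : derivT ord_max (substT (incl v n) c) = 0.
Proof.
apply: tateP_ext => m.
change (substT (incl v n) c (m + U_(ord_max))%MM *+ (m ord_max).+1 = 0); rewrite inclE.
rewrite [X in X *+ _](_ : _ = 0) ?mul0rn//.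
by rewrite ifF// mnmDE mnm1E eqxx addn1.
Qed.

(** The new variable goes to the nilpotent generator: a series maps to its value and its derivative
    at 0 in that variable. *)
Lemma tate_quotient_dual (B : kalg k) : tate_quotient v B -> tate_quotient v (kdual B).
Proof.
move=> [n [Pi [Pic Pis]]].
pose F : {rmorphism tateT v n.+1 -> B} := Pi \o substT (forget v n).
pose E (c : tateT v n.+1) := F (derivT ord_max c).
have [g gE] : exists g : {rmorphism tateT v n.+1 -> dualn B}, forall b, g b = (F b, E b).
  apply: (@derivation_hom B k _ (cstT v n.+1)); split=> [a b|a b|c].
  - by rewrite /E raddfD rmorphD.
  - by rewrite /E derivTM rmorphD !rmorphM addrC [X in _ + X = _]mulrC.
  - by rewrite /E derivT_cst rmorph0.
exists n.+1, g; split=> [c|[a b]].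
  by rewrite gE kdual_str /F /E derivT_cst rmorph0 /= substT_cst Pic.
have [p pa] := Pis a; have [q qb] := Pis b.
exists (substT (incl v n) p + substT (incl v n) q * varT v ord_max); rewrite gE; congr pair.
  rewrite rmorphD rmorphM /F /= forget_last !inclK rmorph0 mulr0 addr0; exact: pa.
rewrite /E raddfD /= derivTM !derivT_incl mul0r !add0r /varT derivT_poly mderivX mnm1E eqxx scale1r.
rewrite (_ : U_(ord_max) - U_(ord_max) = 0)%MM ?mpolyX0 ?rmorph1 ?mulr1.
  by rewrite /F /= inclK.
by rewrite -[X in (X - _)%MM]addm0 addmC addmK.
Qed.

Lemma tate_quotient_pull (A B : kalg k) (phi : {rmorphism A -> B}) (m : set B) :
  kalg_mor phi -> tate_quotient v B -> max_ideal m -> max_ideal (pull phi m).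
Proof.
move=> kphi qB mm; have hm := max_is_ideal mm; apply: maxI_unit.
- split; rewrite /pull /=; first by rewrite rmorph0; apply: ideal0.
    by move=> a b Ja Jb; rewrite rmorphD; apply: idealD.
  by move=> a b Jb; rewrite rmorphM; apply: idealMleft.
- by rewrite /pull /= rmorph1; case: mm.
- move=> a na; have [q qa] := algebraic_inverse mm (tate_quotient_algebraic qB (phi a) mm) na.
  by exists (peval (str A) q a); rewrite /pull /= rmorphB rmorph1 rmorphM (peval_rmorph _ _ kphi).
Qed.

Lemma affinoid_tate_quotient (A : kalg k) : affinoid v A <-> tate_quotient v A.
Proof.
split=> [[n [pi [pic piD piM piS]]]|[n [Pi [Pic PiS]]]].
  pose Pi (c : tateT v n) := pi (tser c).
  have PiD c d : Pi (c + d) = Pi c + Pi d by apply: piD; apply: tate_tser.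
  have Pc a : Pi (cstT v n a) = str A a by rewrite -pic /Pi /= fps_const.
  have PiB : additive Pi.
    by move=> c d; apply: (addIr (Pi d)); rewrite -PiD !subrK.
  have PiM : multiplicative Pi.
    split=> [c d|]; first by apply: piM; apply: tate_tser.
    by rewrite -(rmorph1 (cstT v n)) Pc rmorph1.
  pose ga := GRing.isAdditive.Build _ _ Pi PiB.
  pose gm := GRing.isMultiplicative.Build _ _ Pi PiM.
  exists n, (HB.pack Pi ga gm : {rmorphism tateT v n -> A}); split=> // b.
  by have [c tc <-] := piS b; exists (mkT tc).
pose pi (c : pseries k n) : A := if pselect (tate v c) is left h then Pi (mkT h) else 0.
have piE (c : tateT v n) : pi (tser c) = Pi c.
  rewrite /pi; case: pselect => [h|]; last by case; apply: tate_tser.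
  by congr (Pi _); apply: tateP_ext.
exists n, pi; split.
- by move=> a; rewrite -Pic -piE /= fps_const.
- move=> c d tc td; have := piE (mkT tc + mkT td); rewrite [Pi _]rmorphD -!piE; exact.
- move=> c d tc td; have := piE (mkT tc * mkT td); rewrite [Pi _]rmorphM -!piE; exact.
- by move=> b; have [c <-] := PiS b; exists (tser c); [apply: tate_tser|rewrite piE].
Qed.

Lemma standard_smooth_affinoid_tate (A : kalg k) : standard_smooth_affinoid v A -> tate_smooth v A.
Proof.
move=> [n [c [pi [f [s [pis tf piker [b Jb]]]]]]].
have [pic piD piM piS] := pis.
pose Pi (c : tateT v n) := pi (tser c).
have PiD x y : Pi (x + y) = Pi x + Pi y by apply: piD; apply: tate_tser.
have Pc a : Pi (cstT v n a) = str A a by rewrite -pic /Pi /= fps_const.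
have PiB : additive Pi.
  by move=> x y; apply: (addIr (Pi y)); rewrite -PiD !subrK.
have PiM : multiplicative Pi.
  split=> [x y|]; first by apply: piM; apply: tate_tser.
  by rewrite -(rmorph1 (cstT v n)) Pc rmorph1.
pose ga := GRing.isAdditive.Build _ _ Pi PiB.
pose gm := GRing.isMultiplicative.Build _ _ Pi PiM.
exists n, c, (HB.pack Pi ga gm : {rmorphism tateT v n -> A}), (fun i => mkT (tf i)), s; split=> //.
- by move=> x; have [d td <-] := piS x; exists (mkT td).
- move=> p; rewrite /= /Pi piker; last exact: tate_tser.
  have E (q : 'I_c -> tateT v n) :
      tser (\sum_i q i * mkT (tf i)) = (fun m => \sum_i ps_mul (tser (q i)) (f i) m).
    by apply/funext => m; rewrite rmorph_sum fps_sum.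
  split=> [[q tq e]|[q ->]].
    by exists (fun i => mkT (tq i)); apply: tser_inj; rewrite E.
  by exists (fun i => tser (q i)); [move=> i; apply: tate_tser|rewrite E].
- by exists b.
Qed.

Section Represented.
Variables (A A' : kalg k) (V : set (set A)) (phi : {rmorphism A -> A'}).
Hypothesis rep : represents v V phi.

Lemma rep_quotient : tate_quotient v A'.
Proof. by case: rep => /affinoid_tate_quotient. Qed.

Lemma rep_uniq (B : kalg k) (f g : {rmorphism A' -> B}) : tate_quotient v B ->
  kalg_mor f -> kalg_mor g -> (forall a, f (phi a) = g (phi a)) -> forall a, f a = g a.
Proof.
move=> qB kf kg fg; have [_ kphi land univ] := rep.
have [||n mn|chi [_ _ chiU] a] := univ B (f \o phi) _ _ _.
- exact/affinoid_tate_quotient.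
- by move=> c; rewrite /= kphi kf.
- exact: (land _ (tate_quotient_pull kf qB mn)).
- by rewrite (chiU f)// (chiU g)// => b; rewrite /= fg.
Qed.

Lemma rep_deriv_uniq (C : kalg k) (psi : {rmorphism A' -> C}) E1 E2 : tate_quotient v C ->
  kalg_mor psi -> derivation_along (str A') psi E1 -> derivation_along (str A') psi E2 ->
  (forall a, E1 (phi a) = E2 (phi a)) -> forall b, E1 b = E2 b.
Proof.
move=> qC kpsi d1 d2 e b; have [g1 g1E] := derivation_hom d1; have [g2 g2E] := derivation_hom d2.
have [_ _ c1] := d1; have [_ _ c2] := d2.
have : g1 b = g2 b; last by rewrite g1E g2E => -[].
apply: (@rep_uniq (kdual C)) => [|c|c|a]; first exact: tate_quotient_dual.
- by rewrite kdual_str g1E kpsi c1.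
- by rewrite kdual_str g2E kpsi c2.
- by rewrite g1E g2E e.
Qed.

(** [a] maps to [(phi a, phi (D a))] in the dual numbers of [A'], which have the same maximal ideals
    as [A']; so this map factors through [A']. The first component of the factorization is the
    identity by uniqueness, the second is the extension. *)
Lemma rep_ext D : kderivation (str A) D ->
  exists2 D', kderivation (str A') D' & forall a, D' (phi a) = phi (D a).
Proof.
move=> [DD DM Dc]; have [_ kphi land univ] := rep.
have [g gE] : exists g : {rmorphism A -> dualn A'}, forall a, g a = (phi a, phi (D a)).
  apply: (@derivation_hom A' k A (str A) phi (fun a => phi (D a))); split=> [a b|a b|c].
  - by rewrite DD rmorphD.
  - by rewrite DM rmorphD !rmorphM.
  - by rewrite Dc rmorph0.
have [i iE] : exists i : {rmorphism A' -> dualn A'}, forall a, i a = (a, 0).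
  apply: (@derivation_hom A' k A' (str A') idfun (fun=> 0)); split=> // a b.
    by rewrite addr0.
  by rewrite !mulr0 addr0.
have qd := tate_quotient_dual rep_quotient.
have [||n mn|chi [kchi chig _]] := univ (kdual A') g _ _ _.
- exact/affinoid_tate_quotient.
- by move=> c; rewrite gE kphi Dc rmorph0 kdual_str.
- have ki : @kalg_mor k A' (kdual A') i by move=> c; rewrite iE kdual_str.
  have hn := max_is_ideal mn.
  pose e : dualn A' := (0, 1).
  have e2 : n (e * e).
    have -> : e * e = 0 by congr pair; rewrite /= ?mulr0 ?mul0r ?addr0.
    exact: ideal0.
  have en : n e by case: (max_prime mn e2).
  (* A maximal ideal contains the square-zero element [e], so second components do not matter. *)
  have -> : pull g n = pull phi (pull i n).
    apply/seteqP; split=> a; rewrite /pull /= gE iE => na.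
      have -> : (phi a, 0) = ((phi a, phi (D a)) : dualn A') - e * ((phi (D a), 0) : dualn A') :> dualn A'.
        by congr pair; rewrite /=; ring.
      by apply: idealB => //; apply: idealMright.
    have -> : (phi a, phi (D a)) = ((phi a, 0) : dualn A') + e * ((phi (D a), 0) : dualn A') :> dualn A'.
      by congr pair; rewrite /=; ring.
    by apply: idealD => //; apply: idealMright.
  exact: (land _ (tate_quotient_pull ki qd mn)).
have pr1_add : additive (fun x : dualn A' => x.1) by [].
have pr1_mul : multiplicative (fun x : dualn A' => x.1) by [].
pose ga := GRing.isAdditive.Build _ _ _ pr1_add.
pose gm := GRing.isMultiplicative.Build _ _ _ pr1_mul.
pose pr1 : {rmorphism dualn A' -> A'} := HB.pack (fun x : dualn A' => x.1) ga gm.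
have chi1 a : (chi a).1 = a.
  apply: (rep_uniq (f := pr1 \o chi) (g := idfun)) => [|c|//|b].
  - exact: rep_quotient.
  - by rewrite /= kchi kdual_str.
  - by rewrite /= chig gE.
exists (fun a => (chi a).2) => [|a]; last by rewrite chig gE.
split=> [a b|a b|c]; first by rewrite rmorphD.
  by rewrite rmorphM /= !chi1.
by rewrite kchi kdual_str.
Qed.

(** The quotient of [A] by the square of the contraction of [m] has a single maximal ideal, lying in
    [V]; so it receives a map [chi] from [A']. By uniqueness, [chi] followed by the map to
    [A' / m ^ 2] is the projection. *)
Lemma rep_onto m : tate_quotient v A -> max_ideal m -> forall b, exists a, idealX m 2 (b - phi a).
Proof.
move=> qA mm b; have [_ kphi land univ] := rep; have hm := max_is_ideal mm.
have mA : max_ideal (pull phi m) by apply: tate_quotient_pull mm => //; exact: rep_quotient.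
have hA := idealX_ideal 2 (max_is_ideal mA); have h2 := idealX_ideal 2 hm.
have [||n mn|chi [kchi chiE _]] := univ (kquot hA) (qpi hA) _ _ _.
- by apply/affinoid_tate_quotient/tate_quotient_kquot.
- by [].
- have -> : pull (qpi hA) n = pull phi m.
    have mp := pull_max (qpi_surj (hI := hA)) mn.
    have [_ _ mx] := mA; apply: mx; [exact: max_is_ideal|move=> a ma|by case: mp].
    suff /(max_prime mp)[] : pull (qpi hA) n (a * a) by [].
    rewrite /pull /= (qpi0 hA (a * a)).2; first exact: ideal0 (max_is_ideal mn).
    exact: idealX2.
  exact: land.
have [ka kaE] : exists ka : {rmorphism quotient hA -> quotient h2}, forall a, ka (qpi hA a) = qpi h2 (phi a).
  apply: (rmorph_factor (pi := qpi hA) (f := qpi h2 \o phi)); first exact: qpi_surj.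
  by move=> a /qpi0 a2; apply/qpi0; apply: idealX2_pull.
have [a ae] := qpi_surj (chi b); exists a; apply/qpi_eq.
rewrite -kaE ae.
apply: (rep_uniq (B := kquot h2) (f := qpi h2) (g := ka \o chi)) => //.
- exact: tate_quotient_kquot rep_quotient.
- by move=> c; rewrite /= kchi /= kaE kphi.
- by move=> x; rewrite /= chiE kaE.
Qed.

End Represented.
End Quotients.

Section RigidCharts.
Variables (R : realType) (k : fieldType) (v : nabs R k).

Lemma aff_subdomain_top (A : kalg k) : affinoid v A -> aff_subdomain v (@max_ideal A).
Proof.
move=> aA; split=> //; exists A, idfun; split=> // B psi aB kpsi _.
by exists psi.
Qed.

Lemma aff_subdomain_adm (A : kalg k) (W : set (set A)) : aff_subdomain v W -> adm_sp v W.
Proof.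
move=> aW; exists [set W]; split.
- by move=> _ ->.
- by rewrite bigcup_set1.
move=> B psi aB kpsi land; exists 1%N, (fun=> @max_ideal B); split.
- by move=> _; apply: aff_subdomain_top.
- by move=> m mm; exists ord0.
- by move=> _; exists W => // m; apply: land.
Qed.

Lemma rigid_base (X : rgspace k) (U : opn X) : affinoid_open v U ->
  exists2 Bs, base_of v U Bs & Bs U.
Proof.
move=> [aU [theta [thm thu thV thC threp]]].
have qU : tate_quotient v (reg_alg U) by apply/affinoid_tate_quotient.
have thinj x y : oset U x -> oset U y -> theta x = theta y -> x = y.
  move=> Ux Uy e; have [z [_ zu]] := thu _ (thm y Uy).
  by rewrite -(zu x) // -(zu y).
exists (fun W => W [<=] U /\ @aff_subdomain R k v (reg_alg U) (theta @` oset W)); last first.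
  split=> //; have -> : theta @` oset U = @max_ideal (reg U).
    apply/seteqP; split=> [_ [x Ux <-]|m mm]; first exact: thm.
    by have [x [[Ux xm] _]] := thu m mm; exists x.
  exact: (aff_subdomain_top (A := reg_alg U)).
have rep (W : opn X) (h : W [<=] U) (aW : @aff_subdomain R k v (reg_alg U) (theta @` oset W)) :
  @represents R k v (reg_alg U) (reg_alg W) (theta @` oset W) (rs h) := threp W h aW.
split.
- by move=> W [].
- move=> V hV; have aV := (thV _ hV).1 (opnP V); have [C [Csub CV Cref]] := aV.
  pose C' := [set W | W `<=` oset U /\ C (theta @` W)].
  have CE : [set theta @` W | W in C'] = C.
    apply/seteqP; split=> [_ [W [_ CW] <-]//|S CS].
    have e : theta @` [set x | oset U x /\ S (theta x)] = S.
      apply/seteqP; split=> [_ [x [_ Sx] <-]//|m Sm].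
      have mm : max_ideal m by case: (Csub _ CS) => /(_ _ Sm).
      by have [x [[Ux xm] _]] := thu m mm; exists x => //; split=> //; rewrite xm.
    exists [set x | oset U x /\ S (theta x)] => //; split; last by rewrite e.
    by move=> x [].
  have C'V W : C' W -> W `<=` oset V.
    move=> [WU CW] x Wx; have : (theta @` oset V) (theta x).
      by rewrite -CV; exists (theta @` W) => //; exists x.
    by move=> [y Vy e]; rewrite (thinj x y)//; [apply: WU|apply: hV].
  exists C' => [|W [WU CW]]; last by split=> //; apply: Csub.
  apply/(thC _ _ hV C'V); split=> //; rewrite CE //.
  by move=> S /Csub; apply: (aff_subdomain_adm (A := reg_alg U)).
- move=> D W h [_ aW] hD.
  exact: (@rep_ext _ _ v (reg_alg U) (reg_alg W) _ _ (rep W h aW) D hD).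
- move=> W V hW h E1 E2 [_ aW] [hV aV] d1 d2 e.
  have qV := rep_quotient (rep V hV aV).
  apply: (@rep_deriv_uniq _ _ v (reg_alg U) (reg_alg W) _ _ (rep W hW aW) (reg_alg V) (rs h)) => //.
  by move=> c; apply: rs_cst.
- by move=> W [h aW]; apply: (rep_quotient (rep W h aW)).
- move=> W h m [_ aW] mm; exact: (@rep_onto _ _ v (reg_alg U) (reg_alg W) _ _ (rep W h aW) m qU mm).
Qed.

Lemma rigid_charted (X : rgspace k) : [pchar k] =i pred0 -> smooth_rigid_space v X -> charted X.
Proof.
move=> ch [_ [C cC CP]]; apply: (base_charted ch cC) => U CU.
have [aU sU] := CP U (fun x h => adm_sub (opnP U) h) CU.
have [Bs bU BU] := rigid_base aU.
by exists R, v, Bs; split=> //; apply: standard_smooth_affinoid_tate.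
Qed.

End RigidCharts.

Lemma smooth_charted (k : fieldType) (X : rgspace k) : [pchar k] =i pred0 ->
  smooth_scheme X \/ (exists (R : realType) (nu : k -> R),
    nonarch_field nu /\ smooth_rigid_space nu X) -> charted X.
Proof.
move=> ch [/(scheme_charted ch)//|[R [nu [nn sX]]]].
pose v := NAbs (nu_ge0 nn) (nu_eq0 nn) (nuM nn) (nuD nn) (nu_complete nn).
exact: (@rigid_charted R k v).
Qed.

(** A point yields a proper ideal in the ring of an affine or affinoid open around it. Faithfulness
    relies on this, as all modules vanish on the empty space. *)
Lemma smooth_reg_neq0 (k : fieldType) (X : rgspace k) (x : point X) : whole x ->
  smooth_scheme X \/ (exists (R : realType) (nu : k -> R),
    nonarch_field nu /\ smooth_rigid_space nu X) ->
  exists U : opn X, (1 : reg U) <> 0.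
Proof.
move=> wx; case=> [[_ [C cC CP]]|[R [nu [_ [_ [C cC CP]]]]]].
  have [_ Ca CU] := cov_adm cC; have [U CU' Ux] : (\bigcup_(W in C) W) x by rewrite CU.
  exists (Opn (Ca _ CU')) => e.
  have [[theta [thp _ _ _]] _] := CP (Opn (Ca _ CU')) (fun y h => adm_sub (Ca _ CU') h) CU'.
  by have [[i0 _ _] n1 _] := thp x Ux; apply: n1; rewrite e.
have [_ Ca CU] := cov_adm cC; have [U CU' Ux] : (\bigcup_(W in C) W) x by rewrite CU.
exists (Opn (Ca _ CU')) => e.
have [[_ [theta [thp _ _ _ _]]] _] := CP (Opn (Ca _ CU')) (fun y h => adm_sub (Ca _ CU') h) CU'.
by have [[i0 _ _] n1 _] := thp x Ux; apply: n1; rewrite e.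
Qed.

(** * Horizontal functions *)

Section Local.
Variables (k : fieldType) (X : rgspace k).

(** [locally] speaks of the members of one covering only. Both conditions must pass to smaller opens
    to hold on a common refinement. *)
Lemma locally_and (U : opn X) (P P' : forall V : opn X, V [<=] U -> Prop) :
  (forall V W (h : V [<=] U) (h' : W [<=] U), W [<=] V -> P V h -> P W h') ->
  (forall V W (h : V [<=] U) (h' : W [<=] U), W [<=] V -> P' V h -> P' W h') ->
  locally P -> locally P' -> locally (fun V (h : V [<=] U) => P V h /\ P' V h).
Proof.
move=> mP mP' [C UC CP] [C' UC' CP'].
exists (\bigcup_(W in C) [set W `&` W' | W' in C']).
  apply: (cov_trans (D := fun W => [set W `&` W' | W' in C']) UC) => W CW.
  have [_ /(_ _ CW) aW _] := cov_adm UC.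
  exact: (cov_restr UC' aW (cov_sub UC CW)).
move=> V h [W CW [W' CW' e]].
have [_ /(_ _ CW) aW _] := cov_adm UC; have [_ /(_ _ CW') aW' _] := cov_adm UC'.
split.
  apply: (mP (Opn aW) V (cov_sub UC CW)); last exact: CP.
  by move=> x; rewrite /= -e => -[].
apply: (mP' (Opn aW') V (cov_sub UC' CW')); last exact: CP'.
by move=> x; rewrite /= -e => -[].
Qed.

Lemma locally_trans (U : opn X) (P : forall V : opn X, V [<=] U -> Prop) C :
  cov (oset U) C ->
  (forall V (h : V [<=] U), C (oset V) -> locally (U := V) (fun W h' => P W (osub_trans h h'))) ->
  locally P.
Proof.
move=> UC CP; have [_ Ca _] := cov_adm UC.
have /choice[D DP] : forall V : set (point X), exists D : set (set (point X)), forall CV : C V,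
    cov V D /\ forall W (h' : W [<=] U), D (oset W) -> P W h'.
  move=> V; have [CV|nC] := pselect (C V); last by exists set0.
  have [D VD DP] := CP (Opn (Ca _ CV)) (cov_sub UC CV) CV; exists D => CV'; split=> // W h' DW.
  have hW : W [<=] Opn (Ca _ CV) by exact: (cov_sub VD DW).
  by rewrite (Prop_irrelevance h' (osub_trans (cov_sub UC CV : Opn (Ca V CV) [<=] U) hW)); apply: DP.
exists (\bigcup_(V in C) D V); first by apply: cov_trans UC _ => V /DP[].
by move=> W h [V CV DW]; have [_] := DP V CV; apply.
Qed.

Lemma locally_restr (U V : opn X) (hV : V [<=] U) (P : forall V : opn X, V [<=] U -> Prop) :
  (forall V W (h : V [<=] U) (h' : W [<=] U), W [<=] V -> P V h -> P W h') ->
  locally P -> locally (U := V) (fun W h => P W (osub_trans hV h)).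
Proof.
move=> mP [C UC CP]; exists [set oset V `&` W | W in C].
  by apply: (cov_restr UC (opnP V)).
move=> N hN [W CW e]; have [_ /(_ _ CW) aW _] := cov_adm UC.
apply: (mP (Opn aW) N (cov_sub UC CW)); last exact: CP.
by move=> x; rewrite /= -e => -[].
Qed.

Lemma locally_imp (U : opn X) (P P' : forall V : opn X, V [<=] U -> Prop) :
  (forall V h, P V h -> P' V h) -> locally P -> locally P'.
Proof. by move=> PP' [C UC CP]; exists C => // V h CV; apply/PP'/CP. Qed.

Lemma reg_locally_eq (U : opn X) (a b : reg U) :
  locally (U := U) (fun V h => rs h a = rs h b) -> a = b.
Proof. by move=> [C UC CP]; apply: (reg_sheaf UC).1. Qed.

Lemma sec_locally_eq (M : omod X) (U : opn X) (x y : sec M U) :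
  locally (U := U) (fun V h => mrs h x = mrs h y) -> x = y.
Proof. by move=> [C UC CP]; apply: (sec_sheaf M UC).1. Qed.

Lemma row_locally_eq n (U : opn X) (a b : 'rV[reg U]_n) :
  locally (U := U) (fun V h => map_mx (rs h) a = map_mx (rs h) b) -> a = b.
Proof.
move=> H; apply/rowP => i; apply: reg_locally_eq; apply: locally_imp H => V h e.
by have := congr1 (fun x : 'rV_n => x 0 i) e; rewrite !mxE.
Qed.

Lemma map_rs_comp n m (U V W : opn X) (h : V [<=] U) (h' : W [<=] V) (h'' : W [<=] U)
  (x : 'M[reg U]_(n, m)) : map_mx (rs h') (map_mx (rs h) x) = map_mx (rs h'') x.
Proof. by apply/matrixP => i j; rewrite !mxE (rs_comp _ _ h''). Qed.

Lemma map_rs_id n m (U : opn X) (h : U [<=] U) (x : 'M[reg U]_(n, m)) : map_mx (rs h) x = x.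
Proof. by apply/matrixP => i j; rewrite !mxE rs_id. Qed.

Lemma map_rs_cst n m (U V : opn X) (h : V [<=] U) (P : 'M[k]_(n, m)) :
  map_mx (rs h) (map_mx (cst U) P) = map_mx (cst V) P.
Proof. by apply/matrixP => i j; rewrite !mxE rs_cst. Qed.

(** Local solutions of a problem with at most one solution agree on overlaps. *)
Lemma glue_row n (U : opn X) (P : forall V : opn X, V [<=] U -> 'rV[reg V]_n -> Prop) :
  (forall V W (h : V [<=] U) (h' : W [<=] U) (h'' : W [<=] V) t,
     P V h t -> P W h' (map_mx (rs h'') t)) ->
  (forall V h t t', P V h t -> P V h t' -> t = t') ->
  locally (U := U) (fun V h => exists t, P V h t) ->
  exists t : 'rV[reg U]_n, locally (U := U) (fun V h => P V h (map_mx (rs h) t)).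
Proof.
move=> Pres Puniq [C UC CP].
have CU (W : opn X) (c : C (oset W)) : W [<=] U := cov_sub UC c.
pose s W (c : C (oset W)) := sval (cid (CP W (CU W c) c)).
have sP W (c : C (oset W)) : P W (CU W c) (s W c) := svalP (cid (CP W (CU W c) c)).
have /choice[t tP] : forall j : 'I_n, exists t : reg U, forall W c (h : W [<=] U), rs h t = s W c 0 j.
  move=> j; apply: ((reg_sheaf UC).2 (fun W c => s W c 0 j)) => W1 W2 W c1 c2 h1 h2.
  have hW : W [<=] U := osub_trans (CU W1 c1) h1.
  have e := Puniq W hW _ _ (Pres _ _ _ hW h1 _ (sP W1 c1)) (Pres _ _ _ hW h2 _ (sP W2 c2)).
  by have := congr1 (fun x : 'rV_n => x 0 j) e; rewrite !mxE.
exists (\row_j t j), C => // W h c.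
have -> : map_mx (rs h) (\row_j t j) = s W c by apply/rowP => j; rewrite !mxE (tP j W c).
by rewrite (Prop_irrelevance h (CU W c)).
Qed.

Lemma tapp_mulmx (U : opn X) (D : tangent U) n m p (x : 'M[reg U]_(p, n)) (P : 'M[k]_(n, m)) :
  map_mx (tapp D) (x *m map_mx (cst U) P) = map_mx (tapp D) x *m map_mx (cst U) P.
Proof.
have [DD DM Dc] := tapp_kder D.
apply/matrixP => i j; rewrite !mxE (big_morph _ DD (kder0 (tapp_kder D))).
by apply: eq_bigr => l _; rewrite !mxE DM Dc mulr0 add0r mulrC.
Qed.

(** It suffices that [K = I + Ann(I)] is the unit ideal. Otherwise a maximal [m] contains [K], and
    by [stable_vanish] some [u] outside [m] kills the generators of [I]; but then [u] is in
    [Ann(I)], hence in [m]. *)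
Lemma chart_idempotent (W : opn X) (I : set (reg W)) : [pchar k] =i pred0 -> chart W ->
  is_ideal I -> (forall (D : tangent W) a, I a -> I (tapp D a)) ->
  exists2 e, I e & forall a, I a -> e * a = a.
Proof.
move=> ch [nW aW [n [D ED]]] hI DI.
pose Ann : set (reg W) := fun b => forall a, I a -> b * a = 0.
pose K : set (reg W) := fun x => exists2 e, I e & Ann (x - e).
have hK : is_ideal K.
  split.
  - by exists 0; [apply: ideal0|move=> a _; rewrite subrr mul0r].
  - move=> x y [e Ie xe] [e' Ie' ye]; exists (e + e'); first exact: idealD.
    by move=> a Ia; rewrite opprD addrACA mulrDl xe// ye// addr0.
  - move=> x y [e Ie ye]; exists (x * e); first exact: idealMleft.
    by move=> a Ia; rewrite -mulrBr -mulrA ye// mulr0.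
have [[e Ie e1]|K1] := pselect (K 1).
  exists e => // a Ia; apply/esym/eqP; rewrite -subr_eq0 -{1}[a]mul1r -mulrBl; apply/eqP; exact: e1.
have [m mm Km] := ex_max_ideal nW hK K1.
have Im a : I a -> m a by move=> Ia; apply: Km; exists a => // b _; rewrite subrr mul0r.
have [s sI sgen] := nW I hI.
have [u mu us] := stable_vanish ch (fun i => tapp_kder (D i)) nW mm (ED m mm) Im
  (fun g i Ig => DI (D i) g Ig) sI.
case: mu; apply: Km; exists 0; first exact: ideal0.
have hJ : is_ideal (fun a => u * a = 0).
  split; first by rewrite mulr0.
    by move=> a b a0 b0; rewrite mulrDr a0 b0 addr0.
  by move=> a b b0; rewrite mulrCA b0 mulr0.
by rewrite subr0 => a Ia; apply: (sgen _ hJ us).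
Qed.

End Local.

Section Constants.
Variables (k : fieldType) (X : rgspace k).
Hypotheses (ch : [pchar k] =i pred0) (cX : charted X).

(** At a point [m] let [p] be the minimal polynomial of the value of [f]: as [p(f)] is
    horizontal and vanishes at [m], it vanishes near [m], hence so does
    [d (p(f)) = p'(f) df], where [p'(f)] is invertible in characteristic 0. *)
Lemma horizontal_differential (Om : omod X) (d : forall U : opn X, reg U -> sec Om U)
    (f : reg (owhole X)) : is_derivation d ->
  (forall W (h : W [<=] owhole X) (D : tangent W), tapp D (rs h f) = 0) -> d _ f = 0.
Proof.
move=> [dD dM dc dres] Df; apply: sec_locally_eq.
have [C' cC' C'P] := cX (cov1 (adm_whole X)).
exists C' => // W h /C'P[[nW aW [n [D ED]]] _].
have d0 : d W 0 = 0 by apply: (addrI (d W 0)); rewrite -dD !addr0.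
have m0 : mrs h (0 : sec Om (owhole X)) = 0.
  by apply: (addrI (mrs h 0)); rewrite -mrs_additive !addr0.
rewrite m0 dres; set g := rs h f.
pose Ann : set (reg W) := fun a => a *: d W g = 0.
have hAnn : is_ideal Ann.
  split; rewrite /Ann; first by rewrite scale0r.
    by move=> a b a0 b0; rewrite scalerDl a0 b0 addr0.
  by move=> a b b0; rewrite -scalerA b0 scaler0.
have [A1|A1] := pselect (Ann 1); first by move: A1; rewrite /Ann scale1r.
have [m mm Am] := ex_max_ideal nW hAnn A1.
have [p [pg pg' _]] := minimal_poly_mod ch mm (aW m g mm).
pose J : set (reg W) := fun z => z = peval (cst W) p g \/ z = 0.
have [|z i|z|u mu us] := stable_vanish ch (fun i => tapp_kder (D i)) nW mm (ED m mm) (J := J)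
  (s := [:: peval (cst W) p g]).
- by move=> z [->|->]; [exact: pg|exact: ideal0 (max_is_ideal mm)].
- have [Da Dm Dc] := tapp_kder (D i); move=> [->|->]; right; last exact: kder0 (tapp_kder _).
  rewrite (peval_derivation (V := (reg W)^o) Da _ Dc) ?Df ?scaler0//.
- by rewrite inE => /eqP ->; left.
have u0 : u * peval (cst W) p g = 0 by apply: us; rewrite mem_head.
(* The further factor [u] removes the term with [d u]. There remains [u ^ 2 p'(g) dg = 0], which
   puts [u ^ 2 p'(g)] in [Ann], hence in [m]: a contradiction. *)
have : u *: d W (u * peval (cst W) p g) = 0 by rewrite u0 d0 scaler0.
rewrite dM scalerDr [X in _ + X]scalerA u0 scale0r addr0 (peval_derivation (dD W) (dM W) (dc W)).
rewrite !scalerA => /Am /(max_prime mm)[|//].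
by move=> /(max_prime mm)[].
Qed.

End Constants.

(** * Stable subsheaves of free modules *)

Section RowCons.
Variables (A : comPzRingType) (m : nat).

Definition rowc (a : A) (y : 'rV[A]_m) : 'rV[A]_m.+1 := row_mx (const_mx a : 'rV_1) y.
Definition rtl (x : 'rV[A]_m.+1) : 'rV[A]_m := rsubmx (x : 'rV_(1 + m)).

Lemma rowc0 a y : rowc a y 0 0 = a.
Proof.
transitivity (row_mx (const_mx a : 'rV_1) y 0 (lshift m (0 : 'I_1))).
  by congr (row_mx _ _ _ _); apply: val_inj.
by rewrite row_mxEl mxE.
Qed.

Lemma rowcS a y i : rowc a y 0 (lift ord0 i) = y 0 i.
Proof.
transitivity (row_mx (const_mx a : 'rV_1) y 0 (rshift 1 i)); last by rewrite row_mxEr.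
by congr (row_mx _ _ _ _); apply: val_inj.
Qed.

Lemma rtlE (x : 'rV[A]_m.+1) i : rtl x 0 i = x 0 (lift ord0 i).
Proof. by rewrite mxE; congr (fun_of_matrix x _ _); apply: val_inj. Qed.

Lemma rtl_rowc a y : rtl (rowc a y) = y. Proof. exact: row_mxKr. Qed.

Lemma rowcE (x : 'rV[A]_m.+1) : x = rowc (x 0 0) (rtl x).
Proof.
apply: (etrans (esym (hsubmxK (x : 'rV_(1 + m))))); congr (row_mx _ _).
by apply/rowP => i; rewrite !mxE ord1; congr (fun_of_matrix x _ _); apply: val_inj.
Qed.

Lemma rowcD a b y z : rowc (a + b) (y + z) = rowc a y + rowc b z.
Proof. by apply/rowP => i; rewrite !mxE; case: split => j; rewrite !mxE. Qed.

Lemma rowcZ c a y : rowc (c * a) (c *: y) = c *: rowc a y.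
Proof. by apply/rowP => i; rewrite !mxE; case: split => j; rewrite !mxE. Qed.


End RowCons.

Lemma map_rowc (A B : comPzRingType) (f : A -> B) m a (y : 'rV_m) :
  map_mx f (rowc a y) = rowc (f a) (map_mx f y).
Proof. by apply/rowP => i; rewrite !mxE; case: split => j; rewrite !mxE. Qed.

Lemma map_rtl (A B : comPzRingType) (f : A -> B) m (x : 'rV_m.+1) :
  map_mx f (rtl x) = rtl (map_mx f x).
Proof. by apply/rowP => i; rewrite !mxE. Qed.

(** The block triangular matrix with block rows [(a, z)] and [(0, P)]. *)
Definition extm (A : comPzRingType) m (a : A) (z : 'rV[A]_m) (P : 'M[A]_m) : 'M[A]_m.+1 :=
  \matrix_(i, j) (if unlift ord0 i is Some i' then rowc 0 (row i' P) else rowc a z) 0 j.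

Lemma map_extm (A B : comPzRingType) (f : {rmorphism A -> B}) m a (z : 'rV_m) P :
  map_mx f (extm a z P) = extm (f a) (map_mx f z) (map_mx f P).
Proof.
have E b y j : f (rowc b y 0 j) = rowc (f b) (map_mx f y) 0 j by rewrite -map_rowc [RHS]mxE.
apply/matrixP => i j; rewrite [LHS]mxE [X in f X]mxE [RHS]mxE; case: unlift => [i'|]; last exact: E.
by rewrite E rmorph0 map_row.
Qed.

Lemma mul_extm (A : comPzRingType) m (x : 'rV_m.+1) (a : A) z P :
  x *m extm a z P = rowc (x 0 0 * a) (x 0 0 *: z + rtl x *m P).
Proof.
apply/rowP => j; rewrite mxE big_ord_recl mxE unlift_none.
under eq_bigr => i _ do rewrite mxE liftK.
case: (unliftP ord0 j) => [l|] ->; last first.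
  by rewrite !rowc0 big1 ?addr0// => i _; rewrite rowc0 mulr0.
rewrite !rowcS [RHS]mxE; congr (_ + _); rewrite [RHS]mxE//; apply: eq_bigr => i _.
by rewrite rowcS rtlE mxE.
Qed.

(** * Stable finitely generated subsheaves are cut out by constants *)

Section Engine.
Variables (k : fieldType) (X : rgspace k) (G H : groupType) (act : gact (dprod G H) X).
Hypotheses (ch : [pchar k] =i pred0) (cX : charted X).

Definition horizontal (f : reg (owhole X)) : Prop :=
  forall W (h : W [<=] owhole X) (D : tangent W), tapp D (rs h f) = 0.

Hypothesis cst_inj : injective (cst (owhole X)).
Hypothesis cstP : forall f, horizontal f ->
  (forall g : G, oact (within_whole act (inG H g)) f = f) -> exists c, f = cst (owhole X) c.

Record stable_sub m (Q : forall U : opn X, set 'rV[reg U]_m) : Prop := {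
  ss_sub : forall U, is_submod (Q U);
  ss_res : forall U V (h : V [<=] U) x, Q U x -> Q V (map_mx (rs h) x);
  ss_loc : forall U x, locally (U := U) (fun V h => Q V (map_mx (rs h) x)) -> Q U x;
  ss_der : forall U (D : tangent U) x, Q U x -> Q U (map_mx (tapp D) x);
  ss_act : forall g U V (h : within act (inG H g) V U) x, Q U x -> Q V (map_mx (oact h) x);
  ss_fg : locally (U := owhole X) (fun W _ => exists n (s : 'I_n -> 'rV[reg W]_m),
    (forall i, Q W (s i)) /\ forall V (h : V [<=] W) x, Q V x ->
      locally (U := V) (fun V' h' => exists c : 'I_n -> reg V',
        map_mx (rs h') x = \sum_i c i *: map_mx (rs (osub_trans h h')) (s i))) }.

Lemma sep_trans (g : G) C n (x y : 'rV[reg (owhole X)]_n) : cov (whole (g := X)) C ->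
  (forall W (h : otrans act (inG H g) W [<=] owhole X), C (oset W) ->
     map_mx (rs h) x = map_mx (rs h) y) -> x = y.
Proof.
move=> cC H0; apply: row_locally_eq.
have := pact_cov act (inG H g) cC; have -> : translate act (inG H g) (whole (g := X)) = whole (g := X).
  by apply/seteqP; split=> z; [case|move=> wz; split=> //; apply: pact_whole].
move=> cC'; exists [set translate act (inG H g) W | W in C] => // V hV [W CW e].
have [_ /(_ _ CW) aW _] := cov_adm cC.
have eV : V = otrans act (inG H g) (Opn aW) by case: V hV e => V aV /= _ e; subst V; congr Opn; apply: Prop_irrelevance.
by subst V; apply: H0.
Qed.

Section Step.
Variables (m : nat) (Q : forall U : opn X, set 'rV[reg U]_m.+1).
Arguments Q : clear implicits.
Hypothesis SQ : stable_sub Q.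

(** On each chart the first coordinates of [Q] form a stable ideal, so an idempotent generates it.
    An idempotent generator is unique, which gives gluing and [G]-invariance. *)
Lemma stable_sub_first : exists e : reg (owhole X),
  [/\ horizontal e, forall g : G, oact (within_whole act (inG H g)) e = e,
      forall V (h : V [<=] owhole X) x, Q V x -> rs h e * x 0 0 = x 0 0
    & locally (U := owhole X) (fun W h => exists2 y, Q W y & y 0 0 = rs h e)].
Proof.
(* [t] is a first coordinate and acts as identity on all of them, also over smaller opens. Two such
   elements agree, since each equals their product. *)
pose P V (h : V [<=] owhole X) (t : 'rV[reg V]_1) := (exists2 y, Q V y & y 0 0 = t 0 0) /\
  forall W (h' : W [<=] V) x, Q W x -> rs h' (t 0 0) * x 0 0 = x 0 0.
have [|V h t t' [[y Qy yt] tP] [[y' Qy' yt'] tP']||t tloc] := @glue_row k X 1 (owhole X) P.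
- move=> V W h h' h'' t [[y Qy yt] tP]; split.
    by exists (map_mx (rs h'') y); [apply: ss_res SQ _ _ _ _ Qy|rewrite !mxE yt].
  by move=> N hN x Qx; rewrite mxE (rs_comp _ _ (osub_trans h'' hN)); apply: tP.
- apply/rowP => i; rewrite ord1; have := tP' _ (osub_refl V) _ Qy; have := tP _ (osub_refl V) _ Qy'.
  by rewrite !rs_id yt yt' mulrC => -> ->.
- have [C cC CP] := ss_fg SQ; have [C' cC' C'P] := cX cC.
  exists C' => // W h /C'P[chW [W0 CW0 WW0]].
  have [_ /(_ _ CW0) aW0 _] := cov_adm cC.
  have [n [s [Qs sgen]]] := CP (Opn aW0) (adm_sub aW0) CW0.
  have hW : W [<=] Opn aW0 := WW0.
  pose I : set (reg W) := fun a => exists2 y, Q W y & y 0 0 = a.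
  have [Q0 QD QZ] := ss_sub SQ W.
  have hI : is_ideal I.
    split; first by exists 0; rewrite ?mxE.
      by move=> a b [x Qx <-] [y Qy <-]; exists (x + y); rewrite ?mxE//; apply: QD.
    by move=> a b [x Qx <-]; exists (a *: x); rewrite ?mxE//; apply: QZ.
  have [D a [y Qy <-]|e Ie eI] := chart_idempotent ch chW hI.
    by exists (map_mx (tapp D) y); rewrite ?mxE//; apply: ss_der.
  exists (const_mx e); split; first by have [y Qy ye] := Ie; exists y; rewrite ?mxE.
  move=> V hV x Qx; apply: reg_locally_eq.
  apply: locally_imp (sgen V (osub_trans hW hV) x Qx) => V' h' [c xc].
  have -> : rs h' (x 0 0) = \sum_i c i * rs (osub_trans (osub_trans hW hV) h') (s i 0 0).
    have := congr1 (fun x : 'rV_m.+1 => x 0 0) xc; rewrite mxE summxE => ->.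
    by apply: eq_bigr => i _; rewrite !mxE.
  rewrite rmorphM mxE.
  have -> : rs h' (x 0 0) = \sum_i c i * rs (osub_trans hV h') (rs hW (s i 0 0)).
    have := congr1 (fun x : 'rV_m.+1 => x 0 0) xc; rewrite mxE summxE => ->.
    by apply: eq_bigr => i _; rewrite !mxE (rs_comp _ _ (osub_trans (osub_trans hW hV) h')).
  rewrite (rs_comp _ _ (osub_trans hV h')) mulr_sumr; apply: eq_bigr => i _.
  rewrite mulrCA -rmorphM eI ?(rs_comp _ _ (osub_trans (osub_trans hW hV) h'))//.
  by exists (map_mx (rs hW) (s i)); rewrite ?mxE//; apply: ss_res SQ _ _ _ _ (Qs i).
pose e := t 0 0; exists e.
have E1 V (h : V [<=] owhole X) x : Q V x -> rs h e * x 0 0 = x 0 0.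
  move=> Qx; apply: reg_locally_eq; have [C cC CP] := tloc.
  exists [set oset V `&` W | W in C]; first by apply: (cov_restr cC (opnP V)).
  move=> N hN [W CW eN]; have [_ /(_ _ CW) aW _] := cov_adm cC.
  have [_ tP] := CP (Opn aW) (adm_sub aW) CW.
  have hN' : N [<=] Opn aW by move=> z; rewrite /= -eN => -[].
  have := tP N hN' (map_mx (rs hN) x) (ss_res SQ hN Qx).
  by rewrite !mxE rmorphM !(rs_comp _ _ (osub_trans h hN)).
have E2 : locally (U := owhole X) (fun W h => exists2 y, Q W y & y 0 0 = rs h e).
  by apply: locally_imp tloc => W h [[y Qy ye] _]; exists y; rewrite ?ye ?mxE.
have ee : e * e = e.
  apply: reg_locally_eq; apply: locally_imp E2 => W h [y Qy ye].
  by rewrite rmorphM -{2 3}ye E1.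
have eg (g : G) : e * oact (within_whole act (inG H g)) e = oact (within_whole act (inG H g)) e.
  have [C cC CP] := E2.
  suff : const_mx (e * oact (within_whole act (inG H g)) e) = const_mx (oact (within_whole act (inG H g)) e) :> 'rV_1.
    by move=> /rowP/(_ 0); rewrite !mxE.
  apply: (sep_trans (g := g) cC) => W h CW; apply/rowP => i; rewrite !mxE rmorphM.
  have [y Qy ye] := CP W (adm_sub (opnP W)) CW.
  have := E1 _ h _ (ss_act SQ (@within_trans _ _ _ act (inG H g) W) Qy); rewrite mxE ye.
  suff -> : oact (@within_trans _ _ _ act (inG H g) W) (rs (adm_sub (opnP W) : W [<=] owhole X) e) =
    rs h (oact (within_whole act (inG H g)) e) by [].
  rewrite -(oact1 (osub_within (act := act) h)) -(oact1 (osub_within (act := act) (adm_sub (opnP W) : W [<=] owhole X))).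
  by apply: oact_comm; rewrite mul1g mulg1.
split=> // [W h D|g].
  (* Idempotents are horizontal: [D a = 2 a D a], and multiplication by [a] gives [a D a = 0]. *)
  set a := rs h e; have aa : a * a = a by rewrite /a -rmorphM ee.
  have [_ DM _] := tapp_kder D; have := DM a a; rewrite aa => e1.
  have e2 : a * tapp D a = 0.
    have := congr1 (fun z => a * z) e1; rewrite mulrDr mulrA aa => /esym/eqP.
    by rewrite -subr_eq0 addrK => /eqP.
  by rewrite e1 e2 addr0.
(* The two ideals contain each other: [e] fixes its translate by [g], and the same fact for the
   inverse of [g], translated by [g], is the converse. *)
have e1 := eg g; have := congr1 (oact (within_whole act (inG H g))) (eg g^-1%g).
rewrite rmorphM (oact_comm _ _ (within_whole act 1%g) (within_whole act 1%g)).
  rewrite !(oact1 _ (osub_refl (owhole X))) !rs_id => e2.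
  by rewrite -[RHS]e2 mulrC e1.
by congr pair; rewrite /= ?mulg1 ?mulgV.
Qed.

(** The point is finite generation. Let [y] have first coordinate [e]; the elements
    [s i - s i 0 0 *: y] have first coordinate 0, and a combination of the [s i] with first
    coordinate 0 is unchanged by these corrections. *)
Lemma stable_sub_tail (e : reg (owhole X)) :
  (forall V (h : V [<=] owhole X) x, Q V x -> rs h e * x 0 0 = x 0 0) ->
  locally (U := owhole X) (fun W h => exists2 y, Q W y & y 0 0 = rs h e) ->
  stable_sub (fun V y => Q V (rowc 0 y)).
Proof.
move=> E1 E2; split.
- move=> U; have [Q0 QD QZ] := ss_sub SQ U; split.
  + suff -> : rowc 0 0 = 0 :> 'rV[reg U]_m.+1 by [].
    by apply/rowP => i; rewrite !mxE; case: split => j; rewrite mxE.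
  + by move=> x y Qx Qy; rewrite -[0]addr0 rowcD; apply: QD.
  + by move=> a x Qx; rewrite -(mulr0 a) rowcZ; apply: QZ.
- by move=> U V h x Qx; rewrite -(rmorph0 (rs h)) -map_rowc; apply: ss_res SQ _ _ _ _ Qx.
- move=> U x Qx; apply: (ss_loc SQ); apply: locally_imp Qx => V h.
  by rewrite map_rowc rmorph0.
- move=> U D x Qx; rewrite -(kder0 (tapp_kder D)) -map_rowc; exact: ss_der.
- by move=> g U V h x Qx; rewrite -(rmorph0 (oact h)) -map_rowc; apply: ss_act.
pose P W (h : W [<=] owhole X) := exists n (s : 'I_n -> 'rV[reg W]_m.+1),
    (forall i, Q W (s i)) /\ forall V (h : V [<=] W) x, Q V x ->
      locally (U := V) (fun V' h' => exists c : 'I_n -> reg V',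
        map_mx (rs h') x = \sum_i c i *: map_mx (rs (osub_trans h h')) (s i)).
have [] := @locally_and k X _ P (fun W h => exists2 y, Q W y & y 0 0 = rs h e) _ _ (ss_fg SQ) E2.
- move=> V W h h' hWV [n [s [Qs sgen]]]; exists n, (fun i => map_mx (rs hWV) (s i)); split.
    by move=> i; apply: ss_res SQ _ _ _ _ (Qs i).
  move=> N hN x Qx; apply: locally_imp (sgen N (osub_trans hWV hN) x Qx) => V' h1 [c ->].
  exists c; apply: eq_bigr => i _.
  by rewrite (map_rs_comp _ _ (osub_trans (osub_trans hWV hN) h1)).
- move=> V W h h' hWV [y Qy ye]; exists (map_mx (rs hWV) y); first exact: ss_res SQ _ _ _ _ Qy.
  by rewrite mxE ye (rs_comp _ _ h').
move=> C cC CP; exists C => // W h /CP-/(_ h)[[n [s [Qs sgen]]] [y Qy ye]].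
exists n, (fun i => rtl (s i - s i 0 0 *: y)).
have [Q0 QD QZ] := ss_sub SQ W.
have s0 i : rowc 0 (rtl (s i - s i 0 0 *: y)) = s i - s i 0 0 *: y.
  rewrite [RHS]rowcE; congr rowc; rewrite !mxE ye mulrC.
  have := E1 W h _ (Qs i); by move=> ->; rewrite subrr.
split=> [i|V hV x Qx].
  by rewrite s0; apply: (submodB (ss_sub SQ W) (Qs i)); apply: (QZ).
apply: locally_imp (sgen V hV _ Qx) => V' h' [c xc]; exists c.
have c0 : \sum_i c i * rs (osub_trans hV h') (s i 0 0) = 0.
  have := congr1 (fun x : 'rV_m.+1 => x 0 0) xc; rewrite map_rowc rowc0 rmorph0 summxE => /esym.
  by under eq_bigr do rewrite !mxE.
have := congr1 (@rtl _ _) xc; rewrite map_rowc rtl_rowc => ->.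
have -> : \sum_i c i *: map_mx (rs (osub_trans hV h')) (rtl (s i - s i 0 0 *: y)) =
  rtl (\sum_i c i *: map_mx (rs (osub_trans hV h')) (s i)) -
  (\sum_i c i * rs (osub_trans hV h') (s i 0 0)) *: map_mx (rs (osub_trans hV h')) (rtl y).
  apply/rowP => j; rewrite !mxE !summxE mulr_suml -sumrB; apply: eq_bigr => i _.
  by rewrite !mxE rmorphB rmorphM mulrBr mulrA.
by rewrite c0 scale0r subr0.
Qed.

End Step.

(** Induction on [m]. The idempotent of the first coordinates is a constant, hence 0 or 1, and the
    rows with first coordinate 0 are the kernel of a constant [Pi]. *)
Lemma stable_sub_const m (Q : forall U : opn X, set 'rV[reg U]_m) : stable_sub Q ->
  exists Pi : 'M[k]_m, Pi *m Pi = Pi /\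
    forall U (x : 'rV[reg U]_m), Q U x <-> x *m map_mx (cst U) Pi = 0.
Proof.
elim: m Q => [|m IH] Q SQ.
  exists 0; split=> [|U x]; first by rewrite mul0mx.
  by rewrite !thinmx0; split=> // _; case: (ss_sub SQ U).
have [e [He Ge E1 E2]] := stable_sub_first SQ.
have SQ' := stable_sub_tail SQ E1 E2; have [Pi [Pi2 PiQ]] := IH _ SQ'.
have {He Ge} [c ec] := cstP He Ge.
have cc : c * c = c.
  apply: cst_inj; rewrite rmorphM -ec.
  apply: reg_locally_eq; apply: locally_imp E2 => W h [y Qy ye].
  by rewrite rmorphM -{2 3}ye E1.
have rsE V (h : V [<=] owhole X) : rs h e = cst V c by rewrite ec rs_cst.
(* For [c = 0] the first coordinate vanishes on [Q]; the entry 1 of the block matrix imposes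
   this. *)
have [c0|c0] := eqVneq c 0.
  exists (extm 1 0 Pi); split.
    apply/row_matrixP => i; rewrite row_mul rowE !mul_extm !rtl_rowc !rowc0 !scaler0 !add0r !mulr1.
    by rewrite -mulmxA Pi2.
  move=> U x; rewrite map_extm mul_extm map_mx0 scaler0 add0r rmorph1 mulr1.
  have hU : U [<=] owhole X := adm_sub (opnP U).
  split=> [Qx|xP].
    have x0 : x 0 0 = 0 by rewrite -(E1 U hU x Qx) rsE c0 rmorph0 mul0r.
    have : Q U (rowc 0 (rtl x)) by rewrite -x0 -rowcE.
    by move=> /PiQ ->; rewrite x0; apply/rowP => j; rewrite !mxE; case: split => l; rewrite mxE.
  have x0 : x 0 0 = 0.
    by have := congr1 (fun x : 'rV_m.+1 => x 0 0) xP; rewrite rowc0 mxE.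
  rewrite [x]rowcE x0; apply/PiQ; have := congr1 (@rtl _ _) xP; rewrite rtl_rowc => ->.
  by apply/rowP => j; rewrite !mxE.
have {c0 cc rsE} e1 V (h : V [<=] owhole X) : rs h e = 1.
  have c1 : c = 1 by apply: (mulfI c0); rewrite cc mulr1.
  by rewrite rsE c1 rmorph1.
have dec U (x : 'rV[reg U]_m.+1) y : x - x 0 0 *: rowc 1 y = rowc 0 (rtl x - x 0 0 *: y).
  rewrite {1}[x]rowcE -rowcZ mulr1 -scaleN1r -rowcZ -rowcD mulN1r subrr.
  by rewrite scaleN1r.
(* For [c = 1] there are local rows [(1, y)] in [Q], with [y] unique modulo the kernel of [Pi]. So
   [y Pi] is unique and glues to the row [zz], and [Q] is the set of [x] whose tail [x'] satisfies
   [x' Pi = x_0 zz]. *)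
pose P V (h : V [<=] owhole X) t := exists2 y, Q V (rowc 1 y) & t = y *m map_mx (cst V) Pi.
have Pres V W (h : V [<=] owhole X) (h' : W [<=] owhole X) (h'' : W [<=] V) t :
    P V h t -> P W h' (map_mx (rs h'') t).
  move=> [y Qy ->]; exists (map_mx (rs h'') y); last by rewrite map_mxM map_rs_cst.
  by rewrite -(rmorph1 (rs h'')) -map_rowc; apply: ss_res SQ _ _ _ _ Qy.
have Pdec V (h : V [<=] owhole X) t x : P V h t -> (Q V x <-> rtl x *m map_mx (cst V) Pi = x 0 0 *: t).
  move=> [y Qy ->]; have [_ QD QZ] := ss_sub SQ V; split=> [Qx|xP].
    have : Q V (x - x 0 0 *: rowc 1 y) by apply: (submodB (ss_sub SQ V) Qx); apply: QZ.
    by rewrite dec => /PiQ/eqP; rewrite mulmxBl -scalemxAl subr_eq0 => /eqP.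
  rewrite -[x](subrK (x 0 0 *: rowc 1 y)); apply: QD; last exact: QZ.
  by rewrite dec; apply/PiQ; rewrite mulmxBl -scalemxAl xP subrr.
have [V h t t' Pt [y Qy ->]||zz Zloc] := @glue_row k X m (owhole X) P Pres.
- by have := (Pdec V h t _ Pt).1 Qy; rewrite rtl_rowc rowc0 scale1r.
- apply: locally_imp E2 => W h [y Qy ye]; exists (rtl y *m map_mx (cst W) Pi), (rtl y) => //.
  by rewrite -(e1 W h) -ye -rowcE.
have mP V W (h : V [<=] owhole X) (h' : W [<=] owhole X) : W [<=] V ->
    P V h (map_mx (rs h) zz) -> P W h' (map_mx (rs h') zz).
  by move=> hWV /(Pres V W h h' hWV); rewrite (map_rs_comp _ _ h').
have Z1 V (h : V [<=] owhole X) x : Q V x <-> rtl x *m map_mx (cst V) Pi = x 0 0 *: map_mx (rs h) zz.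
  split=> [Qx|xP].
    apply: row_locally_eq; apply: locally_imp (locally_restr h mP Zloc) => N hN PN.
    have := (Pdec N _ _ _ PN).1 (ss_res SQ hN Qx).
    by rewrite map_mxM map_rs_cst map_rtl map_mxZ (map_rs_comp _ _ (osub_trans h hN)) mxE.
  apply: (ss_loc SQ); apply: locally_imp (locally_restr h mP Zloc) => N hN PN.
  apply/(Pdec N _ _ _ PN); have := congr1 (map_mx (rs hN)) xP.
  by rewrite map_mxM map_rs_cst map_rtl map_mxZ (map_rs_comp _ _ (osub_trans h hN)) mxE.
(* The derivative of [(1, y)] is [(0, D y)], which again lies in [Q], so [Pi] kills [D y]. *)
have Zhor j : horizontal (zz 0 j).
  move=> W h D; apply: reg_locally_eq; apply: locally_imp (locally_restr h mP Zloc) => N hN [y Qy ze].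
  rewrite -tapp_restr rmorph0 (rs_comp _ _ (osub_trans h hN)).
  have D1 : tapp (restr_tangent hN D) 1 = 0.
    by have [_ _ Dc] := tapp_kder (restr_tangent hN D); rewrite -(rmorph1 (cst N)) Dc.
  have := ss_der SQ (restr_tangent hN D) Qy; rewrite map_rowc D1 => /PiQ.
  rewrite -tapp_mulmx -ze => /rowP/(_ j); by rewrite !mxE.
have Zinv (g : G) : map_mx (oact (within_whole act (inG H g))) zz = zz.
  have [C cC CP] := Zloc.
  apply: (sep_trans (g := g) cC) => W h CW.
  have [y Qy ye] := CP W (adm_sub (opnP W)) CW.
  have := (Z1 _ h _).1 (ss_act SQ (@within_trans _ _ _ act (inG H g) W) Qy).
  rewrite map_rowc rtl_rowc rowc0 rmorph1 scale1r => <-.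
  have -> : map_mx (cst (otrans act (inG H g) W)) Pi =
      map_mx (oact (@within_trans _ _ _ act (inG H g) W)) (map_mx (cst W) Pi).
    by apply/matrixP => i j; rewrite !mxE oact_cst.
  rewrite -map_mxM -ye; apply/rowP => j; rewrite !mxE.
  rewrite -(oact1 (osub_within (act := act) h)) -(oact1 (osub_within (act := act) (adm_sub (opnP W) : W [<=] owhole X))).
  by apply: oact_comm; rewrite mul1g mulg1.
have /choice[zk zkE] : forall j, exists c, zz 0 j = cst (owhole X) c.
  move=> j; apply: cstP => // g; have := congr1 (fun x : 'rV_m => x 0 j) (Zinv g).
  by rewrite mxE.
have zzE : zz = map_mx (cst (owhole X)) (\row_j zk j) by apply/rowP => j; rewrite !mxE.
have zkP : (\row_j zk j) *m Pi = \row_j zk j.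
  have : zz *m map_mx (cst (owhole X)) Pi = zz.
    apply: row_locally_eq; apply: locally_imp Zloc => N hN [y _ ze].
    by rewrite map_mxM map_rs_cst ze -mulmxA -map_mxM Pi2.
  rewrite zzE -map_mxM => /rowP E; apply/rowP => j; apply: cst_inj.
  by have := E j; rewrite [in LHS]mxE [in RHS]mxE.
exists (extm 0 (- \row_j zk j) Pi); split.
  apply/row_matrixP => i; rewrite row_mul rowE !mul_extm !rtl_rowc !rowc0 !mulr0 scale0r add0r.
  by rewrite mulmxDl -mulmxA Pi2 -scalemxAl mulNmx zkP.
move=> U x; have h : U [<=] owhole X := adm_sub (opnP U).
rewrite map_extm mul_extm rmorph0 mulr0 (Z1 U h) zzE map_rs_cst map_mxN scalerN addrC.
split=> [->|/(congr1 (@rtl _ _))]; first by rewrite subrr; apply/rowP => j; rewrite !mxE; case: split => l; rewrite mxE.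
rewrite rtl_rowc => /eqP; have -> : rtl (0 : 'rV[reg U]_m.+1) = 0 by apply/rowP => j; rewrite !mxE.
by rewrite subr_eq0 => /eqP.
Qed.

End Engine.

(** * Frames *)

Lemma locally_all (k : fieldType) (X : rgspace k) (U : opn X) n
    (P : 'I_n -> forall V : opn X, V [<=] U -> Prop) :
  (forall i V W (h : V [<=] U) (h' : W [<=] U), W [<=] V -> P i V h -> P i W h') ->
  (forall i, locally (P i)) -> locally (fun V (h : V [<=] U) => forall i, P i V h).
Proof.
elim: n P => [|n IH] P mP lP; first by apply: locally_triv => V h [].
have [] := @locally_and k X U (P ord0) (fun V h => forall i, P (lift ord0 i) V h) (mP ord0) _ (lP ord0)
  (IH (fun i => P (lift ord0 i)) (fun i => mP _) (fun i => lP _)).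
  by move=> V W h h' hWV H i; apply: mP hWV (H i).
move=> C cC CP; exists C => // V h /CP-/(_ h)[P0 PS] i.
by case: (unliftP ord0 i) => [j|] ->.
Qed.

Section Frames.
Variables (k : fieldType) (X : rgspace k) (M : omod X).

Definition frame r (W : opn X) (e : 'I_r -> sec M W) : Prop :=
  forall V (h : V [<=] W) (x : sec M V),
    exists! c : {ffun 'I_r -> reg V}, x = \sum_i c i *: mrs h (e i).

(** A section over [W] of the dual sheaf of [M]. *)
Definition covector (W : opn X) (la : forall V, V [<=] W -> sec M V -> reg V) : Prop :=
  (forall V h (a : reg V) x y, la V h (a *: x + y) = a * la V h x + la V h y) /\
  forall V V' (h : V [<=] W) (h' : V' [<=] W) (h'' : V' [<=] V) x,
    rs h'' (la V h x) = la V' h' (mrs h'' x).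

Lemma mrs0 (U V : opn X) (h : V [<=] U) : mrs h (0 : sec M U) = 0.
Proof. by apply: (addrI (mrs h 0)); rewrite -mrs_additive !addr0. Qed.

Lemma mrs_sum (U V : opn X) (h : V [<=] U) I (r : seq I) (F : I -> sec M U) :
  mrs h (\sum_(i <- r) F i) = \sum_(i <- r) mrs h (F i).
Proof. exact: (big_morph _ (mrs_additive h) (mrs0 h)). Qed.

Lemma covector_sum (W : opn X) la V (h : V [<=] W) I (r : seq I) (F : I -> sec M V)
    (c : I -> reg V) : covector la ->
  la V h (\sum_(i <- r) c i *: F i) = \sum_(i <- r) c i * la V h (F i).
Proof.
move=> [lin _]; have la0 : la V h 0 = 0.
  have := lin V h 1 0 0; rewrite scale1r mul1r addr0 => e.
  by apply: (addrI (la V h 0)); rewrite -e addr0.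
elim: r => [|i r IH]; first by rewrite !big_nil.
by rewrite !big_cons lin IH.
Qed.

Lemma covector_restr (W W' : opn X) (h : W' [<=] W) la :
  covector (W := W) la -> covector (W := W') (fun V hV => la V (osub_trans h hV)).
Proof. by move=> [l1 l2]; split=> [V hV a x y|V V' h1 h2 h3 x]; [apply: l1|apply: l2]. Qed.

Lemma frame_dual r (W : opn X) (e : 'I_r -> sec M W) : frame e ->
  exists la : 'I_r -> forall V, V [<=] W -> sec M V -> reg V,
    (forall i, covector (la i)) /\ forall V (h : V [<=] W) x, x = \sum_i la i V h x *: mrs h (e i).
Proof.
move=> fe; pose co V (h : V [<=] W) x := sval (cid (fe V h x)).
have coE V (h : V [<=] W) x : x = \sum_i co V h x i *: mrs h (e i).
  by have [] := svalP (cid (fe V h x)).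
have coU V (h : V [<=] W) x (c : {ffun 'I_r -> reg V}) : x = \sum_i c i *: mrs h (e i) -> co V h x = c.
  by move=> xc; have [_] := svalP (cid (fe V h x)); apply.
exists (fun i V h x => co V h x i); split=> [i|V h x]; last exact: coE.
split=> [V h a x y|V V' h h' h'' x].
  suff -> : co V h (a *: x + y) = [ffun i => a * co V h x i + co V h y i] by rewrite ffunE.
  apply: coU; rewrite {1}(coE V h x) {1}(coE V h y) scaler_sumr -big_split.
  by apply: eq_bigr => j _; rewrite ffunE scalerDl scalerA.
suff -> : co V' h' (mrs h'' x) = [ffun i => rs h'' (co V h x i)] by rewrite ffunE.
apply: coU; rewrite {1}(coE V h x) mrs_sum; apply: eq_bigr => j _.
by rewrite ffunE mrs_scale (mrs_comp _ _ h').
Qed.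

(** Independence makes the local coefficients unique, so they glue. *)
Lemma frame_glue r (s : 'I_r -> sec M (owhole X)) :
  (forall V (h : V [<=] owhole X) (c : 'I_r -> reg V), \sum_i c i *: mrs h (s i) = 0 -> forall i, c i = 0) ->
  (forall V (h : V [<=] owhole X) (x : sec M V), locally (U := V) (fun N hN =>
    exists c : 'I_r -> reg N, mrs hN x = \sum_i c i *: mrs (osub_trans h hN) (s i))) ->
  frame s.
Proof.
move=> inj loc V h x.
have U1 N (hN : N [<=] owhole X) (c c' : 'I_r -> reg N) :
    \sum_i c i *: mrs hN (s i) = \sum_i c' i *: mrs hN (s i) -> forall i, c i = c' i.
  move=> cc i; apply/eqP; rewrite -subr_eq0; apply/eqP.
  apply: (inj N hN (fun i => c i - c' i)); apply/eqP.
  under eq_bigr do rewrite scalerBl.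
  by rewrite sumrB subr_eq0 cc.
pose P N (hN : N [<=] V) (t : 'rV[reg N]_r) :=
  mrs hN x = \sum_i t 0 i *: mrs (osub_trans h hN) (s i).
have [V1 V2 h1 h2 h3 t|||t tloc] := @glue_row k X r V P.
- rewrite /P => xt; rewrite -(mrs_comp h1 h3) xt mrs_sum; apply: eq_bigr => i _.
  by rewrite mxE mrs_scale (mrs_comp _ _ (osub_trans h h2)).
- by rewrite /P => N hN t t' -> e; apply/rowP => i; apply: (U1 _ _ (fun i => t 0 i) (fun i => t' 0 i) e).
- apply: locally_imp (loc V h x) => N hN [c cE].
  by exists (\row_i c i); rewrite /P cE; apply: eq_bigr => i _; rewrite mxE.
exists [ffun i => t 0 i]; split.
  apply: sec_locally_eq; apply: locally_imp tloc => N hN; rewrite /P => ->.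
  rewrite mrs_sum; apply: eq_bigr => i _.
  by rewrite mxE ffunE mrs_scale (mrs_comp _ _ (osub_trans h hN)).
move=> c xc; apply/ffunP => i; rewrite ffunE; apply: (U1 V h (fun i => t 0 i) c); rewrite -xc.
apply/esym; apply: sec_locally_eq; apply: locally_imp tloc => N hN; rewrite /P => ->.
rewrite mrs_sum; apply: eq_bigr => j _.
by rewrite mxE mrs_scale (mrs_comp _ _ (osub_trans h hN)).
Qed.

Lemma frame_rank r (s : 'I_r -> sec M (owhole X)) : frame s -> has_rank M r.
Proof.
move=> fs; apply: locally_triv => W h; exists (fun i => mrs h (s i)) => V hV x.
have [c [xc cu]] := fs V (osub_trans h hV) x; exists c; split=> [|c' xc'].
  by rewrite xc; apply: eq_bigr => i _; rewrite (mrs_comp _ _ (osub_trans h hV)).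
apply: cu; rewrite xc'; apply: eq_bigr => i _; rewrite (mrs_comp _ _ (osub_trans h hV)).
by [].
Qed.

End Frames.

(** * Flat sections *)

Definition subw (k : fieldType) (X : rgspace k) (U : opn X) : U [<=] owhole X := adm_sub (opnP U).
Arguments subw {k X} U.

Section Flat.
Variables (k : fieldType) (X : rgspace k) (G H : groupType) (act : gact (dprod G H) X).


Section Object.
Variable M : vectcon act.

(** By [homGD_flat] and [flat_homGD] these sections are the images of 1 under the [G]-equivariant
    [D]-linear morphisms from the structure sheaf. *)
Definition flat (x : sec M (owhole X)) : Prop :=
  (forall V (h : V [<=] owhole X) (D : tangent V), nab D (mrs h x) = 0) /\
  forall g : G, eact (within_whole act (inG H g)) x = x.

Lemma nab_sum (U : opn X) (D : tangent U) I (r : seq I) (F : I -> sec M U) :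
  nab D (\sum_(i <- r) F i) = \sum_(i <- r) nab D (F i).
Proof. by apply: big_morph => [x y|]; [apply: nabD|apply: nab0]. Qed.

Lemma eact_sum g (U V : opn X) (h : within act g V U) I (r : seq I) (F : I -> sec M U) :
  eact h (\sum_(i <- r) F i) = \sum_(i <- r) eact h (F i).
Proof.
apply: (big_morph _ (eact_additive h)).
by apply: (addrI (eact h 0)); rewrite -eact_additive !addr0.
Qed.

Lemma flat_eact (x : sec M (owhole X)) g (U V : opn X) (h : within act (inG H g) V U)
    (hU : U [<=] owhole X) (hV : V [<=] owhole X) : flat x ->
  eact h (mrs hU x) = mrs hV x.
Proof. by move=> [_ xG]; rewrite -(mrs_eact (within_whole act (inG H g)) h hV) xG. Qed.

Lemma homGD_val (phi : homGD M) (U : opn X) (a : reg U) (h : U [<=] owhole X) :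
  sval phi U a = a *: mrs h (sval phi (owhole X) 1).
Proof.
have [[[fl fr] fn] fe] := svalP phi.
have f0 : sval phi U 0 = 0.
  have := fl U 1 0 0; rewrite !scale1r addr0 => e.
  by apply: (addrI (sval phi U 0)); rewrite addr0 -e.
have -> : a = (a : reg U) *: (mrs h (1 : sec (reg_vc act) (owhole X)) : (reg U)^o) + (0 : (reg U)^o).
  by rewrite /= rmorph1 addr0 /GRing.scale /= mulr1.
rewrite fl f0 addr0 fr; congr (_ *: _).
by rewrite /= rmorph1 addr0 /GRing.scale /= mulr1.
Qed.

Lemma homGD_flat (phi : homGD M) : flat (sval phi (owhole X) 1).
Proof.
have [[[fl fr] fn] fe] := svalP phi; split=> [V h D|g].
  have f0 : sval phi V 0 = 0 by rewrite (homGD_val phi 0 h) scale0r.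
  rewrite fr /= rmorph1 -fn /=.
  have [_ _ Dc] := tapp_kder D.
  by rewrite -(rmorph1 (cst V)) Dc f0.
by rewrite -fe /= rmorph1.
Qed.

Lemma flat_homGD x : flat x ->
  exists phi : homGD M, forall U (a : reg U) h, sval phi U a = a *: mrs h x.
Proof.
move=> fx; have [xD xG] := fx.
unshelve eexists.
  exists (fun U a => (a : reg U) *: mrs (subw U) x); split; first split; first split.
  - by move=> U a b c; rewrite scalerDl -scalerA.
  - by move=> U V h a; rewrite mrs_scale (mrs_comp _ _ (subw V)).
  - by move=> U D a; rewrite nabM xD scaler0 add0r.
  - by move=> g U V h a; rewrite eact_scale (flat_eact h (subw U) (subw V) fx).
by move=> U a h; rewrite /= (Prop_irrelevance h (subw U)).
Qed.

Lemma homGD_sumE I (r : seq I) (c : I -> k) (phi : I -> homGD M) U x :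
  sval (\sum_(i <- r) c i *: phi i) U x = \sum_(i <- r) cst U (c i) *: sval (phi i) U x.
Proof.
elim: r => [|i r IH]; first by rewrite !big_nil.
by rewrite !big_cons -IH homGD_combE.
Qed.

Lemma homGD_eq1 (phi psi : homGD M) :
  sval phi (owhole X) 1 = sval psi (owhole X) 1 -> phi = psi.
Proof.
by move=> e; apply: homGD_ext => U a; rewrite (homGD_val phi a (subw U)) (homGD_val psi a (subw U)) e.
Qed.

Hypothesis cst_inj : injective (cst (owhole X)).
Hypothesis cstP : forall f : reg (owhole X), horizontal f ->
  (forall g : G, oact (within_whole act (inG H g)) f = f) -> exists c, f = cst (owhole X) c.

(** The coefficients of a flat section in a flat frame are unique, hence horizontal and
    [G]-invariant, hence constant. *)
Lemma flat_frame_dim r (s : 'I_r -> sec M (owhole X)) (phi : 'I_r -> homGD M) :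
  frame s -> (forall i, sval (phi i) (owhole X) 1 = s i) ->
  forall psi : homGD M, exists! c : {ffun 'I_r -> k}, psi = \sum_i c i *: phi i.
Proof.
move=> fs phis psi; have fl i : flat (s i) by rewrite -phis; apply: homGD_flat.
have [pD pG] := homGD_flat psi.
have [a [pa au]] := fs _ (osub_refl _) (sval psi (owhole X) 1).
have {}pa : sval psi (owhole X) 1 = \sum_i a i *: s i.
  by rewrite pa; apply: eq_bigr => i _; rewrite mrs_id.
have {}au (b : 'I_r -> reg (owhole X)) : sval psi (owhole X) 1 = \sum_i b i *: s i -> forall i, a i = b i.
  move=> pb i; rewrite (au [ffun i => b i]) ?ffunE// pb.
  by apply: eq_bigr => j _; rewrite ffunE mrs_id.
have /choice[c cE] : forall i, exists c, a i = cst (owhole X) c.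
  move=> i; apply: cstP => [W h D|g].
    have [z [_ zu]] := fs W h 0.
    have z0 (b : 'I_r -> reg W) : \sum_i b i *: mrs h (s i) = 0 -> b i = 0.
      move=> b0; have e1 : z = [ffun i => b i].
        by apply: zu; rewrite -[LHS]b0; apply: eq_bigr => j _; rewrite ffunE.
      have e2 : z = [ffun i => 0] by apply: zu; rewrite big1// => j _; rewrite ffunE scale0r.
      by move: e1; rewrite e2 => /ffunP/(_ i); rewrite !ffunE.
    apply: (z0 (fun i => tapp D (rs h (a i)))).
    rewrite -[RHS](pD W h D) pa mrs_sum nab_sum; apply: eq_bigr => j _.
    by rewrite mrs_scale nabM (fl j).1 scaler0 add0r.
  rewrite -(au (fun i => oact (within_whole act (inG H g)) (a i)))// -[LHS](pG g) pa eact_sum.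
  by apply: eq_bigr => j _; rewrite eact_scale (fl j).2.
exists [ffun i => c i]; split.
  apply: homGD_eq1; rewrite homGD_sumE pa; apply: eq_bigr => i _.
  by rewrite ffunE phis cE.
move=> c' pc'; apply/ffunP => i; rewrite ffunE; apply: cst_inj; rewrite -cE.
by apply: (au (fun i => cst _ (c' i))); rewrite pc' homGD_sumE; apply: eq_bigr => j _; rewrite phis.
Qed.

Lemma flat_frame_rank r (s : 'I_r -> sec M (owhole X)) : frame s -> (forall i, flat (s i)) ->
  dim_hom_eq_rank (M : vc_cat act).
Proof.
move=> fs fl; exists r; split; first exact: frame_rank fs.
have /choice[phi phiE] : forall i, exists phi : homGD M, sval phi (owhole X) 1 = s i.
  move=> i; have [phi phiE] := flat_homGD (fl i); exists phi.
  by rewrite (phiE _ _ (osub_refl _)) scale1r mrs_id.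
by exists phi; apply: flat_frame_dim fs phiE.
Qed.

Hypotheses (ch : [pchar k] =i pred0) (cX : charted X).

(** The image of the dual of [M] under evaluation at the [s i]; unlike the sheaf of relations
    between the [s i], it is visibly locally finitely generated. *)
Definition evaluations r (s : 'I_r -> sec M (owhole X)) (V : opn X) : set 'rV[reg V]_r :=
  fun x => locally (U := V) (fun W h => exists la, covector (M := M) (W := W) la /\
    map_mx (rs h) x = \row_i la W (osub_refl W) (mrs (subw W) (s i))).

(** The dual connection. On a flat section its second term vanishes, so evaluations are stable under
    vector fields. *)
Lemma covector_der (W : opn X) (D : tangent W) la : covector (M := M) (W := W) la ->
  covector (M := M) (W := W) (fun V h x => tapp (restr_tangent h D) (la V h x) - la V h (nab (restr_tangent h D) x)).
Proof.
move=> [l1 l2]; split=> [V h a x y|V V' h h' h'' x].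
  have [Da Dm _] := tapp_kder (restr_tangent h D).
  have -> : la V h (nab (restr_tangent h D) (a *: x + y)) = a * la V h (nab (restr_tangent h D) x) +
      (tapp (restr_tangent h D) a * la V h x + la V h (nab (restr_tangent h D) y)).
    by rewrite nabD nabM -addrA !l1.
  rewrite l1 Da Dm; ring.
rewrite rmorphB (l2 V V' h h' h'' (nab _ _)); congr (_ - _).
  rewrite -tapp_restr /tapp /= (l2 V V' h h' h''); exact: tfun_irr.
by congr (la _ _ _); apply: nab_res => N hN b /=; exact: tfun_irr.
Qed.

(** The contragredient action: [la] conjugated by [g]. *)
Definition translate_covector (g : G) (W : opn X) (la : forall V, V [<=] W -> sec M V -> reg V)
    V (h : V [<=] otrans act (inG H g) W) (x : sec M V) : reg V :=
  oact (@within_transV _ _ _ act (inG H g) V)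
    (la (otrans act (inG H g)^-1%g V) (trans_sub h) (eact (@within_trans _ _ _ act (inG H g)^-1%g V) x)).

Lemma covector_act (g : G) (W : opn X) la : covector (M := M) (W := W) la ->
  covector (M := M) (W := otrans act (inG H g) W) (@translate_covector g W la).
Proof.
rewrite /translate_covector.
move=> [l1 l2]; split=> [V h a x y|V V' h h' h'' x].
  by rewrite eact_lin l1 rmorphD rmorphM oact_inv.
have hs : otrans act (inG H g)^-1%g V' [<=] otrans act (inG H g)^-1%g V by move=> y [wy /h''].
rewrite -(mrs_eact (@within_trans _ _ _ act (inG H g)^-1%g V) _ hs h'').
rewrite -(l2 _ _ (trans_sub h) _ hs) -(oact1 (osub_within (act := act) h'')) -(oact1 (osub_within (act := act) hs)).
by apply: oact_comm; rewrite mul1g mulg1.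
Qed.

Lemma evaluations_mono r (s : 'I_r -> sec M (owhole X)) (V : opn X) (x : 'rV[reg V]_r) W W'
    (h : W [<=] V) (h' : W' [<=] V) : W' [<=] W ->
  (exists la, covector (M := M) (W := W) la /\
    map_mx (rs h) x = \row_i la W (osub_refl W) (mrs (subw W) (s i))) ->
  exists la, covector (M := M) (W := W') la /\
    map_mx (rs h') x = \row_i la W' (osub_refl W') (mrs (subw W') (s i)).
Proof.
move=> hW [la [la1 xE]]; exists (fun V hV => la V (osub_trans hW hV)); split.
  exact: covector_restr.
rewrite -(map_rs_comp h hW) xE; apply/rowP => i; rewrite !mxE.
by case: la1 => _ l2; rewrite (l2 _ _ _ (osub_trans hW (osub_refl W'))) (mrs_comp _ _ (subw W')).
Qed.

Lemma evaluations_stable r r' (s : 'I_r -> sec M (owhole X)) : (forall i, flat (s i)) ->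
  has_rank M r' -> stable_sub act (evaluations s).
Proof.
move=> fl [C0 cC0 fC0]; split.
- move=> U; split.
  + apply: locally_triv => V h; exists (fun _ _ _ => 0); split.
      by split=> *; rewrite ?mulr0 ?addr0 ?rmorph0.
    by apply/rowP => i; rewrite !mxE rmorph0.
  + move=> x y Qx Qy; have [] := locally_and (evaluations_mono (s := s) (x := x)) (evaluations_mono (s := s) (x := y)) Qx Qy.
    move=> C cC CP; exists C => // W h /CP-/(_ h)[[la [l1 xE]] [lb [m1 yE]]].
    exists (fun V hV z => la V hV z + lb V hV z); split.
      case: l1 m1 => [l1 l2] [m1 m2]; split=> [V hV a z t|V V' h1 h2 h3 z].
        by rewrite l1 m1 mulrDr addrACA.
      by rewrite rmorphD (l2 _ _ _ h2) (m2 _ _ _ h2).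
    by rewrite map_mxD xE yE; apply/rowP => i; rewrite !mxE.
  + move=> a x Qx; apply: locally_imp Qx => V h [la [[l1 l2] xE]].
    exists (fun W hW z => rs (osub_trans h hW) a * la W hW z); split.
      split=> [W hW b z t|W W' h1 h2 h3 z]; first by rewrite l1 mulrDr mulrCA.
      by rewrite rmorphM (l2 _ _ _ h2) (rs_comp _ _ (osub_trans h h2)).
    rewrite map_mxZ xE; apply/rowP => i; rewrite !mxE.
    by rewrite (Prop_irrelevance (osub_trans h _) h).
- move=> U V h x Qx; apply: locally_imp (locally_restr h (evaluations_mono (s := s) (x := x)) Qx).
  by move=> W hW [la [l1 xE]]; exists la; split=> //; rewrite (map_rs_comp _ _ (osub_trans h hW)).
- move=> U x [C cC CP]; apply: (locally_trans cC) => V h CV.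
  apply: locally_imp (CP V h CV) => W hW [la [l1 xE]]; exists la; split=> //.
  by rewrite -(map_rs_comp h hW).
- move=> U D x Qx; apply: locally_imp Qx => V h [la [l1 xE]].
  exists (fun W hW z => tapp (restr_tangent hW (restr_tangent h D)) (la W hW z) -
    la W hW (nab (restr_tangent hW (restr_tangent h D)) z)); split; first exact: covector_der.
  have la0 : la V (osub_refl V) 0 = 0.
    by have := covector_sum (V := V) (osub_refl V) [::] (fun i : 'I_0 => 0) (fun=> 0) l1; rewrite !big_nil.
  apply/rowP => i; have := congr1 (fun x : 'rV_r => x 0 i) xE; rewrite !mxE => e.
  rewrite -(tapp_restr h) e (fl i).1 la0 subr0 /tapp /=; exact: tfun_irr.
- move=> g U V h x [C cC CP].
  have e : translate act (inG H g) (oset U) `&` oset V = oset V.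
    by apply/seteqP; split=> [z []|z Vz] //; split=> //; split; [apply: whole_opn Vz|apply: h].
  have cV : cov (oset V) [set oset V `&` W | W in [set translate act (inG H g) W | W in C]].
    apply: (cov_restr (pact_cov act (inG H g) cC) (opnP V)).
    by move=> z Vz; split; [apply: whole_opn Vz|apply: h].
  exists [set oset V `&` W | W in [set translate act (inG H g) W | W in C]] => //.
  move=> N hN [_ [W CW <-] eN]; have [_ /(_ _ CW) aW _] := cov_adm cC.
  have hW : Opn aW [<=] U := cov_sub cC CW.
  have hN' : N [<=] otrans act (inG H g) (Opn aW) by move=> z; rewrite /= -eN => -[].
  have [la [l1 xE]] := CP (Opn aW) hW CW.
  have l1' := covector_act g l1.
  exists (fun V' hV' => @translate_covector g _ la V' (osub_trans hN' hV')); split; first exact: (covector_restr hN' l1').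
  apply/rowP => i; rewrite !mxE /translate_covector /=.
  set T := otrans act (inG H g)^-1%g N.
  have hT : T [<=] Opn aW := trans_sub (osub_trans hN' (osub_refl N)).
  have eV : (inG H g)^-1%g = inG H g^-1%g by congr pair; rewrite /= invg1.
  have -> : eact (@within_trans _ _ _ act (inG H g)^-1%g N) (mrs (subw N) (s i)) = mrs (subw T) (s i).
    have hT2 : within act (inG H g^-1%g) T N by rewrite -eV; exact: within_trans.
    rewrite (eact_eq _ hT2)//; exact: flat_eact.
  case: (l1) => _ l2.
  have := congr1 (fun x : 'rV_r => x 0 i) xE; rewrite !mxE => e0.
  have -> : la T (trans_sub (osub_trans hN' (osub_refl N))) (mrs (subw T) (s i)) = rs hT (rs hW (x 0 i)).
    by rewrite e0 (l2 _ _ _ (trans_sub (osub_trans hN' (osub_refl N)))) (mrs_comp _ _ (subw T)).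
  rewrite (rs_comp _ _ (osub_trans hW hT)) -(oact1 (osub_within (act := act) hN)).
  rewrite -(oact1 (osub_within (act := act) (osub_trans hW hT))).
  by apply: oact_comm; rewrite mul1g mulg1.
(* The evaluations of a local dual frame generate all evaluations. *)
exists C0 => // W h CW; have [e fe] := fC0 W h CW; have [la [lac laE]] := frame_dual fe.
exists r', (fun l => \row_i la l W (osub_refl W) (mrs (subw W) (s i))); split.
  move=> l; apply: locally_triv => V hV; exists (fun N hN => la l N (osub_trans hV hN)); split.
    exact: covector_restr.
  apply/rowP => i; rewrite !mxE; have [_ l2] := lac l.
  by rewrite (l2 _ _ _ (osub_trans hV (osub_refl V))) (mrs_comp _ _ (subw V)).
move=> V hV x Qx; apply: locally_imp Qx => N hN [mu [m1 xE]].
exists (fun l => mu N (osub_refl N) (mrs (osub_trans hV hN) (e l))).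
rewrite xE; apply/rowP => i; rewrite mxE summxE {1}(laE N (osub_trans hV hN) (mrs (subw N) (s i))).
rewrite (covector_sum _ _ _ _ m1); apply: eq_bigr => l _; rewrite !mxE mulrC; congr (_ * _).
have [_ l2] := lac l.
by rewrite (l2 _ _ _ (osub_trans hV hN)) (mrs_comp _ _ (subw N)).
Qed.

(** The evaluations are cut out by constants, and a nonzero constant equation would be a
    linear relation over [k] between the [phi i]; so the evaluations are all of [O ^ r]. *)
Lemma dim_rank_frame r (phi : 'I_r -> homGD M) : has_rank M r ->
  (forall psi : homGD M, exists! c : {ffun 'I_r -> k}, psi = \sum_i c i *: phi i) ->
  frame (fun i => sval (phi i) (owhole X) 1).
Proof.
move=> rM phiB; set s := fun i => _; have fl i : flat (s i) := homGD_flat (phi i).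
have [Pi [_ PiQ]] := stable_sub_const ch cX cst_inj cstP (evaluations_stable fl rM).
have [C0 cC0 fC0] := rM.
have Pi0 : Pi = 0.
  apply/matrixP => i j; rewrite mxE.
  (* Column [j] of [Pi] is orthogonal to all evaluations, so every member of a local dual frame
     kills this combination. *)
  have sP : \sum_i cst (owhole X) (Pi i j) *: s i = 0.
    apply: sec_locally_eq; exists C0 => // W h CW; have [e fe] := fC0 W h CW.
    have [la [lac laE]] := frame_dual fe; rewrite mrs0 (laE W (osub_refl W) (mrs h _)).
    rewrite big1// => l _; rewrite mrs_sum.
    under eq_bigr do rewrite mrs_scale rs_cst.
    rewrite (covector_sum _ _ _ _ (lac l)).
    have Ql : evaluations s (\row_i la l W (osub_refl W) (mrs (subw W) (s i))).
      apply: locally_triv => V hV; exists (fun N hN => la l N (osub_trans hV hN)); split.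
        exact: covector_restr.
      apply/rowP => i'; rewrite !mxE; have [_ l2] := lac l.
      by rewrite (l2 _ _ _ (osub_trans hV (osub_refl V))) (mrs_comp _ _ (subw V)).
    have := (PiQ _ _).1 Ql => /rowP/(_ j); rewrite !mxE => e0.
    rewrite (_ : \sum_i _ = 0) ?scale0r// -[RHS]e0; apply: eq_bigr => i' _.
    by rewrite !mxE mulrC (Prop_irrelevance h (subw W)).
  have [c [_ cu]] := phiB 0.
  have e1 : c = [ffun i => Pi i j].
    apply: cu; apply/esym/homGD_eq1; rewrite homGD_sumE.
    by rewrite -[RHS]sP; apply: eq_bigr => i' _; rewrite ffunE.
  have e2 : c = [ffun i => 0] by apply: cu; rewrite big1// => i' _; rewrite ffunE scale0r.
  by move: e1; rewrite e2 => /ffunP/(_ i); rewrite !ffunE.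
have Qall U x : evaluations s (V := U) x by apply/PiQ; rewrite Pi0 map_mx0 mulmx0.
(* Locally there are covectors dual to the [s i], which gives their independence. *)
have Qd j := Qall (owhole X) (delta_mx 0 j).
apply: frame_glue.
  move=> V h c c0 j; apply: reg_locally_eq.
  apply: locally_imp (locally_restr h (evaluations_mono (s := s) (x := delta_mx 0 j)) (Qd j)).
  move=> W hW [la [l1 dE]]; rewrite rmorph0.
  have := congr1 (fun z => la W (osub_refl W) (mrs hW z)) c0; rewrite mrs_sum mrs0.
  have -> : la W (osub_refl W) 0 = 0.
    by have := covector_sum (V := W) (osub_refl W) [::] (fun i : 'I_0 => 0) (fun=> 0) l1; rewrite !big_nil.
  under eq_bigr do rewrite mrs_scale (mrs_comp _ _ (subw W)).
  rewrite (covector_sum _ _ _ _ l1) (bigD1 j)//= big1 => [|i ij].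
    have /rowP/(_ j) := dE; rewrite !mxE !eqxx rmorph1 => <-.
    by rewrite mulr1 addr0.
  have /rowP/(_ i) := dE; rewrite !mxE (negbTE ij) andbF rmorph0 => <-.
  by rewrite mulr0.
have mono0 V W (h : V [<=] owhole X) (h' : W [<=] owhole X) : W [<=] V -> free_on M r V -> free_on M r W.
  move=> hW [e fe]; exists (fun i => mrs hW (e i)) => N hN x.
  have [c [xc cu]] := fe N (osub_trans hW hN) x; exists c; split=> [|c' xc'].
    by rewrite xc; apply: eq_bigr => i _; rewrite (mrs_comp _ _ (osub_trans hW hN)).
  by apply: cu; rewrite xc'; apply: eq_bigr => i _; rewrite (mrs_comp _ _ (osub_trans hW hN)).
have lQ := locally_all (fun j => evaluations_mono (s := s) (x := delta_mx 0 j)) Qd.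
have [|C cC CP] := locally_and mono0 _ rM lQ.
  move=> V W h h' hWV lV j; exact: evaluations_mono hWV (lV j).
move=> V0 h0 x0; exists [set oset V0 `&` W | W in C]; first by apply: (cov_restr cC (opnP V0)).
move=> V hV0 [W0 CW eN]; have [_ /(_ _ CW) aW _] := cov_adm cC.
pose W := Opn aW; have hW : W [<=] owhole X := adm_sub aW.
have hV : V [<=] W by move=> z; rewrite /= -eN => -[].
move: (osub_trans h0 hV0) (mrs hV0 x0) => h x.
have [[e fe] /choice[la laP]] := CP W hW CW.
have [mu [muc muE]] := frame_dual fe.
(* [S] expresses the [s i] in a local frame and [L] contains the values of the dual covectors on
   that frame. Both are square, as the number of the [s i] is the rank; hence [S L = 1] implies
   [L S = 1], and the [s i] generate. *)
pose S : 'M[reg W]_r := \matrix_(i, l) mu l W (osub_refl W) (mrs (subw W) (s i)).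
pose L : 'M[reg W]_r := \matrix_(l, j) la j W (osub_refl W) (e l).
have sE i : mrs (subw W) (s i) = \sum_l S i l *: e l.
  by rewrite {1}(muE W (osub_refl W) (mrs (subw W) (s i))); apply: eq_bigr => l _; rewrite mxE mrs_id.
have SL : S *m L = 1%:M.
  apply/matrixP => i j; have [l1 /rowP/(_ i)] := laP j; rewrite !mxE eqxx /= rmorph_nat => ->.
  by rewrite sE (covector_sum _ _ _ _ l1); apply: eq_bigr => l _; rewrite !mxE.
have LS := mulmx1C SL.
have eE l : e l = \sum_i L l i *: mrs (subw W) (s i).
  transitivity (\sum_l' (L *m S) l l' *: e l').
    rewrite LS (bigD1 l)//= big1 => [|l' l'l]; first by rewrite mxE eqxx scale1r addr0.
    by rewrite mxE eq_sym (negbTE l'l) scale0r.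
  under [RHS]eq_bigr do rewrite sE scaler_sumr.
  rewrite exchange_big /=; apply: eq_bigr => l' _.
  by rewrite mxE scaler_suml; apply: eq_bigr => i _; rewrite scalerA.
exists (fun i => \sum_l mu l V hV x * rs hV (L l i)).
rewrite {1}(muE V hV x).
under [in RHS]eq_bigr do rewrite scaler_suml.
rewrite exchange_big /=; apply: eq_bigr => l _; rewrite eE mrs_sum scaler_sumr.
by apply: eq_bigr => i _; rewrite mrs_scale (mrs_comp _ _ h) scalerA.
Qed.

End Object.
End Flat.

(** * The adjunction *)

Lemma rep_iso_bij (k : fieldType) (H : groupType) (V W : rep k H) (f : rep_hom V W) :
  injective (sval f) -> (forall w, exists v, sval f v = w) ->
  exists g : rep_hom W V, cancel (sval f) (sval g) /\ cancel (sval g) (sval f).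
Proof.
move=> fi /choice[g gK]; have [fl fe] := svalP f.
have gl : linear g by move=> a u v; apply: fi; rewrite fl !gK.
have ge h v : g (ract h v) = ract h (g v) by apply: fi; rewrite fe !gK.
by exists (exist _ g (conj gl ge)); split=> // v; apply: fi; rewrite /= gK.
Qed.

Section Adjunction.
Variables (k : fieldType) (X : rgspace k) (G H : groupType) (act : gact (dprod G H) X).

Lemma vc_homD (M N : vectcon act) (f : vc_hom M N) U x y : sval f U (x + y) = sval f U x + sval f U y.
Proof.
by have [[[fl _] _] _] := svalP f; rewrite -[x in LHS]scale1r fl scale1r.
Qed.

Lemma vc_hom0 (M N : vectcon act) (f : vc_hom M N) U : sval f U 0 = 0.
Proof. by apply: (addrI (sval f U 0)); rewrite -vc_homD !addr0. Qed.

Lemma vc_homZ (M N : vectcon act) (f : vc_hom M N) U a x : sval f U (a *: x) = a *: sval f U x.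
Proof.
by have [[[fl _] _] _] := svalP f; rewrite -[a *: x]addr0 fl vc_hom0 addr0.
Qed.

Lemma vc_hom_sum (M N : vectcon act) (f : vc_hom M N) U I (r : seq I) (F : I -> sec M U) :
  sval f U (\sum_(i <- r) F i) = \sum_(i <- r) sval f U (F i).
Proof. exact: (big_morph _ (vc_homD f (U := U)) (vc_hom0 f U)). Qed.

Lemma vc_hom_res (M N : vectcon act) (f : vc_hom M N) U V (h : V [<=] U) x :
  mrs h (sval f U x) = sval f V (mrs h x).
Proof. by have [[[_ fr] _] _] := svalP f; rewrite fr. Qed.

Lemma vc_hom_ext (M N : vectcon act) (f g : vc_hom M N) :
  (forall U x, sval f U x = sval g U x) -> f = g.
Proof.
by move=> fg; apply/sig_ext/functional_extensionality_dep => U; apply/funext => x.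
Qed.

Lemma vc_iso_bij (M N : vc_cat act) (f : hom M N) :
  (forall U, injective (sval f U)) -> (forall U y, exists x, sval f U x = y) -> is_iso f.
Proof.
move=> fi fs; have [[[fl fr] fn] fe] := svalP f.
pose g U (y : sec (N : vectcon act) U) := sval (cid (fs U y)).
have gK U y : sval f U (g U y) = y := svalP (cid (fs U y)).
have gP : dmod_mor g /\ forall x, commutes_with g x.
  split; first split; first split.
  - by move=> U a x y; apply: fi; rewrite fl !gK.
  - by move=> U V h x; apply: fi; rewrite -fr !gK.
  - by move=> U D x; apply: fi; rewrite fn !gK.
  - by move=> x U V h y; apply: fi; rewrite fe !gK.
exists (exist _ g gP : hom N M); split; apply: vc_hom_ext => U x /=; last exact: gK.
by apply: fi; rewrite gK.
Qed.

Lemma vc_isoK (M N : vc_cat act) (f : hom M N) : is_iso f ->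
  exists g : hom N M, forall U, cancel (sval f U) (sval g U) /\ cancel (sval g U) (sval f U).
Proof.
move=> [g [gf fg]]; exists g => U; split=> x.
  by have := congr1 (fun h : vc_hom M M => sval h U x) gf.
by have := congr1 (fun h : vc_hom N N => sval h U x) fg.
Qed.

(** [phi] commutes with [G], so conjugation by [g] depends only on its component in [H]. *)
Lemma homGD_act_val (M : vectcon act) (phi : homGD M) (g : dprod G H) U W (h : within act g W U) (a : reg U) :
  sval (homGD_act g.2 phi) W (oact h a) = eact h (sval phi U a).
Proof.
rewrite (homGD_val _ _ (subw W)) (homGD_val phi a (subw U)) eact_scale; congr (_ *: _).
rewrite -(mrs_eact (within_whole act g) h (subw W)); congr (mrs _ _).
rewrite (homGD_actE phi (within_whole act (inH G g.2)) (within_whole act (inH G g.2)^-1%g)).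
have e1 : eact (v := reg_vc act) (within_whole act (inH G g.2)^-1%g) (1 : reg (owhole X)) =
  (1 : reg (owhole X)) by exact: rmorph1.
rewrite [X in sval phi _ X]e1 {e1}.
have e : g = (inH G g.2 * inG H g.1)%g by case: (g) => g1 g2; congr pair; rewrite /= ?mul1g ?mulg1.
have [_ fG] := homGD_flat phi.
rewrite -{1}(fG g.1) -(eactM _ _ (within_mul (within_whole act (inH G g.2)) (within_whole act (inG H g.1)))).
by apply: eact_eq.
Qed.

Lemma pure_gen (V : rep k H) U (T : tens (cst (r := X) U) V) :
  exists s : seq (reg U * V), T = \sum_(p <- s) pure (cst U) p.1 p.2.
Proof.
have [s sE] := svalP T; exists s; apply/sig_ext/funext => l.
by rewrite tens_sum sE.
Qed.

Lemma triv_hom_eq (V : repfd k H) (M : vectcon act) (f g : vc_hom (triv act V : vectcon act) M) :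
  (forall U (a : reg U) (v : rep_of V), sval f U (pure (cst U) a v) = sval g U (pure (cst U) a v)) -> f = g.
Proof.
move=> fg; apply: vc_hom_ext => U T; have [s ->] := pure_gen T.
by rewrite !vc_hom_sum; apply: eq_bigr => p _.
Qed.

Lemma triv_homE (V W : repfd k H) (f : hom V W) U (a : reg U) v :
  sval (fmap (triv act) f) U (pure (cst U) a v) = pure (cst U) a (sval f v).
Proof. exact/sig_ext. Qed.

Lemma pureD (A : comPzRingType) (iota : {rmorphism k -> A}) (V : lmodType k) a b (v : V) :
  pure iota (a + b) v = pure iota a v + pure iota b v.
Proof. by apply/sig_ext/funext => l; rewrite /= /pure_fun mulrDr. Qed.

Lemma pureZ (A : comPzRingType) (iota : {rmorphism k -> A}) (V : lmodType k) a b (v : V) :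
  pure iota (a * b) v = a *: pure iota b v.
Proof. by apply/sig_ext/funext => l; rewrite /= /pure_fun mulrCA. Qed.

Lemma pure_lin (A : comPzRingType) (iota : {rmorphism k -> A}) (V : lmodType k) a c (u v : V) :
  pure iota a (c *: u + v) = iota c *: pure iota a u + pure iota a v.
Proof.
apply/sig_ext/funext; case=> l lE; rewrite /= /pure_fun /= lE.
by rewrite rmorphD mulrDl rmorphM mulrA.
Qed.

Lemma triv_mrs (V : repfd k H) U W (h : W [<=] U) (a : reg U) (v : rep_of V) :
  mrs h (pure (cst U) a v : sec (triv act V : vectcon act) U) = pure (cst W) (rs h a) v.
Proof.
by apply/sig_ext/funext => l; rewrite /mrs triv_resE /= /pure_fun rmorphM rs_cst.
Qed.

Lemma triv_nab_pure (V : repfd k H) U (D : tangent U) (a : reg U) (v : rep_of V) :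
  nab D (pure (cst U) a v : sec (triv act V : vectcon act) U) = pure (cst U) (tapp D a) v.
Proof.
apply/sig_ext/funext => l; rewrite /nab triv_nabE /= /pure_fun.
by have [_ Dm Dc] := tapp_kder D; rewrite Dm Dc mulr0 addr0.
Qed.

Lemma triv_eact_pure (V : repfd k H) g U W (h : within act g W U) (a : reg U) (v : rep_of V) :
  eact h (pure (cst U) a v : sec (triv act V : vectcon act) U) = pure (cst W) (oact h a) (ract g.2 v).
Proof.
by apply/sig_ext/funext => l; rewrite /= /pure_fun rmorphM oact_cst.
Qed.

Lemma triv_frame (V : repfd k H) r (e : 'I_r -> rep_of V) :
  (forall v, exists! c : {ffun 'I_r -> k}, v = \sum_i c i *: e i) ->
  frame (M := (triv act V : vectcon act)) (fun i => pure (cst (owhole X)) 1 (e i)) /\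
  forall i, flat (M := (triv act V : vectcon act)) (pure (cst (owhole X)) 1 (e i)).
Proof.
move=> eP; have [x [xe xd]] := coord_exists eP; split=> [U h T|i].
  have E (c : 'I_r -> reg U) l : sval (\sum_i c i *: mrs h (pure (cst (owhole X)) 1 (e i) : sec (triv act V : vectcon act) (owhole X))) l =
      \sum_i cst U (sval l (e i)) * c i.
    rewrite tens_sum; apply: eq_bigr => i _.
    by rewrite triv_mrs tensZ /= /pure_fun rmorph1 mulr1 mulrC.
  exists [ffun i => sval T (x i)]; split.
    apply/sig_ext/funext => l; rewrite E (tens_expand T xe).
    by apply: eq_bigr => i _; rewrite ffunE.
  move=> c ->; apply/ffunP => i; rewrite ffunE E (bigD1 i)//= xd eqxx rmorph1 mul1r.
  by rewrite big1 ?addr0// => j /negbTE ji; rewrite xd eq_sym ji rmorph0 mul0r.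
have p0 U v : pure (cst (r := X) U) 0 v = 0 :> tens (cst U) (rep_of V).
  by apply/sig_ext/funext => l; rewrite /= /pure_fun mulr0.
split=> [U h D|g]; last by rewrite triv_eact_pure rmorph1 ract1.
rewrite triv_mrs triv_nab_pure rmorph1.
by have [_ _ Dc] := tapp_kder D; rewrite -(rmorph1 (cst U)) Dc p0.
Qed.

(** Half of the adjunction between [triv] and [Hom(O, -)]. Coordinates on [V] define the map on
    elements of [tens], which are functions on the dual; the formula on pure tensors shows that it
    does not depend on them. *)
Lemma triv_adj (V : repfd k H) (M : vectcon act) (b : rep_hom (rep_of V) (homGD_rep M)) :
  exists f : vc_hom (triv act V : vectcon act) M,
    forall U (a : reg U) (v : rep_of V), sval f U (pure (cst U) a v) = sval (sval b v : homGD M) U a.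
Proof.
have [n [e eP]] := svalP V; have [x [xe xd]] := coord_exists eP.
have [bl be] := svalP b.
pose F U (T : tens (cst U) (rep_of V)) : sec M U := \sum_i sval (sval b (e i) : homGD M) U (sval T (x i)).
have b0 : sval b 0 = 0.
  have := bl 1 0 0; rewrite !scale1r addr0 => e0.
  by apply: (addrI (sval b 0)); rewrite addr0 -e0.
have bsum I (r : seq I) (c : I -> k) (v : I -> rep_of V) :
    sval b (\sum_(i <- r) c i *: v i) = \sum_(i <- r) c i *: sval b (v i).
  by elim: r => [|i r IH]; rewrite ?big_nil// !big_cons bl IH.
have FE U (a : reg U) (v : rep_of V) : F U (pure (cst U) a v) = sval (sval b v : homGD M) U a.
  rewrite {2}(xe v) bsum homGD_sumE; apply: eq_bigr => i _.
  have [[[fl _] _] _] := svalP (sval b (e i) : homGD M).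
  rewrite /= /pure_fun (homGD_val _ _ (subw U)) (homGD_val _ a (subw U)).
  by rewrite scalerA.
have FP : dmod_mor (M := (triv act V : vectcon act)) F /\ forall g, commutes_with (M := (triv act V : vectcon act)) F g.
  have FD U S T : F U (S + T) = F U S + F U T.
    rewrite /F -big_split; apply: eq_bigr => i _; rewrite tensD.
    by rewrite !(homGD_val _ _ (subw U)) scalerDl.
  have FZ U a T : F U (a *: T) = a *: F U T.
    rewrite /F scaler_sumr; apply: eq_bigr => i _; rewrite tensZ.
    by rewrite !(homGD_val _ _ (subw U)) scalerA.
  have F0 U : F U 0 = 0 by apply: (addrI (F U 0)); rewrite -FD !addr0.
  have Fs U I (r : seq I) S : F U (\sum_(i <- r) S i) = \sum_(i <- r) F U (S i).
    exact: (big_morph _ (FD U) (F0 U)).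
  split; first split; first split.
  - by move=> U a S T; rewrite FD FZ.
  - move=> U W h T; rewrite /F mrs_sum; apply: eq_bigr => i _.
    have [[[_ fr] _] _] := svalP (sval b (e i) : homGD M).
    by rewrite fr /mrs /= dcomp_id.
  - move=> U D T; rewrite /F nab_sum; apply: eq_bigr => i _.
    have [[_ fn] _] := svalP (sval b (e i) : homGD M).
    by rewrite -fn /nab /= dcomp_id.
  - move=> g U W h T; have [s ->] := pure_gen T.
    have E1 := eact_sum (M := (triv act V : vectcon act)) h s (fun p => pure (cst U) p.1 p.2).
    rewrite Fs eact_sum; transitivity (F W (\sum_(p <- s) eact (v := (triv act V : vectcon act)) h (pure (cst U) p.1 p.2))).
      by congr (F W _).
    rewrite Fs; apply: eq_bigr => p _.
    by rewrite triv_eact_pure !FE be; apply: homGD_act_val.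
by exists (exist _ F FP).
Qed.

Lemma triv_unit_subproof (V : repfd k H) (v : rep_of V) : exists phi : homGD (triv act V : vectcon act),
  forall U (a : reg U), sval phi U a = pure (cst U) a v.
Proof.
have p0 U : pure (cst (r := X) U) 0 v = 0 :> tens (cst U) (rep_of V).
  by apply/sig_ext/funext => l; rewrite /= /pure_fun mulr0.
have [|phi phiE] := @flat_homGD _ _ _ _ act (triv act V : vectcon act) (pure (cst (owhole X)) 1 v).
  split=> [U h D|g]; last by rewrite triv_eact_pure rmorph1 ract1.
  rewrite triv_mrs triv_nab_pure rmorph1.
  by have [_ _ Dc] := tapp_kder D; rewrite -(rmorph1 (cst U)) Dc p0.
exists phi => U a; rewrite (phiE U a (subw U)) triv_mrs rmorph1.
by rewrite -{2}(mulr1 a) (pureZ (cst U)).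
Qed.

Definition triv_unit_fun (V : repfd k H) (v : rep_of V) : homGD (triv act V : vectcon act) :=
  sval (cid (triv_unit_subproof v)).

Lemma triv_unitE (V : repfd k H) (v : rep_of V) U (a : reg U) :
  sval (triv_unit_fun v) U a = pure (cst U) a v.
Proof. exact: (svalP (cid (triv_unit_subproof v))). Qed.

Definition triv_unit (V : repfd k H) : rep_hom (rep_of V) (homGD_rep (triv act V : vectcon act)).
Proof.
exists (@triv_unit_fun V); split=> [c u v|h v]; apply: homGD_ext => U a.
  by rewrite homGD_combE !triv_unitE pure_lin.
have hw : within act (inH G h) U (otrans act (inH G h)^-1%g U) := @within_transV _ _ _ act _ U.
have hw' : within act (inH G h)^-1%g (otrans act (inH G h)^-1%g U) U := @within_trans _ _ _ act _ U.
rewrite triv_unitE; apply/esym/(etrans (homGD_actE (triv_unit_fun v) hw hw' a)).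
by rewrite triv_unitE triv_eact_pure; congr (pure _ _ _); exact: oact_inv.
Defined.

End Adjunction.

(** * Unit and counit are isomorphisms *)

Section Equivalence.
Variables (k : fieldType) (X : rgspace k) (G H : groupType) (act : gact (dprod G H) X).
Hypothesis cst_inj : injective (cst (owhole X)).
Hypothesis cstP : forall f : reg (owhole X), horizontal f ->
  (forall g : G, oact (within_whole act (inG H g)) f = f) -> exists c, f = cst (owhole X) c.

Lemma triv_unit_bij (V : repfd k H) : injective (sval (triv_unit act V)) /\
  forall phi, exists v, sval (triv_unit act V) v = phi.
Proof.
have [n [e eP]] := svalP V; have [fe fl] := triv_frame act eP.
have [ul _] := svalP (triv_unit act V).
have u0 : sval (triv_unit act V) 0 = 0.
  have := ul 1 0 0; rewrite !scale1r addr0 => e0.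
  by apply: (addrI (sval (triv_unit act V) 0)); rewrite addr0 -e0.
have usum (c : 'I_n -> k) : sval (triv_unit act V) (\sum_i c i *: e i) = \sum_i c i *: sval (triv_unit act V) (e i).
  by elim: (index_enum _) => [|i r IH]; rewrite ?big_nil// !big_cons ul IH.
have B := flat_frame_dim cst_inj cstP (phi := fun i => sval (triv_unit act V) (e i)) fe
  (fun i => triv_unitE act (e i) 1).
split=> [u v uv|phi]; last first.
  by have [c [-> _]] := B phi; exists (\sum_i c i *: e i); rewrite usum.
have [c [uc _]] := eP u; have [c' [vc _]] := eP v.
have [d [_ dU]] := B (sval (triv_unit act V) u).
rewrite uc vc -(dU c) ?(dU c')//; last by rewrite uc usum.
by rewrite uv vc usum.
Qed.

(** As the unit is bijective, [g] comes from [Hom(O, g)] transported along the units of [V] and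
    [W]. *)
Lemma triv_full : full (triv act).
Proof.
move=> V W g; have [Wi Ws] := triv_unit_bij W.
have [u [_ uK]] := rep_iso_bij Wi Ws.
exists (rep_cmp u (rep_cmp (homGD_map g) (triv_unit act V)) : hom V W).
apply: triv_hom_eq => U a v; rewrite triv_homE /=.
rewrite -(triv_unitE act (sval u _) a) [triv_unit_fun act _](uK _) /=.
by rewrite triv_unitE.
Qed.

Lemma frame_iso (M N : vc_cat act) (f : hom M N) r (s : 'I_r -> sec (M : vectcon act) (owhole X)) :
  is_iso f -> frame s -> frame (fun i => sval f (owhole X) (s i)).
Proof.
move=> /vc_isoK[g fg] fs U h x; have [c [xc cu]] := fs U h (sval g U x).
have E (b : 'I_r -> reg U) : \sum_i b i *: mrs h (sval f (owhole X) (s i)) = sval f U (\sum_i b i *: mrs h (s i)).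
  by rewrite vc_hom_sum; apply: eq_bigr => i _; rewrite vc_homZ vc_hom_res.
exists c; split; first by rewrite E -xc (fg U).2.
by move=> c' xc'; apply: cu; rewrite xc' E (fg U).1.
Qed.

Lemma flat_hom (M N : vectcon act) (f : vc_hom M N) x : flat x -> flat (sval f (owhole X) x).
Proof.
have [[[fl fr] fn] fe] := svalP f => -[xD xG]; split=> [U h D|g]; last by rewrite -fe xG.
by rewrite fr -fn xD vc_hom0.
Qed.

Lemma ess_image_frame (M : vc_cat act) : ess_image (triv act) M ->
  exists r (s : 'I_r -> sec (M : vectcon act) (owhole X)), frame s /\ forall i, flat (s i).
Proof.
move=> [V [f fi]]; have [n [e eP]] := svalP V; have [fe fl] := triv_frame act eP.
exists n, (fun i => sval f (owhole X) (pure (cst (owhole X)) 1 (e i))); split.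
  exact: frame_iso fi fe.
by move=> i; apply: flat_hom.
Qed.

Lemma ess_image_dim (M : vc_cat act) : ess_image (triv act) M -> dim_hom_eq_rank M.
Proof. by move=> /ess_image_frame[r [s [fs fl]]]; apply: flat_frame_rank fl. Qed.

Hypotheses (ch : [pchar k] =i pred0) (cX : charted X).

(** The counit is evaluation; by [dim_rank_frame] it sends a frame to a frame. *)
Lemma triv_counit (M : vc_cat act) (dM : dim_hom_eq_rank M) :
  exists f : hom (triv act (exist _ (homGD_rep (M : vectcon act)) (dim_hom_fd dM) : repfd k H)) M,
    is_iso f /\ forall U (a : reg U) (phi : homGD (M : vectcon act)), sval f U (pure (cst U) a phi) = sval phi U a.
Proof.
pose V : repfd k H := exist _ (homGD_rep (M : vectcon act)) (dim_hom_fd dM).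
have [f fE] := triv_adj (V := V) (rep_id (homGD_rep (M : vectcon act))).
exists f; split=> //; have [r [rM [phi phiB]]] := dM.
have fs := dim_rank_frame cst_inj cstP ch cX rM phiB.
have [fe _] := triv_frame act (V := V) phiB.
have E U (h : U [<=] owhole X) (c : 'I_r -> reg U) : sval f U (\sum_i c i *: mrs h (pure (cst (owhole X)) 1 (phi i) : sec (triv act V : vectcon act) (owhole X))) =
    \sum_i c i *: mrs h (sval (phi i) (owhole X) 1).
  rewrite vc_hom_sum; apply: eq_bigr => i _; rewrite vc_homZ triv_mrs rmorph1 fE /=.
  by rewrite (homGD_val (phi i) _ h) scale1r.
apply: vc_iso_bij => U.
  move=> S T; have [c [-> _]] := fe U (subw U) S; have [c' [-> _]] := fe U (subw U) T.
  rewrite !E => cc; have [d [_ dU]] := fs U (subw U) (\sum_i c i *: mrs (subw U) (sval (phi i) (owhole X) 1)).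
  by rewrite -(dU c)// (dU c').
move=> y; have [c [-> _]] := fs U (subw U) y.
by exists (\sum_i c i *: mrs (subw U) (pure (cst (owhole X)) 1 (phi i) : sec (triv act V : vectcon act) (owhole X))); rewrite E.
Qed.

Lemma ess_imageP (M : vc_cat act) : ess_image (triv act) M <-> dim_hom_eq_rank M.
Proof.
split; first exact: ess_image_dim.
by move=> dM; have [f [fi _]] := triv_counit dM; exists (exist _ (homGD_rep (M : vectcon act)) (dim_hom_fd dM)), f.
Qed.

Lemma triv_quasi_inverse : exists inS : forall V : repfd k H, dim_hom_eq_rank (triv act V),
  quasi_inverse (corestrict inS) (homGD_sub act).
Proof.
have inS V : dim_hom_eq_rank (triv act V).
  by apply: ess_image_dim; exists V, (idm _), (idm _); rewrite !cmp1m.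
have uP (V : repfd k H) : exists u : rep_hom (homGD_rep (triv act V : vectcon act)) (rep_of V),
    cancel (sval (triv_unit act V)) (sval u) /\ cancel (sval u) (sval (triv_unit act V)).
  by have [Vi Vs] := triv_unit_bij V; apply: rep_iso_bij.
pose u V := sval (cid (uP V)).
have uK V : cancel (sval (triv_unit act V)) (sval (u V)) by case: (svalP (cid (uP V))).
have Ku V : cancel (sval (u V)) (sval (triv_unit act V)) by case: (svalP (cid (uP V))).
exists inS; split.
  exists u; split=> [V|V W f].
    by exists (triv_unit act V); split; apply/sig_ext/funext => x /=; [apply: Ku|apply: uK].
  apply/sig_ext/funext => phi.
  transitivity (sval (u W) (sval (homGD_map (fmap (triv act) f)) phi)); first by [].
  apply: (can_inj (uK W)); rewrite Ku; apply: homGD_ext => U a.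
  transitivity (sval (fmap (triv act) f) U (sval phi U a)); first by [].
  rewrite triv_unitE -{1}(Ku V phi) triv_unitE triv_homE.
  by [].
pose e (M : full_subcat (C := vc_cat act) (@dim_hom_eq_rank G H k X act)) := sval (cid (triv_counit (svalP M))).
have eI M : is_iso (e M) by case: (svalP (cid (triv_counit (svalP M)))).
have eE M U (a : reg U) (phi : homGD (sval M : vectcon act)) : sval (e M) U (pure (cst U) a phi) = sval phi U a.
  by case: (svalP (cid (triv_counit (svalP M)))).
exists e; split=> [M|M N f]; first exact: eI.
apply: triv_hom_eq => U a v.
transitivity (sval (e N) U (sval (fmap (triv act) (fmap (homGD_sub act) f)) U (pure (cst U) a v))); first by [].
rewrite triv_homE eE /=.
transitivity (sval f U (sval (e M) U (pure (cst U) a v))); last by [].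
by rewrite eE.
Qed.

End Equivalence.

(** * Subquotients *)

Section Combinations.
Variables (k : fieldType) (X : rgspace k) (G H : groupType) (act : gact (dprod G H) X).

Definition lc (M : omod X) r (s : 'I_r -> sec M (owhole X)) (V : opn X) (x : 'rV[reg V]_r) : sec M V :=
  \sum_i x 0 i *: mrs (subw V) (s i).

Section Object.
Variables (M : vectcon act) (r : nat) (s : 'I_r -> sec M (owhole X)).
Hypothesis fl : forall i, flat (s i).

Lemma lc_lin V a (x y : 'rV[reg V]_r) : lc s (a *: x + y) = a *: lc s x + lc s y.
Proof.
rewrite /lc scaler_sumr -big_split; apply: eq_bigr => i _.
by rewrite !mxE scalerDl scalerA.
Qed.

Lemma lcB V (x y : 'rV[reg V]_r) : lc s (x - y) = lc s x - lc s y.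
Proof.
have -> : x - y = -1 *: y + x by rewrite scaleN1r addrC.
by rewrite lc_lin scaleN1r addrC.
Qed.

Lemma lc0 V : lc s (0 : 'rV[reg V]_r) = 0.
Proof. by rewrite /lc big1// => i _; rewrite mxE scale0r. Qed.

Lemma lc_sum V I (q : seq I) (c : I -> reg V) (F : I -> 'rV[reg V]_r) :
  lc s (\sum_(j <- q) c j *: F j) = \sum_(j <- q) c j *: lc s (F j).
Proof. by elim: q => [|j q IH]; rewrite ?big_nil ?lc0// !big_cons lc_lin IH. Qed.

Lemma lc_res V W (h : W [<=] V) (x : 'rV[reg V]_r) : mrs h (lc s x) = lc s (map_mx (rs h) x).
Proof.
rewrite /lc mrs_sum; apply: eq_bigr => i _.
by rewrite mxE mrs_scale (mrs_comp _ _ (subw W)).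
Qed.

Lemma lc_nab V (D : tangent V) (x : 'rV[reg V]_r) : nab D (lc s x) = lc s (map_mx (tapp D) x).
Proof.
rewrite /lc nab_sum; apply: eq_bigr => i _.
by rewrite nabM (fl i).1 scaler0 add0r mxE.
Qed.

Lemma lc_eact (g : G) U V (h : within act (inG H g) V U) (x : 'rV[reg U]_r) :
  eact h (lc s x) = lc s (map_mx (oact h) x).
Proof.
rewrite /lc eact_sum; apply: eq_bigr => i _.
by rewrite eact_scale (flat_eact h (subw U) (subw V) (fl i)) mxE.
Qed.

Lemma lc_mul V n (x : 'rV[reg V]_n) (B : 'M[k]_(n, r)) :
  lc s (x *m map_mx (cst V) B) = lc (fun l => lc s (map_mx (cst (owhole X)) (row l B))) x.
Proof.
rewrite /lc.
under [RHS]eq_bigr do rewrite mrs_sum scaler_sumr.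
rewrite exchange_big /=; apply: eq_bigr => j _; rewrite mxE scaler_suml; apply: eq_bigr => l _.
by rewrite !mxE mrs_scale rs_cst scalerA (mrs_comp _ _ (subw V)).
Qed.

Lemma lc_flat (c : 'rV[k]_r) : flat (lc s (map_mx (cst (owhole X)) c)).
Proof.
split=> [V h D|g].
  rewrite lc_res lc_nab -[RHS](lc0 V); congr (lc s _); apply/rowP => i; rewrite !mxE rs_cst.
  by have [_ _] := tapp_kder D.
by rewrite lc_eact; congr (lc s _); apply/rowP => i; rewrite !mxE oact_cst.
Qed.

Lemma frame_lc : frame s -> (forall V (y : sec M V), exists x, y = lc s x) /\
  forall V, injective (@lc M r s V).
Proof.
move=> fs; split=> [V y|V x x' xx'].
  have [c [yc _]] := fs V (subw V) y; exists (\row_i c i); rewrite yc.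
  by apply: eq_bigr => i _; rewrite mxE.
have [c [_ cu]] := fs V (subw V) (lc s x).
have e1 : c = [ffun i => x 0 i] by apply: cu; apply: eq_bigr => i _; rewrite ffunE.
have e2 : c = [ffun i => x' 0 i] by apply: cu; rewrite xx'; apply: eq_bigr => i _; rewrite ffunE.
by apply/rowP => i; move: e1; rewrite e2 => /ffunP/(_ i); rewrite !ffunE.
Qed.

End Object.

Lemma lc_hom (M N : vectcon act) (f : vc_hom M N) r (s : 'I_r -> sec M (owhole X)) V (x : 'rV[reg V]_r) :
  sval f V (lc s x) = lc (fun i => sval f (owhole X) (s i)) x.
Proof.
rewrite /lc vc_hom_sum; apply: eq_bigr => i _.
by rewrite vc_homZ vc_hom_res.
Qed.

Lemma mono_glue (P M : vectcon act) (i : vc_hom P M) : sheaf_mono i -> forall U (z : sec M U),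
  locally (U := U) (fun V h => exists y, sval i V y = mrs h z) -> exists y, sval i U y = z.
Proof.
move=> im U z [C cC CP].
have CU (W : opn X) (c : C (oset W)) : W [<=] U := cov_sub cC c.
pose s W (c : C (oset W)) := sval (cid (CP W (CU W c) c)).
have sP W (c : C (oset W)) : sval i W (s W c) = mrs (CU W c) z := svalP (cid (CP W (CU W c) c)).
have [|y yP] := (sec_sheaf P cC).2 s.
  move=> W1 W2 W c1 c2 h1 h2; apply: im.
  by rewrite -!vc_hom_res !sP !(mrs_comp _ _ (osub_trans (CU W1 c1) h1)).
exists y; apply: sec_locally_eq; exists C => // W h c.
by rewrite vc_hom_res (yP W c) sP (Prop_irrelevance h (CU W c)).
Qed.

Hypothesis cst_inj : injective (cst (owhole X)).
Hypothesis cstP : forall f : reg (owhole X), horizontal f ->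
  (forall g : G, oact (within_whole act (inG H g)) f = f) -> exists c, f = cst (owhole X) c.
Hypotheses (ch : [pchar k] =i pred0) (cX : charted X).

Lemma submodule_stable (P M : vectcon act) (i : vc_hom P M) r (s : 'I_r -> sec M (owhole X)) :
  sheaf_mono i -> frame s -> (forall j, flat (s j)) ->
  stable_sub act (fun V (x : 'rV[reg V]_r) => exists y, sval i V y = lc s x).
Proof.
move=> im fs fl; have [[[il ir] inab] ie] := svalP i; have [lcS lcI] := frame_lc fs; split.
- move=> U; split.
  + by exists 0; rewrite vc_hom0 lc0.
  + by move=> x y [a ax] [b by']; exists (a + b); rewrite vc_homD ax by' -[x]scale1r lc_lin !scale1r.
  + by move=> c x [a ax]; exists (c *: a); rewrite vc_homZ ax -[c *: x]addr0 lc_lin lc0 addr0.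
- by move=> U V h x [y yx]; exists (mrs h y); rewrite -vc_hom_res yx lc_res.
- move=> U x xl; apply: mono_glue => //; apply: locally_imp xl => V h [y yx].
  by exists y; rewrite lc_res.
- by move=> U D x [y yx]; exists (nab D y); rewrite inab yx lc_nab.
- by move=> g U V h x [y yx]; exists (eact h y); rewrite ie yx lc_eact.
have [C cC CP] := vcoh P; exists C => // W h CW.
have [n [m [e [A [_ gen _]]]]] := CP W h CW.
have /choice[S SE] : forall j, exists x, sval i W (e j) = lc s x by move=> j; apply: lcS.
exists n, S; split=> [j|V hV x [y yx]]; first by exists (e j).
apply: locally_imp (gen V hV y) => V' h' [c yc]; exists c; apply: lcI.
rewrite -lc_res -yx vc_hom_res yc vc_hom_sum /=.
by rewrite lc_sum; apply: eq_bigr => j _; rewrite vc_homZ -vc_hom_res SE lc_res.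
Qed.

(** Finite generation is the point: coherence provides a presentation by other generators [e] with
    relations [A]. Locally [s = B e] and [e = C s], and the relations between the [s j] are
    generated by the rows of [1 - B C] and of [A C]. *)
Lemma relations_stable (N : vectcon act) r (s : 'I_r -> sec N (owhole X)) : (forall j, flat (s j)) ->
  (forall V (z : sec N V), locally (U := V) (fun W h => exists x, mrs h z = lc s x)) ->
  stable_sub act (fun V (x : 'rV[reg V]_r) => lc s x = 0).
Proof.
move=> fl gen; split.
- move=> U; split; first exact: lc0.
  + by move=> x y x0 y0; rewrite -[x]scale1r lc_lin x0 y0 scaler0 addr0.
  + by move=> a x x0; rewrite -[_ *: _]addr0 lc_lin x0 lc0 scaler0 addr0.
- by move=> U V h x x0; rewrite -lc_res x0 mrs0.
- move=> U x xl; apply: sec_locally_eq; apply: locally_imp xl => V h.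
  by rewrite lc_res mrs0.
- by move=> U D x x0; rewrite -lc_nab// x0 nab0.
- move=> g U V h x x0; rewrite -lc_eact// x0.
  by apply: (addrI (eact h 0)); rewrite -eact_additive !addr0.
have [C cC CP] := vcoh N; apply: (locally_trans cC) => W h CW.
have [n [m [e [A [Ae geni reli]]]]] := CP W h CW.
have L1 j : locally (U := W) (fun W' h' => exists c : 'I_n -> reg W', mrs (subw W') (s j) = \sum_a c a *: mrs h' (e a)).
  apply: locally_imp (geni W (osub_refl W) (mrs (subw W) (s j))) => W' h' [c cE].
  exists c; rewrite -(mrs_comp (subw W) h') cE; apply: eq_bigr => a _.
  by rewrite (Prop_irrelevance (osub_trans _ _) h').
have L2 a := gen W (e a).
have M1 j V V' (h1 : V [<=] W) (h2 : V' [<=] W) : V' [<=] V ->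
    (exists c : 'I_n -> reg V, mrs (subw V) (s j) = \sum_a c a *: mrs h1 (e a)) ->
    exists c : 'I_n -> reg V', mrs (subw V') (s j) = \sum_a c a *: mrs h2 (e a).
  move=> hV [c cE]; exists (fun a => rs hV (c a)).
  rewrite -(mrs_comp (subw V) hV) cE mrs_sum; apply: eq_bigr => a _.
  by rewrite mrs_scale (mrs_comp _ _ h2).
have M2 a V V' (h1 : V [<=] W) (h2 : V' [<=] W) : V' [<=] V ->
    (exists x, mrs h1 (e a) = lc s x) -> exists x, mrs h2 (e a) = lc s x.
  move=> hV [x xE]; exists (map_mx (rs hV) x).
  by rewrite -lc_res -xE (mrs_comp _ _ h2).
have [||D cD DP] := @locally_and k X W _ _ _ _ (locally_all M1 L1) (locally_all M2 L2).
- by move=> V V' h1 h2 hV H0 j; apply: M1 hV (H0 j).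
- by move=> V V' h1 h2 hV H0 j; apply: M2 hV (H0 j).
exists D => // W' h' DW'; have [/choice[Bf BE] /choice[Cf CE]] := DP W' h' DW'.
pose B : 'M[reg W']_(r, n) := \matrix_(j, a) Bf j a.
pose C' : 'M[reg W']_(n, r) := \matrix_(a, j) Cf a 0 j.
pose A' : 'M[reg W']_(m, n) := \matrix_(b, a) rs h' (A b a).
pose ec V (hV : V [<=] W') (y : 'rV[reg V]_n) := \sum_a y 0 a *: mrs (osub_trans h' hV) (e a).
have lcB' V (hV : V [<=] W') (x : 'rV[reg V]_r) : lc s x = ec V hV (x *m map_mx (rs hV) B).
  rewrite /ec; under [RHS]eq_bigr do rewrite mxE scaler_suml.
  rewrite exchange_big /=; apply: eq_bigr => j _.
  rewrite -(mrs_comp (subw W') hV) BE mrs_sum scaler_sumr; apply: eq_bigr => a _.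
  by rewrite !mxE mrs_scale scalerA (mrs_comp _ _ (osub_trans h' hV)).
have lcC V (hV : V [<=] W') (y : 'rV[reg V]_n) : ec V hV y = lc s (y *m map_mx (rs hV) C').
  rewrite mulmx_sum_row lc_sum; apply: eq_bigr => a _; congr (_ *: _).
  rewrite -(mrs_comp h' hV) CE lc_res; congr (lc s _).
  by apply/rowP => j; rewrite !mxE.
have eqBC V (hV : V [<=] W') (x : 'rV[reg V]_r) :
    lc s x = lc s (x *m map_mx (rs hV) B *m map_mx (rs hV) C') by rewrite (lcB' _ hV) lcC.
have ecA V (hV : V [<=] W') (y : 'rV[reg V]_m) : ec V hV (y *m map_mx (rs hV) A') = 0.
  rewrite /ec; under eq_bigr do rewrite mxE scaler_suml.
  rewrite exchange_big /= big1// => b _.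
  transitivity (y 0 b *: mrs (osub_trans h' hV) (\sum_a A b a *: e a)); last first.
    by rewrite Ae mrs0 scaler0.
  rewrite mrs_sum scaler_sumr; apply: eq_bigr => a _.
  by rewrite !mxE mrs_scale scalerA (rs_comp _ _ (osub_trans h' hV)).
pose S : 'M[reg W']_(r + m, r) := col_mx (1%:M - B *m C') (A' *m C').
have mapS V (hV : V [<=] W') (x : 'rV[reg V]_r) (y : 'rV[reg V]_m) : row_mx x y *m map_mx (rs hV) S =
    x - x *m map_mx (rs hV) B *m map_mx (rs hV) C' + y *m map_mx (rs hV) A' *m map_mx (rs hV) C'.
  rewrite map_col_mx mul_row_col map_mxB map_mx1 !map_mxM mulmxBr mulmx1 -!mulmxA.
  by [].
have S0 V (hV : V [<=] W') (x : 'rV[reg V]_(r + m)) : lc s (x *m map_mx (rs hV) S) = 0.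
  rewrite -[x]hsubmxK mapS -[_ - _]scale1r lc_lin scale1r lcB -eqBC subrr add0r.
  by rewrite -lcC ecA.
exists (r + m)%N, (fun i => row i S); split=> [i|V hV x x0].
  by rewrite rowE -{1}[S](map_rs_id (osub_refl W')) S0.
have := reli V (osub_trans h' hV) (fun a => (x *m map_mx (rs hV) B) 0 a).
rewrite -/(ec V hV _) -lcB' x0 => /(_ erefl); apply: locally_imp => V' h'' [b bE].
exists (fun i => row_mx (map_mx (rs h'') x) (\row_l b l) 0 i).
(* A relation [x] is [x (1 - B C) + (x B) C], and [x B] is a relation between the [e a], hence a
   combination [b A] of the given ones. *)
transitivity (row_mx (map_mx (rs h'') x) (\row_l b l) *m map_mx (rs (osub_trans hV h'')) S).
  rewrite mapS; suff -> : map_mx (rs h'') x *m map_mx (rs (osub_trans hV h'')) B =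
    (\row_l b l) *m map_mx (rs (osub_trans hV h'')) A' by rewrite subrK.
  rewrite -(map_rs_comp hV h'') -map_mxM; apply/rowP => a; rewrite [LHS]mxE bE mxE.
  apply: eq_bigr => l _; rewrite !mxE (rs_comp _ _ (osub_trans h' (osub_trans hV h''))).
  by congr (_ * rs _ _); apply: Prop_irrelevance.
rewrite mulmx_sum_row; apply: eq_bigr => i _; congr (_ *: _).
by apply/rowP => j; rewrite !mxE.
Qed.

(** [N] is the quotient of the free module by the kernel of the constant idempotent [Pi], so a basis
    over [k] of the row space of [Pi] provides a flat frame. *)
Lemma quotient_frame (N : vectcon act) r (s : 'I_r -> sec N (owhole X)) : (forall j, flat (s j)) ->
  (forall V (z : sec N V), locally (U := V) (fun W h => exists x, mrs h z = lc s x)) ->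
  exists p (t : 'I_p -> sec N (owhole X)), frame t /\ forall j, flat (t j).
Proof.
move=> fl gen.
have [Pi [Pi2 PiP]] := stable_sub_const ch cX cst_inj cstP (relations_stable fl gen).
pose B := row_base Pi.
have BPi : B *m Pi = B.
  have /submxP[D ->] : (B <= Pi)%MS by rewrite eq_row_base.
  by rewrite -mulmxA Pi2.
pose t l := lc s (map_mx (cst (owhole X)) (row l B)); exists (\rank Pi), t.
have tE V (x : 'rV[reg V]_(\rank Pi)) : \sum_i x 0 i *: mrs (subw V) (t i) = lc s (x *m map_mx (cst V) B).
  by rewrite lc_mul.
split; last by move=> j; apply: lc_flat.
apply: frame_glue => [V h c c0 i|V h z].
  have : lc s (\row_i c i *m map_mx (cst V) B) = 0.
    rewrite -tE -[RHS]c0; apply: eq_bigr => j _.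
    by rewrite mxE (Prop_irrelevance (subw V) h).
  move=> /PiP; rewrite -mulmxA -map_mxM BPi => /(congr1 (mulmxr (map_mx (cst V) (pinvmx B)))).
  rewrite /= mul0mx -mulmxA -map_mxM mulmxVp ?row_base_free// map_mx1 mulmx1.
  by move=> /rowP/(_ i); rewrite !mxE.
apply: locally_imp (gen V z) => W hW [x ->].
exists (fun i => (x *m map_mx (cst W) (col_base Pi)) 0 i).
transitivity (lc s (x *m map_mx (cst W) Pi)).
  apply/eqP; rewrite -subr_eq0 -lcB; apply/eqP/PiP.
  by rewrite mulmxBl -mulmxA -map_mxM Pi2 subrr.
rewrite -{1}(mulmx_base Pi) map_mxM mulmxA -tE; apply: eq_bigr => i _.
by rewrite (Prop_irrelevance (subw W) (osub_trans h hW)).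
Qed.

Lemma subquotient_frame (M P N : vectcon act) (i : vc_hom P M) (q : vc_hom P N) r
    (s : 'I_r -> sec M (owhole X)) : frame s -> (forall j, flat (s j)) ->
  sheaf_mono i -> sheaf_epi q ->
  exists p (t : 'I_p -> sec N (owhole X)), frame t /\ forall j, flat (t j).
Proof.
move=> fs fl im qe; have [lcS lcI] := frame_lc fs.
have [[[il ir] inab] ie] := svalP i.
have [Pi [Pi2 PiP]] := stable_sub_const ch cX cst_inj cstP (submodule_stable im fs fl).
(* The kernel of the idempotent [Pi] is spanned by the rows of [1 - Pi]. They are constant, so [P]
   is generated by global flat sections. *)
have /choice[p pE] : forall j, exists y, sval i (owhole X) y = lc s (map_mx (cst (owhole X)) (row j (1%:M - Pi))).
  move=> j; apply/PiP; rewrite -map_mxM -row_mul mulmxBl mul1mx Pi2 subrr row0.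
  by apply/rowP => l; rewrite !mxE rmorph0.
have pfl j : flat (p j).
  have [D1 G1] := lc_flat fl (row j (1%:M - Pi)); split=> [V h D|g]; apply: im.
    by rewrite inab -vc_hom_res pE D1 vc_hom0.
  by rewrite ie pE G1.
apply: (@quotient_frame N r (fun j => sval q (owhole X) (p j))).
  by move=> j; apply: flat_hom.
move=> V z; apply: locally_imp (qe V z) => W h [y <-].
have [x yx] := lcS W (sval i W y); exists x.
rewrite -lc_hom; congr (sval q W _); apply: im; rewrite lc_hom yx.
have xP : x *m map_mx (cst W) Pi = 0 by apply/PiP; exists y.
rewrite -{1}[x]subr0 -xP -{1}[x]mulmx1 -(map_mx1 (cst W)) -mulmxBr -map_mxB lc_mul.
by apply: eq_bigr => j _; rewrite pE.
Qed.

End Combinations.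

(** * Exactness and faithfulness *)

Lemma linear_section (k : fieldType) (V W : lmodType k) (g : V -> W) n : linear g ->
  has_dim W n -> (forall w, exists v, g v = w) -> exists2 s : W -> V, linear s & cancel s g.
Proof.
move=> gl [e eP] /choice[t tK]; have [x [xe _]] := coord_exists eP.
exists (fun w => \sum_i sval (x i) w *: t (e i)) => [a u w|w].
  rewrite scaler_sumr -big_split; apply: eq_bigr => i _ /=.
  by rewrite (svalP (x i)) scalerDl scalerA.
have g0 : g 0 = 0.
  have := gl 1 0 0; rewrite !scale1r addr0 => e0.
  by apply: (addrI (g 0)); rewrite addr0 -e0.
rewrite [RHS](xe w); elim: (index_enum _) => [|i r IH]; first by rewrite !big_nil.
by rewrite !big_cons gl tK IH.
Qed.

Section Exact.
Variables (k : fieldType) (X : rgspace k) (G H : groupType) (act : gact (dprod G H) X).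

Lemma tens_dualD (V : lmodType k) (A : comPzRingType) (iota : {rmorphism k -> A}) (T : tens iota V) (l l1 l2 : dual V) :
  (forall v, sval l v = sval l1 v + sval l2 v) -> sval T l = sval T l1 + sval T l2.
Proof.
move=> lE; have [s sE] := svalP T; rewrite !sE -big_split; apply: eq_bigr => p _.
by rewrite /pure_fun lE rmorphD mulrDl.
Qed.

(** A short exact sequence of representations splits over [k], though not equivariantly. The
    splitting induces one on sections over each open, so exactness holds before any localization. *)
Lemma triv_exact : exact_functor (triv act).
Proof.
move=> V' V V'' f g [fi fg gs]; have [n hn] := svalP V''.
have [fl _] := svalP f; have [gl _] := svalP g.
have [s sl sK] := linear_section gl hn gs.
have gB u v : sval g (u - v) = sval g u - sval g v.
  by rewrite addrC -scaleN1r gl scaleN1r addrC.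
have /choice[r rK] : forall v, exists u, sval f u = v - s (sval g v).
  by move=> v; apply/fg; rewrite gB sK subrr.
have sgl : linear (fun v : rep_of V => s (sval g v)) by move=> a u v; rewrite gl sl.
have rl : linear r.
  by move=> a u v; apply: fi; rewrite fl !rK gl sl scalerBr opprD addrACA.
have rf u : r (sval f u) = u.
  apply: fi; rewrite rK; have -> : sval g (sval f u) = 0 by apply/fg; exists u.
  have s0 : s 0 = 0.
    by have := sl 1 0 0; rewrite !scale1r addr0 => e0; apply: (addrI (s 0)); rewrite addr0 -e0.
  by rewrite s0 subr0.
have fr v : v = sval f (r v) + s (sval g v) by rewrite rK subrK.
split.
- move=> U S T ST.
  have E (Y : tens (cst U) (rep_of V')) : tmap (@id_klinear k X U) rl (sval (fmap (triv act) f) U Y) = Y.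
    by apply/sig_ext/funext => l; rewrite /=; congr (sval Y _); apply/sig_ext/funext => v /=; rewrite rf.
  by rewrite -(E S) -(E T) ST.
- move=> U T; split=> [T0|Tl].
    apply: locally_triv => W h; exists (mrs h (tmap (@id_klinear k X U) rl T : sec (triv act V' : vectcon act) U)).
    rewrite -vc_hom_res; congr (mrs _ _); apply/sig_ext/funext => l.
    (* [l] is the sum of [l f r] and [l s g]; the value of [T] at the second form only depends on
       the image of [T] under [g], which is 0. *)
    rewrite [RHS](@tens_dualD _ _ _ T l (dcomp rl (dcomp (proj1 (svalP f)) l)) (dcomp (proj1 (svalP g)) (dcomp sl l))) /=.
      have := congr1 (fun Y : tens (cst U) (rep_of V'') => sval Y (dcomp sl l)) T0.
      by rewrite /= => ->; rewrite addr0.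
    move=> v; rewrite {1}(fr v); case: (l) => l0 ll /=.
    by rewrite -[sval f _ in LHS]scale1r ll scale1r.
  apply: sec_locally_eq; apply: locally_imp Tl => W h [Y YT].
  rewrite vc_hom_res -YT mrs0; apply/sig_ext/funext => l /=.
  have [q qE] := svalP Y; rewrite qE big1// => p _; rewrite /pure_fun /=.
  have -> : sval g (sval f p.2) = 0 by apply/fg; exists p.2.
  by have l0 : sval l 0 = 0; [case: (l) => l0 ll /=; have := ll (-1) 0 0; rewrite scaleN1r addNr => ->; rewrite scaleN1r addNr|rewrite l0 rmorph0 mul0r].
- move=> U Y; apply: locally_triv => W h; exists (mrs h (tmap (@id_klinear k X U) sl Y : sec (triv act V : vectcon act) U)).
  rewrite -vc_hom_res; congr (mrs _ _); apply/sig_ext/funext => l /=; congr (sval Y _).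
  by apply/sig_ext/funext => v /=; rewrite sK.
Qed.

Lemma triv_faithful : (exists U : opn X, (1 : reg U) <> 0) -> faithful (triv act).
Proof.
move=> [U U1] V W f g fg; apply/sig_ext/funext => v; have [n [e eP]] := svalP W.
have [x [xe _]] := coord_exists eP; rewrite (xe (sval f v)) (xe (sval g v)).
apply: eq_bigr => i _; congr (_ *: _).
have ci c : cst U c = 0 -> c = 0.
  have [//|c0 e0] := eqVneq c 0; case: U1.
  by rewrite -(rmorph1 (cst U)) -(mulVf c0) rmorphM e0 mulr0.
have := congr1 (fun h : vc_hom (triv act V : vectcon act) (triv act W) => sval (sval h U (pure (cst U) 1 v)) (x i)) fg.
rewrite !triv_homE /= /pure_fun !mulr1 => /eqP; rewrite -subr_eq0 -rmorphB => /eqP/ci/eqP.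
by rewrite subr_eq0 => /eqP.
Qed.

End Exact.

(** * The monoidal structure *)

Section PureExt.
Variables (k : fieldType) (A : comPzRingType) (iota : {rmorphism k -> A}).

Lemma tens_pure_ext (V : lmodType k) (E : zmodType) (f g : tens iota V -> E) :
  (forall S T, f (S + T) = f S + f T) -> (forall S T, g (S + T) = g S + g T) ->
  (forall a v, f (pure iota a v) = g (pure iota a v)) -> forall T, f T = g T.
Proof.
move=> fD gD fg T; have f0 : f 0 = 0 by apply: (addrI (f 0)); rewrite -fD !addr0.
have g0 : g 0 = 0 by apply: (addrI (g 0)); rewrite -gD !addr0.
have [s sE] := svalP T; have -> : T = \sum_(p <- s) pure iota p.1 p.2.
  by apply/sig_ext/funext => l; rewrite tens_sum sE.
by rewrite (big_morph _ fD f0) (big_morph _ gD g0); apply: eq_bigr.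
Qed.

Lemma pure_sum (V : lmodType k) a I (r : seq I) (c : I -> k) (v : I -> V) :
  pure iota a (\sum_(i <- r) c i *: v i) = \sum_(i <- r) iota (c i) *: pure iota a (v i).
Proof.
elim: r => [|i r IH]; last by rewrite !big_cons pure_lin IH.
rewrite !big_nil; apply/sig_ext/funext => -[l ll]; rewrite /= /pure_fun /=.
have -> : l 0 = 0 by have := ll (-1) 0 0; rewrite scaleN1r addNr => ->; rewrite scaleN1r addNr.
by rewrite rmorph0 mul0r.
Qed.

End PureExt.

Lemma linear_comb (k : fieldType) (A B : lmodType k) (h : A -> B) I (r : seq I) (b : I -> k) (u : I -> A) :
  linear h -> h (\sum_(i <- r) b i *: u i) = \sum_(i <- r) b i *: h (u i).
Proof.
move=> hl; elim: r => [|i r IH]; last by rewrite !big_cons hl IH.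
rewrite !big_nil; have := hl 1 0 0; rewrite !scale1r addr0 => e0.
by apply: (addrI (h 0)); rewrite addr0 -e0.
Qed.

Section Monoidal.
Variables (k : fieldType) (X : rgspace k) (G H : groupType) (act : gact (dprod G H) X).
Notation F V := (triv act V : vectcon act).

Section Tensor.
Variables (TX : vc_tensor act) (TH : rep_tensor k H) (V W : repfd k H).

(** The universal property gives coordinates [L] on the tensor product. The endomorphism [N] rebuilt
    from them fixes pure tensors, so it is the identity by uniqueness. *)
Lemma rpp_span nv (e : 'I_nv -> rep_of V) nw (f : 'I_nw -> rep_of W) (x : 'I_nv -> dual (rep_of V))
    (y : 'I_nw -> dual (rep_of W)) : (forall v, v = \sum_i sval (x i) v *: e i) ->
  (forall w, w = \sum_j sval (y j) w *: f j) ->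
  forall z : rep_of (rpt TH V W), exists Z : 'M[k]_(nv, nw), z = \sum_i \sum_j Z i j *: rpp TH (e i) (f j).
Proof.
move=> xe yf.
pose c (v : rep_of V) (w : rep_of W) : 'M[k]_(nv, nw) := \matrix_(i, j) (sval (x i) v * sval (y j) w).
have [||L [Ll Lc _]] := rpp_univ TH (c := c).
- by move=> a v v' w; apply/matrixP => i j; rewrite !mxE (svalP (x i)) mulrDl /GRing.scale /= mulrA.
- by move=> a v w w'; apply/matrixP => i j; rewrite !mxE (svalP (y j)) mulrDr /GRing.scale /= mulrCA.
have [||I [_ _ Iu]] := rpp_univ TH (c := fun v w => rpp TH (v : rep_of V) (w : rep_of W)).
- by move=> *; apply: rpp_l.
- by move=> *; apply: rpp_r.
pose N (z : rep_of (rpt TH V W)) := \sum_i \sum_j L z i j *: rpp TH (e i) (f j).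
have Nl : linear N.
  move=> a u w; rewrite /N scaler_sumr -big_split; apply: eq_bigr => i _.
  rewrite scaler_sumr -big_split; apply: eq_bigr => j _.
  by rewrite Ll !mxE scalerDl scalerA.
have NE v w : N (rpp TH v w) = rpp TH v w.
  have hl : linear (fun v : rep_of V => rpp TH v w) by move=> a u u'; apply: rpp_l.
  rewrite {2}(xe v) (linear_comb _ _ _ hl); apply: eq_bigr => i _.
  have hr : linear (fun w : rep_of W => rpp TH (e i) w) by move=> a u u'; apply: rpp_r.
  rewrite {2}(yf w) (linear_comb _ _ _ hr) scaler_sumr; apply: eq_bigr => j _.
  by rewrite Lc mxE scalerA.
move=> z; exists (L z); rewrite -/(N z).
by rewrite (Iu N Nl NE) -(Iu id)// => *.
Qed.

(** The universal property of the tensor product over [O] only yields [O]-linear maps. So the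
    equivariant [D]-linear morphism [psi] is built in the other direction by adjunction, its
    [O]-linear inverse [phi] by the universal property, and [mu] is the inverse of [psi]. *)
Lemma triv_tensor : exists mu : vc_hom (vct TX (F V) (F W)) (F (rpt TH V W)),
  is_iso (C := vc_cat act) mu /\
  forall U (a b : reg U) (v : rep_of V) (w : rep_of W),
    sval mu U (vcp TX (pure (cst U) a v : sec (F V) U) (pure (cst U) b w : sec (F W) U)) =
    pure (cst U) (a * b) (rpp TH v w).
Proof.
have [[bl br bres] bnab beact buniv] := vctP TX (F V) (F W).
have [nv [e eP]] := svalP V; have [x [xe _]] := coord_exists eP.
have [nw [f fP]] := svalP W; have [y [yf _]] := coord_exists fP.
pose p1 (V0 : repfd k H) (v : rep_of V0) : sec (F V0) (owhole X) := pure (cst (owhole X)) 1 v.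
have flp V0 (v : rep_of V0) : flat (p1 V0 v).
  have := homGD_flat (triv_unit_fun act v); by rewrite triv_unitE.
have b0r U (m : sec (F V) U) : vcp TX m (0 : sec (F W) U) = 0.
  by have := br U (-1) m 0 0; rewrite scaleN1r addNr => ->; rewrite scaleN1r addNr.
have b0l U (m : sec (F W) U) : vcp TX (0 : sec (F V) U) m = 0.
  by have := bl U (-1) 0 0 m; rewrite scaleN1r addNr => ->; rewrite scaleN1r addNr.
have flb v w : flat (vcp TX (p1 V v) (p1 W w)).
  split=> [U h D|g]; last by rewrite beact (flp V v).2 (flp W w).2.
  by rewrite bres bnab (flp V v).1 (flp W w).1 b0l b0r addr0.
pose c v w : homGD (vct TX (F V) (F W)) := sval (cid (flat_homGD (flb v w))).
have cE v w U (a : reg U) h : sval (c v w) U a = a *: mrs h (vcp TX (p1 V v) (p1 W w)).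
  exact: (svalP (cid (flat_homGD (flb v w)))).
have p1lin V0 a (v v' : rep_of V0) : p1 V0 (a *: v + v') = cst _ a *: p1 V0 v + p1 V0 v' by exact: pure_lin.
have c1 v w : sval (c v w) (owhole X) 1 = vcp TX (p1 V v) (p1 W w).
  by rewrite (cE v w _ 1 (osub_refl _)) scale1r mrs_id.
have [||L [Ll Lc Lu]] := rpp_univ TH (c := c).
- by move=> a v v' w; apply: homGD_eq1; rewrite homGD_combE !c1 p1lin bl.
- by move=> a v w w'; apply: homGD_eq1; rewrite homGD_combE !c1 p1lin br.
have Le h z : L (ract h z) = homGD_act h (L z).
  pose c' v w := homGD_act h (c v w).
  have hl := homGD_act_lin h (M := vct TX (F V) (F W)).
  have [||L' [_ _ Lu']] := rpp_univ TH (c := c').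
  - by move=> a v v' w; rewrite /c' -hl; congr (homGD_act h _); rewrite -Lc rpp_l Ll !Lc.
  - by move=> a v w w'; rewrite /c' -hl; congr (homGD_act h _); rewrite -Lc rpp_r Ll !Lc.
  rewrite (Lu' (fun z => L (ract h z))) ?(Lu' (fun z => homGD_act h (L z)))//.
  - by move=> a u w; rewrite Ll hl.
  - by move=> v w; rewrite Lc.
  - by move=> a u w; rewrite ract_lin Ll.
  move=> v w; rewrite rpp_act Lc /c'; apply: homGD_eq1.
  rewrite (homGD_actE (c v w) (within_whole act (inH G h)) (within_whole act (inH G h)^-1%g)).
  have e1 : eact (v := reg_vc act) (within_whole act (inH G h)^-1%g) (1 : reg (owhole X)) =
    (1 : reg (owhole X)) by exact: rmorph1.
  rewrite [X in sval (c v w) _ X]e1 !c1 beact !triv_eact_pure rmorph1.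
  by [].
have [psi psiE] := triv_adj (V := rpt TH V W) (exist _ L (conj Ll Le) : rep_hom (rep_of (rpt TH V W)) (homGD_rep (vct TX (F V) (F W)))).
have psiP U (a b : reg U) v w : sval psi U (pure (cst U) (a * b) (rpp TH v w)) =
    vcp TX (pure (cst U) a v : sec (F V) U) (pure (cst U) b w : sec (F W) U).
  rewrite psiE /= Lc (cE v w U _ (subw U)) bres !triv_mrs rmorph1.
  have blZ c0 m n : vcp TX (c0 *: m : sec (F V) U) (n : sec (F W) U) = c0 *: vcp TX m n.
    by rewrite -[c0 *: m]addr0 bl b0l addr0.
  have brZ c0 m n : vcp TX (m : sec (F V) U) (c0 *: n : sec (F W) U) = c0 *: vcp TX m n.
    by rewrite -[c0 *: n]addr0 br b0r addr0.
  have e1 (V0 : repfd k H) (a0 : reg U) (v0 : rep_of V0) : pure (cst U) a0 v0 = a0 *: (pure (cst U) 1 v0 : sec (F V0) U).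
    by rewrite -[in LHS](mulr1 a0) (pureZ (cst U)).
  by rewrite (e1 V a) (e1 W b) blZ brZ scalerA.
pose B U (S : sec (F V) U) (T : sec (F W) U) : sec (F (rpt TH V W)) U :=
  \sum_i \sum_j (sval S (x i) * sval T (y j)) *: pure (cst U) 1 (rpp TH (e i) (f j)).
have BE U (a b : reg U) v w : B U (pure (cst U) a v) (pure (cst U) b w) = pure (cst U) (a * b) (rpp TH v w).
  have vw : rpp TH v w = \sum_i sval (x i) v *: \sum_j sval (y j) w *: rpp TH (e i) (f j).
    have hl : linear (fun v : rep_of V => rpp TH v w) by move=> c0 u u'; apply: rpp_l.
    rewrite {1}(xe v) (linear_comb _ _ _ hl); apply: eq_bigr => i _.
    have hr : linear (fun w : rep_of W => rpp TH (e i) w) by move=> c0 u u'; apply: rpp_r.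
    by rewrite {1}(yf w) (linear_comb _ _ _ hr).
  rewrite vw pure_sum; apply: eq_bigr => i _; rewrite pure_sum scaler_sumr; apply: eq_bigr => j _.
  rewrite -[X in _ = _ *: (_ *: pure _ X _)](mulr1 (a * b)) (pureZ (cst U)) !scalerA; congr (_ *: _).
  by rewrite /= /pure_fun; ring.
have Bbil : bilin B.
  split=> [U a S S' T|U a S T T'|U U' h S T].
  - rewrite /B scaler_sumr -big_split; apply: eq_bigr => i _.
    rewrite scaler_sumr -big_split; apply: eq_bigr => j _.
    by rewrite tensD tensZ mulrDl scalerDl scalerA mulrA.
  - rewrite /B scaler_sumr -big_split; apply: eq_bigr => i _.
    rewrite scaler_sumr -big_split; apply: eq_bigr => j _.
    by rewrite tensD tensZ mulrDr scalerDl scalerA mulrCA.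
  - rewrite /B mrs_sum; apply: eq_bigr => i _; rewrite mrs_sum; apply: eq_bigr => j _.
    by rewrite mrs_scale triv_mrs rmorph1 rmorphM /mrs !triv_resE.
have [phi [[phil phir] phiB _]] := buniv _ B Bbil.
have phi0 U : phi U 0 = 0.
  have := phil U 1 0 0; rewrite !scale1r addr0 => e0.
  by apply: (addrI (phi U 0)); rewrite addr0 -e0.
have phis U I (r : seq I) (c0 : I -> reg U) m : phi U (\sum_(i <- r) c0 i *: m i) = \sum_(i <- r) c0 i *: phi U (m i).
  by elim: r => [|i r IH]; [rewrite !big_nil|rewrite !big_cons phil IH].
have phipsi U T : phi U (sval psi U T) = T.
  apply: (tens_pure_ext (f := fun T => phi U (sval psi U T)) (g := id)) => // [S S'|a z].
    have := phil U 1 (sval psi U S) (sval psi U S'); rewrite !scale1r => <-.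
    by congr (phi U _); apply: vc_homD.
  have [Z ->] := rpp_span xe yf z.
  have E i j : phi U (sval psi U (pure (cst U) a (rpp TH (e i) (f j)))) = pure (cst U) a (rpp TH (e i) (f j)).
    by rewrite -(mulr1 a) psiP phiB BE.
  have zE : \sum_i \sum_j Z i j *: rpp TH (e i) (f j) = \sum_(p : 'I_nv * 'I_nw) Z p.1 p.2 *: rpp TH (e p.1) (f p.2).
    by rewrite pair_big.
  rewrite zE pure_sum vc_hom_sum.
  under eq_bigr do rewrite vc_homZ.
  by rewrite phis; apply: eq_bigr => p _; rewrite E.
have psiphi U z : sval psi U (phi U z) = z.
  have [[[psil psir] _] _] := svalP psi.
  have [chi [_ _ chiU]] := buniv _ (@vcp _ _ _ _ TX (F V) (F W)) (Build_bilin bl br bres).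
  rewrite (chiU (fun U z => sval psi U (phi U z))).
  - by apply/esym/(chiU (fun U z => z)).
  - by split=> [U0 a m n|U0 U1 h m]; rewrite ?phil ?psil// psir phir.
  move=> U0 S T; rewrite phiB.
  apply: (tens_pure_ext (f := fun S => sval psi U0 (B U0 S T)) (g := fun S => vcp TX (S : sec (F V) U0) T)).
  - move=> S1 S2; have [b1 _ _] := Bbil; have := b1 U0 1 S1 S2 T; rewrite !scale1r => ->; exact: vc_homD.
  - by move=> S1 S2; have := bl U0 1 S1 S2 T; rewrite !scale1r.
  move=> a v; apply: (tens_pure_ext (f := fun T => sval psi U0 (B U0 (pure (cst U0) a v) T))
    (g := fun T => vcp TX (pure (cst U0) a v : sec (F V) U0) (T : sec (F W) U0))).
  - move=> T1 T2; have [_ b2 _] := Bbil; have := b2 U0 1 (pure (cst U0) a v) T1 T2; rewrite !scale1r => ->; exact: vc_homD.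
  - by move=> T1 T2; have := br U0 1 (pure (cst U0) a v) T1 T2; rewrite !scale1r.
  by move=> b w; rewrite BE psiP.
have psiI : is_iso (C := vc_cat act) psi.
  apply: (@vc_iso_bij _ _ _ _ act (F (rpt TH V W)) (vct TX (F V) (F W)) psi) => U.
    by move=> S T /(congr1 (phi U)); rewrite !phipsi.
  by move=> z; exists (phi U z); apply: psiphi.
have [mu [mu1 mu2]] := psiI; exists mu; split; first by exists psi.
move=> U a b v w; rewrite -psiP.
exact: (congr1 (fun h : vc_hom (F (rpt TH V W)) (F (rpt TH V W)) => sval h U (pure (cst U) (a * b) (rpp TH v w))) mu1).
Qed.

End Tensor.
Lemma triv_unit_iso : exists eps : vc_hom (reg_vc act) (F (unitfd k H)),
  is_iso (C := vc_cat act) eps /\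
  forall U (a : reg U), sval eps U a = pure (cst U) a ((1 : k) : rep_of (unitfd k H)).
Proof.
pose f U (a : sec (reg_vc act) U) : sec (F (unitfd k H)) U :=
  pure (cst U) a ((1 : k) : rep_of (unitfd k H)).
have fP : dmod_mor f /\ forall g, commutes_with f g.
  split; first split; first split.
  - by move=> U a x y; rewrite /f (pureD (cst U)) (pureZ (cst U)).
  - by move=> U U' h x; rewrite /f triv_mrs.
  - by move=> U D x; rewrite /f triv_nab_pure.
  - by move=> g U U' h x; rewrite /f triv_eact_pure.
exists (exist _ f fP : vc_hom (reg_vc act) (F (unitfd k H))); split=> //.
have idl : linear ((id : k -> k) : rep_of (unitfd k H) -> k^o) by [].
pose id1 : dual (rep_of (unitfd k H)) := exist _ (id : k -> k) idl.
apply: (@vc_iso_bij _ _ _ _ act (reg_vc act) (F (unitfd k H)) (exist _ f fP)) => U.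
  move=> a b /(congr1 (fun T : tens (cst U) (rep_of (unitfd k H)) => sval T id1)).
  by rewrite /= /pure_fun /= rmorph1 !mul1r.
move=> T; exists (sval T id1); apply/sig_ext/funext => l; rewrite /= /pure_fun.
have [s sE] := svalP T; rewrite !sE mulr_sumr; apply: eq_bigr => p _; rewrite /pure_fun /=.
rewrite mulrA -rmorphM; congr (cst U _ * _); case: (l) => l0 ll /=.
have l00 : l0 0 = 0 by have := ll (-1) 0 0; rewrite scaleN1r addNr => ->; rewrite scaleN1r addNr.
have := ll p.2 1 0; rewrite !addr0 l00 addr0 => e; rewrite mulrC.
by apply: (etrans (esym e)); congr (l0 _); rewrite /GRing.scale /= mulr1.
Qed.

Lemma triv_monoidal : monoidal_functor (triv act).
Proof.
move=> TX TH.
pose mu V W := sval (cid (triv_tensor TX TH V W)).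
have muI V W : is_iso (C := vc_cat act) (mu V W) by case: (svalP (cid (triv_tensor TX TH V W))).
have muE V W U (a b : reg U) (v : rep_of V) (w : rep_of W) :
    sval (mu V W) U (vcp TX (pure (cst U) a v : sec (F V) U) (pure (cst U) b w : sec (F W) U)) =
    pure (cst U) (a * b) (rpp TH v w).
  by case: (svalP (cid (triv_tensor TX TH V W))) => _; apply.
have [eps [epsI epsE]] := triv_unit_iso.
have muDl V W U (S S' : sec (F V) U) (T : sec (F W) U) :
    sval (mu V W) U (vcp TX (S + S') T) = sval (mu V W) U (vcp TX S T) + sval (mu V W) U (vcp TX S' T).
  have [[bl _ _] _ _ _] := vctP TX (F V) (F W).
  by have := bl U 1 S S' T; rewrite !scale1r => ->; rewrite vc_homD.
have muDr V W U (S : sec (F V) U) (T T' : sec (F W) U) :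
    sval (mu V W) U (vcp TX S (T + T')) = sval (mu V W) U (vcp TX S T) + sval (mu V W) U (vcp TX S T').
  have [[_ br _] _ _ _] := vctP TX (F V) (F W).
  by have := br U 1 S T T'; rewrite !scale1r => ->; rewrite vc_homD.
exists mu, eps; split=> //.
- move=> V V' W W' f g fg fgE U x y.
  move: x; apply: tens_pure_ext => [S S'|S S'|a v]; [by rewrite muDl vc_homD|by rewrite vc_homD muDl|].
  move: y; apply: tens_pure_ext => [S S'|S S'|b w]; [by rewrite muDr vc_homD|by rewrite vc_homD muDr|].
  by rewrite muE !triv_homE muE fgE.
- move=> V W Z al alE U x y z.
  move: x; apply: tens_pure_ext => [S S'|S S'|a v]; [by rewrite !muDl vc_homD|by rewrite muDl|].
  move: y; apply: tens_pure_ext => [S S'|S S'|b w]; [by rewrite muDr muDl vc_homD|by rewrite muDl muDr|].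
  move: z; apply: tens_pure_ext => [S S'|S S'|c t]; [by rewrite muDr vc_homD|by rewrite !muDr|].
  by rewrite !muE triv_homE alE mulrA.
move=> V lu ru luE ruE U a x.
split; move: x; apply: tens_pure_ext => [S S'|S S'|b v].
- by rewrite muDr vc_homD.
- exact: scalerDr.
- by rewrite epsE muE triv_homE luE scale1r (pureZ (cst U)).
- by rewrite muDl vc_homD.
- exact: scalerDr.
- by rewrite epsE muE triv_homE ruE scale1r mulrC (pureZ (cst U)).
Qed.

End Monoidal.

(** * The constants of [X] *)

Section Constants.
Variables (k : fieldType) (X : rgspace k) (G H : groupType) (act : gact (dprod G H) X).
Variables (Om : omod X) (d : forall U : opn X, reg U -> sec Om U).
Hypotheses (dOm : is_differentials d) (inv : invariant_constants_are_k act d).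

(** The uniqueness of [c] in [invariant_constants_are_k], applied to the function 1; in particular
    it excludes that [O(X)] is zero. *)
Lemma constants_inj : injective (cst (owhole X)).
Proof.
have [_ [_ _ dc _] _] := dOm.
have : @d (owhole X) 1 = 0 /\ forall g : G, oact (within_whole act (inG H g)) 1 = 1.
  by split=> [|g]; [rewrite -(rmorph1 (cst (owhole X))) dc|rewrite rmorph1].
move=> /(inv _).1[c [c1 cu]] a b ab.
have e1 : c = 1 by apply: cu; rewrite rmorph1.
have : c = 1 + (a - b) by apply: cu; rewrite rmorphD rmorphB ab subrr addr0 rmorph1.
by rewrite e1 => /esym/eqP; rewrite -subr_eq0 addrC addKr subr_eq0 => /eqP.
Qed.

Lemma constants_horizontal (f : reg (owhole X)) : [pchar k] =i pred0 -> charted X ->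
  horizontal f -> (forall g : G, oact (within_whole act (inG H g)) f = f) ->
  exists c, f = cst (owhole X) c.
Proof.
move=> ch cX fh fG; have [_ dd _] := dOm.
have [c [fc _]] := (inv f).1 (conj (horizontal_differential ch cX dd fh) fG).
by exists c.
Qed.

End Constants.

Theorem theorem4p4 (k : fieldType) (char0 : [pchar k] =i pred0)
    (G H : groupType) (X : rgspace k)
    (smX : smooth_scheme X \/
           exists (R : realType) (nu : k -> R),
             nonarch_field nu /\ smooth_rigid_space nu X)
    (act : gact (dprod G H) X) :
  [/\ exact_functor (triv act), monoidal_functor (triv act)
    & (exists x : point X, whole x) -> faithful (triv act)] /\
  (forall (Om : omod X) (d : forall U : opn X, reg U -> sec Om U),
     is_differentials d ->
     invariant_constants_are_k act d ->
     [/\ full (triv act),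
         (forall M : vc_cat act,
            ess_image (triv act) M <-> dim_hom_eq_rank M) /\
         (exists inS : forall V : repfd k H, dim_hom_eq_rank (triv act V),
            quasi_inverse (corestrict inS) (homGD_sub act))
       & forall M N : vc_cat act,
           ess_image (triv act) M -> subquotient M N ->
           ess_image (triv act) N]).
Proof.
have cX := smooth_charted char0 smX; split.
  split; [exact: triv_exact|exact: triv_monoidal|move=> [x wx]].
  by have [U U1] := smooth_reg_neq0 wx smX; apply: triv_faithful; exists U.
move=> Om d dOm inv; have inj := constants_inj dOm inv.
have cstP f hf fG := constants_horizontal dOm inv (f := f) char0 cX hf fG.
split; first exact: triv_full inj cstP.
  by split; [move=> M; apply: ess_imageP|apply: triv_quasi_inverse].
move=> M N /ess_image_frame[r [s [fs fl]]] [P [i [q [im qe]]]].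
have [p [t [ft tl]]] := subquotient_frame inj cstP char0 cX fs fl im qe.
by apply/(ess_imageP inj cstP char0 cX); exact: (flat_frame_rank inj cstP ft tl).
Qed.
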